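(* Let $\alpha>n$ and let $\Omega\subset\mathbb{R}^n$ be a bounded domain with smooth boundary. Put $q_\alpha=\frac{2n}{n+\alpha}$ and $d(\Omega)=\sup_{x,y\in\Omega}|x-y|$. For real parameters $q$ and $\lambda$, consider the integral equation $$(E)\qquad f^{q-1}(x)=\int_\Omega\frac{f(y)}{|x-y|^{n-\alpha}}\,dy+\lambda\int_\Omega\frac{f(y)}{|x-y|^{n-\alpha-1}}\,dy,\qquad f\ge 0,\quad x\in\overline{\Omega}.$$ (1) (Subcritical case) If $0<q<q_\alpha$ and $\lambda>-\frac{1}{d(\Omega)}$, then there is a positive solution $f\in C^1(\overline{\Omega})$ to (E). (2) (Critical case) If $q=q_\alpha$ and $-\frac{1}{d(\Omega)}<\lambda<0$, then there is a positive solution $f\in C^1(\overline{\Omega})$ to (E). (3) (Critical and supercritical cases) If $q_\alpha\le q<1$, $\lambda\ge 0$, and $\Omega$ is a star-shaped domain, then there is no positive $C^1(\overline{\Omega})$ solution to (E).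
   Context: Here $n$ is the dimension of $\mathbb{R}^n$ and $\alpha$ is a real number; since $\alpha>n$, one has $q_\alpha<1$. Star-shaped means star-shaped with respect to some point of $\Omega$. *)

(* Defs.v *)
From HB Require Import structures.
From mathcomp Require Import all_boot all_order all_algebra.
From mathcomp Require Import all_classical all_reals all_analysis.

Set Implicit Arguments.
Unset Strict Implicit.
Unset Printing Implicit Defensive.

Import Order.TTheory GRing.Theory Num.Theory.
Import numFieldNormedType.Exports.

Local Open Scope classical_set_scope.
Local Open Scope ring_scope.

(* The library norm on 'rV[R]_n is the sup norm; it is used only through the
   topology, derivatives and bounded sets it induces. *)
Definition enorm (R : realType) (n : nat) (x : 'rV[R]_n) : R :=
  Num.sqrt (\sum_(i < n) x ord0 i ^+ 2).

Definition rV_display : measure_display.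
Proof. exact: default_measure_display. Qed.

Section rV_measurable.
Context (R : realType) (n : nat).

Let coord (i : 'I_n) (x : 'rV[R]_n) : measurableTypeR R := x ord0 i.

Let rV_set0 : g_sigma_preimage coord set0.
Proof. exact: sigma_algebra0. Qed.

Let rV_setC A : g_sigma_preimage coord A -> g_sigma_preimage coord (~` A).
Proof. exact: sigma_algebraC. Qed.

Let rV_bigcup (F : (set 'rV[R]_n)^nat) :
  (forall i, g_sigma_preimage coord (F i)) ->
  g_sigma_preimage coord (\bigcup_i F i).
Proof. exact: sigma_algebra_bigcup. Qed.

(* the product sigma-algebra, i.e., the Borel sigma-algebra of R^n *)
HB.instance Definition _ := @isMeasurable.Build rV_display
  'rV[R]_n (g_sigma_preimage coord) rV_set0 rV_setC rV_bigcup.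

End rV_measurable.

Definition consr (R : realType) (n : nat) (p : measurableTypeR R * 'rV[R]_n) :
  'rV[R]_n.+1 := row_mx (p.1)%:M p.2 : 'rV[R]_(1 + n).

Fixpoint lebesgue_rV (R : realType) (n : nat) : set 'rV[R]_n -> \bar R :=
  match n with
  | 0 => \d_(0 : 'rV[R]_0)
  | m.+1 => pushforward (lebesgue_measure \x @lebesgue_rV R m)%E (@consr R m)
  end.

Section lebesgue_rV_measure.
Context (R : realType).

Lemma measurable_coord n (i : 'I_n) :
  measurable_fun [set: 'rV[R]_n] (fun x => x ord0 i : measurableTypeR R).
Proof.
move=> _ Y mY; rewrite setTI; apply: sub_sigma_algebra => /=.
rewrite -bigcup_seq/=; exists i => /=; first by rewrite mem_index_enum.
by exists Y => //; rewrite setTI.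
Qed.

Lemma measurable_fun_coordP d (T : measurableType d) n (f : T -> 'rV[R]_n) :
  (forall i, measurable_fun [set: T] (fun x => f x ord0 i : measurableTypeR R)) ->
  measurable_fun [set: T] f.
Proof.
move=> mf _ A mA; rewrite setTI.
suff : @g_sigma_preimage _ _ _ n
    (fun i (x : 'rV[R]_n) => x ord0 i : measurableTypeR R)
    `<=` [set B | measurable (f @^-1` B)] by apply.
apply: smallest_sub.
  split => /= [|B mB|F mF].
  - by rewrite preimage_set0.
  - by rewrite setTD -preimage_setC; exact: measurableC.
  - by rewrite preimage_bigcup; exact: bigcup_measurable.
move=> B; rewrite -bigcup_seq => -[i _ [C mC <-]] /=.
rewrite setTI -comp_preimage -[X in measurable X]setTI.
exact: mf.
Qed.

Lemma consr0 n (p : measurableTypeR R * 'rV[R]_n) : consr p ord0 ord0 = p.1.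
Proof.
have -> : (ord0 : 'I_n.+1) = lshift n (ord0 : 'I_1) by exact: val_inj.
by rewrite /consr; apply: etrans (row_mxEl _ _ _ _) _; rewrite mxE eqxx.
Qed.

Lemma consrS n (p : measurableTypeR R * 'rV[R]_n) i :
  consr p ord0 (lift ord0 i) = p.2 ord0 i.
Proof.
have -> : lift ord0 i = rshift 1 i by exact: val_inj.
by rewrite /consr; apply: etrans (row_mxEr _ _ _ _) _.
Qed.

Lemma measurable_consr n : measurable_fun setT (@consr R n).
Proof.
apply: measurable_fun_coordP => i.
case: (unliftP ord0 i) => [j|] ->.
- under eq_fun do rewrite consrS.
  exact: (measurableT_comp (measurable_coord j) measurable_snd).
- under eq_fun do rewrite consr0.
  exact: measurable_fst.
Qed.

Definition unconsr n (x : 'rV[R]_n.+1) : measurableTypeR R * 'rV[R]_n :=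
  (x ord0 ord0, \row_i x ord0 (lift ord0 i)).

Lemma consrK n : cancel (@consr R n) (@unconsr n).
Proof.
move=> p; rewrite /unconsr consr0 [RHS]surjective_pairing; congr pair.
by apply/rowP => i; rewrite mxE consrS.
Qed.

Lemma unconsrK n : cancel (@unconsr n) (@consr R n).
Proof.
move=> x; apply/rowP => i.
by case: (unliftP ord0 i) => [j|] ->; rewrite ?consrS ?consr0//= mxE.
Qed.

Lemma measurable_unconsr n : measurable_fun setT (@unconsr n).
Proof.
apply: measurable_fun_pair => /=; first exact: measurable_coord.
apply: measurable_fun_coordP => i.
under eq_fun do rewrite mxE.
exact: measurable_coord.
Qed.

End lebesgue_rV_measure.

Section cons_measure.
Local Open Scope ereal_scope.
Context (R : realType) (n : nat).
Variable mu : {sigma_finite_measure set 'rV[R]_n -> \bar R}.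

Let nu : set 'rV[R]_n.+1 -> \bar R :=
  pushforward (lebesgue_measure \x mu) (@consr R n).

Let mpre A : measurable A -> measurable (@consr R n @^-1` A).
Proof. by move=> mA; rewrite -[X in measurable X]setTI; exact: measurable_consr. Qed.

Let nu0 : nu set0 = 0.
Proof. by rewrite /nu /pushforward preimage_set0 measure0. Qed.

Let nu_ge0 A : 0 <= nu A.
Proof. by rewrite /nu /pushforward measure_ge0. Qed.

Let nu_sigma_additive : semi_sigma_additive nu.
Proof.
move=> F mF tF mUF; rewrite /nu /pushforward preimage_bigcup.
apply: measure_semi_sigma_additive.
- by move=> k; exact: mpre.
- apply/trivIsetP => /= i j _ _ ij; rewrite -preimage_setI.
  by move/trivIsetP : tF => /(_ _ _ _ _ ij) ->//; rewrite preimage_set0.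
- by rewrite -preimage_bigcup; exact: mpre.
Qed.

HB.instance Definition _ := isMeasure.Build _ _ _ nu
  nu0 nu_ge0 nu_sigma_additive.

Let nu_sigma_finite : sigma_finite setT nu.
Proof.
have [F FT Foo] : sigma_finite setT (@lebesgue_measure R \x mu).
  have /sigma_finiteP[F [TF ndF Foo]] := sigma_finiteT (@lebesgue_measure R).
  have /sigma_finiteP[G [TG ndG Goo]] := sigma_finiteT mu.
  exists (fun k => F k `*` G k).
    rewrite -setXTT TF TG predeqE => -[x y]; split.
      move=> [/= [k _ Fkx] [l _ Gly]]; exists (maxn k l) => //; split.
      - by move: x Fkx; exact/subsetPset/ndF/leq_maxl.
      - by move: y Gly; exact/subsetPset/ndG/leq_maxr.
    by move=> [k _ []/= ? ?]; split; exists k.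
  move=> k; have [? ?] := Foo k; have [? ?] := Goo k.
  split; first exact: measurableX.
  by rewrite product_measure1E// lte_mul_pinfty// ge0_fin_numE.
exists (fun k => @unconsr R n @^-1` F k).
  by rewrite -preimage_bigcup -FT preimage_setT.
move=> k; have [mF Fk] := Foo k; split.
  by rewrite -[X in measurable X]setTI; exact: measurable_unconsr.
rewrite /nu /pushforward -comp_preimage.
rewrite (_ : _ \o _ = id)//.
by apply/funext => x /=; rewrite consrK.
Qed.

HB.instance Definition _ := @Measure_isSigmaFinite.Build _ _ _ nu
  nu_sigma_finite.

Lemma cons_sigma_finite_measure :
  exists nu' : {sigma_finite_measure set 'rV[R]_n.+1 -> \bar R},
    pushforward (lebesgue_measure \x mu) (@consr R n) = nu'.
Proof. by exists nu. Qed.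

End cons_measure.

Section lebesgue_rV_instance.
Local Open Scope ereal_scope.
Context (R : realType) (n : nat).

Lemma lebesgue_rV_sigma_finite_measure :
  exists mu : {sigma_finite_measure set 'rV[R]_n -> \bar R},
    @lebesgue_rV R n = mu.
Proof.
elim: n => [|m [mu emu]]; first by exists (\d_(0%R : 'rV[R]_0)).
by rewrite /= emu; exact: cons_sigma_finite_measure.
Qed.

Let lebesgue_rV0 : @lebesgue_rV R n set0 = 0.
Proof. by have [mu ->] := lebesgue_rV_sigma_finite_measure. Qed.

Let lebesgue_rV_ge0 A : 0 <= @lebesgue_rV R n A.
Proof. by have [mu ->] := lebesgue_rV_sigma_finite_measure. Qed.

Let lebesgue_rV_sigma_additive : semi_sigma_additive (@lebesgue_rV R n).
Proof.
have [mu ->] := lebesgue_rV_sigma_finite_measure.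
exact: measure_semi_sigma_additive.
Qed.

HB.instance Definition _ := isMeasure.Build _ _ _ (@lebesgue_rV R n)
  lebesgue_rV0 lebesgue_rV_ge0 lebesgue_rV_sigma_additive.

Let lebesgue_rV_sigma_finite : sigma_finite setT (@lebesgue_rV R n).
Proof.
have [mu ->] := lebesgue_rV_sigma_finite_measure.
exact: sigma_finiteT.
Qed.

HB.instance Definition _ := @Measure_isSigmaFinite.Build _ _ _
  (@lebesgue_rV R n) lebesgue_rV_sigma_finite.

End lebesgue_rV_instance.

Lemma lebesgue_rV_box (R : realType) (n : nat) (a b : 'rV[R]_n) :
  (forall i, a ord0 i <= b ord0 i) ->
  lebesgue_rV [set x : 'rV[R]_n | forall i, x ord0 i \in `[a ord0 i, b ord0 i]] =
  (\prod_(i < n) (b ord0 i - a ord0 i))%:E.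
Proof.
elim: n => [|n IHn] in a b * => ab.
  rewrite /= diracE big_ord0 mem_set//= => -[]//.
pose a' := (unconsr a).2; pose b' := (unconsr b).2.
rewrite /= /pushforward.
have -> : @consr R n @^-1`
      [set x : 'rV[R]_n.+1 | forall i, x ord0 i \in `[a ord0 i, b ord0 i]]
  = `[a ord0 ord0, b ord0 ord0]%classic `*`
    [set x : 'rV[R]_n | forall i, x ord0 i \in `[a' ord0 i, b' ord0 i]].
  apply/seteqP; split=> [p /= H|p /= [H1 H2] i].
    split; first by have := H ord0; rewrite consr0.
    by move=> i; have := H (lift ord0 i); rewrite consrS !mxE.
  case: (unliftP ord0 i) => [j|] ->; last by rewrite consr0.
  by have := H2 j; rewrite consrS !mxE.
rewrite product_measure1E//; last first.
  have -> : [set x : 'rV[R]_n | forall i, x ord0 i \in `[a' ord0 i, b' ord0 i]]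
    = \bigcap_(i in [set: 'I_n])
        ((fun x => x ord0 i) @^-1` `[a' ord0 i, b' ord0 i]%classic).
    by apply/seteqP; split=> [x H i _|x H i]; [exact: H|exact: (H i)].
  apply: fin_bigcap_measurable => // i _.
  by rewrite -[X in measurable X]setTI; exact: measurable_coord.
rewrite [X in (_ * X)%E](IHn a' b'); last by move=> i; rewrite !mxE.
rewrite [X in (X * _)%E](lebesgue_measure_itv `[_, _])/= lte_fin.
rewrite big_ord_recl EFinM.
congr (_ * _)%E; last by congr EFin; apply: eq_bigr => i _; rewrite !mxE.
case: ltP => //; rewrite le_eqVlt ltNge ab orbF => /eqP ->.
by rewrite subrr.
Qed.

Definition unit_vec (R : realType) (n : nat) (i : 'I_n) : 'rV[R]_n :=
  delta_mx ord0 i.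

Definition domain (R : realType) (n : nat) (Om : set 'rV[R]_n) : Prop :=
  [/\ open Om, connected Om & Om !=set0].

Fixpoint Ck (R : realType) (n : nat) (k : nat) (g : 'rV[R]_n -> R) : Prop :=
  continuous g /\
  if k is k'.+1 then
    forall i : 'I_n, (forall x, derivable g x (unit_vec R i)) /\
                     Ck k' (fun x => 'D_(unit_vec R i) g x)
  else True.

Definition smooth (R : realType) (n : nat) (g : 'rV[R]_n -> R) : Prop :=
  forall k, Ck k g.

(* Near each boundary point p, after singling out a coordinate i and choosing
   its orientation, Om is the strict epigraph of a smooth function of the
   other n - 1 coordinates [col' i x]. *)
Definition smooth_boundary (R : realType) (n : nat) (Om : set 'rV[R]_n) : Prop :=
  forall p, (closure Om `\` interior Om) p ->
  exists (r : R) (i : 'I_n) (neg : bool) (g : 'rV[R]_n.-1 -> R),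
    [/\ 0 < r, smooth g &
      forall x, enorm (x - p) < r ->
        (Om x <-> g (col' i x) < (-1) ^+ neg * x ord0 i)].

Definition star_shaped (R : realType) (n : nat) (Om : set 'rV[R]_n) : Prop :=
  exists2 x0, Om x0 &
    forall x (t : R), Om x -> 0 <= t <= 1 -> Om (x0 + t *: (x - x0)).

Definition diam (R : realType) (n : nat) (Om : set 'rV[R]_n) : R :=
  sup [set r | exists x y, [/\ Om x, Om y & r = enorm (x - y)]].

(* C^1 up to the boundary in the sense of continuous extension of the partial
   derivatives; f is relevant only on the closure of Om. *)
Definition C1_closure (R : realType) (n : nat) (Om : set 'rV[R]_n)
    (f : 'rV[R]_n -> R) : Prop :=
  {within closure Om, continuous f} /\
  forall i : 'I_n,
    (forall x, Om x -> derivable f x (unit_vec R i)) /\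
    exists2 g : 'rV[R]_n -> R, {within closure Om, continuous g} &
      forall x, Om x -> g x = 'D_(unit_vec R i) f x.

Definition q_crit (R : realType) (n : nat) (alpha : R) : R :=
  2 * n%:R / (n%:R + alpha).

(* \int_Om f(y) / |x - y|^s dy. The exponents s used below are negative; the
   integrand is then 0 at y = x, which is also the limit value. *)
Definition riesz_pot (R : realType) (n : nat) (Om : set 'rV[R]_n) (s : R)
    (f : 'rV[R]_n -> R) (x : 'rV[R]_n) : \bar R :=
  (\int[@lebesgue_rV R n]_(y in Om) (f y / (enorm (x - y) `^ s))%:E)%E.

Definition solves (R : realType) (n : nat) (Om : set 'rV[R]_n)
    (alpha q lam : R) (f : 'rV[R]_n -> R) : Prop :=
  forall x, closure Om x ->
    0 <= f x /\
    (f x `^ (q - 1))%:E =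
      (riesz_pot Om (n%:R - alpha) f x +
       lam%:E * riesz_pot Om (n%:R - alpha - 1) f x)%E.

(* Positivity is required on the whole closure, where q - 1 < 0 makes
   f ^ (q - 1) meaningful ([powR] sends 0 to 0 for nonzero exponents). *)
Definition positive_C1_solution (R : realType) (n : nat) (Om : set 'rV[R]_n)
    (alpha q lam : R) (f : 'rV[R]_n -> R) : Prop :=
  [/\ C1_closure Om f, solves Om alpha q lam f &
      forall x, closure Om x -> 0 < f x].

(* Main.v *)
(* Write g = alpha - n > 0. Solutions are critical points of the energy
   J(f) = \int \int (|x - y|^g + lam |x - y|^(g+1)) f(x) f(y) under the constraint
   \int f^q = 1, with q < 1. For a strictly positive kernel J has a minimizer: if f is
   a near-minimizer, the function phi with phi^(q-1) proportional to the potential of f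
   is L^1-close to f by the strict concavity of t^q, and these potentials are
   relatively compact. So minimize J with the kernel raised by eps > 0 and let eps tend
   to 0; the limit is a solution as soon as the minimizers stay bounded below on a set
   of fixed measure.
   For q < 2n/(n+alpha) this follows from a weak-type bound on f. For q critical, mass
   could only concentrate at a point, where the term in lam is negligible, so that the
   energy would tend to the sharp constant S of |x - y|^g; hence it suffices that the
   infimum of J is < S when lam < 0. By scaling S is the same on a cube as everywhere.
   On a cube, with lam/2 in place of lam, minimizers do not concentrate: dilating a
   minimizer about a corner bounds its |x - y|^(g+1)-energy, while concentration at
   scale rho makes that energy larger by a factor of the number of dyadic shells around
   the concentration point. So this energy is bounded below, and passing from lam/2 to
   lam strictly decreases the infimum below S.
   Nonexistence compares J(f) with J(f_t) for the contractions f_t(x) = f(x / t) about a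
   star centre, to first order in 1 - t: the contribution of the part of Om left
   uncovered, where f is bounded below, has the wrong sign. *)

Require Import Defs.
From mathcomp Require Import all_boot all_order all_algebra.
From mathcomp Require Import all_classical all_reals all_analysis.
From mathcomp Require Import measurable_realfun ring lra.
Import Order.TTheory GRing.Theory Num.Theory.
Import numFieldNormedType.Exports.
Local Open Scope classical_set_scope.
Local Open Scope ring_scope.

Set Implicit Arguments.
Unset Strict Implicit.
Unset Printing Implicit Defensive.

(** * Integrals of bounded measurable functions *)

Section bounded_measurable.
Context {d} {T : measurableType d} {R : realType}.
Implicit Types (D : set T) (f g : T -> R).

(** Write u for the potential of f. Since q < 1, the Euler-Lagrange relation u = m f^(q - 1) has a
    negative exponent: an upper bound on f comes from a lower bound on u, and a lower bound on f
    from an upper bound on u. Every estimate is therefore two-sided, and the danger is that u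
    becomes small when eps tends to 0. Moreover the integral of f^q does not pass to weak limits.
    For both reasons compactness is asked only of potentials, and f is recovered from u as (u /
    m)^(-1 / (1 - q)). Once u lies between positive constants, so does f. Competitors may then be
    restricted to bounded measurable functions on sets of finite measure, where all integrals are
    finite and Fubini's theorem is always available. With g = alpha - n the critical exponent is 2n
    / (2n + g), the one for which the |x - y|^g-energy and the power 2 / q of the integral of f^q
    scale alike under dilations. Criticality is used through this scaling and through g / (1 - q) =
    2n + g, the decay rate of f away from a concentration point. *)

Definition bmeas D f :=
  measurable_fun D f /\ exists C, forall x, D x -> `|f x| <= C.

Lemma bmeas_ext D f g : (forall x, D x -> f x = g x) -> bmeas D f -> bmeas D g.
Proof.
move=> fg [mf [C fC]]; split; last by exists C => x Dx; rewrite -fg// fC.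
by apply: eq_measurable_fun mf => x /set_mem Dx; rewrite fg.
Qed.

Lemma bmeasS D D' f : measurable D -> D' `<=` D -> bmeas D f -> bmeas D' f.
Proof.
move=> mD DD [mf [C fC]]; split; first exact: measurable_funS mf.
by exists C => x /DD /fC.
Qed.

Lemma bmeas_cst D (c : R) : bmeas D (fun=> c).
Proof. by split; [exact: measurable_cst|exists `|c|]. Qed.

Lemma bmeasD D f g : bmeas D f -> bmeas D g -> bmeas D (fun x => f x + g x).
Proof.
move=> [mf [C fC]] [mg [C' gC]]; split; first exact: measurable_funD.
exists (C + C') => x Dx; rewrite (le_trans (ler_normD _ _))//.
by rewrite lerD// ?fC ?gC.
Qed.

Lemma bmeasM D f g : bmeas D f -> bmeas D g -> bmeas D (fun x => f x * g x).
Proof.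
move=> [mf [C fC]] [mg [C' gC]]; split; first exact: measurable_funM.
exists (C * C') => x Dx; rewrite normrM.
by rewrite ler_pM// ?fC ?gC.
Qed.

Lemma bmeasZ D c f : bmeas D f -> bmeas D (fun x => c * f x).
Proof. by apply: bmeasM; exact: bmeas_cst. Qed.

Lemma bmeasZr D c f : bmeas D f -> bmeas D (fun x => f x * c).
Proof. by move=> bf; apply: bmeasM => //; exact: bmeas_cst. Qed.

Lemma bmeasN D f : bmeas D f -> bmeas D (fun x => - f x).
Proof.
by move=> /(bmeasZ (-1)); apply: bmeas_ext => x _; rewrite mulN1r.
Qed.

Lemma bmeasB D f g : bmeas D f -> bmeas D g -> bmeas D (fun x => f x - g x).
Proof. by move=> bf bg; exact/bmeasD/bmeasN. Qed.

Lemma bmeas_norm D f : bmeas D f -> bmeas D (fun x => `|f x|).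
Proof.
move=> [mf [C fC]]; split; first exact: measurableT_comp.
by exists C => x Dx; rewrite normr_id fC.
Qed.

Lemma bmeas_indic D (A : set T) : measurable A -> bmeas D (\1_A : T -> R).
Proof.
move=> mA; split; first exact: measurable_indic.
by exists 1 => x _; rewrite indicE; case: (x \in A); rewrite ?normr1 ?normr0.
Qed.

Lemma bmeas_powR D f p : (forall x, D x -> 0 <= f x) -> 0 <= p ->
  bmeas D f -> bmeas D (fun x => f x `^ p).
Proof.
move=> f0 p0 [mf [C fC]]; split.
  by apply: (measurableT_comp (measurable_powR p)).
exists (C `^ p) => x Dx; rewrite ger0_norm ?powR_ge0//.
apply: ge0_ler_powR => //; rewrite ?nnegrE ?f0//.
  by rewrite (le_trans _ (fC _ Dx)).
by rewrite (le_trans (ler_norm _))// fC.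
Qed.

Lemma bmeas_powR_pos D f c p : 0 < c -> (forall x, D x -> c <= f x) ->
  bmeas D f -> bmeas D (fun x => f x `^ p).
Proof.
move=> c0 fc bf; have f0 x : D x -> 0 <= f x by move=> /fc; apply/le_trans/ltW.
have [p0|p0] := leP 0 p; first exact: bmeas_powR.
split; first by apply: (measurableT_comp (measurable_powR p)); case: bf.
exists (c `^ p) => x Dx; rewrite ger0_norm ?powR_ge0//.
rewrite -(opprK p) !(powRN _ (- p)) lef_pV2 ?posrE ?powR_gt0//; last first.
  exact: lt_le_trans (fc _ Dx).
by apply: ge0_ler_powR; rewrite ?nnegrE ?fc ?f0 ?(ltW c0)// oppr_ge0 ltW.
Qed.

Lemma bmeas_patch D (A : set T) f : measurable A -> measurable D ->
  bmeas D f -> bmeas D (fun x => f x * \1_A x).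
Proof. by move=> mA mD bf; apply: bmeasM => //; exact: bmeas_indic. Qed.

(** A uniform cluster point suffices: terms within 1 / (k + 1) of [f] are chosen, measurability
    passes to their pointwise limit, and one of them already bounds [f]. This is the form of
    convergence that [uniform_cluster] delivers. *)
Lemma bmeas_lim D (F : nat -> T -> R) f : measurable D ->
  (forall k, bmeas D (F k)) ->
  (forall e, 0 < e -> forall N, exists2 k, (N <= k)%N &
     forall x, D x -> `|F k x - f x| <= e) -> bmeas D f.
Proof.
move=> mD bF Ff.
have /choice[s sP] : forall k, exists j, forall x, D x ->
    `|F j x - f x| <= k.+1%:R^-1.
  by move=> k; have [j _ jP] := Ff k.+1%:R^-1 ltac:(by rewrite invr_gt0) 0%N; exists j.
split.
  apply: (measurable_fun_cvg (h := fun k => F (s k))) => [k|x Dx]; first by case: (bF (s k)).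
  apply/cvgrPdist_le => e e0.
  near=> k; rewrite distrC (le_trans (sP _ _ Dx))//.
  by apply: ltW; near: k; exact: near_infty_natSinv_lt (PosNum e0).
have [_ [C FC]] := bF (s 0%N); exists (C + 1) => x Dx.
have := sP 0%N x Dx; rewrite invr1 => ?.
have := FC _ Dx => ?.
rewrite -(subrK (F (s 0%N) x) (f x)) (le_trans (ler_normD _ _))//.
by rewrite distrC addrC lerD.
Unshelve. all: by end_near. Qed.

End bounded_measurable.

Section integral.
Context {d} {T : measurableType d} {R : realType}.
Variables (mu : {measure set T -> \bar R}) (D : set T).
Hypotheses (mD : measurable D) (fD : (mu D < +oo)%E).
Implicit Types f g : T -> R.

Definition vol (A : set T) : R := fine (mu A).

Lemma bmeas_integrable f : bmeas D f -> mu.-integrable D (EFin \o f).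
Proof.
move=> [mf [C fC]]; apply: measurable_bounded_integrable => //.
exists C; split; first exact: num_real.
by move=> M CM x Dx; rewrite /= (le_trans (fC _ Dx))// ltW.
Qed.

Lemma bint_EFin f : bmeas D f ->
  (\int[mu]_(x in D) (f x)%:E)%E = (\int[mu]_(x in D) f x)%:E.
Proof.
by move=> bf; rewrite fineK//; exact/integrable_fin_num/bmeas_integrable.
Qed.

Lemma bintD f g : bmeas D f -> bmeas D g ->
  \int[mu]_(x in D) (f x + g x) =
  \int[mu]_(x in D) f x + \int[mu]_(x in D) g x.
Proof. by move=> bf bg; apply: RintegralD => //; exact: bmeas_integrable. Qed.

Lemma bintB f g : bmeas D f -> bmeas D g ->
  \int[mu]_(x in D) (f x - g x) =
  \int[mu]_(x in D) f x - \int[mu]_(x in D) g x.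
Proof. by move=> bf bg; apply: RintegralB => //; exact: bmeas_integrable. Qed.

Lemma bintZ c f : bmeas D f ->
  \int[mu]_(x in D) (c * f x) = c * \int[mu]_(x in D) f x.
Proof. by move=> bf; apply: RintegralZl => //; exact: bmeas_integrable. Qed.

Lemma bintZr c f : bmeas D f ->
  \int[mu]_(x in D) (f x * c) = (\int[mu]_(x in D) f x) * c.
Proof. by move=> bf; apply: RintegralZr => //; exact: bmeas_integrable. Qed.

Lemma le_bint f g : bmeas D f -> bmeas D g ->
  (forall x, D x -> f x <= g x) ->
  \int[mu]_(x in D) f x <= \int[mu]_(x in D) g x.
Proof. by move=> bf bg; apply: le_Rintegral => //; exact: bmeas_integrable. Qed.

Lemma eq_bint f g : (forall x, D x -> f x = g x) ->
  \int[mu]_(x in D) f x = \int[mu]_(x in D) g x.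
Proof. by move=> fg; apply: eq_Rintegral => x /set_mem; exact: fg. Qed.

Lemma bint_cst (c : R) : \int[mu]_(x in D) c = c * vol D.
Proof. exact: Rintegral_cst. Qed.

Lemma vol_ge0 A : 0 <= vol A.
Proof. exact/fine_ge0/measure_ge0. Qed.

Lemma bint_le_cst c f : bmeas D f -> (forall x, D x -> f x <= c) ->
  \int[mu]_(x in D) f x <= c * vol D.
Proof.
move=> bf fc; rewrite -bint_cst; apply: le_bint => //; exact: bmeas_cst.
Qed.

Lemma cst_le_bint c f : bmeas D f -> (forall x, D x -> c <= f x) ->
  c * vol D <= \int[mu]_(x in D) f x.
Proof.
move=> bf fc; rewrite -bint_cst; apply: le_bint => //; exact: bmeas_cst.
Qed.

Lemma le_norm_bint f : bmeas D f ->
  `|\int[mu]_(x in D) f x| <= \int[mu]_(x in D) `|f x|.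
Proof. by move=> bf; apply: le_normr_Rintegral => //; exact: bmeas_integrable. Qed.

Lemma bint_indic f A : measurable A -> A `<=` D ->
  \int[mu]_(x in D) (f x * \1_A x) = \int[mu]_(x in A) f x.
Proof.
move=> mA AD; rewrite -[in RHS](setIidr AD) Rintegral_mkcondr.
by apply: eq_bint => x Dx; rewrite patchE indicE; case: ifP => xA; rewrite ?mulr1 ?mulr0.
Qed.

Lemma bint_indic1 A : measurable A -> A `<=` D ->
  \int[mu]_(x in D) (\1_A x) = vol A.
Proof.
move=> mA AD.
rewrite -(@eq_bint (fun x => 1 * \1_A x))//; last by move=> x _; rewrite mul1r.
by rewrite (bint_indic (fun=> 1))// Rintegral_cst// mul1r.
Qed.

Lemma bintS f A : measurable A -> A `<=` D -> bmeas D f ->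
  (forall x, D x -> 0 <= f x) ->
  \int[mu]_(x in A) f x <= \int[mu]_(x in D) f x.
Proof.
move=> mA AD bf f0; rewrite -(bint_indic _ mA AD); apply: le_bint => //.
  exact: bmeas_patch.
by move=> x Dx; rewrite indicE ler_piMr ?f0//; case: (x \in A).
Qed.

Lemma bint_split f A : measurable A -> A `<=` D -> bmeas D f ->
  \int[mu]_(x in D) f x = \int[mu]_(x in A) f x + \int[mu]_(x in D `\` A) f x.
Proof.
move=> mA AD bf; rewrite -(bint_indic _ mA AD) -(@bint_indic f (D `\` A)).
- rewrite -bintD; [|exact: bmeas_patch|apply: bmeas_patch => //; exact: measurableD].
  apply: eq_bint => x Dx; rewrite !indicE in_setD (mem_set Dx)/=.
  by case: (x \in A) => /=; rewrite ?mulr1 ?mulr0 ?addr0 ?add0r.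
- exact: measurableD.
- exact: subDsetl.
Qed.

Lemma vol_le A B : measurable A -> measurable B -> A `<=` B -> B `<=` D ->
  vol A <= vol B.
Proof.
move=> mA mB AB BD; rewrite fine_le//.
- rewrite ge0_fin_numE// (le_lt_trans _ fD)//; apply: le_measure; rewrite ?inE//.
  exact: subset_trans BD.
- by rewrite ge0_fin_numE// (le_lt_trans _ fD)//; apply: le_measure; rewrite ?inE.
- by apply: le_measure; rewrite ?inE.
Qed.

Lemma vol_fin A : measurable A -> A `<=` D -> (mu A < +oo)%E.
Proof.
by move=> mA AD; rewrite (le_lt_trans _ fD)//; apply: le_measure; rewrite ?inE.
Qed.

Lemma vol_split A : measurable A -> A `<=` D ->
  vol D = vol A + vol (D `\` A).
Proof.
move=> mA AD; have := bint_split mA AD (@bmeas_cst _ _ R D 1).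
by rewrite !Rintegral_cst ?mul1r//; exact: measurableD.
Qed.

End integral.

Arguments vol {d T R} mu A.

(** * Potentials and energies *)

Section fubini.
Context {d} {T : measurableType d} {R : realType}.
Variables (mu : {sigma_finite_measure set T -> \bar R}) (D : set T).
Hypotheses (mD : measurable D) (fD : (mu D < +oo)%E).
Implicit Types (f g : T -> R) (H : T * T -> R).

Lemma bmeas_fst f : bmeas D f -> bmeas (D `*` D) (fun z => f z.1).
Proof.
move=> [mf [C fC]]; split; last by exists C => -[x y] /= [Dx _]; exact: fC.
apply: (measurable_comp (F := D) mD _ mf).
  by move=> _ [[x y] /= [Dx _] <-].
exact: (measurable_funTS measurable_fst).
Qed.

Lemma bmeas_snd f : bmeas D f -> bmeas (D `*` D) (fun z => f z.2).
Proof.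
move=> [mf [C fC]]; split; last by exists C => -[x y] /= [_ Dy]; exact: fC.
apply: (measurable_comp (F := D) mD _ mf).
  by move=> _ [[x y] /= [_ Dy] <-].
exact: (measurable_funTS measurable_snd).
Qed.

Lemma bmeas_sec H x : D x -> bmeas (D `*` D) H -> bmeas D (fun y => H (x, y)).
Proof.
move=> Dx [mH [C HC]]; split; last by exists C => y Dy; exact: HC.
apply: (measurable_comp (F := D `*` D) _ _ mH).
- exact: measurableX.
- by move=> _ [y Dy <-].
- exact: (measurable_funTS (pair1_measurable x)).
Qed.

Lemma bmeas_swap H : bmeas (D `*` D) H -> bmeas (D `*` D) (fun z => H (z.2, z.1)).
Proof.
move=> [mH [C HC]]; split; last by exists C => -[x y] [/= Dx Dy]; exact: HC.
apply: (measurable_comp (F := D `*` D) _ _ mH).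
- exact: measurableX.
- by move=> _ [[x y] [/= Dx Dy] <-].
- apply: measurable_funTS; apply: measurable_fun_pair; [exact: measurable_snd|exact: measurable_fst].
Qed.

(** Extension by zero turns integrals over [D] into integrals over the whole space, where Fubini's
    theorem is applied. *)
Let G H := H \_ (D `*` D).

Let G_integrable H : bmeas (D `*` D) H ->
  (mu \x mu)%E.-integrable setT (EFin \o G H).
Proof.
move=> [mH [C HC]].
have mDD : measurable (D `*` D) by exact: measurableX.
rewrite (_ : EFin \o G H = (EFin \o H) \_ (D `*` D)); last first.
  by apply/funext => z; rewrite /G/= !patchE; case: ifP.
have /= E := integrable_mkcond (mu := product_measure1 mu mu) (EFin \o H) mDD.
apply/E.
apply: (@measurable_bounded_integrable _ _ R (mu \x mu)%E H (D `*` D) mDD) => //.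
  apply: (@le_lt_trans _ _ (mu D * mu D)%E).
    by rewrite -(product_measure1E mu mu mD mD).
  by rewrite lte_mul_pinfty// ge0_fin_numE.
exists C; split; first exact: num_real.
by move=> M CM z Dz; rewrite /= (le_trans (HC _ Dz))// ltW.
Qed.

Let GF H x : D x ->
  (\int[mu]_y (G H (x, y))%:E = \int[mu]_(y in D) (H (x, y))%:E)%E.
Proof.
move=> Dx; rewrite [RHS]integral_mkcond; apply: eq_integral => y _.
by rewrite /G !patchE in_setX (mem_set Dx)/=; case: ifP.
Qed.

Let GF0 H x : ~ D x -> (\int[mu]_y (G H (x, y))%:E = 0)%E.
Proof.
move=> Dx; rewrite integral0_eq// => y _.
by rewrite /G !patchE in_setX memNset.
Qed.

Let GF' H y : D y ->
  (\int[mu]_x (G H (x, y))%:E = \int[mu]_(x in D) (H (x, y))%:E)%E.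
Proof.
move=> Dx; rewrite [RHS]integral_mkcond; apply: eq_integral => x _.
by rewrite /G !patchE in_setX (mem_set Dx)/= andbT; case: ifP.
Qed.

Let GF0' H y : ~ D y -> (\int[mu]_x (G H (x, y))%:E = 0)%E.
Proof.
move=> Dx; rewrite integral0_eq// => x _.
by rewrite /G !patchE in_setX (memNset Dx) andbF.
Qed.

Lemma bmeas_bint H : bmeas (D `*` D) H ->
  bmeas D (fun x => \int[mu]_(y in D) H (x, y)).
Proof.
move=> bH; have iG := G_integrable bH; split.
  apply: (@eq_measurable_fun _ _ _ _ _
    (fine \o (fun x => \int[mu]_y (G H (x, y))%:E)%E)).
    by move=> x /set_mem Dx; rewrite /= GF.
  apply: measurable_funTS; apply: measurableT_comp => //.
  exact: (measurable_fubini_F iG).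
have [_ [C HC]] := bH.
exists (C * vol mu D) => x Dx; have bx := bmeas_sec Dx bH.
rewrite (le_trans (le_norm_bint mD fD bx))//.
apply: bint_le_cst => //; first exact: bmeas_norm.
by move=> y Dy; apply: HC.
Qed.

Lemma bint_fubini H : bmeas (D `*` D) H ->
  \int[mu]_(x in D) \int[mu]_(y in D) H (x, y) =
  \int[mu]_(y in D) \int[mu]_(x in D) H (x, y).
Proof.
move=> bH; have iG := G_integrable bH.
have := Fubini iG => /= FG.
rewrite /Rintegral; congr fine.
transitivity (\int[mu]_x \int[mu]_y (G H (x, y))%:E)%E.
  rewrite integral_mkcond; apply: eq_integral => x _.
  rewrite patchE; case: ifPn => [/set_mem Dx|/negP xD].
    by rewrite GF// (bint_EFin mD fD (bmeas_sec Dx bH)).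
  by rewrite GF0// => Dx; apply: xD; rewrite inE.
rewrite FG [RHS]integral_mkcond; apply: eq_integral => y _.
rewrite patchE; case: ifPn => [/set_mem Dy|/negP yD].
  by rewrite GF'// (bint_EFin mD fD (bmeas_sec Dy (bmeas_swap bH))).
by rewrite GF0'// => Dy; apply: yD; rewrite inE.
Qed.

End fubini.

Section potential.
Context {d} {T : measurableType d} {R : realType}.
Variables (mu : {sigma_finite_measure set T -> \bar R}) (K : T -> T -> R).

Definition pot (D : set T) (f : T -> R) (x : T) : R :=
  \int[mu]_(y in D) (K x y * f y).

(** With both arguments equal to [f] this is the energy J(f). *)
Definition bil (D : set T) (f g : T -> R) : R :=
  \int[mu]_(x in D) (f x * pot D g x).

Variable D : set T.
Hypotheses (mD : measurable D) (fD : (mu D < +oo)%E).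
Hypothesis bK : bmeas (D `*` D) (fun z => K z.1 z.2).
Implicit Types f g h : T -> R.

Let bKf f x : D x -> bmeas D f -> bmeas D (fun y => K x y * f y).
Proof.
move=> Dx bf; apply: bmeasM => //.
exact: (@bmeas_sec _ _ _ _ mD (fun z => K z.1 z.2) x Dx bK).
Qed.

Lemma bmeas_K_l x : D x -> bmeas D (K x).
Proof. by move=> Dx; exact: (@bmeas_sec _ _ _ _ mD (fun z => K z.1 z.2) x Dx bK). Qed.

Lemma bmeas_pot f : bmeas D f -> bmeas D (pot D f).
Proof.
move=> bf; rewrite /pot.
apply: (@bmeas_bint _ _ _ mu D mD fD (fun z => K z.1 z.2 * f z.2)).
by apply: bmeasM => //; exact: bmeas_snd.
Qed.

Lemma potD f g x : D x -> bmeas D f -> bmeas D g ->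
  pot D (fun y => f y + g y) x = pot D f x + pot D g x.
Proof.
move=> Dx bf bg; rewrite /pot -bintD//; try exact: bKf.
by apply: eq_bint => y _; rewrite mulrDr.
Qed.

Lemma potZ c f x : D x -> bmeas D f ->
  pot D (fun y => c * f y) x = c * pot D f x.
Proof.
move=> Dx bf; rewrite /pot -bintZ//; try exact: bKf.
by apply: eq_bint => y _; rewrite mulrCA.
Qed.

Lemma bilDr f g h : bmeas D f -> bmeas D g -> bmeas D h ->
  bil D f (fun y => g y + h y) = bil D f g + bil D f h.
Proof.
move=> bf bg bh; rewrite /bil -bintD//; last 2 first.
- by apply: bmeasM => //; exact: bmeas_pot.
- by apply: bmeasM => //; exact: bmeas_pot.
by apply: eq_bint => x Dx; rewrite potD// mulrDr.
Qed.

Lemma bilDl f g h : bmeas D f -> bmeas D g -> bmeas D h ->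
  bil D (fun y => f y + g y) h = bil D f h + bil D g h.
Proof.
move=> bf bg bh; rewrite /bil -bintD//; last 2 first.
- by apply: bmeasM => //; exact: bmeas_pot.
- by apply: bmeasM => //; exact: bmeas_pot.
by apply: eq_bint => x Dx; rewrite mulrDl.
Qed.

Lemma bilZr c f g : bmeas D f -> bmeas D g ->
  bil D f (fun y => c * g y) = c * bil D f g.
Proof.
move=> bf bg; rewrite /bil -bintZ//; last first.
  by apply: bmeasM => //; exact: bmeas_pot.
by apply: eq_bint => x Dx; rewrite potZ// mulrCA.
Qed.

Lemma bilZl c f g : bmeas D f -> bmeas D g ->
  bil D (fun y => c * f y) g = c * bil D f g.
Proof.
move=> bf bg; rewrite /bil -bintZ//; last first.
  by apply: bmeasM => //; exact: bmeas_pot.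
by apply: eq_bint => x Dx; rewrite mulrA.
Qed.

Hypothesis symK : forall x y, K x y = K y x.

Lemma bilC f g : bmeas D f -> bmeas D g -> bil D f g = bil D g f.
Proof.
move=> bf bg; rewrite /bil /pot.
transitivity (\int[mu]_(x in D) \int[mu]_(y in D) (f x * (K x y * g y))).
  by apply: eq_bint => x Dx; rewrite bintZ//; exact: bKf.
rewrite (@bint_fubini _ _ _ mu D mD fD (fun z => f z.1 * (K z.1 z.2 * g z.2))); last first.
  apply: bmeasM; first exact: bmeas_fst.
  by apply: bmeasM => //; exact: bmeas_snd.
apply: eq_bint => y Dy /=; rewrite -bintZ//; last exact: bKf.
by apply: eq_bint => x Dx; rewrite symK; ring.
Qed.

(** Serves twice: for the second variation of a near-minimizer towards phi, and with [t] = 1 for the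
    comparison of a solution with its contractions. *)
Lemma bil_line f h t : bmeas D f -> bmeas D h ->
  bil D (fun x => f x + t * h x) (fun x => f x + t * h x) =
  bil D f f + 2 * t * bil D h f + t ^+ 2 * bil D h h.
Proof.
move=> bf bh; have bth := bmeasZ t bh.
rewrite (bilDl bf bth (bmeasD bf bth)) (bilDr bf bf bth) (bilDr bth bf bth).
rewrite (bilZr t bf bh) (bilZl t bh bf) (bilZl t bh bth) (bilZr t bh bh).
rewrite (bilC bf bh).
by move: (bil D f f) (bil D h f) (bil D h h) => a b c; ring.
Qed.

End potential.

(** * Concavity and compactness *)

Section powR_inequalities.
Context {R : realType}.
Implicit Types a b p q s t x y : R.

Lemma powR_tangent q a t : 0 < q < 1 -> 0 < a -> 0 <= t ->
  t `^ q <= a `^ q + q * a `^ (q - 1) * (t - a).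
Proof.
move=> /andP[q0 q1] a0 t0.
have aq : a `^ (q - 1) = a `^ q / a.
  by rewrite powRB ?powRr1 ?ltW// (gt_eqF a0) implybT.
have ta0 : 0 <= t / a by rewrite divr_ge0// ltW.
suff H : (t / a) `^ q <= 1 + q * (t / a - 1).
  have -> : a `^ q + q * a `^ (q - 1) * (t - a) = a `^ q * (1 + q * (t / a - 1)).
    by rewrite aq; field; rewrite gt_eqF.
  have -> : t `^ q = a `^ q * (t / a) `^ q.
    by rewrite -powRM ?(ltW a0)// mulrCA mulfV ?gt_eqF// mulr1.
  by rewrite ler_pM2l// powR_gt0.
(* Young's inequality with the conjugate exponents 1 / q and 1 / (1 - q), for the product of (t /
   a)^q and 1, is the tangent inequality at 1. *)
have := @conjugate_powR _ ((t / a) `^ q) 1 q^-1 (1 - q)^-1 (powR_ge0 _ _) ler01.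
rewrite !invr_gt0 subr_gt0 !invrK => /(_ q0 q1).
rewrite -powRrM mulfV ?gt_eqF// powRr1// powR1 mulr1 => H.
by apply: (le_trans (H _)); lra.
Qed.

Lemma powR_concave q a b t : 0 < q < 1 -> 0 <= a -> 0 <= b -> 0 <= t <= 1 ->
  (1 - t) * a `^ q + t * b `^ q <= ((1 - t) * a + t * b) `^ q.
Proof.
move=> q01 a0 b0 /andP[t0 t1]; set c := _ + t * b.
have q0 : 0 < q by case/andP: q01.
have ta : 0 <= (1 - t) * a by rewrite mulr_ge0// subr_ge0.
have tb : 0 <= t * b by rewrite mulr_ge0.
have [c0|] := ltP 0 c.
  have /(ler_wpM2l (_ : 0 <= 1 - t)) := powR_tangent q01 c0 a0.
  rewrite subr_ge0 => /(_ t1) h1.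
  have /(ler_wpM2l t0) h2 := powR_tangent q01 c0 b0.
  apply: (le_trans (lerD h1 h2)); rewrite le_eqVlt; apply/orP; left; apply/eqP.
  transitivity (c `^ q + q * c `^ (q - 1) * ((1 - t) * a + t * b - c)); first by ring.
  by rewrite -/c; ring.
rewrite /c => c0; have a00 : (1 - t) * a = 0 by lra.
have b00 : t * b = 0 by lra.
rewrite a00 b00 addr0 powR0 ?gt_eqF//.
move/eqP: a00; rewrite mulf_eq0 => /orP[|]/eqP -> ; last first.
  rewrite powR0 ?gt_eqF// mulr0 add0r.
  by move/eqP: b00; rewrite mulf_eq0 => /orP[|]/eqP ->; rewrite ?powR0 ?gt_eqF// ?mulr0 ?mul0r.
rewrite mul0r add0r.
by move/eqP: b00; rewrite mulf_eq0 => /orP[|]/eqP ->; rewrite ?powR0 ?gt_eqF// ?mulr0 ?mul0r.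
Qed.

(** The Bregman distance of the convex function - t^q / q: the height at x of the tangent to t^q / q
    at y above the graph. *)
Definition cgap q x y := y `^ (q - 1) * (x - y) - (x `^ q - y `^ q) / q.

Lemma cgap_ge0 q x y : 0 < q < 1 -> 0 <= x -> 0 < y -> 0 <= cgap q x y.
Proof.
move=> q01 x0 y0; have q0 : 0 < q by case/andP: q01.
have := powR_tangent q01 y0 x0; rewrite -(ler_pM2l (_ : 0 < q^-1)) ?invr_gt0//.
move=> H; rewrite /cgap subr_ge0.
have -> : y `^ (q - 1) * (x - y) = q^-1 * (q * y `^ (q - 1) * (x - y)).
  by rewrite -mulrA mulKf// gt_eqF.
by rewrite [X in X <= _]mulrC; lra.
Qed.

(* Stability: the tangent at (1 + e) y (resp. (1 - e) y) has strictly smaller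
   (resp. larger) slope than the tangent at y. *)
Lemma cgap_stable q e : 0 < q < 1 -> 0 < e < 1 ->
  exists2 C, 0 < C & forall x y, 0 <= x -> 0 < y ->
    `|x - y| <= e * y + C * (y `^ (1 - q) * cgap q x y).
Proof.
move=> q01 /andP[e0 e1]; have q0 : 0 < q by case/andP: q01.
have q1 : 0 < 1 - q by case/andP: q01; lra.
pose k1 := 1 - (1 + e) `^ (q - 1).
pose k2 := (1 - e) `^ (q - 1) - 1.
have one : (1 : R) = 1 `^ (1 - q) by rewrite powR1.
have P1 : 0 < (1 + e) `^ (q - 1) < 1.
  rewrite powR_gt0 ?addr_gt0//= -opprB powRN invf_lt1 ?powR_gt0 ?addr_gt0//.
  by rewrite [ltLHS]one gt0_ltr_powR ?nnegrE; lra.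
have P2 : 1 < (1 - e) `^ (q - 1).
  rewrite -(opprB 1 q) powRN invf_gt1 ?powR_gt0 ?subr_gt0//.
  by rewrite [ltRHS]one gt0_ltr_powR ?nnegrE; lra.
have k10 : 0 < k1 by rewrite /k1; lra.
have k20 : 0 < k2 by rewrite /k2; lra.
exists (k1^-1 + k2^-1); first by rewrite addr_gt0 ?invr_gt0.
move=> x y x0 y0; set h := y `^ _ * _.
have h0 : 0 <= h by rewrite mulr_ge0 ?powR_ge0 ?cgap_ge0.
have yy : y `^ (1 - q) * y `^ (q - 1) = 1.
  by rewrite -(opprB 1 q) powRN divff// gt_eqF ?powR_gt0.
(* the gap seen from the tangent at a = r y *)
have key r : 0 < r -> (1 - r `^ (q - 1)) * (x - r * y) <= h.
  move=> r0; have ry0 : 0 < r * y by rewrite mulr_gt0.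
  have t1 := powR_tangent q01 ry0 x0.
  have t2 := powR_tangent q01 y0 (ltW ry0).
  have -> : h = (x - y) - y `^ (1 - q) * (x `^ q - y `^ q) / q.
    by rewrite /h /cgap mulrBr !mulrA yy mul1r.
  have : y `^ (1 - q) * (x `^ q - y `^ q) / q <=
      y `^ (1 - q) * (q * (r * y) `^ (q - 1) * (x - r * y) +
         q * y `^ (q - 1) * (r * y - y)) / q.
    by rewrite ler_pM2r ?invr_gt0// ler_pM2l ?powR_gt0//; lra.
  rewrite (powRM (q - 1) (ltW r0) (ltW y0)) => H.
  suff : y `^ (1 - q) * (q * (r `^ (q - 1) * y `^ (q - 1)) * (x - r * y) +
         q * y `^ (q - 1) * (r * y - y)) / q =
     (y `^ (1 - q) * y `^ (q - 1)) * (r `^ (q - 1) * (x - r * y) + (r * y - y)).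
    by rewrite yy => E; rewrite E in H; lra.
  by field; rewrite gt_eqF.
have [xy|xy] := leP ((1 + e) * y) x.
  have := key (1 + e) ltac:(lra); rewrite -/k1 mulrC -ler_pdivlMr// => H.
  have : 0 <= k2^-1 * h by rewrite mulr_ge0// invr_ge0 ltW.
  by rewrite ger0_norm; [|nra]; rewrite mulrDl [k1^-1 * h]mulrC; nra.
have [xy'|xy'] := leP x ((1 - e) * y).
  have := key (1 - e) ltac:(lra).
  have -> : (1 - (1 - e) `^ (q - 1)) * (x - (1 - e) * y) = ((1 - e) * y - x) * k2.
    by rewrite /k2; ring.
  rewrite -ler_pdivlMr// => H.
  have : 0 <= k1^-1 * h by rewrite mulr_ge0// invr_ge0 ltW.
  by rewrite ler0_norm; [|nra]; rewrite mulrDl [k2^-1 * h]mulrC; nra.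
have : 0 <= (k1^-1 + k2^-1) * h by rewrite mulr_ge0// addr_ge0// invr_ge0 ltW.
by rewrite ler_norml; nra.
Qed.

(** By the mean value theorem the constant has to dominate z^(p - 1) on [c, C]; the sum of the two
    endpoint values does so whatever the sign of p - 1. *)
Lemma powR_lipschitz p c C : 0 < c -> exists2 L, 0 <= L & forall x y,
  c <= x <= C -> c <= y <= C -> `|x `^ p - y `^ p| <= L * `|x - y|.
Proof.
move=> c0; exists (`|p| * (c `^ (p - 1) + C `^ (p - 1))).
  by rewrite mulr_ge0// addr_ge0// powR_ge0.
suff H x y : c <= x <= C -> c <= y <= C -> x < y ->
    `|x `^ p - y `^ p| <= `|p| * (c `^ (p - 1) + C `^ (p - 1)) * `|x - y|.
  move=> x y xc yc; have [xy|xy|->] := ltgtP x y; first exact: H.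
  - by rewrite distrC [X in _ * X]distrC; exact: H.
  - by rewrite !subrr !normr0 mulr0.
move=> /andP[cx xC] /andP[cy yC] xy.
have dp z : z \in `]x, y[ -> is_derive z 1 (@powR R ^~ p) (p * z `^ (p - 1)).
  by rewrite in_itv/= => /andP[xz _]; apply: is_derive1_powR; lra.
have [|z] := MVT xy dp.
  apply: derivable_within_continuous => z; rewrite in_itv/= => /andP[xz _].
  apply: derivable_powR; rewrite in_itv/= andbT; lra.
rewrite in_itv/= => /andP[xz zy] E.
have -> : `|x `^ p - y `^ p| = `|p| * `|z `^ (p - 1)| * `|x - y|.
  by rewrite distrC E !normrM (distrC x).
apply: ler_wpM2r => //; apply: ler_wpM2l => //.
rewrite ger0_norm ?powR_ge0//.
have [p1|p1] := leP 0 (p - 1).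
  apply: (le_trans (ge0_ler_powR p1 _ _ (_ : z <= C))); rewrite ?nnegrE; [lra|lra|lra|].
  by rewrite lerDr powR_ge0.
apply: (@le_trans _ _ (c `^ (p - 1))); last by rewrite lerDl powR_ge0.
rewrite -(opprK (p - 1)) ![_ `^ (- - _)]powRN lef_pV2 ?posrE ?powR_gt0//; [|lra].
by apply: ge0_ler_powR; rewrite ?nnegrE; lra.
Qed.

End powR_inequalities.

Section ascoli.
Import ArrowAsProduct.

(* Arzela-Ascoli: a cluster point for pointwise convergence, given by
   Tychonoff's theorem, is a uniform cluster point. *)
Lemma uniform_cluster (R : realType) (T : Type) (D : set T) (u : nat -> T -> R) C :
  (forall j x, D x -> `|u j x| <= C) ->
  (forall e, 0 < e -> exists k (p : 'I_k -> T), (forall i, D (p i)) /\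
     forall x, D x -> exists i, forall j, `|u j x - u j (p i)| <= e) ->
  exists v : T -> R, forall e, 0 < e -> forall N, exists2 j, (N <= j)%N &
    forall x, D x -> `|u j x - v x| <= e.
Proof.
move=> uC unet.
(* Cut off outside [D], where nothing bounds [u], so that all functions lie in one product of
   segments. *)
pose U j : {classic T} -> R := fun x => u j x * \1_D x.
have cA := @tychonoff {classic T} (fun=> R) (fun=> `[- `|C|, `|C|]%classic)
  (fun=> @segment_compact R _ _).
have [v [_ vcl]] : [set f : {classic T} -> R | forall x, `[- `|C|, `|C|]%classic (f x)]
    `&` cluster (U @ \oo) !=set0.
  apply: cA; exists 0%N => // j _ x /=; rewrite in_itv/= -ler_norml /U.
  rewrite indicE; case: (boolP (x \in D)) => [/set_mem Dx|_].
    by rewrite mulr1 (le_trans (uC _ _ Dx))// ler_norm.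
  by rewrite mulr0 normr0.
have vnb (e : R) x : 0 < e ->
    nbhs (v : forall _ : {classic T}, R) [set f : {classic T} -> R | `|f x - v x| < e].
  move=> e0; have := @proj_continuous {classic T} (fun=> R) x v.
  move=> /(_ [set r | `|r - v x| < e]); apply.
  by apply/nbhs_ballP; exists e => //= r; rewrite /ball/= distrC.
exists v => e e0 N.
(* Going from u j x to v x costs one [h] for moving u j to the net point, one for replacing it by v
   there, and three for moving v back to x. *)
pose h := e / 5; have h0 : 0 < h by rewrite divr_gt0.
have UE j x : D x -> U j x = u j x by move=> Dx; rewrite /U indicE mem_set// mulr1.
have UN : (U @ \oo) [set U j | j in [set j | (N <= j)%N]].
  by exists N => // j /= Nj; exists j.
have [k [p [Dp pnet]]] := unet h h0.
have vp : nbhs (v : forall _ : {classic T}, R)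
    [set f : {classic T} -> R | forall i, `|f (p i) - v (p i)| < h].
  have F := @filter_forall _ 'I_k (fun i (f : {classic T} -> R) => `|f (p i) - v (p i)| < h)
    (nbhs (v : forall _ : {classic T}, R)) _.
  by apply: F => i; exact: vnb.
have [_ [[j Nj <-] jp]] := vcl _ _ UN vp.
exists j => // x Dx; have [i pi] := pnet _ Dx.
(* The index [j] is close to v only at the finitely many net points; the variation of v up to x is
   read off from another index [j'], chosen after x. *)
have vx : `|v x - v (p i)| <= h + h + h.
  have [_ [[j' _ <-] [jx jpi]]] := vcl _ _ UN (filterI (vnb h x h0) (vnb h (p i) h0)).
  rewrite /= !UE// in jx jpi.
  have := pi j'; move: jx jpi => /ltW + /ltW.
  by rewrite !ler_norml; lra.
have := jp i; rewrite /= UE// => /ltW.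
have := pi j; move: vx; rewrite !ler_norml /h; lra.
Qed.

End ascoli.

Lemma le_of_forall_ge {R : realFieldType} (x y C : R) : 0 <= C ->
  (forall e, 0 < e -> x <= y + C * e) -> x <= y.
Proof.
move=> C0 H; apply/ler_addgt0Pr => e e0.
have := H (e / (C + 1)) ltac:(by rewrite divr_gt0// ltr_wpDl).
move=> /le_trans; apply; rewrite lerD2l mulrCA -[leRHS]mulr1 ler_pM2l//.
by rewrite ler_pdivrMr ?mul1r ?lerDl// ltr_wpDl.
Qed.

Lemma norm_le0_of_forall {R : realFieldType} (x C : R) : 0 <= C ->
  (forall e, 0 < e -> `|x| <= C * e) -> x = 0.
Proof.
move=> C0 H; apply/eqP; rewrite -normr_le0; apply: (le_of_forall_ge C0) => e e0.
by rewrite add0r H.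
Qed.

(** The exponent -1 / (1 - q) inverts the Euler-Lagrange relation. It is negative, so the inversion
    exchanges upper and lower bounds. *)
Lemma powR_conj {R : realType} (q w : R) : q < 1 -> 0 <= w ->
  (w `^ (- (1 - q)^-1)) `^ (q - 1) = w.
Proof.
move=> q1 w0; rewrite -powRrM.
suff -> : - (1 - q)^-1 * (q - 1) = 1 by rewrite powRr1.
by field; rewrite subr_eq0 gt_eqF.
Qed.

Lemma powR_conjV {R : realType} (q w : R) : q < 1 -> 0 <= w ->
  (w `^ (q - 1)) `^ (- (1 - q)^-1) = w.
Proof.
move=> q1 w0; rewrite -powRrM mulrC.
suff -> : - (1 - q)^-1 * (q - 1) = 1 by rewrite powRr1.
by field; rewrite subr_eq0 gt_eqF.
Qed.

Lemma powR_decr {R : realType} (q x y : R) : q <= 0 -> 0 < x -> x <= y ->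
  y `^ q <= x `^ q.
Proof.
move=> q0 x0 xy; rewrite -(opprK q) !(powRN _ (- q)).
rewrite lef_pV2 ?posrE ?powR_gt0//; last exact: lt_le_trans xy.
by apply: ge0_ler_powR; rewrite ?nnegrE ?oppr_ge0 ?(ltW x0)// (le_trans (ltW x0)).
Qed.

Section compactness.
Context {d} {T : measurableType d} {R : realType}.
Variables (mu : {sigma_finite_measure set T -> \bar R}) (D : set T).
Hypotheses (mD : measurable D) (fD : (mu D < +oo)%E).
Variable K : T -> T -> R.
Hypothesis bK : bmeas (D `*` D) (fun z => K z.1 z.2).
Hypothesis netK : forall e, 0 < e -> exists k (p : 'I_k -> T),
  (forall i, D (p i)) /\ forall x, D x -> exists i, forall y, D y ->
     `|K x y - K (p i) y| <= e.

Lemma bound_K : exists2 b, 0 < b & forall x y, D x -> D y -> `|K x y| <= b.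
Proof.
have [_ [C KC]] := bK; exists (`|C| + 1); first by rewrite ltr_wpDl.
move=> x y Dx Dy; have := KC (x, y) (conj Dx Dy) => /= /le_trans; apply.
by rewrite (le_trans (ler_norm _))// lerDl.
Qed.

Lemma pot_le (b : R) f x : (forall y, D y -> `|K x y| <= b) -> D x -> bmeas D f ->
  `|pot mu K D f x| <= b * \int[mu]_(y in D) `|f y|.
Proof.
move=> Kb Dx bf; have bKf : bmeas D (fun y => K x y * f y).
  by apply: bmeasM => //; exact: bmeas_K_l.
rewrite (le_trans (le_norm_bint _ _ _))//.
rewrite -bintZ//; last exact: bmeas_norm.
apply: le_bint => //; first exact: bmeas_norm.
  exact/bmeasZ/bmeas_norm.
by move=> y Dy; rewrite normrM ler_wpM2r// Kb.
Qed.

Lemma pot_dist (b c : R) f g x : 0 <= b -> (forall y, D y -> `|K x y| <= b) ->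
  D x -> bmeas D f -> bmeas D g -> (forall y, D y -> `|f y - g y| <= c) ->
  `|pot mu K D f x - pot mu K D g x| <= b * (c * vol mu D).
Proof.
move=> b0 Kb Dx bf bg fg.
have -> : pot mu K D f x - pot mu K D g x = pot mu K D (fun y => f y - g y) x.
  rewrite /pot -bintB//; last 2 first.
  - by apply: bmeasM => //; exact: bmeas_K_l.
  - by apply: bmeasM => //; exact: bmeas_K_l.
  by apply: eq_bint => y _; rewrite mulrBr.
apply: (le_trans (pot_le Kb Dx (bmeasB bf bg))); apply: ler_wpM2l => //.
by apply: bint_le_cst => //; exact/bmeas_norm/bmeasB.
Qed.

(** The multipliers [m j] are adjoined to the potentials as their value at one more point [None], so
    that a single compactness argument handles both along the same indices. *)
Lemma pot_cluster (f : nat -> T -> R) (m : nat -> R) M M' :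
  (forall j, bmeas D (f j)) -> (forall j, \int[mu]_(y in D) `|f j y| <= M) ->
  (forall j, `|m j| <= M') ->
  exists v c, forall e, 0 < e -> forall N, exists2 j, (N <= j)%N &
    `|m j - c| <= e /\ forall x, D x -> `|pot mu K D (f j) x - v x| <= e.
Proof.
move=> bf fM mM; have [b b0 Kb] := bound_K.
pose D' := [set o : option T | if o is Some x then D x else True].
pose u j (o : option T) := if o is Some x then pot mu K D (f j) x else m j.
have M0 : 0 <= M.
  by apply: le_trans (fM 0%N); apply: Rintegral_ge0.
have [||v Hv] := @uniform_cluster R (option T) D' u (b * M + M').
- move=> j [x|] /= Dx; last first.
    by rewrite (le_trans (mM _))// lerDr mulr_ge0// ltW.
  apply: (le_trans (pot_le (fun y => Kb x y Dx) Dx (bf j))).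
  have : b * \int[mu]_(y in D) `|f j y| <= b * M by rewrite ler_pM2l.
  by move=> /le_trans; apply; rewrite lerDl (le_trans _ (mM 0%N)).
- move=> e e0; have e1 : 0 < e / (M + 1) by rewrite divr_gt0// ltr_wpDl.
  have [k [p [Dp pK]]] := netK e1.
  exists k.+1, (fun i => if unlift ord0 i is Some j then Some (p j) else None).
  split; first by move=> i; case: unliftP => //= *; exact: Dp.
  move=> [x|] /= Dx; last by exists ord0; rewrite unlift_none/= => j; rewrite subrr normr0 ltW.
  have [i Ki] := pK _ Dx; exists (lift ord0 i) => j; rewrite liftK/=.
  have bKx z : D z -> bmeas D (fun y => K z y * f j y).
    by move=> Dz; apply: bmeasM => //; exact: bmeas_K_l.
  rewrite /pot -bintB//; [|exact: bKx|exact: bKx].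
  rewrite (le_trans (le_norm_bint _ _ _))//; first by apply: bmeasB; exact: bKx.
  apply: (@le_trans _ _ (e / (M + 1) * \int[mu]_(y in D) `|f j y|)).
    rewrite -bintZ//; last exact: bmeas_norm.
    apply: le_bint => //; first by apply: bmeas_norm; apply: bmeasB; exact: bKx.
      exact/bmeasZ/bmeas_norm.
    by move=> y Dy; rewrite -mulrBl normrM ler_wpM2r// Ki.
  apply: (@le_trans _ _ (e / (M + 1) * (M + 1))).
    by apply: ler_wpM2l; [exact: ltW|rewrite (le_trans (fM j))// lerDl].
  by rewrite divfK// gt_eqF// ltr_wpDl.
exists (fun x => v (Some x)), (v None) => e e0 N; have [j Nj jv] := Hv e e0 N.
by exists j => //; split; [exact: (jv None)|move=> x; exact: (jv (Some x))].
Qed.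

(** Where the potentials and the multipliers cluster, so do the powers f_j^(q - 1), up to the error
    in the equation. The inverse power is Lipschitz on [F^(q - 1), dl^(q - 1)], so the f_j
    themselves cluster uniformly. The last conclusion serves to identify [c] when the limit of [m]
    is known. *)
Lemma solution_limit q (f : nat -> T -> R) (m : nat -> R) dl F m0 m1 :
  0 < q < 1 -> 0 < dl -> 0 < m0 ->
  (forall j, bmeas D (f j)) -> (forall j x, D x -> dl <= f j x <= F) ->
  (forall j, m0 <= m j <= m1) ->
  (forall j, \int[mu]_(x in D) (f j x `^ q) = 1) ->
  (forall e, 0 < e -> exists N, forall j, (N <= j)%N -> forall x, D x ->
     `|pot mu K D (f j) x - m j * f j x `^ (q - 1)| <= e) ->
  exists g c, [/\ bmeas D g, forall x, D x -> dl <= g x <= F,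
    forall x, D x -> pot mu K D g x = c * g x `^ (q - 1),
    \int[mu]_(x in D) (g x `^ q) = 1 &
    m0 <= c /\ forall e, 0 < e -> forall N, exists2 j, (N <= j)%N & `|m j - c| <= e].
Proof.
move=> q01 dl0 m00 bf fb mb fq fe.
have [q0 q1] := andP q01.
have [b b0 Kb] := bound_K.
have f0 j x : D x -> 0 < f j x by move=> /(fb j)/andP[? _]; apply: lt_le_trans dl0 _.
have [||v [c vc]] := @pot_cluster f m (F * vol mu D) m1 bf.
- move=> j; apply: bint_le_cst => //; first exact: bmeas_norm.
  by move=> x Dx; rewrite ger0_norm ?(ltW (f0 _ _ Dx))//; case/andP: (fb j _ Dx).
- move=> j; have /andP[? ?] := mb j; rewrite ger0_norm//; lra.
have c0 : m0 <= c.
  apply: (@le_of_forall_ge _ _ _ 1) => // e e0.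
  have [j _ [jc _]] := vc e e0 0%N; have /andP[? ?] := mb j.
  move: jc; rewrite ler_norml; lra.
have c00 : 0 < c by exact: lt_le_trans c0.
pose X := dl `^ (q - 1).
pose Y := F `^ (q - 1).
(* The constraint excludes an empty [D]; a point of [D] then shows [F] to be positive. *)
have [D0|[x1 Dx1]] : D = set0 \/ D !=set0.
    by case: (pselect (D !=set0)); [right|left; apply/eqP/negPn/negP => /set0P].
  move: (fq 0%N); rewrite D0 Rintegral_set0 => /eqP; by rewrite eq_sym oner_eq0.
have F0 : 0 < F by have /andP[? ?] := fb 0%N _ Dx1; lra.
have Y0 : 0 < Y by rewrite powR_gt0.
have fX j x : D x -> Y <= f j x `^ (q - 1) <= X.
  move=> Dx; have /andP[? ?] := fb j _ Dx.
  by apply/andP; split; apply: powR_decr => //; [lra|exact: f0|lra].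
have X0 : 0 <= X by rewrite powR_ge0.
have Hw e : 0 < e -> forall N, exists2 j, (N <= j)%N &
    `|m j - c| <= e /\ forall x, D x -> `|pot mu K D (f j) x - v x| <= e /\
       `|f j x `^ (q - 1) - v x / c| <= e * ((X + 2) / c).
  move=> e0 N; have [N' HN'] := fe e e0.
  have [j] := vc e e0 (maxn N N').
  rewrite geq_max => /andP[Nj N'j] [mc vj]; exists j => //; split => // x Dx.
  have vx := vj _ Dx; split => //.
  have fx := HN' j N'j x Dx; have /andP[Yx Xx] := fX j x Dx.
  have -> : f j x `^ (q - 1) - v x / c =
     (- ((m j - c) * f j x `^ (q - 1)) - (pot mu K D (f j) x - m j * f j x `^ (q - 1))
       + (pot mu K D (f j) x - v x)) / c.
    by field; rewrite gt_eqF.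
  rewrite normrM (ger0_norm (_ : 0 <= c^-1)) ?invr_ge0 ?(ltW c00)//.
  rewrite mulrA ler_wpM2r ?invr_ge0 ?(ltW c00)//.
  rewrite (le_trans (ler_normD _ _))//.
  have := ler_normB (- ((m j - c) * f j x `^ (q - 1))) (pot mu K D (f j) x - m j * f j x `^ (q - 1)).
  rewrite normrN normrM (ger0_norm (_ : 0 <= f j x `^ (q - 1))) ?powR_ge0//.
  have : `|m j - c| * f j x `^ (q - 1) <= e * X by apply: ler_pM => //; exact: powR_ge0.
  by lra.
have cX0 : 0 <= (X + 2) / c by rewrite divr_ge0 ?addr_ge0// ltW.
have vb x : D x -> Y <= v x / c <= X.
  move=> Dx; apply/andP; split; apply: (le_of_forall_ge cX0) => e e0.
    have [j _ [_ /(_ _ Dx)[_]]] := Hw e e0 0%N; have := fX j x Dx.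
    by rewrite ler_norml [_ / c * e]mulrC; lra.
  have [j _ [_ /(_ _ Dx)[_]]] := Hw e e0 0%N; have := fX j x Dx.
  by rewrite ler_norml [_ / c * e]mulrC; lra.
pose s := (1 - q)^-1.
(* The limit is defined from the limit potential [v]; its equation is verified afterwards by passing
   to the limit in the potentials. *)
pose g x := (v x / c) `^ (- s).
have [L L0 HL] := @powR_lipschitz _ (- s) Y X Y0.
have [L' L'0 HL'] := @powR_lipschitz _ (- s * q) Y X Y0.
have bv : bmeas D v.
  apply: (bmeas_lim (F := fun j => pot mu K D (f j))) => // [j|e e0 N].
    exact: bmeas_pot.
  by have [j Nj [_ jv]] := vc e e0 N; exists j.
have bg : bmeas D g.
  apply: (bmeas_powR_pos (- s) Y0); first by move=> x /vb/andP[].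
  exact: bmeasZr.
have s0 : - s <= 0 by rewrite oppr_le0 invr_ge0 subr_ge0 ltW.
have fg e : 0 < e -> forall N, exists2 j, (N <= j)%N &
    forall x, D x -> `|pot mu K D (f j) x - v x| <= e /\
       `|f j x - g x| <= L * (e * ((X + 2) / c)) /\
       `|f j x `^ q - g x `^ q| <= L' * (e * ((X + 2) / c)).
  move=> e0 N; have [j Nj [_ H]] := Hw e e0 N; exists j => // x Dx.
  have [? H2] := H _ Dx; split => //; split.
    rewrite -[f j x](powR_conjV q1 (ltW (f0 _ _ Dx))) /g -/s.
    by apply: (le_trans (HL _ _ (fX _ _ Dx) (vb _ Dx))); exact: ler_wpM2l.
  rewrite -[f j x](powR_conjV q1 (ltW (f0 _ _ Dx))) /g -/s -!powRrM.
  by rewrite powRrM; apply: (le_trans (HL' _ _ (fX _ _ Dx) (vb _ Dx))); exact: ler_wpM2l.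
exists g, c; split=> //.
- move=> x Dx; have /andP[Yx xX] := vb _ Dx; apply/andP; split.
    rewrite -[leLHS](powR_conjV q1 (ltW dl0)); apply: powR_decr => //.
    exact: lt_le_trans Yx.
  by rewrite -[leRHS](powR_conjV q1 (ltW F0)); apply: powR_decr.
- move=> x Dx.
  rewrite /g powR_conj//; last by rewrite (le_trans (ltW Y0))//; case/andP: (vb _ Dx).
  rewrite mulrC divfK ?gt_eqF//; apply/eqP; rewrite -subr_eq0; apply/eqP.
  apply: (@norm_le0_of_forall _ _ (b * (L * ((X + 2) / c) * vol mu D) + 1)).
    apply: addr_ge0 => //; apply: mulr_ge0; first exact: ltW.
    by apply: mulr_ge0; [exact: mulr_ge0|exact: vol_ge0].
  move=> e e0; have [j _ jP] := fg e e0 0%N.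
  have H : forall y, D y -> `|g y - f j y| <= L * (e * ((X + 2) / c)).
    by move=> y /jP[_ [+ _]]; rewrite distrC.
  have := pot_dist (ltW b0) (fun y => Kb x y Dx) Dx bg (bf j) H.
  have [+ _] := jP _ Dx.
  move: (pot mu K D g x) (pot mu K D (f j) x) => r1 r2; rewrite !ler_norml => h1 h2; lra.
- apply/eqP; rewrite -subr_eq0; apply/eqP.
  apply: (@norm_le0_of_forall _ _ (L' * ((X + 2) / c) * vol mu D)).
    by apply: mulr_ge0; [exact: mulr_ge0|exact: vol_ge0].
  move=> e e0; have [j _ jP] := fg e e0 0%N.
  have bgq : bmeas D (fun x => g x `^ q).
    by apply: bmeas_powR => // [x _|]; [exact: powR_ge0|exact: ltW].
  have bfq : bmeas D (fun x => f j x `^ q).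
    by apply: bmeas_powR => // [x Dx|]; [exact/ltW/f0|exact: ltW].
  rewrite -[Z in _ - Z](fq j) -bintB// (le_trans (le_norm_bint _ _ _))//; first exact: bmeasB.
  apply: (@le_trans _ _ (L' * (e * ((X + 2) / c)) * vol mu D)); last first.
    by rewrite le_eqVlt; apply/orP; left; apply/eqP; move: ((X + 2) / c) => Z; ring.
  apply: bint_le_cst => //; first exact/bmeas_norm/bmeasB.
  by move=> x /jP[_ [_]]; rewrite distrC.
- split => // e e0 N; have [j Nj [jc _]] := vc e e0 N; by exists j.
Qed.

End compactness.

(** * Existence of minimizers for positive kernels *)

Lemma powR_bmeas_ge0 {d} {T : measurableType d} {R : realType} (D : set T)
  (f : T -> R) q : 0 <= q -> (forall x, D x -> 0 <= f x) -> bmeas D f ->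
  bmeas D (fun x => f x `^ q).
Proof. by move=> q0 f0 bf; exact: bmeas_powR. Qed.

Lemma powR_ge1 {R : realType} (x p : R) : 1 <= x -> 0 <= p -> 1 <= x `^ p.
Proof. by move=> x1 p0; rewrite -[leLHS](powRr0 x); exact: ler_powR. Qed.

Section mass.
Context {d} {T : measurableType d} {R : realType}.
Variables (mu : {measure set T -> \bar R}) (D : set T).
Hypotheses (mD : measurable D) (fD : (mu D < +oo)%E).

(** The tangent to t^q at the level a with a^q |D| = 1 / 2 bounds f^q. Its constant part accounts
    for at most half of the constraint, so the linear part, a multiple of the mass, has to supply
    the rest. *)
Lemma mass_ge q : 0 < q < 1 -> 0 < vol mu D ->
  exists2 M0, 0 < M0 & forall f, bmeas D f -> (forall x, D x -> 0 <= f x) ->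
    \int[mu]_(x in D) (f x `^ q) = 1 -> M0 <= \int[mu]_(x in D) f x.
Proof.
move=> q01 V0; have [q0 q1] := andP q01.
pose a : R := (2 * vol mu D)^-1 `^ q^-1.
have a0 : 0 < a by rewrite powR_gt0// invr_gt0 mulr_gt0.
have aq : a `^ q * vol mu D = 2^-1.
  rewrite /a -powRrM mulVf ?gt_eqF// powRr1; last by rewrite invr_ge0 mulr_ge0// ltW.
  by rewrite invfM divfK// gt_eqF.
have p0 : 0 < q * a `^ (q - 1) by rewrite mulr_gt0// powR_gt0.
exists (2 * (q * a `^ (q - 1)))^-1; first by rewrite invr_gt0 mulr_gt0.
move=> f bf f0 f1.
have : \int[mu]_(x in D) (f x `^ q) <=
    \int[mu]_(x in D) (a `^ q + q * a `^ (q - 1) * f x).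
  apply: le_bint => //; first exact: powR_bmeas_ge0 (ltW q0) f0 bf.
    by apply: bmeasD; [exact: bmeas_cst|exact: bmeasZ].
  move=> x Dx; apply: (le_trans (powR_tangent q01 a0 (f0 _ Dx))).
  by rewrite lerD2l ler_pM2l// gerBl ltW.
rewrite f1 bintD//; [|exact: bmeas_cst|exact: bmeasZ].
rewrite bint_cst// aq bintZ// => H.
rewrite invfM ler_pdivrMr// mulrC; lra.
Qed.

End mass.

(** A near-minimizer of accuracy t^2 is perturbed by a step t. The accuracy is then of the order of
    the quadratic term, and division by t leaves J - N = O(t). *)
Lemma second_variation_le {R : realFieldType} (J N m t b B : R) : 0 < t ->
  m <= J + 2 * t * (N - J) + t ^+ 2 * b -> J <= m + t ^+ 2 -> b <= B ->
  J - N <= t * (1 + B) / 2.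
Proof.
move=> t0 h1 h2 /(ler_wpM2l (sqr_ge0 t)) h3.
have : t * (2 * (J - N)) <= t * (t * (1 + B)) by rewrite expr2 in h1 h2 h3; lra.
by rewrite ler_pM2l//; lra.
Qed.

Lemma half_split {R : realFieldType} (x E e : R) : 0 <= x -> 0 <= e ->
  x + x * (2 * E) <= e -> E * (x / 2) <= e / 2.
Proof. by move=> x0 e0 h; lra. Qed.

Section existence.
Context {d} {T : measurableType d} {R : realType}.
Variables (mu : {sigma_finite_measure set T -> \bar R}) (D : set T).
Hypotheses (mD : measurable D) (fD : (mu D < +oo)%E).
Variable K : T -> T -> R.

(** The homogeneous form of a lower bound of J on the constraint set, applicable to competitors that
    are not normalised. *)
Definition energy_lb (q m : R) := forall g, bmeas D g ->
  (forall x, D x -> 0 <= g x) ->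
  m * (\int[mu]_(x in D) (g x `^ q)) `^ (2 / q) <= bil mu K D g g.

(** Minimality is encoded by the Euler-Lagrange equation with multiplier [m] and the lower bound [m]
    on the energy: integrating the equation against f gives J(f) = m. *)
Definition minimizer (q m dl : R) (f : T -> R) := [/\ bmeas D f,
  0 < dl /\ (forall x, D x -> dl <= f x),
  forall x, D x -> pot mu K D f x = m * f x `^ (q - 1),
  \int[mu]_(x in D) (f x `^ q) = 1 & 0 < m /\ energy_lb q m].

Hypothesis bK : bmeas (D `*` D) (fun z => K z.1 z.2).

Lemma bil_ge0 f : (forall x y, D x -> D y -> 0 <= K x y) ->
  (forall x, D x -> 0 <= f x) -> 0 <= bil mu K D f f.
Proof.
move=> K0 f0; apply: Rintegral_ge0 => x Dx; apply: mulr_ge0; first exact: f0.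
by apply: Rintegral_ge0 => y Dy; apply: mulr_ge0; [exact: K0|exact: f0].
Qed.

Lemma energy_lbP q m : 0 < q < 1 ->
  (forall x y, D x -> D y -> 0 <= K x y) ->
  (forall g, bmeas D g -> (forall x, D x -> 0 <= g x) ->
    \int[mu]_(x in D) (g x `^ q) = 1 -> m <= bil mu K D g g) ->
  energy_lb q m.
Proof.
move=> /andP[q0 q1] K0 H g bg g0.
have bgq := powR_bmeas_ge0 (ltW q0) g0 bg.
have : 0 <= \int[mu]_(x in D) (g x `^ q) by apply: Rintegral_ge0 => x _; exact: powR_ge0.
set G := \int[mu]_(x in D) _; rewrite le_eqVlt => /predU1P[<-|G0].
  rewrite powR0 ?mulr0 ?bil_ge0//.
  by rewrite mulf_neq0 ?invr_eq0 ?gt_eqF.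
pose c := G `^ (- q^-1).
have c0 : 0 < c by rewrite powR_gt0.
have bcg : bmeas D (fun x => c * g x) by exact: bmeasZ.
have := H _ bcg; rewrite bilZl// bilZr//.
have -> : \int[mu]_(x in D) ((c * g x) `^ q) = 1.
  transitivity (\int[mu]_(x in D) (c `^ q * g x `^ q)).
    by apply: eq_bint => x Dx; rewrite powRM ?g0// ltW.
  rewrite bintZ// -/G /c -powRrM mulNr mulVf ?gt_eqF// powRN powRr1 ?ltW//.
  by rewrite mulVf// gt_eqF.
move=> /(_ _ erefl) H1.
have {}H1 : m <= c * (c * bil mu K D g g).
  by apply: H1 => x Dx; rewrite mulr_ge0 ?g0// ltW.
have cc : c * c = (G `^ (2 / q))^-1.
  by rewrite -powRN /c -powRD ?(gt_eqF G0) ?implybT//; congr (_ `^ _); ring.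
by rewrite mulrA cc mulrC ler_pdivlMr ?powR_gt0 in H1.
Qed.

Hypothesis netK : forall e, 0 < e -> exists k (p : 'I_k -> T),
  (forall i, D (p i)) /\ forall x, D x -> exists i, forall y, D y ->
     `|K x y - K (p i) y| <= e.
Hypothesis symK : forall x y, K x y = K y x.
Variables (q a : R).
Hypotheses (q01 : 0 < q < 1) (a0 : 0 < a) (V0 : 0 < vol mu D).
Hypothesis Ka : forall x y, D x -> D y -> a <= K x y.

Let q0 : 0 < q. Proof. by case/andP: q01. Qed.
Let q1 : q < 1. Proof. by case/andP: q01. Qed.
Let s := (1 - q)^-1.
Let s0 : 0 < s. Proof. by rewrite invr_gt0 subr_gt0. Qed.
Let K0 x y : D x -> D y -> 0 <= K x y.
Proof. by move=> Dx Dy; rewrite (le_trans (ltW a0))// Ka. Qed.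

Let adm f := [/\ bmeas D f, forall x, D x -> 0 <= f x &
  \int[mu]_(x in D) (f x `^ q) = 1].

Lemma pot_ge f x : D x -> bmeas D f -> (forall x, D x -> 0 <= f x) ->
  a * \int[mu]_(y in D) f y <= pot mu K D f x.
Proof.
move=> Dx bf f0; rewrite -bintZ//; apply: le_bint => //; first exact: bmeasZ.
  by apply: bmeasM => //; exact: bmeas_K_l.
by move=> y Dy; rewrite ler_wpM2r ?f0 ?Ka.
Qed.

Lemma bil_ge f : bmeas D f -> (forall x, D x -> 0 <= f x) ->
  a * (\int[mu]_(y in D) f y) ^+ 2 <= bil mu K D f f.
Proof.
move=> bf f0; rewrite expr2 mulrA -bintZ//; apply: le_bint => //.
- exact: bmeasZ.
- by apply: bmeasM => //; exact: bmeas_pot.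
- by move=> x Dx; rewrite mulrC ler_wpM2l ?f0// pot_ge.
Qed.

Lemma bil_le b f g : 0 <= b -> (forall x y, D x -> D y -> `|K x y| <= b) ->
  bmeas D f -> bmeas D g -> bil mu K D f g <=
    b * (\int[mu]_(y in D) `|f y|) * \int[mu]_(y in D) `|g y|.
Proof.
move=> b0 Kb bf bg; set M := \int[mu]_(y in D) `|g y|.
rewrite mulrAC -bintZ//; last exact: bmeas_norm.
apply: le_bint => //; first by apply: bmeasM => //; exact: bmeas_pot.
  exact/bmeasZ/bmeas_norm.
move=> x Dx; rewrite (le_trans (ler_norm _))// normrM mulrC ler_wpM2r//.
by apply: pot_le => // y Dy; exact: Kb.
Qed.

(* A near-minimizer f is L^1-close to the function phi with
   [\int phi^q = 1] and [phi^(q-1)] proportional to the potential of f. *)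
Lemma near_minimizer m lo hi M1 : 0 < lo -> lo <= hi -> 0 <= M1 -> 0 <= m ->
  energy_lb q m ->
  exists dl F N0, [/\ 0 < dl, 0 < N0 &
    forall e, 0 < e -> exists2 t0, 0 < t0 &
    forall f t, adm f -> 0 < t <= t0 ->
     bil mu K D f f <= m + t ^+ 2 -> \int[mu]_(x in D) f x <= M1 ->
     (forall x, D x -> lo <= pot mu K D f x <= hi) ->
     exists phi N, [/\ bmeas D phi, forall x, D x -> dl <= phi x <= F,
       \int[mu]_(x in D) (phi x `^ q) = 1,
       N0 <= N & [/\ forall x, D x -> pot mu K D f x = N * phi x `^ (q - 1),
       bil mu K D f f - e <= N <= bil mu K D f f &
       \int[mu]_(x in D) `|f x - phi x| <= e]]].
Proof.
move=> lo0 lohi M10 m0 mlb; set V := vol mu D.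
have hi0 : 0 < hi by exact: lt_le_trans lohi.
have [b b0 Kb] := bound_K bK.
have sq0 : 0 < s * q by rewrite mulr_gt0.
(* Lower and upper bounds for the integral [A] of u^(-s q) below. The normalising constant of phi is
   N = A^(-1 / (s q)), so its bounds [N0] and [N1] depend only on [lo], [hi], [q] and |D|. *)
pose A0 := hi `^ (- (s * q)) * V; pose A1 := lo `^ (- (s * q)) * V.
have A00 : 0 < A0 by rewrite mulr_gt0// powR_gt0.
have A10 : 0 < A1 by rewrite mulr_gt0// powR_gt0.
have sqV0 : - (s * q)^-1 <= 0 by rewrite oppr_le0 invr_ge0 ltW.
have [N0 [N00 HN0]] : exists N0, 0 < N0 /\ forall A, 0 < A -> A <= A1 ->
    N0 <= A `^ (- (s * q)^-1).
  exists (A1 `^ (- (s * q)^-1)); split; first exact: powR_gt0.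
  by move=> A ? ?; exact: powR_decr.
have [N1 [N10 HN1]] : exists N1, 0 < N1 /\ forall A, A0 <= A ->
    A `^ (- (s * q)^-1) <= N1.
  exists (A0 `^ (- (s * q)^-1)); split; first exact: powR_gt0.
  by move=> A ?; exact: powR_decr.
have [dl [dl0 Hdl]] : exists dl, 0 < dl /\ forall w, 0 < w -> w <= hi / N0 ->
    dl <= w `^ (- s).
  exists ((hi / N0) `^ (- s)); split; first exact: powR_gt0 (divr_gt0 hi0 N00).
  by move=> w w0 wh; apply: powR_decr => //; rewrite oppr_le0 ltW.
have [F [F0 HF]] : exists F, 0 < F /\ forall w, lo / N1 <= w -> w `^ (- s) <= F.
  exists ((lo / N1) `^ (- s)); split; first exact: powR_gt0 (divr_gt0 lo0 N10).
  by move=> w wh; apply: powR_decr; rewrite ?divr_gt0// oppr_le0 ltW.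
exists dl, F, N0; split => // e e0.
pose B := b * (F * V + M1) * (F * V + M1).
have FV0 : 0 < F * V by rewrite mulr_gt0.
have B0 : 0 <= B by rewrite /B !mulr_ge0 ?(ltW b0)// addr_ge0// ltW.
(* [cgap_stable] costs e' phi pointwise, plus a multiple of the gap. The first takes at most half of
   [e]; the smallness of [t] keeps the second below the other half. *)
pose e' := Num.min 2^-1 (e / (2 * (F * V))).
have e'0 : 0 < e' by rewrite lt_min invr_gt0 ltr0n divr_gt0// mulr_gt0.
have e'1 : e' < 1 by rewrite gt_min; apply/orP; left; lra.
have e'FV : e' * (F * V) <= e / 2.
  apply: (@le_trans _ _ (e / (2 * (F * V)) * (F * V))).
    by rewrite ler_pM2r// ge_min lexx orbT.
  rewrite le_eqVlt; apply/orP; left; apply/eqP.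
  by field; rewrite !gt_eqF.
have [C C0 HC] := @cgap_stable _ q e' q01 ltac:(by rewrite e'0 e'1).
pose E := C * F `^ (1 - q) / N0.
have E0 : 0 < E by rewrite divr_gt0// mulr_gt0// powR_gt0.
have BE0 : 0 < (1 + B) * (1 + 2 * E).
  by rewrite mulr_gt0 ?ltr_wpDr// mulr_ge0// ltW.
exists (Num.min 1 (e / ((1 + B) * (1 + 2 * E)))).
  by rewrite lt_min ltr01/= divr_gt0.
move=> f t [bf f0 f1] /andP[t0]; rewrite le_min => /andP[t1 te] Jm fM1 ub.
have {}te : t * (1 + B) * (1 + 2 * E) <= e.
  by move: te; rewrite ler_pdivlMr// mulrA.
set u := pot mu K D f in ub *.
set J := bil mu K D f f in Jm *.
have bu : bmeas D u by exact: bmeas_pot.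
have u0 x : D x -> 0 < u x by move=> /ub/andP[? _]; exact: lt_le_trans lo0 _.
have bus : bmeas D (fun x => u x `^ (- (s * q))).
  by apply: (bmeas_powR_pos _ lo0) => // x /ub/andP[].
pose A := \int[mu]_(x in D) (u x `^ (- (s * q))).
have A0A : A0 <= A.
  apply: cst_le_bint => // x Dx; have /andP[_ ?] := ub _ Dx.
  by apply: powR_decr => //; [rewrite oppr_le0 ltW|exact: u0].
have AA1 : A <= A1.
  apply: bint_le_cst => // x Dx; have /andP[? _] := ub _ Dx.
  by apply: powR_decr => //; rewrite oppr_le0 ltW.
have Apos : 0 < A by exact: lt_le_trans A0A.
have [N [Npos N0N NN1 NA]] : exists N, [/\ 0 < N, N0 <= N, N <= N1 &
    N `^ (s * q) * A = 1].
  exists (A `^ (- (s * q)^-1)); split; [exact: powR_gt0|exact: HN0|exact: HN1|].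
  rewrite -powRrM mulNr mulVf ?gt_eqF// powRN powRr1 ?(ltW Apos)//.
  by rewrite mulVf// gt_eqF.
pose phi x := (u x / N) `^ (- s).
have uN0 x : D x -> 0 < u x / N by move=> Dx; rewrite divr_gt0// u0.
have s0' : - s <= 0 by rewrite oppr_le0 ltW.
have phib x : D x -> dl <= phi x <= F.
  move=> Dx; have /andP[ul uh] := ub _ Dx; apply/andP; split.
    by apply: Hdl; rewrite ?uN0// ler_pM ?invr_ge0 ?(ltW (u0 _ Dx)) ?(ltW Npos)// lef_pV2.
  by apply: HF; rewrite ler_pM ?invr_ge0 ?(ltW lo0) ?(ltW N10)// lef_pV2.
have phi0 x : D x -> 0 < phi x by move=> /phib/andP[? _]; exact: lt_le_trans dl0 _.
have bphi : bmeas D phi.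
  apply: (bmeas_powR_pos _ (divr_gt0 lo0 N10)); last exact: bmeasZr.
  move=> x Dx; have /andP[ul _] := ub _ Dx.
  by rewrite ler_pM ?invr_ge0 ?(ltW lo0) ?(ltW N10)// lef_pV2.
have phiq x : D x -> phi x `^ q = N `^ (s * q) * u x `^ (- (s * q)).
  move=> Dx; rewrite /phi -powRrM mulNr powRM ?(ltW (u0 _ Dx)) ?invr_ge0 ?(ltW Npos)//.
  by rewrite mulrC -(powR_inv1 (ltW Npos)) -powRrM mulN1r opprK.
have phi1 : \int[mu]_(x in D) (phi x `^ q) = 1.
  by rewrite (eq_bint _ phiq) bintZ.
have uE x : D x -> u x = N * phi x `^ (q - 1).
  move=> Dx; rewrite /phi powR_conj ?(ltW (uN0 _ Dx))//.
  by rewrite mulrC divfK// gt_eqF.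
have bpq1 : bmeas D (fun x => phi x `^ (q - 1)).
  by apply: (bmeas_powR_pos _ dl0) => // x /phib/andP[].
have bpq : bmeas D (fun x => phi x `^ q).
  by apply: (bmeas_powR_pos _ dl0) => // x /phib/andP[].
have bfq : bmeas D (fun x => f x `^ q) by exact: powR_bmeas_ge0 (ltW q0) f0 bf.
have Bpf : bil mu K D phi f = N.
  rewrite -[RHS]mulr1 -phi1 -bintZ//; apply: eq_bint => x Dx.
  by rewrite -/(u x) uE// mulrCA mulr_powRB1// ltW// phi0.
have Iphi : \int[mu]_(x in D) `|phi x - f x| <= F * V + M1.
  apply: (@le_trans _ _ (\int[mu]_(x in D) (F + f x))).
    apply: le_bint => //; first exact/bmeas_norm/bmeasB.
      by apply: bmeasD => //; exact: bmeas_cst.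
    move=> x Dx; rewrite (le_trans (ler_normB _ _))//.
    by rewrite !ger0_norm ?f0 ?(ltW (phi0 _ Dx))// lerD2r; case/andP: (phib _ Dx).
  by rewrite bintD//; [rewrite bint_cst// lerD2l|exact: bmeas_cst].
have bh : bmeas D (fun x => phi x - f x) by exact: bmeasB.
(* The competitor (1 - t) f + t phi has a constraint integral of at least 1 by concavity, so its
   energy is at least m; expanding this energy in t gives the second variation. *)
have JN : J - N <= t * (1 + B) / 2.
  have Bh : bil mu K D (fun x => phi x - f x) (fun x => phi x - f x) <= B.
    apply: (le_trans (bil_le (ltW b0) Kb bh bh)).
    have I0 : 0 <= \int[mu]_(x in D) `|phi x - f x| by exact: Rintegral_ge0.
    by rewrite /B ler_pM// ?mulr_ge0 ?(ltW b0)// ler_pM2l.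
  have Bhf : bil mu K D (fun x => phi x - f x) f = N - J.
    rewrite -Bpf /J -[RHS]addrC -mulN1r -bilZl// -bilDl//; last exact: bmeasZ.
    by rewrite /bil; apply: eq_bint => x _; rewrite mulN1r [- f x + _]addrC.
  have bg : bmeas D (fun x => f x + t * (phi x - f x)) by apply: bmeasD => //; exact: bmeasZ.
  have gE x : f x + t * (phi x - f x) = (1 - t) * f x + t * phi x by ring.
  have g0 x : D x -> 0 <= f x + t * (phi x - f x).
    move=> Dx; rewrite gE; apply: addr_ge0; apply: mulr_ge0.
    - by rewrite subr_ge0.
    - exact: f0.
    - exact: ltW.
    - exact/ltW/phi0.
  have := mlb _ bg g0.
  rewrite bil_line// Bhf -/J.
  have G1 : 1 <= \int[mu]_(x in D) ((f x + t * (phi x - f x)) `^ q).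
    have -> : 1 = \int[mu]_(x in D) ((1 - t) * f x `^ q + t * phi x `^ q).
      rewrite bintD//; [|exact: bmeasZ|exact: bmeasZ].
      by rewrite !bintZ// f1 phi1; ring.
    apply: le_bint => //.
    - by apply: bmeasD; exact: bmeasZ.
    - exact: powR_bmeas_ge0 (ltW q0) g0 bg.
    - move=> x Dx; rewrite gE; apply: powR_concave => //; [exact: f0|exact/ltW/phi0|].
      by rewrite (ltW t0) t1.
  have G2 : m <= m * (\int[mu]_(x in D) ((f x + t * (phi x - f x)) `^ q)) `^ (2 / q).
    by apply: ler_peMr => //; apply: powR_ge1 => //; rewrite divr_ge0// ltW.
  by move=> /(le_trans G2) G3; exact: second_variation_le t0 G3 Jm Bh.
(* As u = N phi^(q - 1) and both functions are normalised, the q-th powers cancel on integration: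
   the total gap is exactly (J - N) / N. *)
have gapE : N * \int[mu]_(x in D) cgap q (f x) (phi x) = J - N.
  rewrite -bintZ//; last first.
    apply: bmeasB; first by apply: bmeasM => //; exact: bmeasB.
    by apply: bmeasZr; exact: bmeasB.
  rewrite -[X in _ = _ - X]Bpf /J /bil -/u.
  transitivity (\int[mu]_(x in D) ((f x * u x - phi x * u x) -
       N / q * (f x `^ q - phi x `^ q))).
    apply: eq_bint => x Dx; rewrite /cgap uE//.
    by move: (f x) (phi x) (phi x `^ q) (phi x `^ (q - 1)) (f x `^ q) => r1 r2 r3 r4 r5;
      field; rewrite gt_eqF.
  have bfu : bmeas D (fun x => f x * u x) by exact: bmeasM.
  have bpu : bmeas D (fun x => phi x * u x) by exact: bmeasM.
  rewrite bintB//; [|exact: bmeasB|by apply: bmeasZ; exact: bmeasB].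
  by rewrite bintB// bintZ ?bintB// ?f1 ?phi1 ?subrr ?mulr0 ?subr0//; exact: bmeasB.
have gap0 : 0 <= \int[mu]_(x in D) cgap q (f x) (phi x).
  by apply: Rintegral_ge0 => x Dx; apply: cgap_ge0; [|exact: f0|exact: phi0].
have tB0 : 0 <= t * (1 + B) by apply: mulr_ge0; [exact: ltW|exact: addr_ge0].
have tBE0 : 0 <= t * (1 + B) * (2 * E) by apply: mulr_ge0 => //; exact/mulr_ge0/ltW.
rewrite mulrDr mulr1 in te.
have tBe : t * (1 + B) <= e by apply: le_trans te; rewrite lerDl.
have tEe : E * (t * (1 + B) / 2) <= e / 2 by exact: half_split (ltW e0) te.
exists phi, N; split => //; split => //.
  apply/andP; split; last by rewrite -subr_ge0 -gapE mulr_ge0// ltW.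
  by rewrite lerBlDl -lerBlDr (le_trans JN)// (le_trans _ tBe)// ler_pdivrMr// ler_peMr// ler1n.
have bgap : bmeas D (fun x => cgap q (f x) (phi x)).
  apply: bmeasB; first by apply: bmeasM => //; exact: bmeasB.
  by apply: bmeasZr; exact: bmeasB.
apply: (@le_trans _ _ (\int[mu]_(x in D) (e' * F + C * F `^ (1 - q) * cgap q (f x) (phi x)))).
  apply: le_bint => //; first exact/bmeas_norm/bmeasB.
    by apply: bmeasD; [exact: bmeas_cst|exact: bmeasZ].
  move=> x Dx; apply: (le_trans (HC _ _ (f0 _ Dx) (phi0 _ Dx))).
  have /andP[_ pF] := phib _ Dx; have px := ltW (phi0 _ Dx).
  apply: lerD; first by rewrite ler_pM2l.
  rewrite -mulrA ler_pM2l// ler_wpM2r//; first by apply: cgap_ge0; [|exact: f0|exact: phi0].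
  by apply: ge0_ler_powR; rewrite ?nnegrE ?(ltW F0)// subr_ge0 ltW.
rewrite bintD//; [|exact: bmeas_cst|exact: bmeasZ].
rewrite bint_cst// bintZ//.
have H1 : \int[mu]_(x in D) cgap q (f x) (phi x) <= (J - N) / N0.
  rewrite -gapE mulrAC ler_peMl// ler_pdivlMr// mul1r //.
have H2 : C * F `^ (1 - q) * \int[mu]_(x in D) cgap q (f x) (phi x) <= E * (t * (1 + B) / 2).
  apply: (@le_trans _ _ (C * F `^ (1 - q) * ((J - N) / N0))).
    by rewrite ler_pM2l// mulr_gt0// powR_gt0.
  apply: (@le_trans _ _ (E * (J - N))); first by rewrite /E [leRHS]mulrAC -[leRHS]mulrA.
  by apply: ler_wpM2l; [exact: ltW|exact: JN].
by rewrite -mulrA [leRHS]splitr; apply: lerD => //; exact: le_trans tEe.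
Qed.

(** The functions phi_j attached to near-minimizers f_j solve the equation approximately: the
    potential of f_j is N_j phi_j^(q - 1), and that of phi_j differs from it by at most [b] times
    the L^1 distance. Their bounds are uniform, so [solution_limit] applies. *)
Theorem minimizer_exists : exists f m dl, minimizer q m dl f.
Proof.
have [M0 M00 HM0] := mass_ge mD fD q01 V0.
have [b b0 Kb] := bound_K bK.
pose S := [set r | exists2 f, adm f & r = bil mu K D f f].
have Slb : lbound S 0 by move=> _ [f [_ f0 _] ->]; exact: bil_ge0.
have Sne : S !=set0.
  pose c := vol mu D `^ (- q^-1).
  exists (bil mu K D (fun=> c) (fun=> c)); exists (fun=> c) => //; split.
  - exact: bmeas_cst.
  - by move=> x _; exact: powR_ge0.
  - rewrite bint_cst// /c -powRrM mulNr mulVf ?gt_eqF// powRN powRr1 ?(ltW V0)//.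
    by rewrite mulVf// gt_eqF.
pose m := inf S.
have hS : has_inf S by split => //; exists 0.
have mlb : energy_lb q m.
  apply: energy_lbP => // g bg g0 g1.
  by apply: ge_inf; [exists 0|exists g].
have Jlow f : adm f -> a * M0 ^+ 2 <= bil mu K D f f.
  move=> [bf f0 f1]; apply: le_trans (bil_ge bf f0).
  have M1 := HM0 _ bf f0 f1.
  by rewrite ler_pM2l// ler_pXn2r// nnegrE ?(ltW M00)// (le_trans (ltW M00)).
have m0 : 0 < m.
  apply: (@lt_le_trans _ _ (a * M0 ^+ 2)); first by rewrite mulr_gt0// exprn_gt0.
  by apply: lb_le_inf => // _ [f af ->]; exact: Jlow.
pose M1 := (m + 1) / (a * M0).
have aM0 : 0 < a * M0 by rewrite mulr_gt0.
have M10 : 0 <= M1 by rewrite divr_ge0 ?addr_ge0// ltW.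
have massle f : adm f -> bil mu K D f f <= m + 1 -> \int[mu]_(x in D) f x <= M1.
  move=> [bf f0 f1] Jf; rewrite ler_pdivlMr//; apply: le_trans Jf.
  apply: le_trans (bil_ge bf f0); rewrite mulrCA expr2 ler_pM2l//.
  have M1' := HM0 _ bf f0 f1.
  by rewrite ler_wpM2l// (le_trans (ltW M00)).
pose lo := a * M0; pose hi := Num.max lo (b * M1).
have lohi : lo <= hi by rewrite le_max lexx.
have potb f : adm f -> bil mu K D f f <= m + 1 -> forall x, D x ->
    lo <= pot mu K D f x <= hi.
  move=> af Jf x Dx; have [bf f0 f1] := af; apply/andP; split.
    by apply: le_trans (pot_ge Dx bf f0); rewrite ler_pM2l// HM0.
  rewrite le_max; apply/orP; right; rewrite (le_trans (ler_norm _))//.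
  apply: (le_trans (pot_le mD fD bK (fun y => Kb x y Dx) Dx bf)).
  rewrite ler_pM2l// (_ : \int[mu]_(y in D) `|f y| = \int[mu]_(y in D) f y); last first.
    by apply: eq_bint => y Dy; rewrite ger0_norm ?f0.
  exact: massle.
have [dl [F [N0 [dl0 N00 near]]]] := near_minimizer aM0 lohi M10 (ltW m0) mlb.
have /choice[pN HpN] : forall j, exists pN : (T -> R) * R, exists f,
   [/\ bmeas D pN.1, forall x, D x -> dl <= pN.1 x <= F,
     \int[mu]_(x in D) (pN.1 x `^ q) = 1, N0 <= pN.2 &
     [/\ bmeas D f, forall x, D x -> pot mu K D f x = pN.2 * pN.1 x `^ (q - 1),
       `|pN.2 - m| <= 2 * j.+1%:R^-1 &
       \int[mu]_(x in D) `|f x - pN.1 x| <= j.+1%:R^-1]].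
  move=> j; have e0 : 0 < j.+1%:R^-1 :> R by rewrite invr_gt0.
  have [t0 t00 Ht] := near _ e0.
  pose e := Num.min 1 j.+1%:R^-1 : R.
  pose t := Num.min t0 e.
  have t'0 : 0 < t by rewrite !lt_min t00 ltr01 e0.
  have tt0 : t <= t0 by rewrite ge_min lexx.
  have t1 : t <= 1 by rewrite !ge_min lexx orbT.
  have tj : t <= j.+1%:R^-1 by rewrite !ge_min lexx !orbT.
  have [_ [f af ->] Jf] := inf_adherent (exprn_gt0 2 t'0) hS.
  have tt1 : t ^+ 2 <= t by rewrite expr2 ler_piMr// ltW.
  have Jm1 : bil mu K D f f <= m + 1.
    by rewrite (le_trans (ltW Jf))// lerD2l (le_trans tt1).
  have [|phi [N [bphi phib phi1 N0N [uE /andP[N1 N2] If]]]] :=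
    Ht f t af _ (ltW Jf) (massle _ af Jm1) (potb _ af Jm1); first by rewrite t'0.
  have mJ : m <= bil mu K D f f by apply: ge_inf; [exists 0|exists f].
  exists (phi, N), f; have [bf _ _] := af; split => //; split => //=.
  have Jm : bil mu K D f f <= m + j.+1%:R^-1.
    by rewrite (le_trans (ltW Jf))// lerD2l (le_trans tt1).
  rewrite ler_norml; apply/andP; split.
    rewrite lerBrDr.
    apply: le_trans N1; rewrite -subr_ge0.
    have -> : bil mu K D f f - j.+1%:R^-1 - (- (2 * j.+1%:R^-1) + m) =
       (bil mu K D f f - m) + j.+1%:R^-1 by ring.
    by rewrite addr_ge0 ?subr_ge0// ltW.
  rewrite lerBlDr (le_trans N2)// (le_trans Jm)// addrC lerD2r.
  by rewrite ler_peMl ?ler1n// ltW.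
pose phi j := (pN j).1; pose N j := (pN j).2.
have q1' : 0 < 1 - q by rewrite subr_gt0.
have jsmall e : 0 < e -> exists n, forall j, (n <= j)%N -> j.+1%:R^-1 <= e :> R.
  move=> e0; have [n _ Hn] := near_infty_natSinv_lt (PosNum e0).
  by exists n => j /Hn /= /ltW.
have [|||||f [c [bf fb fE f1 [_ Hc]]]] :=
  @solution_limit _ _ _ mu D mD fD K bK netK q phi N dl F N0 (m + 2) q01 dl0 N00.
- by move=> j; have [f []] := HpN j.
- by move=> j; have [f []] := HpN j.
- move=> j; have [f [_ _ _ NN [_ _ Nm _]]] := HpN j; rewrite NN/=.
  move: Nm; rewrite ler_norml => /andP[_]; rewrite lerBlDl => /le_trans; apply.
  by rewrite lerD2l ler_piMr// invf_le1// ler1n.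
- by move=> j; have [f []] := HpN j.
- move=> e e0; have [n Hn] := jsmall (e / b) (divr_gt0 e0 b0).
  exists n => j nj x Dx; have [f [bphi _ _ _ [bf uE _ If]]] := HpN j.
  rewrite -/(phi j) -/(N j) -uE//.
  have -> : pot mu K D (phi j) x - pot mu K D f x =
      pot mu K D (fun y => phi j y + (-1) * f y) x.
    by rewrite potD ?potZ ?mulN1r//; exact: bmeasZ.
  apply: (le_trans (pot_le mD fD bK (fun y => Kb x y Dx) Dx _)).
    by apply: bmeasD => //; exact: bmeasZ.
  rewrite -ler_pdivlMl// mulrC (le_trans _ (Hn _ nj))// (le_trans _ If)//.
  rewrite le_eqVlt; apply/orP; left; apply/eqP.
  by apply: eq_bint => y _; rewrite mulN1r distrC.
(* N_j is within 2 / (j + 1) of the infimum m, and c is a cluster value of the N_j. *)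
have cm : c = m.
  apply/eqP; rewrite -subr_eq0; apply/eqP.
  apply: (@norm_le0_of_forall _ _ 3) => // e e0.
  have [n Hn] := jsmall e e0; have [j nj jc] := Hc e e0 n.
  have [_ [_ _ _ _ [_ _ Nm _]]] := HpN j.
  have -> : c - m = - (N j - c) + (N j - m) by ring.
  rewrite (le_trans (ler_normD _ _))// normrN.
  have -> : 3 * e = e + 2 * e by ring.
  by rewrite lerD// (le_trans Nm)// ler_pM2l// Hn.
exists f, m, dl; split => //.
- by split => // x /fb/andP[].
- by move=> x Dx; rewrite -cm fE.
Qed.

End existence.

(** * Lebesgue measure on R^n *)

Section affine_change_of_variables.
Context {R : realType}.

Definition leb n : {sigma_finite_measure set 'rV[R]_n -> \bar R} :=
  @lebesgue_rV R n.

Lemma lebesgue_measure_affine (c t : R) (A : set (measurableTypeR R)) : 0 < t ->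
  measurable A ->
  lebesgue_measure ((fun x => c + t * x) @^-1` A) = (t^-1%:E * lebesgue_measure A)%E.
Proof.
move=> t0 mA; pose phi (x : measurableTypeR R) : measurableTypeR R := c + t * x.
have mphi : measurable_fun setT phi.
  by apply: measurable_funD; [exact: measurable_cst|exact: measurable_funM].
pose nu : {measure set (measurableTypeR R) -> \bar R} :=
  mscale (NngNum (ltW t0))
    (measure_function_pushforward__canonical__measure_function_Measure lebesgue_measure mphi).
have E : lebesgue_measure A = nu A.
  apply: lebesgue_measure_unique => // _ [[a b] _ <-] /=.
  rewrite /nu /= /mscale/= /pushforward.
  have -> : phi @^-1` `]a, b] = `](a - c) / t, (b - c) / t]%classic.
    apply/seteqP; split => x /=; rewrite !in_itv/= /phi;
      by rewrite ltr_pdivrMr// ler_pdivlMr// ltrBlDl lerBrDl [t * x]mulrC.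
  rewrite !lebesgue_measure_itv/= !lte_fin ltr_pM2r ?invr_gt0// ltrD2r.
  case: ifP => ab; last by rewrite mule0.
  by rewrite -!EFinB -EFinM; congr EFin; field; rewrite gt_eqF.
rewrite E /nu /= /mscale /= /pushforward muleA -EFinM mulVf ?gt_eqF// mul1e.
by [].
Qed.

Definition dil n (c : 'rV[R]_n) (t : R) (x : 'rV[R]_n) : 'rV[R]_n := c + t *: x.

Lemma measurable_dil n (c : 'rV[R]_n) t : measurable_fun setT (dil c t).
Proof.
apply: measurable_fun_coordP => i; rewrite /dil.
under eq_fun do rewrite !mxE.
apply: measurable_funD; first exact: measurable_cst.
by apply: measurable_funM; [exact: measurable_cst|exact: measurable_coord].
Qed.

Lemma measurable_dil_preimage n (c : 'rV[R]_n) t A : measurable A ->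
  measurable (dil c t @^-1` A).
Proof. by move=> mA; rewrite -[X in measurable X]setTI; exact: measurable_dil. Qed.

(** Induction on the dimension: through [consr] the dilation acts separately on the two factors, so
    that uniqueness of the product measure reduces the claim to rectangles. *)
Lemma leb_dil n (c : 'rV[R]_n) t A : 0 < t -> measurable A ->
  leb n (dil c t @^-1` A) = ((t ^+ n)^-1%:E * leb n A)%E.
Proof.
move=> t0; elim: n c A => [|n IH] c A mA.
  rewrite expr0 invr1 mul1e; congr (leb 0 _).
  by apply/seteqP; split => x; rewrite /= (thinmx0 (dil c t x)) (thinmx0 x).
have mcA : measurable (@consr R n @^-1` A).
  by rewrite -[X in measurable X]setTI; exact: measurable_consr.
pose c0 : R := c ord0 ord0; pose c' : 'rV[R]_n := (unconsr c).2.
pose phi (p : measurableTypeR R * 'rV[R]_n) : measurableTypeR R * 'rV[R]_n :=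
  (c0 + t * p.1, dil c' t p.2).
have mphi : measurable_fun setT phi.
  apply: measurable_fun_pair.
    apply: measurable_funD; first exact: measurable_cst.
    by apply: measurable_funM; [exact: measurable_cst|exact: measurable_fst].
  by apply: measurableT_comp; [exact: measurable_dil|exact: measurable_snd].
have E p : dil c t (consr p) = consr (phi p).
  apply/rowP => i.
  change (dil c t (consr p) ord0 i = consr (phi p) ord0 i).
  have dE (y : 'rV[R]_n.+1) k : dil c t y ord0 k = c ord0 k + t * y ord0 k.
    by rewrite !mxE.
  case: (unliftP ord0 i) => [j|] ->; last by rewrite dE !consr0.
  by rewrite dE !consrS !mxE.
have t10 : 0 < t ^+ n.+1 by rewrite exprn_gt0.
pose prod := (@lebesgue_measure R \x leb n)%E.
pose nu : {measure set (measurableTypeR R * 'rV[R]_n) -> \bar R} :=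
  mscale (NngNum (ltW t10))
    (measure_function_pushforward__canonical__measure_function_Measure
       (product_measure1 (@lebesgue_measure R) (leb n)) mphi).
have H : prod (@consr R n @^-1` A) = nu (@consr R n @^-1` A).
  apply: product_measure_unique => // A1 A2 mA1 mA2.
  rewrite /nu /= /mscale /= /pushforward.
  have -> : phi @^-1` (A1 `*` A2) =
      ((fun x => c0 + t * x) @^-1` A1) `*` (dil c' t @^-1` A2) by [].
  have m1 : measurable ((fun x => c0 + t * x : measurableTypeR R) @^-1` A1).
    rewrite -[X in measurable X]setTI.
    have : measurable_fun setT (fun x : measurableTypeR R => c0 + t * x : measurableTypeR R).
      by apply: measurable_funD; [exact: measurable_cst|exact: measurable_funM].
    by apply.
  rewrite product_measure1E//; last exact: measurable_dil_preimage.
  apply: (@etrans _ _ ((t ^+ n.+1)%:E * ((t^-1%:E * lebesgue_measure A1) *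
      ((t ^+ n)^-1%:E * leb n A2)))%E).
    by congr (_ * (_ * _))%E; [exact: lebesgue_measure_affine|exact: IH].
  rewrite muleACA -EFinM !muleA -EFinM exprS.
  rewrite (_ : t * t ^+ n * (t^-1 * (t ^+ n)^-1) = 1) ?mul1e//.
  by field; rewrite !gt_eqF// exprn_gt0.
have -> : leb n.+1 (dil c t @^-1` A) = prod (phi @^-1` (@consr R n @^-1` A)).
  rewrite /leb /= /pushforward; congr (prod _).
  by apply/seteqP; split => p; rewrite /= E.
have -> : leb n.+1 A = prod (@consr R n @^-1` A) by [].
rewrite H /nu /= /mscale /= /pushforward muleA -EFinM mulVf ?gt_eqF//.
by rewrite mul1e.
Qed.

Lemma bint_dil n (c : 'rV[R]_n) t (D : set 'rV[R]_n) f : 0 < t ->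
  measurable D -> (leb n D < +oo)%E -> bmeas D f -> (forall x, D x -> 0 <= f x) ->
  \int[leb n]_(x in dil c t @^-1` D) f (dil c t x) =
  (t ^+ n)^-1 * \int[leb n]_(x in D) f x.
Proof.
move=> t0 mD fD bf f0.
have [mf _] := bf.
have t10 : 0 <= (t ^+ n)^-1 by rewrite invr_ge0 exprn_ge0// ltW.
have mEf : measurable_fun D (EFin \o f) by exact/measurable_EFinP.
transitivity (fine ((t ^+ n)^-1%:E * \int[leb n]_(x in D) (f x)%:E)%E); last first.
  by rewrite fineM// ; exact/integrable_fin_num/bmeas_integrable.
congr fine.
have := ge0_integral_mscale (leb n) mD (NngNum t10) mEf.
rewrite /= => <-; last by move=> x Dx; rewrite lee_fin f0.
have := ge0_integral_pushforward (measurable_dil c t) (leb n) mD mEf.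
rewrite /= => <-; last by move=> x /set_mem Dx; rewrite lee_fin f0.
pose P : {measure set 'rV[R]_n -> \bar R} :=
  measure_function_pushforward__canonical__measure_function_Measure (leb n) (measurable_dil c t).
pose M : {measure set 'rV[R]_n -> \bar R} := mscale (NngNum t10) (leb n).
have PM A : measurable A -> A `<=` D -> P A = M A.
  by move=> mA _; rewrite /P/M /= /pushforward leb_dil.
exact: (eq_measure_integral M PM).
Qed.

Lemma vol_dil n (c : 'rV[R]_n) t (D : set 'rV[R]_n) : 0 < t ->
  measurable D -> (leb n D < +oo)%E ->
  vol (leb n) (dil c t @^-1` D) = (t ^+ n)^-1 * vol (leb n) D.
Proof.
move=> t0 mD fD; have := leb_dil c t0 mD => /(congr1 fine) E.
apply: (etrans E); rewrite fineM// ge0_fin_numE//; exact: measure_ge0.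
Qed.

End affine_change_of_variables.

(** * The Euclidean norm *)

Section enorm.
Context {R : realType} {n : nat}.
Implicit Types x y z : 'rV[R]_n.

Lemma enorm_ge0 x : 0 <= enorm x.
Proof. exact: sqrtr_ge0. Qed.

Lemma enorm_sqr x : enorm x ^+ 2 = \sum_(i < n) x ord0 i ^+ 2.
Proof. by rewrite sqr_sqrtr// sumr_ge0// => i _; exact: sqr_ge0. Qed.

Lemma enorm0 : enorm (0 : 'rV[R]_n) = 0.
Proof. by rewrite /enorm big1 ?sqrtr0// => i _; rewrite mxE expr0n. Qed.

Lemma enormZ t x : enorm (t *: x) = `|t| * enorm x.
Proof.
rewrite /enorm -sqrtr_sqr -sqrtrM ?sqr_ge0//; congr Num.sqrt.
by rewrite mulr_sumr; apply: eq_bigr => i _; rewrite mxE exprMn.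
Qed.

Lemma enormN x : enorm (- x) = enorm x.
Proof. by rewrite -scaleN1r enormZ normrN normr1 mul1r. Qed.

Lemma enormC x y : enorm (x - y) = enorm (y - x).
Proof. by rewrite -enormN opprB. Qed.

Lemma coord_le_enorm x i : `|x ord0 i| <= enorm x.
Proof.
rewrite -(ler_pXn2r (_ : 0 < 2)%N) ?nnegrE ?enorm_ge0// enorm_sqr (bigD1 i)//=.
by rewrite real_normK ?num_real// lerDl sumr_ge0// => j _; exact: sqr_ge0.
Qed.

Lemma enorm_le_coord x r : 0 <= r -> (forall i, `|x ord0 i| <= r) ->
  enorm x <= n%:R * r.
Proof.
move=> r0 xr; rewrite -(ler_pXn2r (_ : 0 < 2)%N) ?nnegrE ?enorm_ge0 ?mulr_ge0//.
rewrite enorm_sqr; apply: (@le_trans _ _ (\sum_(i < n) r ^+ 2)).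
  apply: ler_sum => i _; rewrite -[leLHS]real_normK ?num_real//.
  by rewrite ler_pXn2r// ?nnegrE.
rewrite sumr_const card_ord -[leLHS]mulr_natl exprMn ler_wpM2r ?sqr_ge0//.
by rewrite -natrX ler_nat; case: (n) => // m; rewrite leq_pmulr.
Qed.

Lemma enorm_eq0 x : enorm x = 0 -> x = 0.
Proof.
move=> x0; apply/rowP => i; rewrite mxE; apply/eqP.
by rewrite -normr_le0 -x0 coord_le_enorm.
Qed.

Lemma enorm_triangle x y : enorm (x + y) <= enorm x + enorm y.
Proof.
rewrite -(ler_pXn2r (_ : 0 < 2)%N) ?nnegrE ?addr_ge0 ?enorm_ge0//.
have [x0|x0] := eqVneq (enorm x) 0.
  by rewrite (enorm_eq0 x0) !add0r enorm0 add0r.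
have [y0|y0] := eqVneq (enorm y) 0.
  by rewrite (enorm_eq0 y0) !addr0 enorm0 addr0.
set a := enorm x in x0 *; set b := enorm y in y0 *.
have a0 : 0 < a by rewrite lt0r x0 enorm_ge0.
have b0 : 0 < b by rewrite lt0r y0 enorm_ge0.
suff H : \sum_(i < n) (x ord0 i * y ord0 i) <= a * b.
  rewrite enorm_sqr sqrrD.
  under eq_bigr do rewrite mxE sqrrD.
  rewrite !big_split/= -!enorm_sqr -/a -/b lerD2r lerD2l.
  by rewrite mulr2n lerD.
(* Arithmetic-geometric mean inequality with the weights b / a and a / b, for which the two sums add
   up to exactly a b: this is the Cauchy-Schwarz inequality. *)
apply: (@le_trans _ _ (\sum_(i < n)
   (b / a / 2 * x ord0 i ^+ 2 + a / b / 2 * y ord0 i ^+ 2))).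
  apply: ler_sum => i _; rewrite -subr_ge0.
  have -> : b / a / 2 * x ord0 i ^+ 2 + a / b / 2 * y ord0 i ^+ 2 - x ord0 i * y ord0 i
     = (b * x ord0 i - a * y ord0 i) ^+ 2 / (2 * a * b) by field; rewrite x0 y0.
  by rewrite divr_ge0 ?sqr_ge0// !mulr_ge0// ltW.
rewrite big_split/= -!mulr_sumr -!enorm_sqr -/a -/b.
by rewrite le_eqVlt; apply/orP; left; apply/eqP; field; rewrite x0 y0.
Qed.

Lemma enorm_triangleB x y z : enorm (x - z) <= enorm (x - y) + enorm (y - z).
Proof. by rewrite -[x - z](subrKA y) enorm_triangle. Qed.

Lemma enorm_dist x p y : `|enorm (x - y) - enorm (p - y)| <= enorm (x - p).
Proof.
rewrite ler_norml lerBlDr enorm_triangleB andbT lerNl opprB lerBlDr (enormC x p).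
exact: enorm_triangleB.
Qed.

End enorm.

(** * Borel sets and cubes *)

Section topology_rV.
Context {R : realType} {n : nat}.
Implicit Types (x y : 'rV[R]_n) (U : set 'rV[R]_n).

Lemma open_rV_ball U x : open U -> U x ->
  exists2 e, 0 < e & forall y, (forall i, `|x ord0 i - y ord0 i| < e) -> U y.
Proof.
move=> oU Ux; have : nbhs x U by exact: open_nbhs_nbhs.
move=> /nbhs_ballP[e e0 eU]; exists e => // y xy; apply: eU.
split => // i j; rewrite (ord1 i); exact: xy.
Qed.

(** The sigma-algebra is generated by the coordinates, so an open set is exhausted by countably many
    boxes, those with rational corners that it contains. *)
Lemma open_measurable_rV U : open U -> measurable U.
Proof.
move=> oU.
pose B (ab : 'rV[rat]_n * 'rV[rat]_n) : set 'rV[R]_n :=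
  [set x | forall i, x ord0 i \in `]ratr (ab.1 ord0 i), ratr (ab.2 ord0 i)[].
have mB ab : measurable (B ab).
  have -> : B ab = \bigcap_(i in [set: 'I_n]) ((fun x => x ord0 i) @^-1`
      `]ratr (ab.1 ord0 i), ratr (ab.2 ord0 i)[%classic).
    by apply/seteqP; split=> [x H i _|x H i]; [exact: H|exact: (H i)].
  apply: fin_bigcap_measurable => // i _.
  by rewrite -[X in measurable X]setTI; exact: measurable_coord.
have -> : U = \bigcup_ab (if `[< B ab `<=` U >] then B ab else set0).
  apply/seteqP; split => [x Ux|x [ab _]]; last by case: ifPn => // /asboolP BU /BU.
  have [e e0 eU] := open_rV_ball oU Ux.
  have /choice[a aP] : forall i, exists r : rat, x ord0 i - e / 2 < ratr r < x ord0 i.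
    by move=> i; have [r] := @rat_in_itvoo R (x ord0 i - e / 2) (x ord0 i)
      ltac:(by rewrite ltrBlDr ltrDl divr_gt0); rewrite in_itv/=; exists r.
  have /choice[b bP] : forall i, exists r : rat, x ord0 i < ratr r < x ord0 i + e / 2.
    by move=> i; have [r] := @rat_in_itvoo R (x ord0 i) (x ord0 i + e / 2)
      ltac:(by rewrite ltrDl divr_gt0); rewrite in_itv/=; exists r.
  exists (\row_i a i, \row_i b i) => //.
  rewrite asboolT => [i|y /= yab].
    by rewrite /= !mxE in_itv/=; have /andP[_ ->] := aP i; have /andP[-> _] := bP i.
  apply: eU => i; have := yab i; rewrite !mxE in_itv/= => /andP[ya yb].
  have /andP[? ?] := aP i; have /andP[? ?] := bP i.
  by rewrite ltr_norml; apply/andP; split; lra.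
apply: countable_bigcupT_measurable => [|ab]; last by case: ifP => _.
exact: countableP.
Qed.

Lemma continuous_measurable_rV (D : set 'rV[R]_n) (f : 'rV[R]_n -> R) :
  open D -> {within D, continuous f} -> measurable_fun D f.
Proof.
move=> oD cf mD; have /(_ mD) : measurable_fun D f; last by [].
apply: (measurability _ (RGenOpens.measurableE R)) => _ [_ [a [b ->] <-]].
apply: open_measurable_rV.
move: cf; rewrite continuous_open_subspace// => cf.
rewrite openE => x [Dx fx]; rewrite /interior; apply: filterI.
  exact: open_nbhs_nbhs.
apply: cf; first by rewrite inE.
by apply: open_nbhs_nbhs; split => //; exact: interval_open.
Qed.

Lemma measurable_enormB :
  measurable_fun setT (fun z : 'rV[R]_n * 'rV[R]_n => enorm (z.1 - z.2)).
Proof.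
apply: (@measurableT_comp _ _ _ _ _ _ (@Num.sqrt R)).
  by apply: continuous_measurable_fun; exact: sqrt_continuous.
apply: measurable_sum => i; apply: measurable_funX.
under eq_fun do rewrite !mxE.
apply: measurable_funB.
  exact: (measurableT_comp (measurable_coord i) measurable_fst).
exact: (measurableT_comp (measurable_coord i) measurable_snd).
Qed.

Definition cube (c : 'rV[R]_n) (r : R) : set 'rV[R]_n :=
  [set x | forall i, x ord0 i \in `[c ord0 i - r, c ord0 i + r]].

Lemma measurable_box (a b : 'rV[R]_n) :
  measurable [set x : 'rV[R]_n | forall i, x ord0 i \in `[a ord0 i, b ord0 i]].
Proof.
have -> : [set x : 'rV[R]_n | forall i, x ord0 i \in `[a ord0 i, b ord0 i]]
  = \bigcap_(i in [set: 'I_n])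
      ((fun x => x ord0 i) @^-1` `[a ord0 i, b ord0 i]%classic).
  by apply/seteqP; split=> [x H i _|x H i]; [exact: H|exact: (H i)].
apply: fin_bigcap_measurable => // i _.
by rewrite -[X in measurable X]setTI; exact: measurable_coord.
Qed.

Lemma cubeE c r : cube c r = [set x | forall i,
  x ord0 i \in `[(\row_i (c ord0 i - r)) ord0 i, (\row_i (c ord0 i + r)) ord0 i]].
Proof. by apply/seteqP; split => x H i; have := H i; rewrite !mxE. Qed.

Lemma measurable_cube c r : measurable (cube c r).
Proof. by rewrite cubeE; exact: measurable_box. Qed.

Lemma leb_cube c r : 0 <= r -> leb n (cube c r) = ((2 * r) ^+ n)%:E.
Proof.
move=> r0; rewrite cubeE; apply: etrans (lebesgue_rV_box _) _.
  by move=> i; rewrite !mxE; lra.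
congr EFin; rewrite -[in RHS](card_ord n) -prodr_const; apply: eq_bigr => i _.
by rewrite !mxE; ring.
Qed.

Lemma vol_cube c r : 0 <= r -> vol (leb n) (cube c r) = (2 * r) ^+ n.
Proof. by move=> r0; have /(congr1 fine) := leb_cube c r0. Qed.

Lemma leb_cube_lty c r : 0 <= r -> (leb n (cube c r) < +oo)%E.
Proof. by move=> r0; rewrite leb_cube// ltry. Qed.

End topology_rV.

(** * Moduli of continuity of powers *)

Section powR_moduli.
Context {R : realType}.
Implicit Types a b p g x y : R.

Lemma powR_MVT p x y : 0 < x -> x < y ->
  exists2 z, x < z < y & y `^ p - x `^ p = p * z `^ (p - 1) * (y - x).
Proof.
move=> x0 xy.
have dp z : z \in `]x, y[ -> is_derive z 1 (@powR R ^~ p) (p * z `^ (p - 1)).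
  by rewrite in_itv/= => /andP[xz _]; apply: is_derive1_powR; lra.
have [|z] := MVT xy dp.
  apply: derivable_within_continuous => z; rewrite in_itv/= => /andP[xz _].
  apply: derivable_powR; rewrite in_itv/= andbT; lra.
by rewrite in_itv/= => zxy E; exists z.
Qed.

Lemma powR_dist_le1 g a b : 0 < g <= 1 -> 0 < a -> 0 <= b ->
  `|a `^ g - b `^ g| <= a `^ (g - 1) * `|a - b|.
Proof.
move=> /andP[g0]; rewrite le_eqVlt => /predU1P[->|g1] a0 b0.
  by rewrite subrr powRr0 mul1r !powRr1// ltW.
have [ab|ba] := leP a b.
  have : a `^ g <= b `^ g by apply: ge0_ler_powR; rewrite ?nnegrE ?(ltW a0) ?(ltW g0).
  rewrite -subr_ge0 distrC => h; rewrite ger0_norm//.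
  have := @powR_tangent _ g a b; rewrite g0 g1 => /(_ isT a0 b0) H.
  rewrite distrC ger0_norm ?subr_ge0//.
  have : 0 <= a `^ (g - 1) * (b - a) by rewrite mulr_ge0 ?powR_ge0// subr_ge0.
  move: H; rewrite -mulrA; move: (a `^ (g - 1) * (b - a)) => w H w0.
  have : g * w <= w by rewrite ler_piMl// ltW.
  lra.
have h : b `^ g <= a `^ g by apply: ge0_ler_powR; rewrite ?nnegrE ?(ltW a0) ?(ltW g0) ?(ltW ba).
rewrite !ger0_norm ?subr_ge0 ?(ltW ba)//.
have -> : a `^ g = a `^ (g - 1) * a by rewrite mulrC mulr_powRB1// ltW.
rewrite mulrBr lerB//.
move: b0; rewrite le_eqVlt => /predU1P[<-|b0]; first by rewrite mulr0 powR_ge0.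
rewrite -[leRHS](mulr_powRB1 (ltW b0) g0) mulrC ler_pM2l//.
by apply: powR_decr => //; [lra|exact: ltW].
Qed.

Lemma powR_dist_ge1 g d a b : 1 <= g -> 0 <= a <= d -> 0 <= b <= d ->
  `|a `^ g - b `^ g| <= g * d `^ (g - 1) * `|a - b|.
Proof.
move=> g1.
have g0 : 0 < g by lra.
suff H x y : 0 <= x -> x < y -> y <= d ->
    `|y `^ g - x `^ g| <= g * d `^ (g - 1) * `|y - x|.
  move=> /andP[a0 ad] /andP[b0 bd]; have [ab|ba|->] := ltgtP a b.
  - by rewrite distrC (distrC a); exact: H.
  - exact: H.
  - by rewrite !subrr !normr0 mulr0.
move=> x0 xy yd; have y0 : 0 < y by exact: le_lt_trans xy.
have d0 : 0 < d by exact: lt_le_trans yd.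
rewrite (ger0_norm (_ : 0 <= y - x)) ?subr_ge0 ?(ltW xy)//.
have : x `^ g <= y `^ g by apply: ge0_ler_powR; rewrite ?nnegrE ?(ltW y0) ?(ltW g0) ?(ltW xy).
rewrite -subr_ge0 => h; rewrite ger0_norm//.
have [x00|xp] := leP x 0.
  have -> : x = 0 by apply/eqP; rewrite eq_le x00 x0.
  rewrite powR0 ?gt_eqF// !subr0 -[leLHS](mulr_powRB1 (ltW y0) g0) mulrC.
  rewrite ler_wpM2r ?(ltW y0)//.
  apply: (@le_trans _ _ (d `^ (g - 1))); last by rewrite ler_peMl ?powR_ge0.
  by apply: ge0_ler_powR; rewrite ?nnegrE ?(ltW y0) ?(ltW d0)// subr_ge0.
have [z /andP[xz zy] ->] := powR_MVT g xp xy.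
rewrite ler_wpM2r ?subr_ge0 ?(ltW xy)// ler_pM2l//.
apply: ge0_ler_powR; rewrite ?nnegrE ?subr_ge0 ?(ltW d0)//; lra.
Qed.

(* For [g < 1] the derivative of [r ^ g] is singular, but weaker than [1/r]. *)
Lemma powR_dist g d : 0 < g -> 0 < d -> exists C th, [/\ 0 < C, 0 <= th < 1 &
  forall a b, 0 < a <= d -> 0 <= b <= d ->
    `|a `^ g - b `^ g| <= C * a `^ (- th) * `|a - b|].
Proof.
move=> g0 d0; have [g1|g1] := leP g 1.
  exists 1, (1 - g); split => // [|a b /andP[a0 _] /andP[b0 _]]; first by lra.
  by rewrite mul1r opprB; apply: powR_dist_le1 => //; rewrite g0.
exists (g * d `^ (g - 1)), 0; split => //; [|by rewrite lexx ltr01|].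
  by rewrite mulr_gt0// powR_gt0.
move=> a b /andP[a0 ad] bd; rewrite oppr0 powRr0 mulr1.
by apply: powR_dist_ge1 => //; rewrite ?(ltW g1) ?(ltW a0).
Qed.

Lemma powR_unif g d e : 0 < g -> 0 < d -> 0 < e -> exists2 h, 0 < h &
  forall a b, 0 <= a <= d -> 0 <= b <= d -> `|a - b| <= h ->
    `|a `^ g - b `^ g| <= e.
Proof.
move=> g0 d0 e0; have [g1|g1] := leP g 1.
  exists (e `^ g^-1); first exact: powR_gt0.
  suff H a b : 0 <= a -> 0 <= b -> b < a -> `|a - b| <= e `^ g^-1 ->
      `|a `^ g - b `^ g| <= e.
    move=> a b /andP[a0 _] /andP[b0 _]; have [ab|ba|->] := ltgtP a b.
    - by rewrite distrC (distrC _ (b `^ g)); exact: H.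
    - exact: H.
    - by move=> _; rewrite subrr normr0 ltW.
  move=> a0 b0 ba abe; have ap : 0 < a by exact: le_lt_trans ba.
  apply: (@le_trans _ _ (`|a - b| `^ g)); last first.
    have gN0 : g != 0 by rewrite gt_eqF.
    rewrite -[leRHS](powRr1 (ltW e0)) -(mulVf gN0) powRrM.
    by apply: ge0_ler_powR; rewrite ?nnegrE ?powR_ge0 ?(ltW g0).
  have := @powR_dist_le1 g a b; rewrite g0 g1 => /(_ isT ap b0) /le_trans; apply.
  have ab0 : 0 < `|a - b| by rewrite normr_gt0 subr_eq0 gt_eqF.
  rewrite -[leRHS](mulr_powRB1 (ltW ab0) g0) mulrC ler_pM2l//.
  apply: powR_decr => //; first by rewrite subr_le0.
  by rewrite ger0_norm ?subr_ge0 ?(ltW ba)// gerBl.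
have c0 : 0 < g * d `^ (g - 1) by rewrite mulr_gt0// powR_gt0.
exists (e / (g * d `^ (g - 1))); first by rewrite divr_gt0.
move=> a b ab bd; rewrite ler_pdivlMr// mulrC => H.
by apply: le_trans H; apply: powR_dist_ge1 => //; exact: ltW.
Qed.

End powR_moduli.

Section bounded_domain.
Context {R : realType} {n : nat}.
Variables (D : set 'rV[R]_n) (d : R).
Hypothesis d0 : 0 < d.
Hypothesis Dd : forall x y, D x -> D y -> enorm (x - y) <= d.

Lemma sub_cube p : D p -> D `<=` cube p d.
Proof.
move=> Dp x Dx i; have := coord_le_enorm (x - p) i; rewrite !mxE.
by move=> /le_trans /(_ (Dd Dx Dp)); rewrite in_itv/= ler_norml; lra.
Qed.

Lemma leb_bounded : measurable D -> (leb n D < +oo)%E.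
Proof.
move=> mD; have [[p Dp]|D0] := pselect (D !=set0); last first.
  by rewrite (_ : D = set0) ?measure0//; apply/eqP/negPn/negP => /set0P.
apply: (@le_lt_trans _ _ (leb n (cube p d))).
  by apply: le_measure; rewrite ?inE//; [exact: measurable_cube|exact: sub_cube].
by rewrite leb_cube ?ltry// ltW.
Qed.

(** Points are sorted by the integer parts of their coordinates on a grid. Each occupied cell is
    represented by one of its points in [D], since the kernel is controlled only there; empty cells
    receive the dummy [x0]. *)
Lemma finite_net e : 0 < e -> exists k (p : 'I_k -> 'rV[R]_n),
  (forall i, D (p i)) /\ forall x, D x -> exists i, enorm (x - p i) <= e.
Proof.
move=> e0; have [[x0 Dx0]|D0] := pselect (D !=set0); last first.
  exists 0%N, (fun i => 0); split; first by case.
  by move=> x Dx; exfalso; apply: D0; exists x.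
(* Two points of a cell are at Euclidean distance at most n h <= e; dividing by n + 1 covers n = 0
   as well. *)
pose h := e / n.+1%:R.
have h0 : 0 < h by rewrite divr_gt0.
pose N := (Num.truncn (2 * d / h)).+1.
pose co (x : 'rV[R]_n) i := Num.truncn ((x ord0 i - x0 ord0 i + d) / h).
have coP x i : D x -> 0 <= (x ord0 i - x0 ord0 i + d) / h <= 2 * d / h.
  move=> Dx; have := sub_cube Dx0 Dx i; rewrite in_itv/= => /andP[h1 h2].
  apply/andP; split; first by rewrite divr_ge0 ?(ltW h0)//; lra.
  by rewrite ler_pM2r ?invr_gt0//; lra.
have coN x i : D x -> (co x i < N)%N.
  move=> /(coP x i)/andP[_ H]; rewrite ltnS; exact: le_truncn.
pose cl (x : 'rV[R]_n) : {ffun 'I_n -> 'I_N} := [ffun i => inord (co x i)].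
have clE x i : D x -> cl x i = co x i :> nat by move=> Dx; rewrite ffunE inordK// coN.
have /choice[r rP] : forall f : {ffun 'I_n -> 'I_N}, exists y, D y /\
    ((exists2 x, D x & cl x = f) -> cl y = f).
  move=> f; have [[x Dx xf]|nx] := pselect (exists2 x, D x & cl x = f).
    by exists x.
  by exists x0.
exists #|{ffun 'I_n -> 'I_N}|, (fun i => r (enum_val i)); split.
  by move=> i; case: (rP (enum_val i)).
move=> x Dx; exists (enum_rank (cl x)); rewrite enum_rankK.
have [Dy /(_ (ex_intro2 _ _ x Dx erefl)) ry] := rP (cl x).
move: (r (cl x)) Dy ry => y Dy ry.
apply: (@le_trans _ _ (n%:R * h)); last first.
  rewrite /h mulrCA -[leRHS]mulr1 ler_pM2l// ler_pdivrMr// mul1r ler_nat.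
  exact: leqnSn.
apply: enorm_le_coord; first exact: ltW.
move=> i; rewrite !mxE.
have E : co y i = co x i by rewrite -clE// ry clE.
have /andP[x1 _] := coP x i Dx; have /andP[y1 _] := coP y i Dy.
have := truncn_itv x1; have := truncn_itv y1; rewrite -/(co x i) -/(co y i) E.
rewrite -natr1; move: ((co x i)%:R : R) => m /andP[m1 m2] /andP[m3 m4].
rewrite ler_pdivlMr// in m1; rewrite ltr_pdivrMr// in m2.
rewrite ler_pdivlMr// in m3; rewrite ltr_pdivrMr// in m4.
by rewrite ler_norml; apply/andP; split; nra.
Qed.

End bounded_domain.

(** * Riesz kernels *)

Section riesz_kernel.
Context {R : realType} {n : nat}.
Implicit Types x y : 'rV[R]_n.

Definition rk (g : R) x y : R := enorm (x - y) `^ g.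

(** In terms of the equation, g = alpha - n; [eps] is the regularisation that is sent to 0. *)
Definition ker (g lam eps : R) x y : R := rk g x y + lam * rk (g + 1) x y + eps.

Lemma rk_ge0 g x y : 0 <= rk g x y. Proof. exact: powR_ge0. Qed.

Lemma rkC g x y : rk g x y = rk g y x. Proof. by rewrite /rk enormC. Qed.

Lemma kerC g lam eps x y : ker g lam eps x y = ker g lam eps y x.
Proof. by rewrite /ker !(rkC _ x). Qed.

Lemma rkS g x y : 0 < g -> rk (g + 1) x y = enorm (x - y) * rk g x y.
Proof.
move=> g0; rewrite /rk powRD; last by rewrite gt_eqF// addr_gt0.
by rewrite powRr1 ?enorm_ge0// mulrC.
Qed.

Variables (D : set 'rV[R]_n) (d : R).
Hypothesis mD : measurable D.
Hypothesis d0 : 0 < d.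
Hypothesis Dd : forall x y, D x -> D y -> enorm (x - y) <= d.
Let mu := @leb R n.
Let fD : (mu D < +oo)%E := leb_bounded d0 Dd mD.
Variables (g lam eps : R).
Hypothesis g0 : 0 < g.

Lemma bmeas_rk p : 0 < p -> bmeas (D `*` D) (fun z => rk p z.1 z.2).
Proof.
move=> p0; apply: bmeas_powR; [by move=> z _; exact: enorm_ge0|exact: ltW|split].
  exact: (measurable_funTS measurable_enormB).
by exists d => -[x y] [Dx Dy] /=; rewrite ger0_norm ?enorm_ge0 ?Dd.
Qed.

Lemma bmeas_ker : bmeas (D `*` D) (fun z => ker g lam eps z.1 z.2).
Proof.
have g10 : 0 < g + 1 by rewrite addr_gt0.
apply: bmeasD; last exact: bmeas_cst.
by apply: bmeasD; [exact: bmeas_rk|apply: bmeasZ; exact: bmeas_rk].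
Qed.

Lemma net_ker e : 0 < e -> exists k (p : 'I_k -> 'rV[R]_n),
  (forall i, D (p i)) /\ forall x, D x -> exists i, forall y, D y ->
     `|ker g lam eps x y - ker g lam eps (p i) y| <= e.
Proof.
move=> e0; have g10 : 0 < g + 1 by rewrite addr_gt0.
have c0 : 0 < 1 + `|lam| by rewrite ltr_wpDr.
have e'0 : 0 < e / (1 + `|lam|) by rewrite divr_gt0.
have [h1 h10 H1] := powR_unif g0 d0 e'0.
have [h2 h20 H2] := powR_unif g10 d0 e'0.
have h0 : 0 < Num.min h1 h2 by rewrite lt_min h10.
have [k [p [Dp Hp]]] := finite_net Dd h0; exists k, p; split => // x Dx.
have [i] := Hp _ Dx; rewrite le_min => /andP[xi1 xi2]; exists i => y Dy.
have E1 : `|rk g x y - rk g (p i) y| <= e / (1 + `|lam|).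
  by apply: H1; rewrite ?enorm_ge0 ?Dd// (le_trans (enorm_dist _ _ _)).
have E2 : `|rk (g + 1) x y - rk (g + 1) (p i) y| <= e / (1 + `|lam|).
  by apply: H2; rewrite ?enorm_ge0 ?Dd// (le_trans (enorm_dist _ _ _)).
rewrite /ker; have -> : forall a b a' b' : R,
    a + lam * b + eps - (a' + lam * b' + eps) = (a - a') + lam * (b - b') by move=> *; ring.
rewrite (le_trans (ler_normD _ _))// normrM.
apply: (@le_trans _ _ (e / (1 + `|lam|) + `|lam| * (e / (1 + `|lam|)))).
  by rewrite lerD// ler_wpM2l.
by rewrite -[X in X + _]mul1r -mulrDl mulrCA mulfV ?mulr1// gt_eqF.
Qed.

Lemma ker_le x y : lam <= 0 -> ker g lam eps x y <= rk g x y + eps.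
Proof. by move=> l0; rewrite lerD2r gerDl mulr_le0_ge0// rk_ge0. Qed.

(** Here lam > -1 / d enters: the kernel is |x - y|^g times 1 + lam |x - y|, and this factor is at
    least 1 or 1 + lam d according to the sign of lam. *)
Lemma ker_ge x y : D x -> D y ->
  Num.min 1 (1 + lam * d) * rk g x y + eps <= ker g lam eps x y.
Proof.
move=> Dx Dy; rewrite lerD2r rkS//.
have -> : rk g x y + lam * (enorm (x - y) * rk g x y) =
  (1 + lam * enorm (x - y)) * rk g x y by ring.
apply: ler_wpM2r; first exact: rk_ge0.
have [l0|l0] := leP 0 lam.
  by rewrite ge_min lerDl mulr_ge0// enorm_ge0.
by rewrite ge_min; apply/orP; right; rewrite lerD2l ler_nM2l// Dd.
Qed.

Lemma bmeas_pot_rk p f : 0 < p -> bmeas D f -> bmeas D (pot mu (rk p) D f).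
Proof. by move=> p0 bf; apply: bmeas_pot => //; exact: bmeas_rk. Qed.

Lemma bmeas_rk_l p x : 0 < p -> D x -> bmeas D (rk p x).
Proof. by move=> p0 Dx; apply: bmeas_K_l => //; exact: bmeas_rk. Qed.

Lemma bmeas_ker_l x : D x -> bmeas D (ker g lam eps x).
Proof. by move=> Dx; apply: bmeas_K_l => //; exact: bmeas_ker. Qed.

Lemma pot_kerE f x : D x -> bmeas D f ->
  pot mu (ker g lam eps) D f x =
  pot mu (rk g) D f x + lam * pot mu (rk (g + 1)) D f x + eps * \int[mu]_(y in D) f y.
Proof.
move=> Dx bf; have g10 : 0 < g + 1 by rewrite addr_gt0.
have b1 : bmeas D (fun y => rk g x y * f y) by apply: bmeasM => //; exact: bmeas_rk_l.
have b2 : bmeas D (fun y => rk (g + 1) x y * f y) by apply: bmeasM => //; exact: bmeas_rk_l.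
have b3 := bmeasZ lam b2; have b4 := bmeasD b1 b3; have b5 := bmeasZ eps bf.
rewrite /pot -!bintZ// -!bintD//.
by apply: eq_bint => y _; rewrite /ker; ring.
Qed.

Lemma bil_kerE f h : bmeas D f -> bmeas D h ->
  bil mu (ker g lam eps) D f h =
  bil mu (rk g) D f h + lam * bil mu (rk (g + 1)) D f h +
  eps * ((\int[mu]_(y in D) f y) * \int[mu]_(y in D) h y).
Proof.
move=> bf bh; have g10 : 0 < g + 1 by rewrite addr_gt0.
have b1 : bmeas D (fun y => f y * pot mu (rk g) D h y).
  by apply: bmeasM => //; exact: bmeas_pot_rk.
have b2 : bmeas D (fun y => f y * pot mu (rk (g + 1)) D h y).
  by apply: bmeasM => //; exact: bmeas_pot_rk.
have b3 := bmeasZ lam b2; have b4 := bmeasD b1 b3.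
set I := \int[mu]_(y in D) h y; have b5 := bmeasZ eps (bmeasZr I bf).
rewrite /bil -bintZr// -!bintZ//; last exact: bmeasZr.
rewrite -(bintD mD fD b1 b3) -(bintD mD fD b4 b5).
apply: eq_bint => x Dx; rewrite pot_kerE// -/I.
by move: (pot _ _ _ _ _) (pot _ _ _ _ _) (f x) => r1 r2 r3; ring.
Qed.

Lemma bil_rk_ge0 p f : (forall x, D x -> 0 <= f x) -> 0 <= bil mu (rk p) D f f.
Proof. by move=> f0; apply: bil_ge0 => // x y _ _; exact: rk_ge0. Qed.

(** The cube of half-side r about x can hold only (2 r)^n of the measure of A, and outside it the
    kernel is at least r^p: a set of given measure cannot lie entirely close to x. *)
Lemma rk_set_ge p (A : set 'rV[R]_n) x r : 0 < p -> measurable A -> A `<=` D ->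
  D x -> 0 < r ->
  r `^ p * (vol mu A - (2 * r) ^+ n) <= \int[mu]_(y in A) rk p x y.
Proof.
move=> p0 mA AD Dx r0.
pose B := cube x r; have mB : measurable B by exact: measurable_cube.
have bx := bmeas_rk_l p0 Dx.
have fA : (mu A < +oo)%E by exact: vol_fin AD.
have bxA : bmeas A (rk p x) by exact: bmeasS bx.
have mAB : measurable (A `\` B) by exact: measurableD.
have ABA : A `\` B `<=` A by exact: subDsetl.
apply: (@le_trans _ _ (\int[mu]_(y in A `\` B) rk p x y)); last first.
  by apply: bintS => // y _; exact: rk_ge0.
apply: (@le_trans _ _ (r `^ p * vol mu (A `\` B))).
  apply: ler_wpM2l; first exact: powR_ge0.
  rewrite lerBlDl.
  have -> : vol mu A = vol mu (A `&` B) + vol mu (A `\` B).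
    rewrite (@vol_split _ _ _ mu A mA fA (A `&` B)) ?setDIr ?setDv ?set0U//.
    exact: measurableI.
  rewrite lerD2r.
  have -> : (2 * r) ^+ n = vol mu B by rewrite vol_cube// ltW.
  apply: (@vol_le _ _ _ mu B mB) => //.
  - exact/leb_cube_lty/ltW.
  - exact: measurableI.
apply: cst_le_bint => //; first exact: vol_fin ABA.
- exact: bmeasS bxA.
- move=> y [Ay nBy]; apply: ge0_ler_powR; rewrite ?nnegrE ?enorm_ge0 ?(ltW p0) ?(ltW r0)//.
  rewrite leNgt; apply/negP => xyr; apply: nBy => i.
  have := coord_le_enorm (y - x) i; rewrite enormC in xyr.
  rewrite !mxE in_itv/= => /le_lt_trans/(_ xyr); rewrite ltr_norml => /andP[? ?].
  by apply/andP; split; lra.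
Qed.

Hypothesis V0 : 0 < vol mu D.

Lemma minimizer_ker q : 0 < q < 1 -> 0 < eps -> 0 < 1 + lam * d ->
  exists f m dl, minimizer mu D (ker g lam eps) q m dl f.
Proof.
move=> q01 e0 ld.
apply: (@minimizer_exists _ _ _ mu D mD fD _ bmeas_ker net_ker _ q eps q01 e0 V0).
  by move=> x y; exact: kerC.
move=> x y Dx Dy; apply: le_trans (ker_ge Dx Dy).
by rewrite lerDr mulr_ge0 ?rk_ge0// le_min ler01 ltW.
Qed.

End riesz_kernel.

(** * The subcritical case *)

Section superlevel.
Context {d} {T : measurableType d} {R : realType}.

Lemma measurable_superlevel (D : set T) (f : T -> R) t : measurable D ->
  measurable_fun D f -> measurable (D `&` [set x | t < f x]).
Proof.
move=> mD mf; rewrite (_ : D `&` _ = D `&` f @^-1` `]t, +oo[); first exact: mf.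
by apply/seteqP; split => x /=; rewrite in_itv/= andbT.
Qed.

End superlevel.

(** The choice of r in [rk_set_ge] that leaves half of a set of measure [a] outside the cube. The
    closed form supplies the power of the measure in the weak-type bound. *)
Lemma radius_of_volume {R : realType} (n : nat) (a : R) : (0 < n)%N -> 0 < a ->
  exists2 r, 0 < r & (2 * r) ^+ n = a / 2 /\ r = 2^-1 * (a / 2) `^ n%:R^-1.
Proof.
move=> n0 a0; have a20 : 0 < a / 2 by rewrite divr_gt0.
exists (2^-1 * (a / 2) `^ n%:R^-1); first by rewrite mulr_gt0 ?invr_gt0 ?powR_gt0.
split => //; rewrite mulrA mulfV ?mul1r// -powR_mulrn ?powR_ge0// -powRrM.
by rewrite mulVf ?powRr1 ?(ltW a20)// pnatr_eq0 -lt0n.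
Qed.

Section minimizers.
Context {R : realType} {n : nat}.
Variables (D : set 'rV[R]_n) (d : R).
Hypothesis n0 : (0 < n)%N.
Hypothesis mD : measurable D.
Hypothesis d0 : 0 < d.
Hypothesis Dd : forall x y, D x -> D y -> enorm (x - y) <= d.
Let mu := @leb R n.
Let fD : (mu D < +oo)%E := leb_bounded d0 Dd mD.
Hypothesis V0 : 0 < vol mu D.
Variables (g lam q : R).
Hypotheses (g0 : 0 < g) (ld : 0 < 1 + lam * d) (q01 : 0 < q < 1).
Let kap := Num.min 1 (1 + lam * d).
Let kap0 : 0 < kap. Proof. by rewrite lt_min ltr01. Qed.
Let q0 : 0 < q. Proof. by case/andP: q01. Qed.
Let q1 : q < 1. Proof. by case/andP: q01. Qed.
Let g10 : 0 < g + 1. Proof. by rewrite addr_gt0. Qed.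

Lemma minimizer_le eps m dl f h : minimizer mu D (ker g lam eps) q m dl f ->
  bmeas D h -> (forall x, D x -> 0 <= h x) ->
  \int[mu]_(x in D) (h x `^ q) = 1 -> m <= bil mu (ker g lam eps) D h h.
Proof.
by move=> [_ _ _ _ [_ mlb]] bh h0 h1; have := mlb h bh h0; rewrite h1 powR1 mulr1.
Qed.

Lemma minimizer_bil eps m dl f : minimizer mu D (ker g lam eps) q m dl f ->
  bil mu (ker g lam eps) D f f = m.
Proof.
move=> [bf [dl0 fdl] fE f1 _]; have f0 x : D x -> 0 < f x.
  by move=> /fdl; exact: lt_le_trans.
rewrite -[RHS]mulr1 -f1 -bintZ//; last first.
  by apply: bmeas_powR => // [x /f0/ltW|]; [|exact: ltW].
by apply: eq_bint => x Dx; rewrite fE// mulrCA mulr_powRB1// ltW// f0.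
Qed.

Lemma minimizer_m_bounded : exists2 mb, 0 < mb & forall eps m dl f, 0 < eps <= 1 ->
  minimizer mu D (ker g lam eps) q m dl f -> m <= mb.
Proof.
pose c := vol mu D `^ (- q^-1).
have c1 : \int[mu]_(x in D) (c `^ q) = 1.
  rewrite bint_cst// /c -powRrM mulNr mulVf ?gt_eqF// powRN powRr1 ?(ltW V0)//.
  by rewrite mulVf// gt_eqF.
have bc : bmeas D (fun=> c) by exact: bmeas_cst.
pose I := \int[mu]_(x in D) c.
exists (`|bil mu (rk g) D (fun=> c) (fun=> c) +
   lam * bil mu (rk (g + 1)) D (fun=> c) (fun=> c)| + I * I + 1).
  rewrite ltr_wpDl// addr_ge0// mulr_ge0//; apply: Rintegral_ge0 => x _; exact: powR_ge0.
move=> eps m dl f /andP[e0 e1] Hf.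
apply: (le_trans (minimizer_le Hf bc (fun x _ => powR_ge0 _ _) c1)).
rewrite (bil_kerE mD d0 Dd lam eps g0 bc bc) -/I.
apply: ler_wpDr => //; apply: lerD; first exact: ler_norm.
by rewrite ler_piMl// -expr2 sqr_ge0.
Qed.

(** Uniform in eps, this replaces the lower bound eps times the mass, which degenerates as eps tends
    to 0. *)
Lemma pot_spread t eta : 0 < t -> 0 < eta -> exists2 c, 0 < c &
  forall eps f x, 0 <= eps -> bmeas D f -> (forall y, D y -> 0 <= f y) -> D x ->
    eta <= vol mu (D `&` [set y | t < f y]) ->
    c <= pot mu (ker g lam eps) D f x.
Proof.
move=> t0 e0; have [r r0 [rE _]] := radius_of_volume n0 e0.
exists (kap * (t * (r `^ g * (eta / 2)))).
  by rewrite !mulr_gt0// ?powR_gt0// divr_gt0.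
move=> eps f x eps0 bf f0 Dx; set A := D `&` _ => Aeta.
have mA : measurable A by apply: measurable_superlevel => //; case: bf.
have AD : A `<=` D by move=> y [].
have fA : (mu A < +oo)%E by exact: (vol_fin mD fD mA AD).
have bx : bmeas D (rk g x) by exact: (bmeas_rk_l mD Dd).
have bxA : bmeas A (rk g x) by exact: bmeasS bx.
have bfA : bmeas A f by exact: bmeasS bf.
have bxf : bmeas D (fun y => rk g x y * f y) by exact: bmeasM.
apply: (@le_trans _ _ (kap * \int[mu]_(y in D) (rk g x y * f y))); last first.
  rewrite -bintZ//; apply: le_bint => //; first exact: bmeasZ.
    by apply: bmeasM => //; exact: (bmeas_ker_l mD Dd lam eps g0).
  move=> y Dy; rewrite mulrA; apply: ler_wpM2r; first exact: f0.
  by apply: le_trans (ker_ge Dd lam eps g0 Dx Dy); rewrite lerDl.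
rewrite ler_pM2l//.
apply: (@le_trans _ _ (\int[mu]_(y in A) (rk g x y * f y))); last first.
  by apply: bintS => // y Dy; rewrite mulr_ge0 ?rk_ge0 ?f0.
apply: (@le_trans _ _ (\int[mu]_(y in A) (t * rk g x y))); last first.
  apply: le_bint => //; [exact: bmeasZ|exact: bmeasM|].
  by move=> y [Dy /ltW ty]; rewrite mulrC ler_wpM2l ?rk_ge0.
rewrite bintZ// ler_pM2l//.
apply: le_trans (rk_set_ge mD d0 Dd g0 mA AD Dx r0).
by rewrite ler_wpM2l ?powR_ge0// rE; lra.
Qed.

(** A chain of bounds uniform in eps: a superlevel set of fixed measure bounds the potential below,
    hence f above, hence the potential above, hence f below. The minimizers are then approximate
    solutions for eps = 0. *)
Lemma solution_of_spread t eta e0 : 0 < t -> 0 < eta -> 0 < e0 ->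
  (forall eps m dl f, 0 < eps <= e0 -> minimizer mu D (ker g lam eps) q m dl f ->
     eta <= vol mu (D `&` [set y | t < f y])) ->
  exists f c dl, [/\ bmeas D f, 0 < dl /\ (forall x, D x -> dl <= f x), 0 < c &
    forall x, D x -> pot mu (ker g lam 0) D f x = c * f x `^ (q - 1)].
Proof.
move=> t0 eta0 e00 H.
have [c1 c10 Hc1] := pot_spread t0 eta0.
have [mb mb0 Hmb] := minimizer_m_bounded.
have bK0 := bmeas_ker Dd lam 0 g0.
have [b b0 Kb] := bound_K bK0.
pose s := (1 - q)^-1.
have s0 : 0 < s by rewrite invr_gt0 subr_gt0.
have s0' : - s <= 0 by rewrite oppr_le0 ltW.
have [F [F0 HF]] : exists F, 0 < F /\ forall w, c1 / mb <= w -> w `^ (- s) <= F.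
  exists ((c1 / mb) `^ (- s)); split; first exact: powR_gt0 (divr_gt0 c10 mb0).
  by move=> w wh; apply: powR_decr => //; rewrite divr_gt0.
(* At a point where f > t one has m = u f^(1 - q) >= c1 t^(1 - q). *)
pose m0 := c1 * t `^ (1 - q).
have m00 : 0 < m0 by rewrite mulr_gt0// powR_gt0.
have [U [U0 HU]] : exists U, 0 < U /\ (b + 1) * (F * vol mu D) <= U.
  exists ((b + 1) * (F * vol mu D)); split => //.
  by rewrite !mulr_gt0// addr_gt0.
have [dl [dl0 Hdl]] : exists dl, 0 < dl /\ forall w, 0 < w -> w <= U / m0 ->
    dl <= w `^ (- s).
  exists ((U / m0) `^ (- s)); split; first exact: powR_gt0 (divr_gt0 U0 m00).
  by move=> w w0 wh; apply: powR_decr.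
have step eps : 0 < eps -> eps <= e0 -> eps <= 1 -> exists fm : ('rV[R]_n -> R) * R,
   [/\ bmeas D fm.1, forall x, D x -> dl <= fm.1 x <= F, m0 <= fm.2 <= mb,
     \int[mu]_(x in D) (fm.1 x `^ q) = 1 &
     forall x, D x -> `|pot mu (ker g lam 0) D fm.1 x - fm.2 * fm.1 x `^ (q - 1)| <=
        eps * (F * vol mu D)].
  move=> ep0 epe ep1.
  have [f [m [dl' Hf]]] := minimizer_ker mD d0 Dd g0 V0 q01 ep0 ld.
  have mmb : m <= mb by apply: Hmb Hf; rewrite ep0.
  have sp : eta <= vol mu (D `&` [set y | t < f y]) by apply: H Hf; rewrite ep0.
  have [bf [dl'0 fdl'] fE f1 [mp _]] := Hf.
  have fp x : D x -> 0 < f x by move=> /fdl'; exact: lt_le_trans.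
  have uc x : D x -> c1 <= pot mu (ker g lam eps) D f x.
    by move=> Dx; apply: Hc1 => //; [exact: ltW|move=> y /fp/ltW].
  have wE x : D x -> f x = (f x `^ (q - 1)) `^ (- s).
    by move=> Dx; rewrite powR_conjV// ltW// fp.
  have wc x : D x -> c1 / mb <= f x `^ (q - 1).
    move=> Dx; rewrite ler_pdivrMr// mulrC.
    apply: (@le_trans _ _ (m * f x `^ (q - 1))); first by rewrite -fE// uc.
    by rewrite ler_wpM2r// powR_ge0.
  have fF x : D x -> f x <= F by move=> Dx; rewrite wE//; apply: HF; exact: wc.
  have If : \int[mu]_(x in D) f x <= F * vol mu D by exact: bint_le_cst.
  have If0 : 0 <= \int[mu]_(x in D) f x by apply: Rintegral_ge0 => x /fp/ltW.
  have m0m : m0 <= m.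
    have [x [Dx tx]] : D `&` [set y | t < f y] !=set0.
      apply/set0P/eqP => A0; move: sp; rewrite A0 /vol measure0/=; lra.
    have := uc _ Dx; rewrite fE// => h.
    have ttx : t `^ (1 - q) <= f x `^ (1 - q).
      by apply: ge0_ler_powR; rewrite ?nnegrE ?subr_ge0 ?(ltW q1) ?(ltW t0) ?(ltW (fp _ Dx)) ?(ltW tx).
    apply: (@le_trans _ _ (m * f x `^ (q - 1) * f x `^ (1 - q))).
      by apply: ler_pM => //; [exact: ltW|exact: powR_ge0].
    by rewrite -mulrA -(opprB 1 q) powRN mulVf ?mulr1// gt_eqF// powR_gt0// fp.
  have potE x : D x -> pot mu (ker g lam eps) D f x =
      pot mu (ker g lam 0) D f x + eps * \int[mu]_(y in D) f y.
    move=> Dx; rewrite !(pot_kerE mD d0 Dd)//; ring.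
  exists (f, m); split => //=; last first.
  - move=> x Dx; rewrite -fE// potE// opprD addrA subrr add0r normrN.
    by rewrite ger0_norm ?mulr_ge0 ?(ltW ep0)// ler_pM2l.
  - by rewrite m0m.
  - move=> x Dx; rewrite fF// andbT wE//; apply: Hdl; first by rewrite powR_gt0// fp.
    rewrite ler_pdivlMr//; apply: le_trans HU.
    apply: (@le_trans _ _ (m * f x `^ (q - 1))).
      by rewrite mulrC ler_wpM2r// powR_ge0.
    rewrite -fE// potE// mulrDl mul1r; apply: lerD; last first.
      by apply: (le_trans _ If); rewrite ler_piMl.
    rewrite (le_trans (ler_norm _))//.
    apply: (le_trans (pot_le mD fD bK0 (fun y => Kb x y Dx) Dx bf)).
    rewrite ler_pM2l//; apply: (le_trans _ If); rewrite le_eqVlt; apply/orP; left.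
    by apply/eqP/eq_bint => y Dy; rewrite ger0_norm// ltW// fp.
pose ej j : R := Num.min (Num.min e0 1) j.+1%:R^-1.
have /choice[fm Hfm] : forall j, exists fm : ('rV[R]_n -> R) * R,
   [/\ bmeas D fm.1, forall x, D x -> dl <= fm.1 x <= F, m0 <= fm.2 <= mb,
     \int[mu]_(x in D) (fm.1 x `^ q) = 1 &
     forall x, D x -> `|pot mu (ker g lam 0) D fm.1 x - fm.2 * fm.1 x `^ (q - 1)| <=
        ej j * (F * vol mu D)].
  move=> j; apply: step.
  - by rewrite !lt_min e00 ltr01/= invr_gt0 ltr0n.
  - by rewrite !ge_min lexx.
  - by rewrite !ge_min lexx orbT.
have FV0 : 0 < F * vol mu D by rewrite mulr_gt0.
have [|||||f [c [bf fb fE f1 [cm _]]]] := @solution_limit _ _ _ mu D mD fD _ bK0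
    (net_ker d0 Dd lam 0 g0) q (fun j => (fm j).1) (fun j => (fm j).2) dl F m0 mb q01 dl0 m00.
- by move=> j; have [] := Hfm j.
- by move=> j; have [] := Hfm j.
- by move=> j; have [] := Hfm j.
- by move=> j; have [] := Hfm j.
- move=> e ep; have [N _ HN] := near_infty_natSinv_lt (PosNum (divr_gt0 ep FV0)).
  exists N => j Nj x Dx; have [_ _ _ _ /(_ _ Dx)] := Hfm j => /le_trans; apply.
  rewrite -ler_pdivlMr//; have /ltW := HN j Nj; apply: le_trans.
  by rewrite ge_min lexx orbT.
exists f, c, dl; split => //; last exact: lt_le_trans cm.
by split => // x /fb/andP[].
Qed.

End minimizers.

Lemma powR_lt1 {R : realType} (a p : R) : 1 < a -> p < 0 -> a `^ p < 1.
Proof.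
move=> a1 p0; have a0 : 0 < a by exact: lt_trans a1.
rewrite -(opprK p) powRN invf_lt1 ?powR_gt0//.
have -> : (1 : R) = 1 `^ (- p) by rewrite powR1.
by rewrite gt0_ltr_powR ?nnegrE ?oppr_gt0// ltW.
Qed.

Section tail.
Context {d} {T : measurableType d} {R : realType}.
Variables (mu : {measure set T -> \bar R}) (D : set T).
Hypotheses (mD : measurable D) (fD : (mu D < +oo)%E).

(* Halving the bound on f: the tail at [t] is the part where
   [t < f <= 2 t] plus the tail at [2 t]. *)
Lemma weak_tail_le q p C f t : 0 < q < p -> bmeas D f ->
  (forall x, D x -> 0 <= f x) ->
  (forall t, 0 < t -> vol mu (D `&` [set x | t < f x]) <= C * t `^ (- p)) ->
  0 < t ->
  \int[mu]_(x in D `&` [set x | t < f x]) (f x `^ q) <=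
    2 `^ q * C / (1 - 2 `^ (q - p)) * t `^ (q - p).
Proof.
move=> /andP[q0 qp] bf f0 weak.
set X := _ / _; have [mf [B fB]] := bf.
have two0 : 0 < (2 : R) by [].
have P1 : (2 : R) `^ (q - p) < 1 by rewrite powR_lt1 ?ltr1n// subr_lt0.
have C0 : 0 <= C by have := weak 1 ltr01; rewrite powR1 mulr1; apply: le_trans; exact: vol_ge0.
have X0 : 0 <= X by rewrite /X divr_ge0 ?mulr_ge0 ?powR_ge0// subr_ge0 ltW.
(* In units of t^(q - p), the recursion from the tail at 2 t to the tail at t is X -> 2^q C + 2^(q -
   p) X; it contracts because q < p, and [X] is its fixed point. *)
have XE : 2 `^ q * C + X * 2 `^ (q - p) = X.
  by rewrite /X; field; rewrite subr_eq0 gt_eqF.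
(* Since f is bounded the tail is empty after finitely many doublings of t; the resulting bound does
   not depend on their number k. *)
suff H k : forall t, 0 < t -> B <= 2 ^+ k * t ->
    \int[mu]_(x in D `&` [set x | t < f x]) (f x `^ q) <= X * t `^ (q - p).
  move=> t0; have [k Bk] : exists k, B <= 2 ^+ k * t.
    exists (Num.bound `|B / t|); rewrite -ler_pdivrMr//.
    apply: (le_trans (ler_norm _)); apply: (le_trans (ltW (archi_boundP (normr_ge0 _)))).
    by rewrite -natrX ler_nat ltnW// ltn_expl.
  exact: (H k).
elim: k => [|k IH] {}t t0 Bt.
  have -> : D `&` [set x | t < f x] = set0.
    apply/seteqP; split => x // -[Dx /= tx].
    have := le_trans (ler_norm _) (fB _ Dx); rewrite expr0 mul1r in Bt; lra.
  by rewrite Rintegral_set0; apply: mulr_ge0 => //; exact: powR_ge0.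
set A := D `&` _; pose A' := D `&` [set x | 2 * t < f x].
have mA : measurable A by exact: measurable_superlevel.
have mA' : measurable A' by exact: measurable_superlevel.
have AD : A `<=` D by move=> x [].
have A'A : A' `<=` A by move=> x [Dx /= tx]; split => //=; lra.
have fA : (mu A < +oo)%E by exact: vol_fin AD.
have bfq : bmeas A (fun x => f x `^ q).
  by apply: (bmeasS mD AD); exact: powR_bmeas_ge0 (ltW q0) f0 bf.
rewrite (bint_split mA fA mA' A'A bfq).
have t20 : 0 < 2 * t by rewrite mulr_gt0.
have {}IH := IH _ t20; rewrite mulrA -exprSr in IH.
have mAA : measurable (A `\` A') by exact: measurableD.
have AA : A `\` A' `<=` A by exact: subDsetl.
have E1 : \int[mu]_(x in A `\` A') (f x `^ q) <= (2 * t) `^ q * (C * t `^ (- p)).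
  apply: (@le_trans _ _ ((2 * t) `^ q * vol mu (A `\` A'))).
    apply: bint_le_cst => //; first exact: vol_fin AA.
      exact: bmeasS bfq.
    move=> x [[Dx tx] nA]; apply: ge0_ler_powR; rewrite ?nnegrE ?f0 ?(ltW q0) ?(ltW t20)//.
    by rewrite leNgt; apply/negP => h; apply: nA.
  apply: ler_wpM2l; first exact: powR_ge0.
  by apply: le_trans (weak t t0); exact: (@vol_le _ _ _ mu A).
apply: (le_trans (lerD (IH Bt) E1)).
rewrite !powRM ?(ltW t0)// -[leRHS]mulr1.
have -> : 2 `^ q * t `^ q * (C * t `^ (- p)) = 2 `^ q * C * t `^ (q - p).
  rewrite powRD; last by rewrite (gt_eqF t0) implybT.
  by rewrite -!mulrA; congr (_ * _); rewrite mulrCA.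
by rewrite -{2}XE le_eqVlt; apply/orP; left; apply/eqP; ring.
Qed.

End tail.

Lemma quarter_sum {R : realFieldType} (x y z : R) : x <= 4^-1 ->
  y <= 4^-1 + z -> x + y = 1 -> 2^-1 <= z.
Proof. by move=> *; lra. Qed.

Section subcritical.
Context {R : realType} {n : nat}.
Variables (D : set 'rV[R]_n) (d : R).
Hypothesis n0 : (0 < n)%N.
Hypothesis mD : measurable D.
Hypothesis d0 : 0 < d.
Hypothesis Dd : forall x y, D x -> D y -> enorm (x - y) <= d.
Let mu := @leb R n.
Let fD : (mu D < +oo)%E := leb_bounded d0 Dd mD.

Lemma bil_set_ge p (A : set 'rV[R]_n) f t r : 0 < p -> measurable A ->
  A `<=` D -> bmeas D f -> (forall x, D x -> 0 <= f x) -> 0 < t -> 0 < r ->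
  (forall x, A x -> t <= f x) ->
  t ^+ 2 * (r `^ p * (vol mu A - (2 * r) ^+ n)) * vol mu A <= bil mu (rk p) D f f.
Proof.
move=> p0 mA AD bf f0 t0 r0 tf.
have fA : (mu A < +oo)%E by exact: (vol_fin mD fD mA AD).
have bP := bmeas_pot_rk mD d0 Dd p0 bf.
have bfP : bmeas D (fun x => f x * pot mu (rk p) D f x) by exact: bmeasM.
have P0 x : 0 <= pot mu (rk p) D f x.
  by apply: Rintegral_ge0 => y Dy; rewrite mulr_ge0 ?rk_ge0 ?f0.
apply: (@le_trans _ _ (\int[mu]_(x in A) (f x * pot mu (rk p) D f x))); last first.
  by apply: bintS => // x Dx; rewrite mulr_ge0 ?f0.
set z := r `^ p * _.
(* If A is smaller than the cube, the lower bound is not positive and holds trivially. *)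
have [z0|z0] := leP z 0.
  apply: (@le_trans _ _ 0).
    by rewrite mulr_le0_ge0 ?vol_ge0// mulr_ge0_le0// sqr_ge0.
  by apply: Rintegral_ge0 => x Ax; rewrite mulr_ge0 ?f0//; exact: AD.
apply: cst_le_bint => //; first exact: bmeasS bfP.
move=> x Ax; rewrite expr2 -mulrA.
have tz0 : 0 <= t * z by apply: mulr_ge0; exact: ltW.
apply: ler_pM => //; [exact: ltW|exact: tf|].
have Dx := AD _ Ax.
have bx : bmeas D (rk p x) by exact: (bmeas_rk_l mD Dd).
have bxf : bmeas D (fun y => rk p x y * f y) by exact: bmeasM.
apply: (@le_trans _ _ (\int[mu]_(y in A) (rk p x y * f y))); last first.
  by rewrite /pot; apply: bintS => // y Dy; rewrite mulr_ge0 ?rk_ge0 ?f0.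
apply: (@le_trans _ _ (\int[mu]_(y in A) (t * rk p x y))).
  rewrite bintZ//; last exact: bmeasS bx.
  by rewrite ler_pM2l//; exact: (rk_set_ge mD d0 Dd p0 mA AD Dx r0).
apply: le_bint => //.
- by apply: bmeasZ; exact: bmeasS bx.
- exact: bmeasS bxf.
- by move=> y Ay; rewrite mulrC ler_wpM2l ?rk_ge0 ?tf.
Qed.

Variables (g lam : R).
Hypotheses (g0 : 0 < g) (ld : 0 < 1 + lam * d).
Let kap := Num.min 1 (1 + lam * d).
Let kap0 : 0 < kap. Proof. by rewrite lt_min ltr01. Qed.

Lemma bil_ker_ge eps f : 0 <= eps -> bmeas D f -> (forall x, D x -> 0 <= f x) ->
  kap * bil mu (rk g) D f f <= bil mu (ker g lam eps) D f f.
Proof.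
move=> e0 bf f0.
have bP := bmeas_pot_rk mD d0 Dd g0 bf.
have bPk : bmeas D (pot mu (ker g lam eps) D f).
  exact: (bmeas_pot mD fD (bmeas_ker Dd lam eps g0) bf).
rewrite /bil -bintZ//; last exact: bmeasM.
apply: le_bint => //; [by apply: bmeasZ; exact: bmeasM|exact: bmeasM|].
move=> x Dx; rewrite mulrCA; apply: ler_wpM2l; first exact: f0.
have bx : bmeas D (rk g x) by exact: (bmeas_rk_l mD Dd).
rewrite /pot -bintZ//; last exact: bmeasM.
apply: le_bint => //; [by apply: bmeasZ; exact: bmeasM| |].
  by apply: bmeasM => //; exact: (bmeas_ker_l mD Dd).
move=> y Dy; rewrite mulrA; apply: ler_wpM2r; first exact: f0.
by apply: le_trans (ker_ge Dd lam eps g0 Dx Dy); rewrite lerDl.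
Qed.

Hypothesis V0 : 0 < vol mu D.
Variable q : R.
Hypothesis q01 : 0 < q < 1.
Hypothesis qcrit : q * (2 * n%:R + g) < 2 * n%:R.
Let q0 : 0 < q. Proof. by case/andP: q01. Qed.

(** The energy of a superlevel set A at height t is at least a multiple of t^2 |A|^(2 + g / n),
    while m is bounded: a weak-type bound at the critical exponent p. As q < p, the part of f^q
    above a height t1 integrates to at most 1 / 4, and the part below a height t likewise; the rest
    is carried by the set where f > t with values at most t1^q. *)
Lemma subcritical_spread : exists t eta, [/\ 0 < t, 0 < eta &
  forall eps m dl f, 0 < eps <= 1 -> minimizer mu D (ker g lam eps) q m dl f ->
     eta <= vol mu (D `&` [set y | t < f y])].
Proof.
have nR0 : 0 < n%:R :> R by rewrite ltr0n.
have [mb mb0 Hmb] := minimizer_m_bounded mD d0 Dd V0 lam g0 q01.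
(* The power of |A|: 2 from the two integrations and g / n from r^g, since r is of order |A|^(1 /
   n). Hence p = 2 / e = 2n / (2n + g) is the critical exponent. *)
pose e := 2 + g / n%:R.
have e0 : 0 < e by rewrite addr_gt0// divr_gt0.
pose p := 2 / e.
have qp : q < p.
  rewrite /p ltr_pdivlMr// /e mulrDr mulrA -(ltr_pM2r nR0) mulrDl divfK ?gt_eqF//.
  by move: qcrit; lra.
pose C0 := mb * 2 `^ g / (2 * kap).
have C00 : 0 < C0 by rewrite divr_gt0// ?mulr_gt0// powR_gt0.
pose C := 2 * C0 `^ e^-1.
have C0' : 0 < C by rewrite mulr_gt0// powR_gt0.
have weak eps m dl f : 0 < eps <= 1 -> minimizer mu D (ker g lam eps) q m dl f ->
    forall t, 0 < t -> vol mu (D `&` [set x | t < f x]) <= C * t `^ (- p).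
  move=> ep01 Hf t t0; have [ep0 _] := andP ep01.
  have [bf [dl0 fdl] _ _ _] := Hf.
  have f0 x : D x -> 0 <= f x by move=> /fdl; apply/le_trans/ltW.
  set A := D `&` _.
  have mA : measurable A by apply: measurable_superlevel => //; case: bf.
  have AD : A `<=` D by move=> x [].
  have : 0 <= vol mu A by exact: vol_ge0.
  rewrite le_eqVlt => /predU1P[<-|a0]; first by rewrite mulr_ge0 ?powR_ge0// ltW.
  have [r r0 [rE rr]] := radius_of_volume n0 a0.
  have tf x : A x -> t <= f x by move=> [_ /ltW].
  have H1 := bil_set_ge g0 mA AD bf f0 t0 r0 tf.
  have H2 := bil_ker_ge (ltW ep0) bf f0.
  have H3 := Hmb _ _ _ _ ep01 Hf.
  rewrite (minimizer_bil mD d0 Dd q01 Hf) in H2.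
  move: H1; rewrite rE; set a := vol mu A in a0 rE rr *.
  pose w := a / 2; have w0 : 0 < w by rewrite divr_gt0.
  have aw : a = 2 * w by rewrite /w mulrCA mulfV ?mulr1.
  rewrite rr -/w.
  have -> : (2^-1 * w `^ n%:R^-1) `^ g = (2 `^ g)^-1 * w `^ (g / n%:R).
    rewrite powRM ?powR_ge0 ?invr_ge0// -powRrM mulrC [g / _]mulrC.
    by rewrite -[2^-1]powR_inv1// -powRrM mulN1r powRN mulrC.
  move=> H1.
  have H4 : kap * (t ^+ 2 * ((2 `^ g)^-1 * w `^ (g / n%:R) * (a - w)) * a) <= mb.
    by apply: le_trans H3; apply: le_trans H2; rewrite ler_pM2l.
  have we : w `^ e = w `^ (g / n%:R) * w ^+ 2.
    rewrite /e addrC powRD; last by rewrite (gt_eqF w0) implybT.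
    by rewrite -(powR_mulrn 2 (ltW w0)).
  have {}H4 : w `^ e <= C0 * (t ^+ 2)^-1.
    rewrite ler_pdivlMr ?exprn_gt0// /C0 ler_pdivlMr ?mulr_gt0//.
    have g2 : 0 < (2 : R) `^ g by rewrite powR_gt0.
    rewrite -ler_pdivrMr//; apply: le_trans H4; rewrite aw we le_eqVlt; apply/orP; left.
    by apply/eqP; rewrite expr2; ring.
  have H5 : w <= C0 `^ e^-1 * t `^ (- p).
    have -> : w = (w `^ e) `^ e^-1 by rewrite -powRrM mulfV ?powRr1 ?(ltW w0)// gt_eqF.
    have -> : t `^ (- p) = ((t ^+ 2)^-1) `^ e^-1.
      by rewrite -(powR_mulrn 2 (ltW t0)) -powRN -powRrM mulNr.
    rewrite -powRM ?invr_ge0 ?exprn_ge0 ?(ltW t0) ?(ltW C00)//.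
    apply: ge0_ler_powR => //; rewrite ?nnegrE ?powR_ge0 ?invr_ge0 ?(ltW e0)//.
    by rewrite mulr_ge0 ?invr_ge0 ?exprn_ge0 ?(ltW t0) ?(ltW C00).
  by rewrite aw /C -mulrA ler_pM2l.
pose X := 2 `^ q * C / (1 - 2 `^ (q - p)).
have P1 : (2 : R) `^ (q - p) < 1 by rewrite powR_lt1 ?ltr1n// subr_lt0.
have X0 : 0 < X by rewrite divr_gt0 ?mulr_gt0 ?powR_gt0// subr_gt0.
have qp0 : 0 < p - q by rewrite subr_gt0.
have [t1 t10 t1E] : exists2 t1, 0 < t1 & X * t1 `^ (q - p) = 4^-1.
  have X4 : 0 < 4 * X by exact: mulr_gt0.
  exists ((4 * X) `^ (p - q)^-1); first exact: powR_gt0.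
  rewrite -powRrM -(opprB p q) mulrN mulVf ?gt_eqF// powRN powRr1 ?(ltW X4)//.
  by rewrite invfM mulrCA mulfV ?mulr1// gt_eqF.
have [t t0 tq] : exists2 t, 0 < t & t `^ q * vol mu D = 4^-1.
  exists ((4 * vol mu D)^-1 `^ q^-1); first by rewrite powR_gt0// invr_gt0 mulr_gt0.
  rewrite -powRrM mulVf ?gt_eqF// powRr1; last by rewrite invr_ge0 mulr_ge0// ltW.
  by field; rewrite gt_eqF.
have T0 : 0 < 2 * t1 `^ q by rewrite mulr_gt0// powR_gt0.
exists t, (2 * t1 `^ q)^-1; split; [by []|by rewrite invr_gt0|].
move=> eps m dl f ep01 Hf; have wk := weak _ _ _ _ ep01 Hf.
have [bf [dl0 fdl] _ f1 _] := Hf.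
have f0 x : D x -> 0 <= f x by move=> /fdl; apply/le_trans/ltW.
have H1 : \int[mu]_(x in D `&` [set x | t1 < f x]) (f x `^ q) <= 4^-1.
  rewrite -t1E; apply: (weak_tail_le mD fD _ bf f0 wk t10).
  by rewrite q0 qp.
have [mf _] := bf.
set B := D `&` _ in H1; have mB : measurable B by exact: measurable_superlevel.
have BD : B `<=` D by move=> x [].
have bfq := powR_bmeas_ge0 (ltW q0) f0 bf.
move: (f1); rewrite (bint_split mD fD mB BD bfq).
set A := D `&` [set y | t < f y].
have mA : measurable A by exact: measurable_superlevel.
have AD : A `<=` D by move=> x [].
have mDB : measurable (D `\` B) by exact: measurableD.
have DBD : D `\` B `<=` D by exact: subDsetl.
have bh : bmeas D (fun x => t `^ q + t1 `^ q * \1_A x).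
  by apply: bmeasD; [exact: bmeas_cst|apply: bmeasZ; exact: bmeas_indic].
(* Where f <= t1, f^q is at most t1^q on the set A and at most t^q off it. *)
have H2 : \int[mu]_(x in D `\` B) (f x `^ q) <=
    \int[mu]_(x in D) (t `^ q + t1 `^ q * \1_A x).
  apply: (@le_trans _ _ (\int[mu]_(x in D `\` B) (t `^ q + t1 `^ q * \1_A x))).
    apply: le_bint => //; [exact: vol_fin DBD|exact: bmeasS bfq|exact: bmeasS bh|].
    move=> x [Dx nB]; rewrite indicE; case: (boolP (x \in A)) => /= [_|nA].
      rewrite mulr1; apply: ler_wpDl; first exact: powR_ge0.
      apply: ge0_ler_powR; rewrite ?nnegrE ?f0 ?(ltW q0) ?(ltW t10)//.
      by rewrite leNgt; apply/negP => h; apply: nB.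
    rewrite mulr0 addr0; apply: ge0_ler_powR; rewrite ?nnegrE ?f0 ?(ltW q0) ?(ltW t0)//.
    by rewrite leNgt; apply/negP => h; move/negP: nA; apply; rewrite inE; split.
  apply: bintS => // x Dx; rewrite addr_ge0 ?powR_ge0// mulr_ge0 ?powR_ge0//.
have b1 := @bmeas_indic _ _ R D A mA.
have b2 := bmeasZ (t1 `^ q) b1.
have b3 := @bmeas_cst _ _ R D (t `^ q).
move: H2; rewrite (bintD mD fD b3 b2) (bint_cst mu mD) tq (bintZ mD fD _ b1).
rewrite (bint_indic1 mu mA AD) => H2 H3.
rewrite invfM ler_pdivrMr ?powR_gt0// mulrC.
exact: quarter_sum H1 H2 H3.
Qed.

End subcritical.

(** * The critical case on a cube *)

Section extension_by_zero.
Context {d} {T : measurableType d} {R : realType}.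
Variables (mu : {sigma_finite_measure set T -> \bar R}) (D E : set T).
Hypotheses (mD : measurable D) (mE : measurable E) (DE : D `<=` E).
Implicit Types f h : T -> R.

Lemma bmeas_restrict f : bmeas D f -> bmeas E (f \_ D).
Proof.
move=> [mf [C fC]]; split.
  by apply/(measurable_restrict f mD mE); rewrite (setIidr DE).
exists `|C| => x Ex; rewrite patchE; case: ifPn => [/set_mem Dx|_]; last by rewrite normr0.
by rewrite (le_trans (fC _ Dx))// ler_norm.
Qed.

Lemma bint_restrict f : \int[mu]_(x in E) (f \_ D) x = \int[mu]_(x in D) f x.
Proof. by rewrite -Rintegral_mkcondr (setIidr DE). Qed.

Lemma bint_restrictM f h : \int[mu]_(x in E) (h x * (f \_ D) x) =
  \int[mu]_(x in D) (h x * f x).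
Proof.
rewrite -(bint_restrict (fun x => h x * f x)); apply: eq_bint => x _.
by rewrite !patchE; case: ifP; rewrite ?mulr0.
Qed.

Lemma pot_restrict K f x : pot mu K E (f \_ D) x = pot mu K D f x.
Proof. exact: bint_restrictM. Qed.

Lemma bil_restrict K f : bil mu K E (f \_ D) (f \_ D) = bil mu K D f f.
Proof.
rewrite /bil; transitivity (\int[mu]_(x in E) (pot mu K D f x * (f \_ D) x)).
  by apply: eq_bint => x _; rewrite pot_restrict mulrC.
by rewrite bint_restrictM; apply: eq_bint => x _; rewrite mulrC.
Qed.

Lemma restrict_ge0 f : (forall x, D x -> 0 <= f x) -> forall x, E x -> 0 <= (f \_ D) x.
Proof. by move=> f0 x _; rewrite patchE; case: ifPn => // /set_mem /f0. Qed.

Lemma bint_restrict_powR q f : q != 0 ->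
  \int[mu]_(x in E) ((f \_ D) x `^ q) = \int[mu]_(x in D) (f x `^ q).
Proof.
move=> q0; rewrite -(bint_restrict (fun x => f x `^ q)); apply: eq_bint => x _.
by rewrite !patchE; case: ifP => // _; rewrite powR0.
Qed.

End extension_by_zero.

(** * Scaling of energies under dilations *)

Section scaling.
Context {R : realType} {n : nat}.
Variables (D' : set 'rV[R]_n) (d : R).
Hypothesis mD' : measurable D'.
Hypothesis d0 : 0 < d.
Hypothesis Dd : forall x y, D' x -> D' y -> enorm (x - y) <= d.
Let mu := @leb R n.
Let fD : (mu D' < +oo)%E := leb_bounded d0 Dd mD'.
Variables (z : 'rV[R]_n) (t : R).
Hypothesis t0 : 0 < t.
Let D := dil z t @^-1` D'.
Implicit Types f : 'rV[R]_n -> R.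

Lemma enorm_dil x y : enorm (dil z t x - dil z t y) = t * enorm (x - y).
Proof. by rewrite /dil opprD addrACA subrr add0r -scalerBr enormZ ger0_norm// ltW. Qed.

Lemma rk_dil p x y : rk p x y = (t `^ p)^-1 * rk p (dil z t x) (dil z t y).
Proof.
rewrite /rk enorm_dil powRM ?enorm_ge0 ?(ltW t0)// mulKf//.
by rewrite gt_eqF// powR_gt0.
Qed.

Lemma measurable_dilD : measurable D.
Proof. exact: measurable_dil_preimage. Qed.

Lemma leb_dil_lty : (mu D < +oo)%E.
Proof.
rewrite /mu /D; have -> : leb n (dil z t @^-1` D') = ((t ^+ n)^-1%:E * leb n D')%E.
  exact: leb_dil.
by rewrite lte_mul_pinfty// lee_fin invr_ge0 exprn_ge0// ltW.
Qed.

Lemma bmeas_dil f : bmeas D' f -> bmeas D (fun x => f (dil z t x)).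
Proof.
move=> [mf [C fC]]; split; last by exists C => x; exact: fC.
apply: (measurable_comp (F := D') mD' _ mf); first by move=> _ [x Dx <-].
exact: (measurable_funTS (measurable_dil z t)).
Qed.

Lemma bil_dil p f : 0 < p -> bmeas D' f -> (forall x, D' x -> 0 <= f x) ->
  bil mu (rk p) D (fun x => f (dil z t x)) (fun x => f (dil z t x)) =
  (t `^ p * t ^+ n * t ^+ n)^-1 * bil mu (rk p) D' f f.
Proof.
move=> p0 bf f0.
have tp : t `^ p != 0 by rewrite gt_eqF// powR_gt0.
have tn : t ^+ n != 0 by rewrite gt_eqF// exprn_gt0.
have bP := bmeas_pot_rk mD' d0 Dd p0 bf.
have P0 x : 0 <= pot mu (rk p) D' f x.
  by apply: Rintegral_ge0 => y Dy; rewrite mulr_ge0 ?rk_ge0 ?f0.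
have potE x : D x -> pot mu (rk p) D (fun x => f (dil z t x)) x =
    (t `^ p * t ^+ n)^-1 * pot mu (rk p) D' f (dil z t x).
  move=> Dx; have bx : bmeas D' (rk p (dil z t x)) by exact: (bmeas_rk_l mD' Dd).
  have bxf : bmeas D' (fun y => rk p (dil z t x) y * f y) by exact: bmeasM.
  rewrite invfM -mulrA /pot -(bint_dil z t0 mD' fD bxf); last first.
    by move=> y Dy; rewrite mulr_ge0 ?rk_ge0 ?f0.
  rewrite -(bintZ measurable_dilD leb_dil_lty); last exact: (bmeas_dil bxf).
  by apply: eq_bint => y Dy; rewrite rk_dil mulrA.
have bfP : bmeas D' (fun x => f x * pot mu (rk p) D' f x) by exact: bmeasM.
rewrite [RHS](_ : _ = (t `^ p * t ^+ n)^-1 * ((t ^+ n)^-1 * bil mu (rk p) D' f f)); last first.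
  by rewrite invfM mulrA.
rewrite /bil -(bint_dil z t0 mD' fD bfP); last by move=> x Dx; rewrite mulr_ge0 ?f0.
rewrite -(bintZ measurable_dilD leb_dil_lty); last exact: (bmeas_dil bfP).
by apply: eq_bint => x Dx; rewrite potE// mulrCA.
Qed.

End scaling.

Lemma powR_add_le {R : realType} (g a b : R) : 0 < g -> 0 <= a -> 0 <= b ->
  (a + b) `^ g <= 2 `^ g * (a `^ g + b `^ g).
Proof.
move=> g0 a0 b0.
wlog ab : a b a0 b0 / a <= b.
  move=> H; have [ab|/ltW ba] := leP a b; first exact: H.
  by rewrite addrC [a `^ g + _]addrC; exact: H.
apply: (@le_trans _ _ ((2 * b) `^ g)).
  by apply: ge0_ler_powR; rewrite ?nnegrE ?(ltW g0) ?addr_ge0 ?mulr_ge0//; lra.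
by rewrite powRM// ler_pM2l ?powR_gt0// lerDr powR_ge0.
Qed.

Lemma powR_div {R : realType} (a b x : R) : 0 < a -> 0 < b ->
  (a / b) `^ x = a `^ x * b `^ (- x).
Proof.
move=> a0 b0; rewrite powRM ?invr_ge0 ?ltW//.
by rewrite -[b^-1]powR_inv1 ?(ltW b0)// -powRrM mulN1r.
Qed.

(** The tangent inequality at 1 for the concave power 1 / a, applied to (1 - x)^a. It linearises the
    power 2 / q of a constraint integral 1 - X. *)
Lemma bernoulli_powR {R : realType} (a x : R) : 1 < a -> 0 <= x -> x <= 1 ->
  1 - a * x <= (1 - x) `^ a.
Proof.
move=> a1 x0 x1; have a0 : 0 < a by exact: lt_trans a1.
have q01 : 0 < a^-1 < 1 by rewrite invr_gt0 a0 invf_lt1.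
have := powR_tangent q01 ltr01 (powR_ge0 (1 - x) a).
rewrite !powR1 -powRrM mulfV ?gt_eqF// powRr1 ?subr_ge0// mulr1 => h.
have : a * (1 - x) <= a * (1 + a^-1 * ((1 - x) `^ a - 1)) by rewrite ler_pM2l.
have -> : a * (1 + a^-1 * ((1 - x) `^ a - 1)) = a + ((1 - x) `^ a - 1).
  by field; rewrite gt_eqF.
by lra.
Qed.

Section disjoint_union.
Context {d} {T : measurableType d} {R : realType}.
Variable mu : {measure set T -> \bar R}.

Lemma bint_disjoint_ge k (S : nat -> set T) (D : set T) h a :
  measurable D -> (mu D < +oo)%E -> bmeas D h -> (forall x, D x -> 0 <= h x) ->
  (forall j, (j < k)%N -> [/\ measurable (S j), S j `<=` D &
     a <= \int[mu]_(x in S j) h x]) ->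
  (forall i j x, (i < j)%N -> (j < k)%N -> S i x -> S j x -> False) ->
  k%:R * a <= \int[mu]_(x in D) h x.
Proof.
elim: k D => [|k IH] D mD fD bh h0 HS dS; first by rewrite mul0r; exact: Rintegral_ge0.
have [mS SD Sa] := HS k (ltnSn k).
rewrite (bint_split mD fD mS SD bh) -natr1 mulrDl mul1r addrC; apply: lerD => //.
have mDS : measurable (D `\` S k) by exact: measurableD.
have DSD : D `\` S k `<=` D by exact: subDsetl.
apply: IH => //.
- exact: vol_fin DSD.
- exact: bmeasS bh.
- by move=> x /DSD /h0.
- move=> j jk; have [mj jD ja] := HS j (ltnW jk); split => // x Sx; split; first exact: jD.
  by move=> Sk; exact: (dS j k x jk (ltnSn k) Sx Sk).
- by move=> i j x ij jk; apply: dS => //; exact: ltnW.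
Qed.

End disjoint_union.

Section inner_box.
Context {R : realType} {n : nat}.
Implicit Types (c p x : 'rV[R]_n).

(** In every coordinate the box lies on the side of p that faces the centre c, so it stays in the
    cube even if p is on the boundary. These boxes play the part of dyadic shells around p. *)
Lemma inner_box c r p a b : cube c r p -> 0 <= a -> a <= b -> b <= r ->
  exists S, [/\ measurable S, S `<=` cube c r, vol (leb n) S = (b - a) ^+ n &
    forall x, S x -> forall i, a <= `|x ord0 i - p ord0 i| <= b].
Proof.
move=> Dp a0 ab br.
pose lo := \row_i (if p ord0 i <= c ord0 i then p ord0 i + a else p ord0 i - b).
pose hi := \row_i (if p ord0 i <= c ord0 i then p ord0 i + b else p ord0 i - a).
exists [set x : 'rV[R]_n | forall i, x ord0 i \in `[lo ord0 i, hi ord0 i]].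
split.
- exact: measurable_box.
- move=> x Sx i; have := Sx i; have := Dp i; rewrite !mxE !in_itv/=.
  case: ifPn => [pc|]; last rewrite -ltNge => pc; move=> /andP[? ?] /andP[? ?];
  by apply/andP; split; lra.
- have -> : vol (leb n) [set x : 'rV[R]_n | forall i, x ord0 i \in `[lo ord0 i, hi ord0 i]]
     = \prod_(i < n) (hi ord0 i - lo ord0 i).
    have lohi i : lo ord0 i <= hi ord0 i by rewrite !mxE; case: ifP => _; lra.
    by rewrite /vol; have /(congr1 fine) := lebesgue_rV_box lohi.
  rewrite -[in RHS](card_ord n) -prodr_const; apply: eq_bigr => i _.
  by rewrite !mxE; case: ifP => _; ring.
- move=> x Sx i; have := Sx i; rewrite !mxE in_itv/=; case: ifP => _ /andP[h1 h2].
    by rewrite ger0_norm; [apply/andP; split; lra|lra].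
  by rewrite ler0_norm; [apply/andP; split; lra|lra].
Qed.

End inner_box.

(** * Profile of a minimizer around its peak *)

Section peak.
Context {R : realType} {n : nat}.
Variables (c : 'rV[R]_n) (r d : R).
Let D := cube c r.
Hypothesis n0 : (0 < n)%N.
Hypothesis r0 : 0 < r.
Hypothesis d0 : 0 < d.
Hypothesis Dd : forall x y, D x -> D y -> enorm (x - y) <= d.
Let mu := @leb R n.
Let mD : measurable D := measurable_cube c r.
Let fD : (mu D < +oo)%E := leb_bounded d0 Dd mD.
Variables (g lam q : R).
Hypotheses (g0 : 0 < g) (lam0 : lam < 0) (ld : 0 < 1 + lam * d) (q01 : 0 < q < 1).
Hypothesis qcrit : q * (2 * n%:R + g) = 2 * n%:R.
Let kap := 1 + lam * d.
Let s := (1 - q)^-1.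
Let q0 : 0 < q. Proof. by case/andP: q01. Qed.
Let q1 : q < 1. Proof. by case/andP: q01. Qed.
Let s0 : 0 < s. Proof. by rewrite invr_gt0 subr_gt0. Qed.
Let g10 : 0 < g + 1. Proof. by rewrite addr_gt0. Qed.

(* [rho] is the concentration scale of f at p: with [f p * rho^n] as the unit of
   mass, the potential at p is that of a unit mass at distance [rho]. *)
Definition peak eps m dl f p rho := [/\ 0 < eps <= 1,
  minimizer mu D (ker g lam eps) q m dl f,
  D p /\ (forall x, D x -> f x <= 2 * f p), 0 < rho &
  pot mu (ker g lam eps) D f p = f p * rho ^+ n * rho `^ g].

Let ker_lower eps x y : D x -> D y -> kap * rk g x y + eps <= ker g lam eps x y.
Proof.
move=> Dx Dy; have := ker_ge Dd lam eps g0 Dx Dy.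
by rewrite [Num.min _ _]minElt ltNge (_ : 1 + lam * d <= 1)//= gerDl mulr_le0_ge0// ltW.
Qed.

Section fixed_peak.
Variables (eps m dl : R) (f : 'rV[R]_n -> R) (p : 'rV[R]_n) (rho : R).
Hypothesis Hp : peak eps m dl f p rho.
Let N x := enorm (x - p).
Let M := \int[mu]_(y in D) f y.
Let W := f p * rho ^+ n.
Let u := pot mu (ker g lam eps) D f.

Let bf : bmeas D f. Proof. by case: Hp => _ []. Qed.
Let Dp : D p. Proof. by case: Hp => _ _ []. Qed.
Let rho0 : 0 < rho. Proof. by case: Hp. Qed.
Let eps0 : 0 < eps. Proof. by case: Hp => /andP[]. Qed.

Lemma peak_gt0 x : D x -> 0 < f x.
Proof. by case: Hp => _ [_ [dl0 fdl] _ _ _] _ _ _ /fdl; exact: lt_le_trans. Qed.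

Lemma peak_m_gt0 : 0 < m. Proof. by case: Hp => _ [_ _ _ _ []]. Qed.

Lemma peak_uE x : D x -> u x = m * f x `^ (q - 1).
Proof. by case: Hp => _ [_ _ fE _ _] _ _ _ /fE. Qed.

Lemma peak_W_gt0 : 0 < W.
Proof. by rewrite mulr_gt0 ?peak_gt0 ?exprn_gt0. Qed.

Lemma peak_up : u p = W * rho `^ g. Proof. by case: Hp. Qed.

(** Dividing the Euler-Lagrange equations at x and p eliminates the multiplier, so that f is
    compared with its value at the peak through potentials alone. *)
Lemma peak_fE x : D x -> f x = (u x / u p) `^ (- s) * f p.
Proof.
move=> Dx; rewrite !peak_uE// -mulf_div divff ?gt_eqF ?peak_m_gt0// mul1r.
have fx := peak_gt0 Dx; have fp := peak_gt0 Dp.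
rewrite powRM ?invr_ge0 ?powR_ge0//.
rewrite powR_conjV ?(ltW fx)// -powRN -powRrM.
have -> : - (q - 1) * - s = - 1 by rewrite /s; field; rewrite subr_eq0 gt_eqF.
by rewrite powR_inv1 ?(ltW fp)// divfK// gt_eqF.
Qed.

Lemma peak_u_gt0 x : D x -> 0 < u x.
Proof. by move=> Dx; rewrite peak_uE// mulr_gt0 ?peak_m_gt0// powR_gt0 ?peak_gt0. Qed.

Lemma peak_ge w x : D x -> u x <= w * u p -> w `^ (- s) * f p <= f x.
Proof.
move=> Dx uw; rewrite [leRHS]peak_fE// ler_pM2r ?peak_gt0//.
apply: powR_decr; first by rewrite oppr_le0 ltW.
  by rewrite divr_gt0 ?peak_u_gt0.
by rewrite ler_pdivrMr ?peak_u_gt0.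
Qed.

Lemma peak_le w x : 0 < w -> D x -> w * u p <= u x -> f x <= w `^ (- s) * f p.
Proof.
move=> w0 Dx uw; rewrite [leLHS]peak_fE// ler_pM2r ?peak_gt0//.
apply: powR_decr; first by rewrite oppr_le0 ltW.
  by [].
by rewrite ler_pdivlMr ?peak_u_gt0.
Qed.

Let bx x : D x -> bmeas D (rk g x).
Proof. by move=> Dx; exact: (bmeas_rk_l mD Dd). Qed.
Let bkf x : D x -> bmeas D (fun y => ker g lam eps x y * f y).
Proof. by move=> Dx; apply: bmeasM => //; exact: (bmeas_ker_l mD Dd). Qed.
Let f0 y : D y -> 0 <= f y. Proof. by move=> /peak_gt0/ltW. Qed.

Lemma peak_moment : \int[mu]_(y in D) (rk g p y * f y) <= W * rho `^ g / kap.
Proof.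
rewrite -peak_up ler_pdivlMr// mulrC -(bintZ mD fD); last by apply: bmeasM => //; exact: bx.
apply: (le_bint mD fD); [by apply: bmeasZ; apply: bmeasM => //; exact: bx|exact: bkf|].
move=> y Dy; rewrite mulrA; apply: ler_wpM2r; first exact: f0.
by apply: le_trans (ker_lower eps Dp Dy); rewrite lerDl ltW.
Qed.

(** The triangle inequality splits |x - y|^g between |x - p|^g and |p - y|^g; the second part
    together with eps is absorbed by the potential at p. *)
Lemma peak_pot_le x : D x -> u x <= 2 `^ g / kap * (N x `^ g * M + W * rho `^ g).
Proof.
move=> Dx; set B := _ / kap.
have k1 : kap <= 1 by rewrite gerDl mulr_le0_ge0// ltW.
have two1 : 1 <= (2 : R) `^ g by apply: powR_ge1; rewrite ?ler1n// ltW.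
have B1 : 2 `^ g <= B by rewrite ler_pdivlMr// ler_piMr ?powR_ge0.
have B2 : 2 `^ g = B * kap by rewrite /B divfK// gt_eqF.
have B0 : 0 <= B by rewrite (le_trans _ B1)// powR_ge0.
apply: (@le_trans _ _ (\int[mu]_(y in D)
    (B * N x `^ g * f y + B * (ker g lam eps p y * f y)))).
  apply: (le_bint mD fD); first exact: bkf.
    by apply: bmeasD; [exact: bmeasZ|apply: bmeasZ; exact: bkf].
  move=> y Dy; rewrite mulrA -mulrDl; apply: ler_wpM2r; first exact: f0.
  apply: (le_trans (ker_le g eps _ _ (ltW lam0))).
  apply: (@le_trans _ _ (2 `^ g * (N x `^ g + rk g p y) + eps)).
    rewrite lerD2r; apply: le_trans (powR_add_le g0 (enorm_ge0 _) (enorm_ge0 _)).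
    apply: ge0_ler_powR; rewrite ?nnegrE ?enorm_ge0 ?addr_ge0 ?enorm_ge0 ?(ltW g0)//.
    exact: enorm_triangleB.
  rewrite mulrDr -addrA; apply: lerD; first by rewrite ler_wpM2r ?powR_ge0.
  rewrite {1}B2 -mulrA; apply: (@le_trans _ _ (B * (kap * rk g p y + eps))).
    rewrite mulrDr lerD2l ler_peMl ?(ltW eps0)//; exact: le_trans B1.
  by apply: ler_wpM2l => //; exact: ker_lower.
rewrite (bintD mD fD); [|exact: bmeasZ|by apply: bmeasZ; exact: bkf].
rewrite (bintZ mD fD)// (bintZ mD fD); last exact: bkf.
rewrite -/M (_ : \int[mu]_(y in D) (ker g lam eps p y * f y) = W * rho `^ g); last exact: peak_up.
by rewrite mulrDr [B * (_ * M)]mulrA.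
Qed.

(** Inside the cube of half-side rho about p the bound f <= 2 f p is used, outside it the moment of
    order g divided by rho^g; the definition of rho makes both contributions multiples of [W]. *)
Lemma peak_mass_le : M <= (2 * 2 ^+ n + kap^-1) * W.
Proof.
have bc : bmeas D (\1_(cube p rho) : _ -> R) by apply: bmeas_indic; exact: measurable_cube.
have rg0 : 0 < rho `^ g by rewrite powR_gt0.
have fp0 : 0 < f p by exact: peak_gt0.
have bm : bmeas D (fun y => rk g p y * f y) by apply: bmeasM => //; exact: bx.
apply: (@le_trans _ _ (\int[mu]_(y in D)
    (2 * f p * \1_(cube p rho) y + (rho `^ g)^-1 * (rk g p y * f y)))).
  apply: (le_bint mD fD) => //; first by apply: bmeasD; exact: bmeasZ.
  move=> y Dy; rewrite indicE; case: (boolP (y \in cube p rho)) => [_|yp] /=.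
    rewrite mulr1; apply: ler_wpDr; last by case: Hp => _ _ [_ /(_ _ Dy)].
    by rewrite !mulr_ge0 ?invr_ge0 ?rk_ge0 ?f0 ?(ltW rg0).
  rewrite mulr0 add0r mulrA ler_peMl ?f0// ler_pdivlMl// mulr1.
  apply: ge0_ler_powR; rewrite ?nnegrE ?enorm_ge0 ?(ltW g0) ?(ltW rho0)//.
  rewrite leNgt; apply/negP => h; move/negP: yp; apply; rewrite inE => i.
  have := coord_le_enorm (p - y) i => /le_lt_trans /(_ h).
  by rewrite !mxE in_itv/= ltr_norml => /andP[? ?]; apply/andP; split; lra.
rewrite (bintD mD fD); [|exact: bmeasZ|exact: bmeasZ].
rewrite !(bintZ mD fD)// [leRHS]mulrDl; apply: lerD.
  have -> : \int[mu]_(y in D) \1_(cube p rho) y = vol mu (D `&` cube p rho).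
    have mDC : measurable (D `&` cube p rho).
      by apply: measurableI => //; exact: measurable_cube.
    rewrite -(bint_indic1 mu mDC (@subIsetl _ D (cube p rho))).
    apply: eq_bint => y Dy; rewrite !indicE; congr (_%:R); congr nat_of_bool.
    by rewrite in_setI (mem_set Dy).
  have mC : measurable (cube p rho) by exact: measurable_cube.
  have h : vol mu (D `&` cube p rho) <= 2 ^+ n * rho ^+ n.
    rewrite -exprMn -(vol_cube p (ltW rho0)).
    apply: (@vol_le _ _ _ mu (cube p rho) mC) => //; first exact/leb_cube_lty/ltW.
    exact: measurableI.
  have -> : 2 * 2 ^+ n * W = 2 * f p * (2 ^+ n * rho ^+ n) by rewrite /W; ring.
  by apply: ler_wpM2l => //; rewrite mulr_ge0// ltW.
rewrite ler_pdivrMl// (le_trans peak_moment)// le_eqVlt; apply/orP; left; apply/eqP.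
by rewrite mulrC; ring.
Qed.

Let B := 2 `^ g / kap.
Let kap1 : kap <= 1. Proof. by rewrite gerDl mulr_le0_ge0// ltW. Qed.
Let B1 : 1 <= B.
Proof.
rewrite ler_pdivlMr// mul1r (le_trans kap1)//.
by apply: powR_ge1; rewrite ?ler1n// ltW.
Qed.
Let B0 : 0 < B. Proof. exact: lt_le_trans B1. Qed.
Let nR0 : 0 < n%:R :> R. Proof. by rewrite ltr0n. Qed.
Let nR1 : 1 <= n%:R :> R. Proof. by rewrite ler1n. Qed.
Let rg0 : 0 < rho `^ g. Proof. exact: powR_gt0. Qed.

Lemma peak_near a x : 0 <= a -> D x -> M <= a * W -> N x <= n%:R * rho ->
  (B * (n%:R `^ g * a + 1)) `^ (- s) * f p <= f x.
Proof.
move=> a0 Dx Ma Nx; apply: peak_ge => //; apply: (le_trans (peak_pot_le Dx)).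
rewrite -/B -mulrA ler_pM2l// peak_up mulrDl mul1r lerD2r.
have -> : n%:R `^ g * a * (W * rho `^ g) = (n%:R * rho) `^ g * (a * W).
  by rewrite powRM ?(ltW rho0)//; ring.
apply: ler_pM; rewrite ?powR_ge0//.
- by apply: Rintegral_ge0 => y /f0.
- by apply: ge0_ler_powR; rewrite ?nnegrE ?enorm_ge0 ?(ltW g0)// mulr_ge0// ltW.
Qed.

(** Either M exceeds W, or M <= W can be fed into [peak_near], and then f is comparable to f p on a
    box of side rho with corner p. *)
Lemma peak_mass_ge : rho <= r -> (B * (n%:R `^ g + 1)) `^ (- s) * W <= M.
Proof.
move=> rhor; set c1 := _ `^ (- s).
have nn : 0 <= n%:R `^ g :> R by exact: powR_ge0.
have c11 : c1 <= 1.
  have C0 : 0 < B * (n%:R `^ g + 1) by apply: mulr_gt0 => //; exact: ltr_wpDl.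
  rewrite /c1 powRN invf_le1; last exact: powR_gt0.
  apply: powR_ge1; last exact: ltW.
  by rewrite -[leLHS]mul1r; apply: ler_pM => //; rewrite lerDr.
have W0 := peak_W_gt0.
have [WM|/ltW MW] := leP W M; first by apply: (le_trans _ WM); apply: ler_piMl => //; exact: ltW.
have [S [mS SD vS HS]] := inner_box Dp (lexx 0) (ltW rho0) rhor.
have fS : (mu S < +oo)%E by exact: vol_fin SD.
apply: (@le_trans _ _ (\int[mu]_(y in S) f y)); last by apply: bintS => // y /f0.
have -> : c1 * W = (c1 * f p) * vol mu S by rewrite vS subr0 mulrA.
apply: cst_le_bint => //; first exact: bmeasS bf.
move=> x Sx; have := @peak_near 1 x ler01 (SD _ Sx); rewrite mulr1 mul1r; apply => //.
by apply: enorm_le_coord => [|i]; [exact: ltW|have /andP[_] := HS _ Sx i; rewrite !mxE].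
Qed.

(** Chebyshev's inequality: by [peak_moment] and the choice of b, a mass of at least a W / 2 lies
    within b rho of p, and it is seen from x at distance at least N x / 2. *)
Lemma peak_pot_far a b x : 0 < a -> 0 < b -> a * W <= M ->
  b `^ g * (kap * a) = 2 -> 2 * (b * rho) <= N x -> D x ->
  kap * (N x / 2) `^ g * (a * W / 2) <= u x.
Proof.
move=> a0 b0 aM bE bN Dx.
have br0 : 0 < (b * rho) `^ g by rewrite powR_gt0// mulr_gt0.
pose th := ((b * rho) `^ g)^-1.
have bm : bmeas D (fun y => rk g p y * f y) by apply: bmeasM => //; exact: bx.
have kN0 : 0 <= kap * (N x / 2) `^ g by rewrite mulr_ge0 ?powR_ge0// ltW.
apply: (@le_trans _ _ (\int[mu]_(y in D)
   (kap * (N x / 2) `^ g * (f y - th * (rk g p y * f y))))); last first.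
  apply: (le_bint mD fD) => //.
  - by apply: bmeasZ; apply: bmeasB => //; exact: bmeasZ.
  - exact: bkf.
  move=> y Dy; have [yn|yf] := ltP (enorm (p - y)) (b * rho).
    apply: (@le_trans _ _ (kap * (N x / 2) `^ g * f y)).
      apply: ler_wpM2l => //; rewrite gerBl mulr_ge0 ?invr_ge0 ?(ltW br0)//.
      by rewrite mulr_ge0 ?rk_ge0 ?f0.
    apply: ler_wpM2r; first exact: f0.
    apply: (@le_trans _ _ (kap * rk g x y)); last first.
      by apply: le_trans (ker_lower eps Dx Dy); rewrite lerDl ltW.
    rewrite ler_pM2l//; apply: ge0_ler_powR; rewrite ?nnegrE ?divr_ge0 ?enorm_ge0 ?(ltW g0)//.
    have := enorm_triangleB x y p; rewrite (enormC y p) -/(N x).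
    by move: bN yn; lra.
  apply: (@le_trans _ _ 0).
    apply: mulr_ge0_le0 => //; rewrite subr_le0 mulrA ler_peMl ?f0//.
    rewrite /th ler_pdivlMl// mulr1.
    by apply: ge0_ler_powR; rewrite ?nnegrE ?enorm_ge0 ?(ltW g0)// mulr_ge0 ?ltW.
  by rewrite mulr_ge0 ?f0// (le_trans _ (ker_lower eps Dx Dy))// addr_ge0 ?mulr_ge0 ?rk_ge0 ?ltW.
rewrite (bintZ mD fD); last by apply: bmeasB => //; exact: bmeasZ.
apply: ler_wpM2l => //.
rewrite (bintB mD fD)//; last exact: bmeasZ.
rewrite (bintZ mD fD)// -/M lerBrDr.
have h : th * \int[mu]_(y in D) (rk g p y * f y) <= a * W / 2.
  have := peak_moment; rewrite -(ler_pM2l (_ : 0 < th)) ?invr_gt0// => /le_trans; apply.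
  rewrite /th powRM ?(ltW b0) ?(ltW rho0)// le_eqVlt; apply/orP; left; apply/eqP.
  have bg0 : 0 < b `^ g by rewrite powR_gt0.
  have -> : a = 2 / (b `^ g * kap) by rewrite -bE; field; rewrite !gt_eqF.
  by field; rewrite !gt_eqF.
by apply: (le_trans (lerD (lexx _) h)); rewrite -splitr.
Qed.

(** Since f behaves like u^(-s) and u grows like |x - p|^g, this is the decay rate 2n + g of f away
    from the peak. *)
Let gsE : g * s = 2 * n%:R + g.
Proof.
have E : g = (2 * n%:R + g) * (1 - q).
  by rewrite mulrBr mulr1 [_ * q]mulrC qcrit addrAC subrr add0r.
by rewrite {1}E mulfK// subr_eq0 gt_eqF.
Qed.

Let gsqE : g * (s * q) = n%:R * 2.
Proof. by rewrite mulrA gsE mulrC qcrit mulrC. Qed.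

(** At a fixed distance u exceeds u p by a factor of order rho^(-g), so f^q falls by the factor
    rho^(g s q) = rho^(2n). *)
Lemma peak_far a b x : 0 < a -> 0 < b -> a * W <= M ->
  b `^ g * (kap * a) = 2 -> 2 * (b * rho) <= N x -> D x -> r / 2 <= N x ->
  f x `^ q <= (kap * (r / 4) `^ g * (a / 2)) `^ (- (s * q)) * f p `^ q * (rho ^+ n) ^+ 2.
Proof.
move=> a0 b0 aM bE bN Dx rN; set c3 := kap * _ * _.
have c30 : 0 < c3 by rewrite !mulr_gt0// ?invr_gt0// powR_gt0// divr_gt0.
have fp := peak_gt0 Dp.
have w0 : 0 < c3 / rho `^ g by rewrite divr_gt0.
have H : c3 / rho `^ g * u p <= u x.
  rewrite peak_up mulrCA divfK ?gt_eqF// mulrC.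
  apply: le_trans (peak_pot_far a0 b0 aM bE bN Dx).
  have -> : c3 * W = kap * (r / 4) `^ g * (a * W / 2) by rewrite /c3; ring.
  have ra : r / 4 <= N x / 2 by move: rN; lra.
  have aW0 : 0 <= a * W / 2 by rewrite divr_ge0// mulr_ge0// ltW// peak_W_gt0.
  apply: ler_wpM2r => //; apply: ler_wpM2l; first exact: ltW.
  by apply: ge0_ler_powR; rewrite ?nnegrE ?(ltW g0) ?divr_ge0 ?enorm_ge0 ?(ltW r0).
have := peak_le w0 Dx H => fx.
apply: (@le_trans _ _ (((c3 / rho `^ g) `^ (- s) * f p) `^ q)).
  by apply: ge0_ler_powR; rewrite ?nnegrE ?(ltW q0) ?f0// mulr_ge0 ?powR_ge0 ?(ltW fp).
rewrite powRM ?powR_ge0 ?(ltW fp)// -powRrM mulNr powR_div// -powRrM opprK.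
by rewrite mulrC gsqE powRrM powR_mulrn ?(ltW rho0)// powR_mulrn ?exprn_ge0 ?(ltW rho0)// mulrA [f p `^ q * _]mulrC.
Qed.

Let bxp x : D x -> bmeas D (rk (g + 1) x).
Proof. by move=> Dx; exact: (bmeas_rk_l mD Dd). Qed.

(** The powers of R0 are g + 1 from the kernel, -(2n + g) from the decay of f, and n from the
    volume. Their product R0^(1 - n) is at least r^(1 - n): each shell contributes at least the same
    amount, whatever its radius. *)
Lemma peak_shell a x (R0 : R) S : 0 <= a -> M <= a * W -> D x ->
  N x <= n%:R * rho -> 2 * n%:R * rho <= R0 -> R0 <= r -> measurable S -> S `<=` D ->
  vol mu S = R0 ^+ n ->
  (forall y, S y -> forall i, R0 <= `|y ord0 i - p ord0 i| <= 2 * R0) ->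
  2 `^ (- (g + 1)) * (B * ((2 * n%:R) `^ g * a + 1)) `^ (- s) * r `^ (1 - n%:R) *
    (W * rho ^+ n * rho `^ g) <= \int[mu]_(y in S) (rk (g + 1) x y * f y).
Proof.
move=> a0 Ma Dx Nx nR Rr mS SD vS HS.
set C6 := B * _.
have W0 := peak_W_gt0.
have R00 : 0 < R0 by apply: lt_le_trans nR; rewrite !mulr_gt0.
have rhoR : rho <= R0.
  apply: le_trans nR; rewrite -[leLHS]mul1r ler_wpM2r ?(ltW rho0)//.
  by rewrite -[leLHS]mul1r ler_pM// ler1n.
have C60 : 0 < C6.
  by apply: mulr_gt0 => //; apply: ltr_wpDl => //; rewrite mulr_ge0// powR_ge0.
have fp := peak_gt0 Dp.
have Rrho : 0 < R0 / rho by rewrite divr_gt0.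
pose e := 2 * n%:R + g.
have fy y : S y -> C6 `^ (- s) * (R0 / rho) `^ (- e) * f p <= f y.
  move=> Sy; have Dy := SD _ Sy.
  have Ny : N y <= 2 * n%:R * R0.
    rewrite -mulrA mulrCA; apply: enorm_le_coord => [|i]; first by rewrite mulr_ge0// ltW.
    by have /andP[_] := HS _ Sy i; rewrite !mxE.
  have -> : C6 `^ (- s) * (R0 / rho) `^ (- e) = (C6 * (R0 / rho) `^ g) `^ (- s).
    by rewrite (powRM (- s) (ltW C60) (powR_ge0 _ _)) -powRrM mulrN gsE.
  apply: peak_ge => //; apply: (le_trans (peak_pot_le Dy)); rewrite -/B -/C6.
  rewrite peak_up.
  have -> : C6 * (R0 / rho) `^ g * (W * rho `^ g) =
     B * ((2 * n%:R) `^ g * R0 `^ g * (a * W) + W * R0 `^ g).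
    rewrite (powR_div g R00 rho0) powRN /C6.
    have h : rho `^ g != 0 by rewrite gt_eqF.
    by field.
  rewrite ler_pM2l//.
  apply: lerD.
    apply: ler_pM => //; [exact: powR_ge0|by apply: Rintegral_ge0 => z /f0|].
    rewrite -powRM ?mulr_ge0 ?(ltW R00)//.
    by apply: ge0_ler_powR; rewrite ?nnegrE ?enorm_ge0 ?mulr_ge0 ?(ltW g0) ?(ltW R00).
  rewrite ler_pM2l//; apply: ge0_ler_powR; rewrite ?nnegrE ?(ltW g0) ?(ltW rho0) ?(ltW R00)//.
have ry y : S y -> (R0 / 2) `^ (g + 1) <= rk (g + 1) x y.
  move=> Sy; apply: ge0_ler_powR; rewrite ?nnegrE ?enorm_ge0 ?divr_ge0 ?(ltW g10) ?(ltW R00)//.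
  have := enorm_triangleB y x p; rewrite (enormC y x) -/(N x).
  have := coord_le_enorm (y - p) (Ordinal n0); rewrite !mxE.
  have /andP[h _] := HS _ Sy (Ordinal n0).
  move: h nR Nx; move: (n%:R * rho) (mulrA 2 n%:R rho) => w <-; lra.
have fS : (mu S < +oo)%E by exact: vol_fin SD.
pose cc := (R0 / 2) `^ (g + 1) * (C6 `^ (- s) * (R0 / rho) `^ (- e) * f p).
apply: (@le_trans _ _ (cc * vol mu S)); last first.
  apply: cst_le_bint => //.
    by apply: (bmeasS mD SD); apply: bmeasM => //; exact: bxp.
  move=> y Sy; apply: ler_pM; rewrite ?powR_ge0 ?ry ?fy//.
  by rewrite !mulr_ge0 ?powR_ge0// ltW.
rewrite vS /cc (powR_div _ R00) // (powR_div _ R00 rho0) opprK.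
have -> : R0 `^ (g + 1) * 2 `^ (- (g + 1)) *
    (C6 `^ (- s) * (R0 `^ (- e) * rho `^ e) * f p) * R0 ^+ n =
   2 `^ (- (g + 1)) * C6 `^ (- s) * (R0 `^ (g + 1) * R0 `^ (- e) * R0 ^+ n) *
    (f p * rho `^ e) by ring.
have -> : R0 `^ (g + 1) * R0 `^ (- e) * R0 ^+ n = R0 `^ (1 - n%:R).
  rewrite -powR_mulrn ?(ltW R00)// -!powRD ?(gt_eqF R00) ?implybT//.
  by congr (_ `^ _); rewrite /e; ring.
have -> : W * rho ^+ n * rho `^ g = f p * rho `^ e.
  have -> : e = n%:R + n%:R + g by rewrite /e; ring.
  rewrite !powRD ?(gt_eqF rho0) ?implybT// powR_mulrn ?(ltW rho0)//.
  by rewrite /W; ring.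
apply: ler_wpM2r; first by rewrite mulr_ge0 ?powR_ge0// ltW.
apply: ler_wpM2l; first by rewrite mulr_ge0 ?powR_ge0.
by apply: powR_decr => //; rewrite subr_le0.
Qed.

Lemma peak_E1_ge k a : 0 <= a -> M <= a * W -> rho <= r ->
  3 ^+ k * (2 * (2 * n%:R * rho)) <= r ->
  k%:R * ((B * (n%:R `^ g * a + 1)) `^ (- s) *
    (2 `^ (- (g + 1)) * (B * ((2 * n%:R) `^ g * a + 1)) `^ (- s) * r `^ (1 - n%:R))) *
    (W * (W * rho ^+ n * rho `^ g)) <= bil mu (rk (g + 1)) D f f.
Proof.
move=> a0 Ma rhor kr; set c5 := _ `^ (- s); set c7 := _ * r `^ _.
set Z := W * rho ^+ n * _.
have [S0 [mS0 S0D vS0 HS0]] := inner_box Dp (lexx 0) (ltW rho0) rhor.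
have W0 := peak_W_gt0.
have Z0 : 0 < Z.
  by apply: mulr_gt0 => //; apply: mulr_gt0 => //; exact: exprn_gt0.
(* A shell extends from R to 2 R, so the ratio 3 keeps them disjoint; the first radius separates
   them from the box [S0] around the peak. *)
pose Rj j := 3 ^+ j * (2 * n%:R * rho).
have nrho : 0 < 2 * n%:R * rho by rewrite !mulr_gt0.
have Rj0 j : 0 < Rj j by rewrite mulr_gt0// exprn_gt0.
have Rle i j : (i <= j)%N -> Rj i <= Rj j.
  by move=> ij; rewrite ler_pM2r// ler_weXn2l// ler1n.
have Rjr j : (j < k)%N -> 2 * Rj j <= r.
  move=> jk; apply: le_trans kr; rewrite mulrCA ler_pM2r ?mulr_gt0//.
  by rewrite ler_weXn2l ?ler1n// ltnW.
have /choice[S HS] : forall j, exists S : set 'rV[R]_n, (j < k)%N ->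
    [/\ measurable S, S `<=` D, vol mu S = Rj j ^+ n &
     forall y, S y -> forall i, Rj j <= `|y ord0 i - p ord0 i| <= 2 * Rj j].
  move=> j; have [jk|kj] := ltnP j k; last by exists set0.
  have [|S [h1 h2 h3 h4]] := inner_box Dp (ltW (Rj0 j)) _ (Rjr j jk).
    by rewrite ler_peMl ?ler1n// ltW.
  exists S => _; split => //; rewrite h3; congr (_ ^+ n); ring.
have bP : bmeas D (pot mu (rk (g + 1)) D f) by exact: (bmeas_pot_rk mD d0 Dd).
have bfP : bmeas D (fun x => f x * pot mu (rk (g + 1)) D f x) by exact: bmeasM.
have P0 x : 0 <= pot mu (rk (g + 1)) D f x.
  by apply: Rintegral_ge0 => y Dy; rewrite mulr_ge0 ?rk_ge0 ?f0.
have fS0 : (mu S0 < +oo)%E by exact: vol_fin S0D.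
have c50 : 0 <= c5 by exact: powR_ge0.
have c70 : 0 <= c7 by rewrite !mulr_ge0 ?powR_ge0.
apply: (@le_trans _ _ (\int[mu]_(x in S0) (f x * pot mu (rk (g + 1)) D f x))); last first.
  by apply: (bintS mD fD) => // x Dx; rewrite mulr_ge0 ?f0.
have -> : k%:R * (c5 * c7) * (W * Z) = (c5 * f p * (k%:R * (c7 * Z))) * vol mu S0.
  by rewrite vS0 subr0 /W; ring.
apply: (cst_le_bint mS0 fS0) => //; first exact: bmeasS bfP.
move=> x Sx; have Dx := S0D _ Sx.
have Nx : N x <= n%:R * rho.
  by apply: enorm_le_coord => [|i]; [exact: ltW|have /andP[_] := HS0 _ Sx i; rewrite !mxE].
have cf0 : 0 <= c5 * f p by apply: mulr_ge0 => //; exact/ltW/peak_gt0.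
have kc0 : 0 <= k%:R * (c7 * Z).
  by apply: mulr_ge0 => //; apply: mulr_ge0 => //; exact: ltW.
apply: (ler_pM cf0 kc0); first by exact: peak_near.
apply: (bint_disjoint_ge (S:=S) mD fD).
- by apply: bmeasM => //; exact: bxp.
- by move=> y Dy; rewrite mulr_ge0 ?rk_ge0 ?f0.
- move=> j jk; have [h1 h2 h3 h4] := HS j jk; split => //.
  apply: (@peak_shell a x (Rj j)) => //.
    by apply: le_trans (Rle 0%N j _) => //; rewrite /Rj expr0 mul1r.
  by apply: le_trans (Rjr _ jk); rewrite ler_peMl ?ler1n// ltW.
- move=> i j y ij jk Si Sj.
  have [_ _ _ /(_ _ Si (Ordinal n0))/andP[_ h1]] := HS i (ltn_trans ij jk).
  have [_ _ _ /(_ _ Sj (Ordinal n0))/andP[h2 _]] := HS j jk.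
  have h3 := Rle _ _ ij.
  have h4 : Rj i.+1 = 3 * Rj i by rewrite /Rj exprS -mulrA.
  have := Rj0 i; rewrite h4 in h3; move: h1 h2 h3; lra.
Qed.

End fixed_peak.
End peak.

Section bil_monotone.
Context {d} {T : measurableType d} {R : realType}.
Variables (mu : {sigma_finite_measure set T -> \bar R}) (D : set T) (K : T -> T -> R).
Hypotheses (mD : measurable D) (fD : (mu D < +oo)%E).
Hypothesis bK : bmeas (D `*` D) (fun z => K z.1 z.2).
Hypothesis K0 : forall x y, D x -> D y -> 0 <= K x y.

Lemma bil_mono f h : bmeas D f -> bmeas D h -> (forall x, D x -> 0 <= f x <= h x) ->
  bil mu K D f f <= bil mu K D h h.
Proof.
move=> bf bh fh.
apply: (le_bint mD fD); [by apply: bmeasM => //; exact: bmeas_pot|by apply: bmeasM => //; exact: bmeas_pot|].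
move=> x Dx; have /andP[f0 fhx] := fh x Dx.
apply: ler_pM => //.
  by apply: Rintegral_ge0 => y Dy; apply: mulr_ge0; [exact: K0|have /andP[] := fh y Dy].
apply: (le_bint mD fD); [by apply: bmeasM => //; exact: bmeas_K_l|by apply: bmeasM => //; exact: bmeas_K_l|].
by move=> y Dy; apply: ler_wpM2l; [exact: K0|have /andP[] := fh y Dy].
Qed.

End bil_monotone.

(** * A Pohozaev-type inequality from dilations *)

Section dilation.
Context {R : realType} {n : nat}.
Variables (D D' : set 'rV[R]_n) (d : R).
Hypotheses (mD : measurable D) (mD' : measurable D') (D'D : D' `<=` D).
Hypothesis d0 : 0 < d.
Hypothesis Dd : forall x y, D x -> D y -> enorm (x - y) <= d.
Let mu := @leb R n.
Let fD : (mu D < +oo)%E := leb_bounded d0 Dd mD.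
Variables (g lam q : R).
Hypotheses (g0 : 0 < g) (q01 : 0 < q < 1) (qcrit : q * (2 * n%:R + g) = 2 * n%:R).
Variables (z : 'rV[R]_n) (t : R).
Hypotheses (t1 : 1 <= t) (ltd : 0 <= 1 + lam * t * d).
Hypothesis DE : dil z t^-1 @^-1` D' = D.

(* Comparing a minimizer with its dilate gives a Pohozaev-type inequality. *)
Lemma dilation_le eps m dl f : 0 <= eps -> minimizer mu D (ker g lam eps) q m dl f ->
  - lam * (t - 1) * bil mu (rk (g + 1)) D f f <=
  2 / q * m * \int[mu]_(x in D `\` D') (f x `^ q).
Proof.
move=> eps0 Hf; have := Hf => -[bf [dl0 fdl] _ I1 [m0 lb]].
have [q0 q1] : 0 < q /\ q < 1 by case/andP: q01.
have t0 : 0 < t by exact: lt_le_trans t1.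
have ti0 : 0 < t^-1 by rewrite invr_gt0.
have f0 x : D x -> 0 <= f x by move=> /fdl; apply: le_trans; exact: ltW.
have f0' x : D' x -> 0 <= f x by move=> /D'D /f0.
have Dd' x y : D' x -> D' y -> enorm (x - y) <= d by move=> /D'D Dx /D'D; exact: Dd.
have fD' : (mu D' < +oo)%E by exact: vol_fin D'D.
have bf' : bmeas D' f by exact: bmeasS bf.
have bfq : bmeas D (fun x => f x `^ q) by apply: bmeas_powR => //; exact: ltW.
have g10 : 0 < g + 1 by rewrite addr_gt0.
pose h x := f (dil z t^-1 x).
have bh : bmeas D h by rewrite -DE; exact: (bmeas_dil mD').
have h0 x : D x -> 0 <= h x by rewrite -DE => /f0'.
set X := \int[mu]_(x in D `\` D') _.
have bfq' : bmeas D' (fun x => f x `^ q) by exact: bmeasS bfq.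
have tn0 : 0 < t ^+ n by exact: exprn_gt0.
have tnV k : ((t^-1) ^+ k)^-1 = t ^+ k by rewrite exprVn invrK.
have hq : \int[mu]_(x in D) (h x `^ q) = t ^+ n * (1 - X).
  rewrite -[in LHS]DE (bint_dil z ti0 mD' fD' bfq'); last by move=> x _; exact: powR_ge0.
  by rewrite tnV -I1 (bint_split mD fD mD' D'D bfq) addrK.
have X0 : 0 <= X by apply: Rintegral_ge0 => x _; exact: powR_ge0.
have X1 : X <= 1.
  rewrite -I1 (bint_split mD fD mD' D'D bfq) lerDr.
  by apply: Rintegral_ge0 => x _; exact: powR_ge0.
have hI : \int[mu]_(x in D) h x = t ^+ n * \int[mu]_(x in D') f x.
  by rewrite -[in LHS]DE (bint_dil z ti0 mD' fD' bf')// tnV.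
have hE p : 0 < p -> bil mu (rk p) D h h = t `^ p * (t ^+ n * t ^+ n) * bil mu (rk p) D' f f.
  move=> p0; rewrite -[in LHS]DE (bil_dil mD' d0 Dd' z ti0 p0 bf')//; congr (_ * _).
  by rewrite !invfM !tnV -[t^-1]powR_inv1 ?(ltW t0)// -powRrM mulN1r powRN invrK mulrA.
have := lb h bh h0; rewrite hq (bil_kerE mD d0 Dd _ _ g0)// !hE// hI.
set E0 := bil _ _ _ _ _; set E1 := bil _ _ _ _ _; set M' := \int[mu]_(x in D') f x.
have M0 : 0 <= M' by exact: Rintegral_ge0.
have tg1 : 1 <= t `^ g by apply: powR_ge1 => //; exact: ltW.
set P := t `^ g * (t ^+ n * t ^+ n).
have P0 : 0 < P by rewrite !mulr_gt0// ?powR_gt0.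
(* At the critical exponent the constraint and the |x - y|^g-energy acquire the same factor [P].
   Dividing by it leaves one extra factor t, on lam. *)
have PE : (t ^+ n) `^ (2 / q) = P.
  rewrite -powR_mulrn ?(ltW t0)// -powRrM.
  have -> : n%:R * (2 / q) = g + (n%:R + n%:R).
    rewrite mulrA [n%:R * 2]mulrC -qcrit; field; rewrite gt_eqF//.
  by rewrite !powRD ?(gt_eqF t0) ?implybT// powR_mulrn ?(ltW t0).
rewrite powRM ?(ltW tn0) ?subr_ge0// PE => H.
have {}H : m * (1 - X) `^ (2 / q) <= bil mu (ker g (lam * t) eps) D' f f.
  rewrite -(ler_pM2l P0) mulrCA; apply: (le_trans H).
  rewrite (bil_kerE mD' d0 Dd' _ _ g0)// -/E0 -/E1 -/M' powRD ?(gt_eqF t0) ?implybT//.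
  rewrite powRr1 ?(ltW t0)//.
  have : eps * (t ^+ n * M' * (t ^+ n * M')) <= P * (eps * (M' * M')).
    rewrite /P -subr_ge0.
    rewrite [X in 0 <= X](_ : _ = (t `^ g - 1) * (eps * ((t ^+ n * M') ^+ 2))); last by ring.
    by rewrite mulr_ge0 ?subr_ge0// mulr_ge0 ?sqr_ge0.
  move: (eps * _) (eps * _) => A A' hA.
  rewrite mulrDr; apply: lerD => //; rewrite le_eqVlt; apply/orP; left; apply/eqP.
  by rewrite /P; ring.
have K0 x y : D x -> D y -> 0 <= ker g (lam * t) eps x y.
  move=> Dx Dy; apply: le_trans (ker_ge Dd (lam * t) eps g0 Dx Dy).
  by rewrite addr_ge0 ?mulr_ge0 ?rk_ge0// le_min ler01.
have bK : bmeas (D `*` D) (fun z => ker g (lam * t) eps z.1 z.2) by exact: (bmeas_ker Dd).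
(* By [ltd] the kernel with lam t is nonnegative on D, so enlarging D' to D increases the energy.
   Compared with J(f) = m, this energy differs by lam (t - 1) times the |x - y|^(g + 1)-energy. *)
have {}H : m * (1 - X) `^ (2 / q) <= bil mu (ker g (lam * t) eps) D f f.
  apply: (le_trans H); rewrite -(bil_restrict mu D'D).
  apply: (bil_mono mD fD bK K0) => //; first exact: bmeas_restrict.
  move=> x Dx; rewrite patchE; case: ifPn => [/set_mem D'x|_]; first by rewrite f0'/=.
  by rewrite lexx f0.
have := minimizer_bil mD d0 Dd q01 Hf; move: H.
rewrite !(bil_kerE mD d0 Dd _ _ g0)//; set F1 := bil _ (rk (g + 1)) _ _ _.
move: (bil _ _ _ _ _) (eps * _) => F0 Me H mE.
have B : 1 - 2 / q * X <= (1 - X) `^ (2 / q).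
  by apply: bernoulli_powR => //; rewrite ltr_pdivlMr// mul1r (lt_trans q1)// ltr1n.
have : m * (1 - 2 / q * X) <= m * (1 - X) `^ (2 / q) by rewrite ler_pM2l.
move/le_trans => /(_ _ H); move: mE (2 / q) => mE w.
rewrite -subr_ge0 => ge0; rewrite -subr_ge0; apply: (le_trans ge0).
rewrite -[leLHS]addr0 -[X in _ + X](subrr m) -{3}mE le_eqVlt; apply/orP; left; apply/eqP.
by ring.
Qed.

End dilation.

Section spread_of_bounded.
Context {d} {T : measurableType d} {R : realType}.
Variables (mu : {measure set T -> \bar R}) (D : set T).
Hypotheses (mD : measurable D) (fD : (mu D < +oo)%E).

Lemma spread_of_bounded q L t f : 0 < q -> 0 < L -> 0 < t ->
  bmeas D f -> (forall x, D x -> 0 <= f x <= L) ->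
  \int[mu]_(x in D) (f x `^ q) = 1 -> t `^ q * vol mu D <= 2^-1 ->
  (2 * L `^ q)^-1 <= vol mu (D `&` [set y | t < f y]).
Proof.
move=> q0 L0 t0 bf fL f1 tV; set A := D `&` _.
have mA : measurable A by apply: measurable_superlevel => //; case: bf.
have AD : A `<=` D by move=> x [].
have b1 := @bmeas_indic _ _ R D A mA.
have b2 := bmeasZ (L `^ q) b1.
have b3 := @bmeas_cst _ _ R D (t `^ q).
have Lq : 0 < L `^ q by rewrite powR_gt0.
have f0 x : D x -> 0 <= f x by move=> /fL/andP[].
have bfq := powR_bmeas_ge0 (ltW q0) f0 bf.
have := le_bint mD fD bfq (bmeasD b3 b2).
rewrite f1 (bintD mD fD b3 b2) (bint_cst mu mD) (bintZ mD fD _ b1) (bint_indic1 mu mA AD).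
have H x : D x -> f x `^ q <= t `^ q + L `^ q * \1_A x.
  move=> Dx; rewrite indicE; case: (boolP (x \in A)) => /= [_|nA].
    rewrite mulr1; apply: ler_wpDl; first exact: powR_ge0.
    by apply: ge0_ler_powR; rewrite ?nnegrE ?f0 ?(ltW q0) ?(ltW L0)//; case/andP: (fL _ Dx).
  rewrite mulr0 addr0; apply: ge0_ler_powR; rewrite ?nnegrE ?f0 ?(ltW q0) ?(ltW t0)//.
  by rewrite leNgt; apply/negP => h; move/negP: nA; apply; rewrite inE; split.
move=> /(_ H) h; rewrite invfM ler_pdivrMr// mulrC.
by move: (L `^ q * _) h => z h; lra.
Qed.

End spread_of_bounded.

Section cube_corner.
Context {R : realType} {n : nat}.

(** D' is the cube contracted by 1 / t about the corner [w] nearest to p. A point left uncovered has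
    a coordinate at distance more than 2 r / t >= 3 r / 2 from that of the corner, whereas p stays
    within r of it. *)
Lemma cube_corner (c p : 'rV[R]_n) r t : 0 < r -> cube c r p -> 1 <= t -> t <= 4 / 3 ->
  exists z D', [/\ measurable D', D' `<=` cube c r, dil z t^-1 @^-1` D' = cube c r &
    forall y, (cube c r `\` D') y -> r / 2 <= enorm (y - p)].
Proof.
move=> r0 Dp t1 t43.
have t0 : 0 < t by exact: lt_le_trans t1.
pose w := \row_i (if p ord0 i <= c ord0 i then c ord0 i - r else c ord0 i + r).
have dE (x : 'rV[R]_n) i : dil (w - t *: w) t x ord0 i = w ord0 i + t * (x ord0 i - w ord0 i).
  by rewrite /dil !mxE; ring.
exists (w - t^-1 *: w), (dil (w - t *: w) t @^-1` cube c r); split.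
- by apply: measurable_dil_preimage; exact: measurable_cube.
- move=> x Dx i; have := Dx i; rewrite dE !mxE !in_itv/=.
  case: ifP => _ /andP[]; set s := (X in t * X) => h1 h2.
    have s0 : 0 <= s by rewrite -(pmulr_rge0 _ t0); lra.
    have st : s <= t * s by rewrite ler_peMl.
    by rewrite /s in s0 st h1 h2; apply/andP; split; lra.
  have s0 : s <= 0 by rewrite -(pmulr_rle0 _ t0); lra.
  have st : t * s <= s by rewrite ler_neMl.
  by rewrite /s in s0 st h1 h2; apply/andP; split; lra.
- rewrite -comp_preimage (_ : _ \o _ = id)//; apply/funext => x /=.
  apply/rowP => i; rewrite dE /dil !mxE; set v := (if _ then _ else _).
  by field; rewrite gt_eqF.
- move=> y [Dy nDy]; rewrite leNgt; apply/negP => yp; apply: nDy => i.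
  have := coord_le_enorm (y - p) i => /le_lt_trans /(_ yp); rewrite dE !mxE ltr_norml => /andP[h1 h2].
  have := Dp i; have := Dy i; rewrite !in_itv/= => /andP[h3 h4] /andP[h5 h6].
  case: ifPn => [pc|]; last rewrite -ltNge => pc.
    have s0 : 0 <= y ord0 i - (c ord0 i - r) by lra.
    have : t * (y ord0 i - (c ord0 i - r)) <= 4 / 3 * (y ord0 i - (c ord0 i - r)) by rewrite ler_wpM2r.
    have : 0 <= t * (y ord0 i - (c ord0 i - r)) by rewrite mulr_ge0// ltW.
    by move=> ? ?; apply/andP; split; lra.
  have s0 : y ord0 i - (c ord0 i + r) <= 0 by lra.
  have : 4 / 3 * (y ord0 i - (c ord0 i + r)) <= t * (y ord0 i - (c ord0 i + r)) by rewrite ler_wnM2r.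
  have : t * (y ord0 i - (c ord0 i + r)) <= 0 by rewrite mulr_ge0_le0// ltW.
  by move=> ? ?; apply/andP; split; lra.
Qed.

End cube_corner.

Section critical_cube.
Context {R : realType} {n : nat}.
Variables (c : 'rV[R]_n) (r d : R).
Let D := cube c r.
Hypothesis n0 : (0 < n)%N.
Hypothesis r0 : 0 < r.
Hypothesis d0 : 0 < d.
Hypothesis Dd : forall x y, D x -> D y -> enorm (x - y) <= d.
Let mu := @leb R n.
Let mD : measurable D := measurable_cube c r.
Let fD : (mu D < +oo)%E := leb_bounded d0 Dd mD.
Variables (g lam q : R).
Hypotheses (g0 : 0 < g) (lam0 : lam < 0) (ld : 0 < 1 + lam * d) (q01 : 0 < q < 1).
Hypothesis qcrit : q * (2 * n%:R + g) = 2 * n%:R.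
Let q0 : 0 < q. Proof. by case/andP: q01. Qed.
Let q1 : q < 1. Proof. by case/andP: q01. Qed.
Let Dc : D c.
Proof. by move=> i; rewrite in_itv/= lerBlDr lerDl ltW//= lerDl ltW. Qed.
Let nR0 : 0 < n%:R :> R. Proof. by rewrite ltr0n. Qed.
Let V0 : 0 < vol mu D.
Proof. by rewrite /D vol_cube ?(ltW r0)// exprn_gt0// mulr_gt0. Qed.

(** The supremum of f need not be attained, whence the factor 2 in [peak]; rho is then solved from
    its defining equation. *)
Lemma peak_exists eps m dl f : 0 < eps <= 1 -> minimizer mu D (ker g lam eps) q m dl f ->
  exists p rho, peak c r g lam q eps m dl f p rho.
Proof.
move=> e01 Hf; have [[mf [C fC]] [dl0 fdl] fE _ [m0 _]] := Hf.
have hs : has_sup (f @` D).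
  split; first by exists (f c), c.
  by exists C => _ [x Dx <-]; apply: le_trans (ler_norm _) (fC _ Dx).
have S0 : 0 < sup (f @` D).
  apply: lt_le_trans dl0 _; apply: le_trans (fdl _ Dc) _.
  by apply: ub_le_sup; [case: hs|exists c].
have S2 : 0 < sup (f @` D) / 2 by rewrite divr_gt0.
have [_ [p Dp <-] hp] := sup_adherent S2 hs.
have fp2 x : D x -> f x <= 2 * f p.
  move=> Dx; have : f x <= sup (f @` D) by apply: ub_le_sup; [case: hs|exists x].
  by move: hp; lra.
have fp : 0 < f p by exact: lt_le_trans (fdl _ Dp).
have ng : 0 < n%:R + g by rewrite addr_gt0.
pose A := pot mu (ker g lam eps) D f p / f p.
have A0 : 0 < A by rewrite divr_gt0// fE// mulr_gt0// powR_gt0.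
have rho0 : 0 < A `^ (n%:R + g)^-1 by rewrite powR_gt0.
exists p, (A `^ (n%:R + g)^-1); split => //.
rewrite -powR_mulrn ?(ltW rho0)// -mulrA -powRD ?(gt_eqF rho0) ?implybT//.
rewrite -powRrM mulVf ?gt_eqF// powRr1 ?(ltW A0)// /A mulrCA mulfV ?mulr1//.
by rewrite gt_eqF.
Qed.

(* If rho is small, k dyadic shells around the peak contribute k times a fixed
   multiple of [Z = W^2 rho^n rho^g] to the energy for the kernel |x - y|^(g + 1)
   (with [W = f p * rho^n]), whereas the dilation about the corner of the cube
   nearest to p bounds that energy by a fixed multiple of Z. *)
Lemma peak_scale_ge : exists2 rho0, 0 < rho0 & forall eps m dl f p rho,
  peak c r g lam q eps m dl f p rho -> rho0 <= rho.
Proof.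
pose kap := 1 + lam * d.
have [a1 a10 Ha1] : exists2 a1, 0 < a1 & forall eps m dl f p rho,
    peak c r g lam q eps m dl f p rho -> \int[mu]_(y in D) f y <= a1 * (f p * rho ^+ n).
  exists (2 * 2 ^+ n + kap^-1).
    by apply: addr_gt0; rewrite ?invr_gt0// mulr_gt0// exprn_gt0.
  by move=> eps m dl f p rho; exact: peak_mass_le.
have B0 : 0 < 2 `^ g / kap by rewrite divr_gt0// powR_gt0.
have [a2 a20 Ha2] : exists2 a2, 0 < a2 & forall eps m dl f p rho,
    peak c r g lam q eps m dl f p rho -> rho <= r ->
    a2 * (f p * rho ^+ n) <= \int[mu]_(y in D) f y.
  exists ((2 `^ g / kap * (n%:R `^ g + 1)) `^ (- (1 - q)^-1)).
    by apply: powR_gt0; apply: mulr_gt0 => //; apply: ltr_wpDl => //; exact: powR_ge0.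
  by move=> eps m dl f p rho; exact: peak_mass_ge.
have [b b0 bE] : exists2 b, 0 < b & b `^ g * (kap * a2) = 2.
  have ka : 0 < kap * a2 by exact: mulr_gt0.
  exists ((2 / (kap * a2)) `^ g^-1); first by rewrite powR_gt0// divr_gt0.
  rewrite -powRrM mulVf ?gt_eqF// powRr1 ?divfK ?gt_eqF//.
  by rewrite ltW// divr_gt0.
have [c8 c80 Hc8] : exists2 c8, 0 < c8 & forall eps m dl f p rho,
    peak c r g lam q eps m dl f p rho -> rho <= r ->
    forall x, 2 * (b * rho) <= enorm (x - p) -> D x -> r / 2 <= enorm (x - p) ->
    f x `^ q <= c8 * (f p `^ q * (rho ^+ n) ^+ 2).
  exists ((kap * (r / 4) `^ g * (a2 / 2)) `^ (- ((1 - q)^-1 * q))).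
    apply: powR_gt0; apply: mulr_gt0; last by rewrite divr_gt0.
    by apply: mulr_gt0 => //; rewrite powR_gt0// divr_gt0.
  move=> eps m dl f p rho Hp rr x h1 Dx h2; rewrite mulrA.
  by apply: (peak_far r0 d0 Dd g0 lam0 ld q01 qcrit Hp a20 b0 (Ha2 _ _ _ _ _ _ Hp rr) bE).
have [C1 C10 HC1] : exists2 C1, 0 < C1 & forall k eps m dl f p rho,
    peak c r g lam q eps m dl f p rho -> rho <= r ->
    3 ^+ k * (2 * (2 * n%:R * rho)) <= r ->
    k%:R * C1 * ((f p * rho ^+ n) * (f p * rho ^+ n * rho ^+ n * rho `^ g)) <=
    bil mu (rk (g + 1)) D f f.
  exists ((2 `^ g / kap * (n%:R `^ g * a1 + 1)) `^ (- (1 - q)^-1) *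
    (2 `^ (- (g + 1)) * (2 `^ g / kap * ((2 * n%:R) `^ g * a1 + 1)) `^ (- (1 - q)^-1) *
     r `^ (1 - n%:R))).
    have pos x : 0 <= x -> 0 < (2 `^ g / kap * (x * a1 + 1)) `^ (- (1 - q)^-1).
      move=> x0; apply: powR_gt0; apply: mulr_gt0 => //.
      by apply: ltr_wpDl => //; rewrite mulr_ge0// ltW.
    apply: mulr_gt0; first by apply: pos; exact: powR_ge0.
    apply: mulr_gt0; last exact: powR_gt0.
    apply: mulr_gt0; first exact: powR_gt0.
    by apply: pos; exact: powR_ge0.
  move=> k eps m dl f p rho Hp rr kr.
  by apply: (peak_E1_ge n0 d0 Dd g0 lam0 ld q01 qcrit Hp (ltW a10) (Ha1 _ _ _ _ _ _ Hp)).
(* The bound 1 / 3 is for [cube_corner]; the bound kap gives 1 + lam t d >= kap + kap lam d = kap^2,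
   so that the kernel with lam t stays nonnegative. *)
pose t := 1 + Num.min 3^-1 kap.
have mk0 : 0 < Num.min 3^-1 kap by rewrite lt_min invr_gt0 ltr0n.
have t1 : 1 <= t by rewrite lerDl ltW.
have t43 : t <= 4 / 3.
  have : Num.min 3^-1 kap <= 3^-1 by rewrite ge_min lexx.
  by rewrite /t; lra.
have ltd : 0 <= 1 + lam * t * d.
  have h : Num.min 3^-1 kap <= kap by rewrite ge_min lexx orbT.
  have l0 : lam * d < 0 by rewrite pmulr_llt0.
  have : kap * (lam * d) <= Num.min 3^-1 kap * (lam * d) by rewrite ler_wnM2r// ltW.
  rewrite /t mulrAC mulrDr mulr1 [lam * d * _]mulrC; move: (Num.min _ _ * _) => z.
  have : 0 <= 1 + lam * d + kap * (lam * d).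
    rewrite -/kap -{1}[kap]mulr1 -mulrDr mulr_ge0//; first exact: ltW.
    exact: ltW.
  by lra.
pose Q := 2 / q * c8 * vol mu D / (- lam * (t - 1) * C1).
have lt0 : 0 < - lam * (t - 1).
  by apply: mulr_gt0; [rewrite oppr_gt0|rewrite /t addrAC subrr add0r].
have Q0 : 0 <= Q.
  apply: divr_ge0; last by apply: mulr_ge0; exact: ltW.
  apply: mulr_ge0; last exact: ltW.
  by apply: mulr_ge0; [rewrite divr_ge0// ltW|exact: ltW].
have [k kQ] : exists k : nat, Q < k%:R by exists (Num.truncn Q).+1; exact: truncnS_gt.
have k3 : 0 < 3 ^+ k :> R by rewrite exprn_gt0.
(* Below r the mass bound from below applies; below r / (4 b) the uncovered points, at distance at
   least r / 2, are in the range of [peak_far]; below the last value k shells fit into the cube. *)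
exists (Num.min r (Num.min (r / (4 * b)) (r / (3 ^+ k * (4 * n%:R))))).
  by rewrite !lt_min r0 !divr_gt0// mulr_gt0// mulr_gt0.
move=> eps m dl f p rho Hp; rewrite leNgt; apply/negP; rewrite !lt_min.
move=> /and3P[/ltW rr rb rk3].
have [e01 Hf [Dp _] rho0 upE] := Hp; have [ep0 _] := andP e01.
have [bf [dl0 fdl] fE f1 [m0 _]] := Hf.
have fp : 0 < f p by exact: lt_le_trans (fdl _ Dp).
set W := f p * rho ^+ n.
have W0 : 0 < W by rewrite mulr_gt0// exprn_gt0.
pose Z := W * (W * rho ^+ n * rho `^ g).
have Z0 : 0 < Z by apply: mulr_gt0 => //; rewrite !mulr_gt0 ?exprn_gt0 ?powR_gt0.
have [z [D' [mD' D'D D'E far]]] := cube_corner r0 Dp t1 t43.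
have H1 := dilation_le mD mD' D'D d0 Dd g0 q01 qcrit t1 ltd D'E (ltW ep0) Hf.
have H2 : k%:R * C1 * Z <= bil mu (rk (g + 1)) D f f.
  apply: (HC1 _ _ _ _ _ _ _ Hp rr); move: rk3; rewrite ltr_pdivlMr ?mulr_gt0// => /ltW.
  have -> : rho * (3 ^+ k * (4 * n%:R)) = 3 ^+ k * (2 * (2 * n%:R * rho)).
    by move: (3 ^+ k) => z3; ring.
  by [].
have mE : m = W * rho `^ g * f p `^ (1 - q).
  rewrite /W -upE fE// -mulrA -powRD ?(gt_eqF fp) ?implybT//.
  by rewrite addrC addrA subrK subrr powRr0 mulr1.
have DD' : D `\` D' `<=` D by exact: subDsetl.
have mDD : measurable (D `\` D') by exact: measurableD.
have fDD : (mu (D `\` D') < +oo)%E by exact: (vol_fin mD fD).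
have f0 x : D x -> 0 <= f x by move=> /fdl; apply: le_trans; exact: ltW.
have bfq := powR_bmeas_ge0 (ltW q0) f0 bf.
have F0 : 0 <= c8 * (f p `^ q * (rho ^+ n) ^+ 2).
  by apply: mulr_ge0; [exact: ltW|apply: mulr_ge0; [exact: powR_ge0|exact: sqr_ge0]].
have H3 : \int[mu]_(x in D `\` D') (f x `^ q) <= c8 * (f p `^ q * (rho ^+ n) ^+ 2) * vol mu D.
  apply: (@le_trans _ _ (c8 * (f p `^ q * (rho ^+ n) ^+ 2) * vol mu (D `\` D'))).
    apply: (bint_le_cst mDD fDD); first exact: bmeasS bfq.
    move=> x DDx; have h := far x DDx; apply: (Hc8 _ _ _ _ _ _ Hp rr x _ (DD' _ DDx) h).
    apply: le_trans h; move: rb; rewrite ltr_pdivlMr ?mulr_gt0// => /ltW.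
    have -> : rho * (4 * b) = 4 * (b * rho) by ring.
    by move: (b * rho) => w; lra.
  by apply: ler_wpM2l => //; exact: (vol_le mD fD).
(* m contributes W rho^g (f p)^(1 - q) and [peak_far] contributes (f p)^q rho^(2n); the product is
   exactly [Z]. *)
have H4 : m * \int[mu]_(x in D `\` D') (f x `^ q) <= c8 * vol mu D * Z.
  apply: (@le_trans _ _ (m * (c8 * (f p `^ q * (rho ^+ n) ^+ 2) * vol mu D))).
    by apply: ler_wpM2l => //; exact: ltW.
  have fpE : f p = f p `^ (1 - q) * f p `^ q.
    by rewrite -powRD ?(gt_eqF fp) ?implybT// subrK powRr1// ltW.
  rewrite mE le_eqVlt /Z; apply/orP; left; apply/eqP.
  have -> : W * rho ^+ n = f p `^ (1 - q) * f p `^ q * (rho ^+ n) ^+ 2.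
    by rewrite -fpE /W expr2 mulrA.
  by ring.
have : - lam * (t - 1) * (k%:R * C1 * Z) <= 2 / q * (c8 * vol mu D * Z).
  apply: (@le_trans _ _ (- lam * (t - 1) * bil mu (rk (g + 1)) D f f)).
    by rewrite ler_pM2l.
  apply: (le_trans H1); rewrite -mulrA ler_pM2l//.
  by rewrite divr_gt0.
have -> : - lam * (t - 1) * (k%:R * C1 * Z) = k%:R * (- lam * (t - 1) * C1) * Z by ring.
have -> : 2 / q * (c8 * vol mu D * Z) = 2 / q * c8 * vol mu D * Z by ring.
have lC0 : 0 < - lam * (t - 1) * C1 by exact: mulr_gt0.
rewrite ler_pM2r// -ler_pdivlMr// => /le_lt_trans /(_ kQ).
by rewrite ltxx.
Qed.

(** The equation at the peak reads m = (f p)^(2 - q) rho^(n + g). With m bounded above and rho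
    bounded below, f is uniformly bounded, and a bounded normalised function cannot live on a small
    set. *)
Lemma critical_cube_spread : exists t eta, [/\ 0 < t, 0 < eta &
  forall eps m dl f, 0 < eps <= 1 -> minimizer mu D (ker g lam eps) q m dl f ->
     eta <= vol mu (D `&` [set y | t < f y])].
Proof.
have [rho0 rho00 Hrho] := peak_scale_ge.
have [mb mb0 Hmb] := minimizer_m_bounded mD d0 Dd V0 lam g0 q01.
pose A := mb / (rho0 ^+ n * rho0 `^ g).
have rg0 : 0 < rho0 ^+ n * rho0 `^ g by rewrite mulr_gt0 ?exprn_gt0 ?powR_gt0.
have A0 : 0 < A by rewrite divr_gt0.
have q2 : 0 < 2 - q by rewrite subr_gt0 (lt_trans q1)// ltr1n.
pose L := 2 * A `^ (2 - q)^-1.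
have L0 : 0 < L by rewrite mulr_gt0// powR_gt0.
have [t t0 tq] : exists2 t, 0 < t & t `^ q * vol mu D = 2^-1.
  exists ((2 * vol mu D)^-1 `^ q^-1); first by rewrite powR_gt0// invr_gt0 mulr_gt0.
  rewrite -powRrM mulVf ?gt_eqF// powRr1; last by rewrite invr_ge0 mulr_ge0// ltW.
  by field; rewrite gt_eqF.
exists t, (2 * L `^ q)^-1; split => //; first by rewrite invr_gt0 mulr_gt0// powR_gt0.
move=> eps m dl f e01 Hf; have [p [rho Hp]] := peak_exists e01 Hf.
have [bf [dl0 fdl] fE f1 [m0 _]] := Hf.
have [_ _ [Dp f2] rho1 upE] := Hp.
have fp : 0 < f p by exact: lt_le_trans (fdl _ Dp).
have f0 x : D x -> 0 <= f x by move=> /fdl; apply: le_trans; exact: ltW.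
apply: (spread_of_bounded mD fD q0 L0 t0 bf) => //; last by rewrite tq.
move=> x Dx; rewrite f0//=; apply: (le_trans (f2 _ Dx)); rewrite ler_pM2l//.
have mE : m = f p `^ (2 - q) * (rho ^+ n * rho `^ g).
  have -> : 2 - q = 1 + (1 - q) by ring.
  rewrite powRD ?(gt_eqF fp) ?implybT// powRr1 ?(ltW fp)// mulrAC mulrA -upE fE//.
  rewrite -mulrA -powRD ?(gt_eqF fp) ?implybT//.
  by rewrite addrC addrA subrK subrr powRr0 mulr1.
have H : f p `^ (2 - q) <= A.
  rewrite ler_pdivlMr//; apply: le_trans (Hmb _ _ _ _ e01 Hf); rewrite mE.
  apply: ler_wpM2l; first exact: powR_ge0.
  have rr := Hrho _ _ _ _ _ _ Hp.
  apply: ler_pM; rewrite ?exprn_ge0 ?powR_ge0 ?(ltW rho00)//.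
    by apply: lerXn2r; rewrite ?nnegrE ?(ltW rho00) ?(ltW rho1).
  by apply: ge0_ler_powR; rewrite ?nnegrE ?(ltW rho00) ?(ltW rho1) ?(ltW g0).
have -> : f p = (f p `^ (2 - q)) `^ (2 - q)^-1.
  by rewrite -powRrM mulfV ?gt_eqF// powRr1// ltW.
by apply: ge0_ler_powR; rewrite ?nnegrE ?powR_ge0 ?(ltW A0)// invr_ge0 ltW.
Qed.

End critical_cube.

(** * Strict inequality and absence of concentration *)

Section infimum.
Context {d} {T : measurableType d} {R : realType}.
Variables (mu : {sigma_finite_measure set T -> \bar R}) (D : set T).
Hypotheses (mD : measurable D) (fD : (mu D < +oo)%E) (V0 : 0 < vol mu D).
Variables (K : T -> T -> R) (q : R).
Hypothesis bK : bmeas (D `*` D) (fun z => K z.1 z.2).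
Hypothesis K0 : forall x y, D x -> D y -> 0 <= K x y.
Hypothesis q01 : 0 < q < 1.

(** Meant for the kernel |x - y|^g without eps: its infimum serves as the sharp constant through
    near-minimizers, whether or not it is attained. *)
Lemma energy_infimum : exists m, [/\ 0 <= m, energy_lb mu D K q m &
  forall e, 0 < e -> exists h, [/\ bmeas D h, forall x, D x -> 0 <= h x,
    \int[mu]_(x in D) (h x `^ q) = 1 & bil mu K D h h < m + e]].
Proof.
have q0 : 0 < q by case/andP: q01.
pose S := [set r | exists f, [/\ bmeas D f, forall x, D x -> 0 <= f x,
  \int[mu]_(x in D) (f x `^ q) = 1 & r = bil mu K D f f]].
have Slb : lbound S 0 by move=> _ [f [_ f0 _ ->]]; exact: bil_ge0.
have Sne : S !=set0.
  pose c := vol mu D `^ (- q^-1).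
  exists (bil mu K D (fun=> c) (fun=> c)); exists (fun=> c); split=> //.
  - exact: bmeas_cst.
  - by move=> x _; exact: powR_ge0.
  - rewrite bint_cst// /c -powRrM mulNr mulVf ?gt_eqF// powRN powRr1 ?(ltW V0)//.
    by rewrite mulVf// gt_eqF.
have hS : has_inf S by split => //; exists 0.
exists (inf S); split; first exact: lb_le_inf.
  by apply: energy_lbP => // g bg g0 g1; apply: ge_inf; [exists 0|exists g].
by move=> e e0; have [_ [h [bh h0 h1 ->]] hE] := inf_adherent e0 hS; exists h.
Qed.

End infimum.

Lemma strict_sum {R : realType} (F H a b v w m s : R) : 0 < s -> F + a + w <= H + b + v ->
  0 <= w -> b <= 0 -> a <= - (4 * s) -> H < m + s -> v <= s -> F + (a + a) <= m - s.
Proof. lra. Qed.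

Lemma cube_dist {R : realType} {n : nat} (c x y : 'rV[R]_n) r : 0 <= r ->
  cube c r x -> cube c r y -> enorm (x - y) <= n%:R * (2 * r).
Proof.
move=> r0 Cx Cy; apply: enorm_le_coord => [|i]; first by rewrite mulr_ge0.
have := Cx i; have := Cy i; rewrite !in_itv/= !mxE ler_norml => /andP[? ?] /andP[? ?].
by apply/andP; split; lra.
Qed.

Lemma enorm_cube {R : realType} {n : nat} (c x : 'rV[R]_n) r :
  enorm (x - c) <= r -> cube c r x.
Proof.
move=> xc i; have := coord_le_enorm (x - c) i => /le_trans /(_ xc).
by rewrite !mxE ler_norml in_itv/= => /andP[? ?]; apply/andP; split; lra.
Qed.

Lemma not_cube {R : realType} {n : nat} (c x : 'rV[R]_n) r :
  ~ cube c r x -> r <= enorm (x - c).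
Proof.
move=> nC; rewrite leNgt; apply/negP => xc; apply: nC => i.
have := coord_le_enorm (x - c) i => /le_lt_trans /(_ xc).
by rewrite !mxE in_itv/= ltr_norml => /andP[? ?]; apply/andP; split; lra.
Qed.

(** * Scale invariance and strict inequality for the sharp constant *)

Section scale_invariance.
Context {R : realType} {n : nat}.
Variables (c : 'rV[R]_n) (r d : R).
Let D := cube c r.
Hypothesis n0 : (0 < n)%N.
Hypothesis r0 : 0 < r.
Hypothesis d0 : 0 < d.
Hypothesis Dd : forall x y, D x -> D y -> enorm (x - y) <= d.
Let mu := @leb R n.
Let mD : measurable D := measurable_cube c r.
Let fD : (mu D < +oo)%E := leb_bounded d0 Dd mD.
Variables (g q : R).
Hypotheses (g0 : 0 < g) (q01 : 0 < q < 1).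
Hypothesis qcrit : q * (2 * n%:R + g) = 2 * n%:R.
Let q0 : 0 < q. Proof. by case/andP: q01. Qed.

(** E sits in a cube, which a dilation carries to the reference cube; at the critical exponent both
    sides acquire the same power of e / r. So the constant of one cube holds for every bounded
    measurable set. *)
Lemma energy_lb_scale m (E : set 'rV[R]_n) e f : energy_lb mu D (rk g) q m ->
  measurable E -> 0 < e -> (forall x y, E x -> E y -> enorm (x - y) <= e) ->
  bmeas E f -> (forall x, E x -> 0 <= f x) ->
  m * (\int[mu]_(x in E) (f x `^ q)) `^ (2 / q) <= bil mu (rk g) E f f.
Proof.
move=> lb mE e0 Ee bf f0.
have [[x0 Ex0]|E0] := pselect (E !=set0); last first.
  have -> : E = set0 by apply/seteqP; split => // x Ex; case: E0; exists x.
  rewrite Rintegral_set0 powR0 ?mulr0; last by rewrite mulf_neq0 ?invr_eq0 ?gt_eqF.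
  by rewrite /bil Rintegral_set0.
pose z := x0 - (e / r) *: c.
have t0 : 0 < e / r by rewrite divr_gt0.
have EC : E `<=` cube x0 e.
  by move=> x Ex; apply: enorm_cube; exact: Ee.
have DE : dil z (e / r) @^-1` cube x0 e = D.
  apply/seteqP; split => x Hx i; have := Hx i; rewrite /z /dil /= !mxE !in_itv/=.
    have -> : x0 ord0 i - e / r * c ord0 i + e / r * x ord0 i =
       x0 ord0 i + e / r * (x ord0 i - c ord0 i) by ring.
    move=> /andP[h1 h2].
    have h3 : e / r * - r <= e / r * (x ord0 i - c ord0 i).
      by rewrite mulrN divfK ?gt_eqF//; lra.
    have h4 : e / r * (x ord0 i - c ord0 i) <= e / r * r.
      by rewrite divfK ?gt_eqF//; lra.
    rewrite ler_pM2l// in h3; rewrite ler_pM2l// in h4.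
    by apply/andP; split; lra.
  have -> : x0 ord0 i - e / r * c ord0 i + e / r * x ord0 i =
     x0 ord0 i + e / r * (x ord0 i - c ord0 i) by ring.
  move=> /andP[h1 h2].
  have h3 : e / r * (- r) <= e / r * (x ord0 i - c ord0 i) by rewrite ler_pM2l//; lra.
  have h4 : e / r * (x ord0 i - c ord0 i) <= e / r * r by rewrite ler_pM2l//; lra.
  rewrite mulrN divfK ?gt_eqF// in h3; rewrite divfK ?gt_eqF// in h4.
  by apply/andP; split; lra.
set C := cube x0 e in EC DE.
have mC : measurable C by exact: measurable_cube.
have Cd x y : C x -> C y -> enorm (x - y) <= n%:R * (2 * e).
  exact: cube_dist (ltW e0).
have Cd0 : 0 < n%:R * (2 * e) by rewrite !mulr_gt0// ltr0n.
have fC : (mu C < +oo)%E by exact: (leb_bounded Cd0 Cd mC).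
set F := f \_ E.
have bF : bmeas C F by exact: bmeas_restrict.
have F0 x : C x -> 0 <= F x by exact: restrict_ge0.
have Fq := powR_bmeas_ge0 (ltW q0) F0 bF.
have := lb (fun x => F (dil z (e / r) x)).
rewrite -{1}DE => /(_ (bmeas_dil mC _ _ bF)).
have h0 x : D x -> 0 <= F (dil z (e / r) x) by rewrite -DE => /F0.
move=> /(_ h0); rewrite -DE (bint_dil z t0 mC fC Fq); last by move=> x _; exact: powR_ge0.
rewrite (bil_dil mC Cd0 Cd z t0 g0 bF F0) bil_restrict// bint_restrict_powR ?gt_eqF//.
have I0 : 0 <= \int[mu]_(x in E) (f x `^ q) by apply: Rintegral_ge0 => x _; exact: powR_ge0.
rewrite powRM ?invr_ge0 ?exprn_ge0 ?(ltW t0)//.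
have -> : ((e / r) ^- n) `^ (2 / q) = ((e / r) `^ g * (e / r) ^+ n * (e / r) ^+ n)^-1.
  rewrite -(powR_mulrn _ (ltW t0)) -powRN -powRrM mulNr powRN; congr (_^-1).
  have -> : n%:R * (2 / q) = g + n%:R + n%:R.
    by rewrite mulrA [n%:R * 2]mulrC -qcrit; field; rewrite gt_eqF.
  by rewrite !powRD ?(gt_eqF t0) ?implybT.
rewrite mulrCA ler_pM2l// invr_gt0 !mulr_gt0 ?exprn_gt0 ?powR_gt0//.
Qed.

(* The term lam |x - y|^(g + 1) lowers the sharp constant because the minimizers
   for lam / 2 do not concentrate. *)
Lemma energy_strict m lam : lam < 0 -> 0 < 1 + lam * d -> energy_lb mu D (rk g) q m ->
  (forall e, 0 < e -> exists h, [/\ bmeas D h, forall x, D x -> 0 <= h x,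
    \int[mu]_(x in D) (h x `^ q) = 1 & bil mu (rk g) D h h < m + e]) ->
  exists s h, [/\ 0 < s, bmeas D h, forall x, D x -> 0 <= h x,
    \int[mu]_(x in D) (h x `^ q) = 1 & bil mu (ker g lam 0) D h h <= m - s].
Proof.
move=> lam0 ld lb near.
have V0 : 0 < vol mu D by rewrite /D vol_cube ?(ltW r0)// exprn_gt0// mulr_gt0.
have g10 : 0 < g + 1 by rewrite addr_gt0.
have lam2 : lam / 2 < 0 by rewrite pmulr_llt0// invr_gt0.
have ld2 : 0 < 1 + lam / 2 * d.
  have : lam * d < 0 by rewrite pmulr_llt0.
  by move: ld; rewrite mulrAC; lra.
have [t [eta [t0 eta0 spread]]] :=
  critical_cube_spread n0 r0 d0 Dd g0 lam2 ld2 q01 qcrit.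
(* Spreading for lam / 2: the superlevel set of measure at least eta carries a fixed amount of |x -
   y|^(g + 1)-energy, uniformly in eps. *)
have [e1 e10 HE1] : exists2 e1, 0 < e1 & forall eps m dl f, 0 < eps <= 1 ->
    minimizer mu D (ker g (lam / 2) eps) q m dl f -> e1 <= bil mu (rk (g + 1)) D f f.
  have [rr rr0 [rE rh]] := radius_of_volume n0 eta0.
  exists (t ^+ 2 * (rr `^ (g + 1) * (eta - (2 * rr) ^+ n)) * eta).
    rewrite !mulr_gt0 ?exprn_gt0 ?powR_gt0// rE subr_gt0.
    by rewrite ltr_pdivrMr// ltr_pMr// ltr1n.
  move=> eps m' dl f e01 Hf; have := spread _ _ _ _ e01 Hf; set A := D `&` _ => etaA.
  have [bf [dl0 fdl] fE f1 _] := Hf.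
  have f0 x : D x -> 0 <= f x by move=> /fdl; apply: le_trans; exact: ltW.
  have mA : measurable A by apply: measurable_superlevel => //; case: bf.
  have AD : A `<=` D by move=> x [].
  have tf x : A x -> t <= f x by move=> [_ /ltW].
  apply: le_trans (bil_set_ge mD d0 Dd g10 mA AD bf f0 t0 rr0 tf).
  have h : 0 <= eta - (2 * rr) ^+ n.
    by rewrite rE subr_ge0 ler_pdivrMr// ler_peMr ?ler1n// ltW.
  apply: ler_pM => //; [|exact: ltW|].
    by rewrite mulr_ge0 ?sqr_ge0// mulr_ge0 ?powR_ge0.
  by rewrite ler_pM2l ?exprn_gt0// ler_pM2l ?powR_gt0// lerD2r.
(* The second half of lam gains at least - lam e1 / 2 = 4 s, against a loss of s from the
   near-minimizer [h] and of s from the eps term. *)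
pose s := - lam * e1 / 8.
have s0 : 0 < s by rewrite divr_gt0// mulr_gt0// oppr_gt0.
have [h [bh h0 h1 hm]] := near s s0.
pose M := \int[mu]_(x in D) h x.
have [eps [eps0 eps1 epsM]] : exists eps, [/\ 0 < eps, eps <= 1 & eps * (M * M) <= s].
  have M2 : 0 <= M * M by rewrite -expr2 sqr_ge0.
  have sM : 0 < s + M * M by exact: ltr_wpDr.
  exists (Num.min 1 (s / (s + M * M))); split.
  - by rewrite lt_min ltr01 divr_gt0.
  - by rewrite ge_min lexx.
  - apply: (@le_trans _ _ (s / (s + M * M) * (M * M))).
      by apply: ler_wpM2r => //; rewrite ge_min lexx orbT.
    by rewrite mulrAC ler_pdivrMr// ler_pM2l// lerDr ltW.
have [f [m' [dl Hf]]] := minimizer_ker mD d0 Dd g0 V0 q01 eps0 ld2.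
have e01 : 0 < eps <= 1 by rewrite eps0.
have E1 := HE1 _ _ _ _ e01 Hf.
have [bf [dl0 fdl] fE f1 _] := Hf.
have f0 x : D x -> 0 <= f x by move=> /fdl; apply: le_trans; exact: ltW.
exists s, f; split => //.
have := minimizer_le Hf bh h0 h1; rewrite -(minimizer_bil mD d0 Dd q01 Hf).
rewrite !(bil_kerE mD d0 Dd _ _ g0)// -/M => H.
have M0 : 0 <= eps * ((\int[mu]_(y in D) f y) * \int[mu]_(y in D) f y).
  by rewrite mulr_ge0 ?(ltW eps0)// -expr2 sqr_ge0.
have h1E : lam / 2 * bil mu (rk (g + 1)) D h h <= 0.
  by rewrite mulr_le0_ge0 ?bil_rk_ge0// ltW.
have lE : lam / 2 * bil mu (rk (g + 1)) D f f <= lam / 2 * e1 by rewrite ler_wnM2l// ltW.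
have sE : lam / 2 * e1 = - (4 * s) by rewrite /s; field.
rewrite mul0r addr0.
have -> : lam * bil mu (rk (g + 1)) D f f =
  lam / 2 * bil mu (rk (g + 1)) D f f + lam / 2 * bil mu (rk (g + 1)) D f f.
  by rewrite -mulrDl -splitr.
rewrite sE in lE; rewrite -/M in epsM; move: H M0 h1E lE hm epsM.
exact: (strict_sum s0).
Qed.

End scale_invariance.

Lemma powR_small {R : realType} (A a B : R) : 0 < A -> 0 < a -> 0 < B ->
  exists2 x0, 0 < x0 & forall x, 0 < x <= x0 -> A * x `^ a <= B.
Proof.
move=> A0 a0 B0; have BA : 0 < B / A by rewrite divr_gt0.
exists ((B / A) `^ a^-1); first exact: powR_gt0.
move=> x /andP[x0 xle]; rewrite mulrC -ler_pdivlMr//.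
have -> : B / A = ((B / A) `^ a^-1) `^ a by rewrite -powRrM mulVf ?gt_eqF// powRr1// ltW.
by apply: ge0_ler_powR; rewrite ?nnegrE ?powR_ge0 ?(ltW a0) ?(ltW x0).
Qed.

Lemma floor_arith1 {R : realType} (m a w v s S : R) : m <= a + w -> a <= S - s ->
  w <= v -> v <= s / 2 -> m <= S - s / 2.
Proof. lra. Qed.

Lemma floor_arith2 {R : realType} (m S a b s : R) : 0 <= S -> 0 <= a -> 0 <= b -> 0 < s ->
  (1 - a) * (S * (1 - b)) <= m -> (S + 1) * a <= s / 8 -> (S + 1) * b <= s / 8 ->
  m <= S - s / 2 -> False.
Proof.
move=> S0 a0 b0 s0; have := mulr_ge0 S0 (mulr_ge0 a0 b0).
have -> : (1 - a) * (S * (1 - b)) = S - S * a - S * b + S * (a * b) by ring.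
rewrite !mulrDl !mul1r; move: (S * (a * b)) (S * a) (S * b) => x y z.
by move: s0 a0 b0; lra.
Qed.

(** * Excluding concentration on a general domain *)

Section no_concentration.
Context {R : realType} {n : nat}.
Variables (D : set 'rV[R]_n) (d : R).
Hypothesis n0 : (0 < n)%N.
Hypothesis mD : measurable D.
Hypothesis d0 : 0 < d.
Hypothesis Dd : forall x y, D x -> D y -> enorm (x - y) <= d.
Let mu := @leb R n.
Let fD : (mu D < +oo)%E := leb_bounded d0 Dd mD.
Hypothesis V0 : 0 < vol mu D.
Variables (g lam q : R).
Hypotheses (g0 : 0 < g) (lam0 : lam < 0) (ld : 0 < 1 + lam * d) (q01 : 0 < q < 1).
Let kap := 1 + lam * d.
Let s := (1 - q)^-1.
Let q0 : 0 < q. Proof. by case/andP: q01. Qed.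
Let q1 : q < 1. Proof. by case/andP: q01. Qed.
Let s0 : 0 < s. Proof. by rewrite invr_gt0 subr_gt0. Qed.
(** An upper bound of the kernel on D when lam < 0 and eps <= 1. *)
Let b := d `^ g + 1.
Let b0 : 0 < b. Proof. by apply: ltr_wpDl => //; exact: powR_ge0. Qed.

Let ker_lower eps x y : D x -> D y -> kap * rk g x y + eps <= ker g lam eps x y.
Proof.
move=> Dx Dy; have := ker_ge Dd lam eps g0 Dx Dy.
by rewrite [Num.min _ _]minElt ltNge (_ : 1 + lam * d <= 1)//= gerDl mulr_le0_ge0// ltW.
Qed.

Section fixed.
Variables (eps m dl : R) (f : 'rV[R]_n -> R) (de M0 : R) (x1 : 'rV[R]_n).
Hypotheses (e01 : 0 < eps <= 1) (Hf : minimizer mu D (ker g lam eps) q m dl f).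
Hypotheses (de0 : 0 < de) (Dx1 : D x1) (fx1 : f x1 < de).
Let M := \int[mu]_(y in D) f y.
Hypotheses (M00 : 0 < M0) (M0M : M0 <= M).
Let eps0 : 0 < eps. Proof. by case/andP: e01. Qed.
Let bf : bmeas D f. Proof. by case: Hf. Qed.
Let fgt0 x : D x -> 0 < f x.
Proof. by case: Hf => _ [dl0 fdl] _ _ _ /fdl; exact: lt_le_trans. Qed.
Let f0 x : D x -> 0 <= f x. Proof. by move=> /fgt0/ltW. Qed.
Let m0 : 0 < m. Proof. by case: Hf => _ _ _ _ []. Qed.
Let Mgt0 : 0 < M. Proof. exact: lt_le_trans M0M. Qed.
Let brkf x : D x -> bmeas D (fun y => rk g x y * f y).
Proof. by move=> Dx; apply: bmeasM => //; exact: (bmeas_rk_l mD Dd). Qed.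
Let bkf x : D x -> bmeas D (fun y => ker g lam eps x y * f y).
Proof. by move=> Dx; apply: bmeasM => //; exact: (bmeas_ker_l mD Dd). Qed.

(** A small value of f forces a large potential at that point, hence a mass that is large compared
    with m. *)
Lemma low_value_mass : m * de `^ (q - 1) <= b * M.
Proof.
have [_ _ fE _ _] := Hf.
apply: (@le_trans _ _ (pot mu (ker g lam eps) D f x1)).
  rewrite fE// ler_pM2l//; apply: powR_decr; [by rewrite lerBlDr add0r ltW|exact: fgt0|exact: ltW].
rewrite -(bintZ mD fD)//; apply: (le_bint mD fD); [exact: bkf|exact: bmeasZ|].
move=> y Dy; apply: ler_wpM2r; first exact: f0.
apply: (le_trans (ker_le g eps _ _ (ltW lam0))); apply: lerD; last by case/andP: e01.
by apply: ge0_ler_powR; rewrite ?nnegrE ?enorm_ge0 ?(ltW g0) ?(ltW d0)// Dd.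
Qed.

(** The average of the |x - y|^g-potential with respect to f is at most m / (kap M), and
    [low_value_mass] makes m small against M. At some p the potential is therefore small against M,
    which says that the mass gathers at p. *)
Lemma low_value_point : exists2 p, D p &
  pot mu (rk g) D f p <= 2 * (b / (kap * M0) * de `^ (1 - q)) * M.
Proof.
set A := b / _; apply: contrapT => H.
have A0 : 0 < A by rewrite divr_gt0// mulr_gt0.
have H1 x : D x -> 2 * (A * de `^ (1 - q)) * M <= pot mu (rk g) D f x.
  by move=> Dx; rewrite leNgt; apply/negP => /ltW h; apply: H; exists x.
have bP : bmeas D (pot mu (rk g) D f) by exact: (bmeas_pot_rk mD d0 Dd).
have H2 : 2 * (A * de `^ (1 - q)) * M * M <= bil mu (rk g) D f f.
  rewrite -(bintZ mD fD)//; apply: (le_bint mD fD); [exact: bmeasZ|exact: bmeasM|].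
  by move=> x Dx; rewrite mulrC; apply: ler_wpM2l; [exact: f0|exact: H1].
have := bil_ker_ge mD d0 Dd lam g0 (ltW eps0) bf f0.
rewrite (minimizer_bil mD d0 Dd q01 Hf) [Num.min _ _]minElt ltNge.
have -> /= : 1 + lam * d <= 1 by rewrite gerDl mulr_le0_ge0// ltW.
rewrite -/kap => H3.
have H4 : m <= b * M * de `^ (1 - q).
  rewrite -ler_pdivrMr ?powR_gt0//; apply: le_trans low_value_mass.
  by rewrite -powRN opprB.
have de1 : 0 < de `^ (1 - q) by exact: powR_gt0.
have : kap * (2 * (A * de `^ (1 - q)) * M * M) <= b * M * de `^ (1 - q).
  by apply: le_trans H4; apply: le_trans H3; rewrite ler_pM2l.
have -> : kap * (2 * (A * de `^ (1 - q)) * M * M) = 2 * M / M0 * (b * M * de `^ (1 - q)).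
  by rewrite /A; field; rewrite !gt_eqF.
rewrite ger_pMl ?mulr_gt0// ler_pdivrMr// mul1r => h.
by move: M0M h Mgt0; lra.
Qed.

(** Half of the mass lies within rho of p, so the potential at x is at least kap rho^g M / 2. As M
    is at least m de^(q - 1) / b, the equation bounds f x by a multiple of [de]. *)
Lemma low_value_far p rho x : 0 < rho -> D p -> D x -> 2 * rho <= enorm (x - p) ->
  pot mu (rk g) D f p <= rho `^ g * (M / 2) ->
  f x `^ q <= ((kap * rho `^ g / (2 * b)) `^ (- s)) `^ q * de `^ q.
Proof.
move=> rho0 Dp Dx xp Pp; set w := kap * _ / _.
have rg0 : 0 < rho `^ g by exact: powR_gt0.
have w0 : 0 < w by apply: divr_gt0; exact: mulr_gt0.
have [_ _ fE _ _] := Hf.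
have H1 : kap * rho `^ g * (M / 2) <= m * f x `^ (q - 1).
  rewrite -fE//; apply: (@le_trans _ _ (\int[mu]_(y in D)
     (kap * rho `^ g * (f y - (rho `^ g)^-1 * (rk g p y * f y))))); last first.
    apply: (le_bint mD fD).
    - by apply: bmeasZ; apply: bmeasB => //; apply: bmeasZ; exact: brkf.
    - exact: bkf.
    move=> y Dy; have [yn|yf] := ltP (enorm (p - y)) rho.
      apply: (@le_trans _ _ (kap * rho `^ g * f y)).
        apply: ler_wpM2l; first by rewrite mulr_ge0 ?ltW.
        by rewrite gerBl mulr_ge0 ?invr_ge0 ?(ltW rg0)// mulr_ge0 ?rk_ge0 ?f0.
      apply: ler_wpM2r; first exact: f0.
      apply: (@le_trans _ _ (kap * rk g x y)); last first.
        by apply: le_trans (ker_lower eps Dx Dy); rewrite lerDl ltW.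
      rewrite ler_pM2l//; apply: ge0_ler_powR; rewrite ?nnegrE ?enorm_ge0 ?(ltW g0) ?(ltW rho0)//.
      have := enorm_triangleB x y p; rewrite (enormC y p).
      by move: xp yn; lra.
    apply: (@le_trans _ _ 0).
      apply: mulr_ge0_le0; first by rewrite mulr_ge0 ?ltW.
      rewrite subr_le0 mulrA ler_peMl ?f0// ler_pdivlMl// mulr1.
      by apply: ge0_ler_powR; rewrite ?nnegrE ?enorm_ge0 ?(ltW g0) ?(ltW rho0).
    rewrite mulr_ge0 ?f0// (le_trans _ (ker_lower eps Dx Dy))//.
    by rewrite addr_ge0 ?mulr_ge0 ?rk_ge0 ?ltW.
  have bZ : bmeas D (fun y => (rho `^ g)^-1 * (rk g p y * f y)) by apply: bmeasZ; exact: brkf.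
  rewrite (bintZ mD fD) ?(bintB mD fD)//; last exact: bmeasB.
  rewrite (bintZ mD fD); last exact: brkf.
  apply: ler_wpM2l; first by rewrite mulr_ge0 ?ltW.
  have : (rho `^ g)^-1 * \int[mu]_(y in D) (rk g p y * f y) <= M / 2 by rewrite ler_pdivrMl.
  by rewrite -/M; move: (_^-1 * _) => z; lra.
have H2 : w * de `^ (q - 1) <= f x `^ (q - 1).
  rewrite -(ler_pM2l m0); apply: le_trans H1.
  have -> : kap * rho `^ g * (M / 2) = w * (b * M) by rewrite /w; field; rewrite gt_eqF.
  by rewrite mulrCA ler_pM2l//; exact: low_value_mass.
have fx := fgt0 Dx.
have conj y : 0 < y -> y = (y `^ (q - 1)) `^ (- s).
  move=> y0; rewrite -powRrM; have -> : (q - 1) * - s = 1.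
    by rewrite /s; field; rewrite subr_eq0 gt_eqF.
  by rewrite powRr1// ltW.
have H3 : f x <= w `^ (- s) * de.
  rewrite {1}(conj _ fx) {1}(conj _ de0) -powRM ?powR_ge0 ?(ltW w0)//.
  apply: powR_decr => //; first by rewrite oppr_le0 ltW.
  by rewrite mulr_gt0// powR_gt0.
rewrite -powRM ?powR_ge0 ?(ltW de0)//.
by apply: ge0_ler_powR; rewrite ?nnegrE ?f0 ?(ltW q0)// mulr_ge0 ?powR_ge0 ?(ltW de0).
Qed.

End fixed.

Variables (c : 'rV[R]_n) (r : R).
Hypotheses (r0 : 0 < r) (CD : cube c r `<=` D).
Hypothesis qcrit : q * (2 * n%:R + g) = 2 * n%:R.

(* A minimizer with a very small value concentrates at a point, near which the
   kernel is almost |x - y|^g; its energy would then be close to the sharp constant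
   of that kernel, which [energy_strict] excludes. *)
Lemma minimizer_floor : exists e0 de, [/\ 0 < e0, 0 < de & forall eps m dl f,
  0 < eps <= e0 -> minimizer mu D (ker g lam eps) q m dl f -> forall x, D x -> de <= f x].
Proof.
pose C := cube c r.
have mC : measurable C by exact: measurable_cube.
have Cd x y : C x -> C y -> enorm (x - y) <= d by move=> /CD Dx /CD; exact: Dd.
have fC : (mu C < +oo)%E by exact: (leb_bounded d0 Cd mC).
have VC : 0 < vol mu C by rewrite /C vol_cube ?(ltW r0)// exprn_gt0// mulr_gt0.
have nR0 : 0 < n%:R :> R by rewrite ltr0n.
have rkge x y : C x -> C y -> 0 <= rk g x y by move=> _ _; exact: rk_ge0.
have [S0 [S00 lb near]] := energy_infimum mC fC VC (bmeas_rk Cd g0) rkge q01.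
have [sg [h [sg0 bh h0 h1 hS]]] := energy_strict n0 r0 d0 Cd g0 q01 qcrit lam0 ld lb near.
have [M0 M00 HM0] := mass_ge mD fD q01 V0.
have S1 : 0 < S0 + 1 by exact: ltr_wpDl.
have nl0 : 0 < - lam by rewrite oppr_gt0.
(* On a set of diameter [e] the kernel is at least 1 + lam e times |x - y|^g, so the energy loses at
   most sg / 8 there. [S0] may vanish, hence the divisor S0 + 1. *)
have [e [e0 ed eS]] : exists e, [/\ 0 < e, e <= d & (S0 + 1) * (- lam * e) <= sg / 8].
  exists (Num.min d (sg / 8 / ((S0 + 1) * - lam))); split.
  - by rewrite lt_min d0 !divr_gt0// mulr_gt0.
  - by rewrite ge_min lexx.
  - by rewrite mulrA mulrC -ler_pdivlMr ?mulr_gt0// ge_min lexx orbT.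
(* A cube of half-side 2 rho has diameter at most 4 n rho = e. *)
pose rho := e / (4 * n%:R).
have rho0 : 0 < rho by rewrite divr_gt0// mulr_gt0.
have rg0 : 0 < rho `^ g by exact: powR_gt0.
pose w := kap * rho `^ g / (2 * b).
have w0 : 0 < w by apply: divr_gt0; exact: mulr_gt0.
have A10 : 0 < 4 * (b / (kap * M0)) by apply: mulr_gt0 => //; apply: divr_gt0 => //; exact: mulr_gt0.
have q10 : 0 < 1 - q by rewrite subr_gt0.
have [d1 d10 Hd1] := powR_small A10 q10 rg0.
have A20 : 0 < (S0 + 1) * (2 / q) * ((w `^ (- s)) `^ q * vol mu D).
  by apply: mulr_gt0; apply: mulr_gt0 => //; rewrite ?divr_gt0 ?powR_gt0.
have sg8 : 0 < sg / 8 by exact: divr_gt0.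
have [d2 d20 Hd2] := powR_small A20 q0 sg8.
(* [d1] brings the potential of [low_value_point] below rho^g M / 2, and [d2] makes the integral of
   f^q far from p negligible, through [low_value_far]. *)
pose de := Num.min d1 d2.
have de0 : 0 < de by rewrite lt_min d10.
have {}Hd1 : 4 * (b / (kap * M0)) * de `^ (1 - q) <= rho `^ g.
  by apply: Hd1; rewrite de0 ge_min lexx.
have {}Hd2 : (S0 + 1) * (2 / q) * ((w `^ (- s)) `^ q * vol mu D) * de `^ q <= sg / 8.
  by apply: Hd2; rewrite de0 ge_min lexx orbT.
pose H := \int[mu]_(x in C) h x.
have H2 : 0 <= H * H by rewrite -expr2 sqr_ge0.
have [ee [ee0 ee1 eeH]] : exists ee, [/\ 0 < ee, ee <= 1 & ee * (H * H) <= sg / 2].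
  have sM : 0 < sg / 2 + H * H by apply: ltr_wpDr => //; exact: divr_gt0.
  exists (Num.min 1 (sg / 2 / (sg / 2 + H * H))); split.
  - by rewrite lt_min ltr01 divr_gt0// divr_gt0.
  - by rewrite ge_min lexx.
  - apply: (@le_trans _ _ (sg / 2 / (sg / 2 + H * H) * (H * H))).
      by apply: ler_wpM2r => //; rewrite ge_min lexx orbT.
    by rewrite mulrAC ler_pdivrMr// ler_pM2l ?divr_gt0// lerDr ltW// divr_gt0.
exists ee, de; split => // eps m dl f /andP[eps0 epse] Hf x1 Dx1.
have e01 : 0 < eps <= 1 by rewrite eps0 (le_trans epse).
have [bf [dl0 fdl] fE f1 [m0 _]] := Hf.
have f0 x : D x -> 0 <= f x by move=> /fdl; apply: le_trans; exact: ltW.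
(* The competitor [h] of [energy_strict], extended by zero from the cube; [ee] keeps its eps term
   below half of the gain sg. *)
have mle : m <= S0 - sg / 2.
  have := minimizer_le Hf (bmeas_restrict mC mD CD bh) (restrict_ge0 (E:=D) h0).
  rewrite bint_restrict_powR ?gt_eqF// => /(_ h1); rewrite bil_restrict//.
  rewrite (bil_kerE mC d0 Cd _ _ g0)// -/H => hm.
  move: hS; rewrite (bil_kerE mC d0 Cd _ _ g0)// mul0r addr0 => hS.
  have : eps * (H * H) <= ee * (H * H) by exact: ler_wpM2r.
  by move=> epsH; exact: floor_arith1 hm hS epsH eeH.
rewrite leNgt; apply/negP => fx1.
have M0M := HM0 f bf f0 f1.
have [p Dp Pp] := low_value_point e01 Hf de0 Dx1 fx1 M00 M0M.
have {}Pp : pot mu (rk g) D f p <= rho `^ g * ((\int[mu]_(y in D) f y) / 2).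
  apply: (le_trans Pp); set M := \int[mu]_(y in D) f y.
  have -> : 2 * (b / (kap * M0) * de `^ (1 - q)) * M =
    4 * (b / (kap * M0)) * de `^ (1 - q) * (M / 2).
    by move: (b / _) (de `^ _) => a1 a2; field.
  apply: ler_wpM2r => //; rewrite divr_ge0//; exact: Rintegral_ge0.
pose B := D `&` cube p (2 * rho).
have mB : measurable B by apply: measurableI => //; exact: measurable_cube.
have BD : B `<=` D by move=> x [].
have Be x y : B x -> B y -> enorm (x - y) <= e.
  move=> [_ Bx] [_ By]; have -> : e = n%:R * (2 * (2 * rho)).
    by rewrite /rho; field; rewrite gt_eqF.
  by apply: cube_dist Bx By; rewrite mulr_ge0// ltW.
have bfq := powR_bmeas_ge0 (ltW q0) f0 bf.
have mDB : measurable (D `\` B) by exact: measurableD.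
have DBD : D `\` B `<=` D by exact: subDsetl.
have fDB : (mu (D `\` B) < +oo)%E by exact: (vol_fin mD fD).
pose X := \int[mu]_(x in D `\` B) (f x `^ q).
have X0 : 0 <= X by apply: Rintegral_ge0 => x _; exact: powR_ge0.
have XE : \int[mu]_(x in B) (f x `^ q) = 1 - X.
  by rewrite -f1 (bint_split mD fD mB BD bfq) addrK.
have X1 : X <= 1.
  by rewrite -subr_ge0 -XE; apply: Rintegral_ge0 => x _; exact: powR_ge0.
have XV : X <= (w `^ (- s)) `^ q * vol mu D * de `^ q.
  apply: (@le_trans _ _ ((w `^ (- s)) `^ q * de `^ q * vol mu (D `\` B))).
    apply: (bint_le_cst mDB fDB); first exact: bmeasS bfq.
    move=> x [Dx nBx].
    apply: (low_value_far e01 Hf de0 Dx1 fx1 rho0 Dp Dx) => //.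
    by apply: not_cube => Cx; apply: nBx; split.
  rewrite mulrAC; apply: ler_wpM2r; first exact: powR_ge0.
  apply: ler_wpM2l; first exact: powR_ge0.
  exact: (vol_le mD fD).
have bfB : bmeas B f by exact: bmeasS bf.
have f0B x : B x -> 0 <= f x by move=> /BD; exact: f0.
have lb1 := energy_lb_scale n0 r0 g0 q01 qcrit lb mB e0 Be bfB f0B.
have lb2 := bil_ker_ge mB e0 Be lam g0 (ltW eps0) bfB f0B.
have le1 : 1 + lam * e <= 1 by rewrite gerDl mulr_le0_ge0// ltW.
have le0 : 0 <= 1 + lam * e.
  apply: (le_trans (ltW ld)); rewrite lerD2l; apply: ler_wnM2l => //; exact: ltW.
rewrite minElt ltNge le1/= in lb2; rewrite XE in lb1.
have lb3 : bil mu (ker g lam eps) B f f <= m.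
  rewrite -(minimizer_bil mD d0 Dd q01 Hf) -(bil_restrict mu BD).
  have K0 x y : D x -> D y -> 0 <= ker g lam eps x y.
    move=> Dx Dy; apply: le_trans (ker_lower eps Dx Dy).
    by rewrite addr_ge0 ?mulr_ge0 ?rk_ge0 ?ltW.
  apply: (bil_mono mD fD (bmeas_ker Dd lam eps g0) K0) => //; first exact: bmeas_restrict.
  move=> x Dx; rewrite patchE; case: ifPn => [/set_mem Bx|_]; first by rewrite f0B/=.
  by rewrite lexx f0.
have q2 : 1 < 2 / q by rewrite ltr_pdivlMr// mul1r (lt_trans q1)// ltr1n.
have bern := bernoulli_powR q2 X0 X1.
have lb4 : (1 + lam * e) * (S0 * (1 - 2 / q * X)) <= m.
  apply: le_trans lb3; apply: le_trans lb2; apply: ler_wpM2l => //.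
  by apply: le_trans lb1; apply: ler_wpM2l.
have XS : (S0 + 1) * (2 / q * X) <= sg / 8.
  apply: le_trans Hd2; rewrite -!mulrA ler_pM2l//; rewrite -!mulrA in XV.
  rewrite [2 * _]mulrA [leRHS]mulrA ler_pM2l ?divr_gt0//.
have a0 : 0 <= - lam * e by rewrite mulr_ge0// ltW.
have b00 : 0 <= 2 / q * X by rewrite mulr_ge0// divr_ge0// ltW.
have leE : 1 + lam * e = 1 - - lam * e by rewrite mulNr opprK.
rewrite leE in lb4; exact: floor_arith2 S00 a0 b00 sg0 lb4 eS XS mle.
Qed.

Lemma critical_solution : exists f c dl, [/\ bmeas D f,
   0 < dl /\ forall x, D x -> dl <= f x, 0 < c &
   forall x, D x -> pot mu (ker g lam 0) D f x = c * f x `^ (q - 1)].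
Proof.
have [e0 [de [e00 de0 H]]] := minimizer_floor.
have de2 : 0 < de / 2 by rewrite divr_gt0.
apply: (solution_of_spread n0 mD d0 Dd V0 g0 ld q01 de2 V0 e00).
move=> eps m dl f e01 Hf; rewrite (_ : _ `&` _ = D)//.
apply/seteqP; split => [x []//|x Dx]; split => //=.
by apply: lt_le_trans (H _ _ _ _ e01 Hf x Dx); rewrite ltr_pdivrMr// ltr_pMr// ltr1n.
Qed.

End no_concentration.

(** * Differentiability of Riesz potentials *)

Lemma is_derive_lineP {R : realType} {V : normedModType R} (U : V -> R) x v w :
  is_derive x v U w <-> is_derive (0 : R) 1 (fun t => U (t *: v + x)) w.
Proof.
have E : (fun h : R => h^-1 *: ((U \o shift x) (h *: v) - U x)) =
  (fun h : R => h^-1 *: (((fun t => U (t *: v + x)) \o shift (0 : R)) (h *: 1) -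
     U (0 *: v + x))).
  by apply/funext => h /=; rewrite addr0 scale0r add0r [_%:A]mulr1.
split => -[dU Uw]; split.
- by rewrite /derivable -E.
- by rewrite -Uw /derive -E.
- by rewrite /derivable E.
- by rewrite -Uw /derive E.
Qed.

Section directional_derivative.
Context {R : realType} {V : normedModType R}.
Implicit Types (U W : V -> R) (x v : V).

Lemma is_derive_line U x v w t : is_derive (t *: v + x) v U w ->
  is_derive t 1 (fun t => U (t *: v + x)) w.
Proof.
move=> /is_derive_lineP H; apply/is_derive_lineP.
rewrite (_ : (fun s => _) = (fun h => U (h *: v + (t *: v + x))))//.
by apply/funext => h; rewrite [_%:A]mulr1 scalerDl addrA.
Qed.

Lemma is_derive_small U x v w :
  (forall e, 0 < e -> exists2 h0, 0 < h0 & forall h : R, `|h| < h0 ->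
    `|U (h *: v + x) - U x - h * w| <= e * `|h|) ->
  is_derive x v U w.
Proof.
move=> H; suff C : h^-1 *: ((U \o shift x) (h *: v) - U x) @[h --> 0^'] --> w.
  by split; [exact: cvgP C|exact: cvg_lim C].
apply/cvgrPdist_le => e e0; have [h0 h00 Hh] := H e e0.
near=> h.
have hn0 : h != 0 by near: h; exact: nbhs_dnbhs_neq.
have hh : `|h| < h0 by near: h; exact: dnbhs0_lt.
have -> : w - h^-1 *: ((U \o shift x) (h *: v) - U x) =
    - (h^-1 * (U (h *: v + x) - U x - h * w)).
  by rewrite /= -[h^-1 *: _]/(h^-1 * _) [in RHS]mulrBr mulKf// opprB.
rewrite normrN normrM normfV mulrC ler_pdivrMr ?normr_gt0//.
exact: Hh.
Unshelve. all: by end_near. Qed.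

Lemma derive_mean U W x v h L : (forall y, is_derive y v U (W y)) ->
  (forall t, `|t| <= `|h| -> `|W (t *: v + x) - W x| <= L) ->
  `|U (h *: v + x) - U x - h * W x| <= `|h| * L.
Proof.
move=> dU HL.
pose phi t := U (t *: v + x) - W x * t.
have dphi (t : R) : is_derive t 1 phi (W (t *: v + x) - W x).
  have d1 := is_derive_line (dU (t *: v + x)).
  have d2 : is_derive t 1 (fun t : R => W x * t) (W x).
    have := @is_deriveZ R R R id (W x) t 1 1 (is_derive_id t 1).
    by rewrite [_%:A]mulr1.
  exact: (is_deriveB d1 d2).
have cphi (a b : R) : {within `[a, b], continuous phi}.
  by apply: derivable_within_continuous => t _; case: (dphi t).
have E : U (h *: v + x) - U x - h * W x = phi h - phi 0.
  by rewrite /phi scale0r add0r mulr0 subr0 mulrC addrAC.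
rewrite E; have [h0|h0|->] := ltgtP h 0; last by rewrite subrr normr0 mul0r.
- have [c] := MVT h0 (fun t _ => dphi t) (cphi h 0).
  rewrite in_itv/= => /andP[hc c0] phE; rewrite -normrN opprB phE sub0r normrM normrN mulrC.
  apply: ler_wpM2l => //; apply: HL.
  by rewrite (ltr0_norm c0) (ltr0_norm h0) lerN2 ltW.
- have [c] := MVT h0 (fun t _ => dphi t) (cphi 0 h).
  rewrite in_itv/= => /andP[c0 ch] ->; rewrite subr0 normrM mulrC.
  apply: ler_wpM2l => //; apply: HL.
  by rewrite (gtr0_norm c0) (gtr0_norm h0) ltW.
Qed.

(** Differentiation under a limit. The last hypothesis combines convergence of the derivatives,
    uniform near x along the line, with continuity of their limit at x. *)
Lemma is_derive_limit (Uj Wj : nat -> V -> R) U (w : R) x v :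
  (forall j y, is_derive y v (Uj j) (Wj j y)) ->
  (forall y e, 0 < e -> exists N, forall j, (N <= j)%N -> `|Uj j y - U y| <= e) ->
  (forall e, 0 < e -> exists N, exists2 r, 0 < r & forall j h, (N <= j)%N -> `|h| < r ->
     `|Wj j (h *: v + x) - w| <= e) ->
  is_derive x v U w.
Proof.
move=> dU cU cW; apply: is_derive_small => e e0.
(* Two thirds go to the oscillation of Wj in [derive_mean], one to the distance of Wj x from w; the
   distance between Uj and U is made arbitrarily small afterwards. *)
have e3 : 0 < e / 3 by rewrite divr_gt0.
have [N [r r0 Hr]] := cW _ e3; exists r => // h hr.
apply/ler_addgt0Pr => e' e'0; have e'2 : 0 < e' / 2 by rewrite divr_gt0.
have [N1 H1] := cU (h *: v + x) _ e'2; have [N2 H2] := cU x _ e'2.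
pose j := maxn N (maxn N1 N2).
have Nj : (N <= j)%N by exact: leq_maxl.
have {}H1 := H1 j (leq_trans (leq_maxl _ _) (leq_maxr N (maxn N1 N2))).
have {}H2 := H2 j (leq_trans (leq_maxr _ _) (leq_maxr N (maxn N1 N2))).
have Wx : `|Wj j x - w| <= e / 3.
  by have := Hr j 0 Nj; rewrite normr0 scale0r add0r; apply.
have := @derive_mean (Uj j) (Wj j) x v h (e / 3 + e / 3) (dU j).
have Ht t : `|t| <= `|h| -> `|Wj j (t *: v + x) - Wj j x| <= e / 3 + e / 3.
  move=> th; have -> : Wj j (t *: v + x) - Wj j x = (Wj j (t *: v + x) - w) - (Wj j x - w).
    by rewrite opprB addrA subrK.
  apply: (le_trans (ler_normB _ _)); apply: lerD => //.
  by apply: Hr => //; exact: le_lt_trans hr.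
move=> /(_ Ht) H3.
have -> : U (h *: v + x) - U x - h * w =
  (Uj j (h *: v + x) - Uj j x - h * Wj j x) + h * (Wj j x - w)
  + ((Uj j x - U x) - (Uj j (h *: v + x) - U (h *: v + x))) by ring.
apply: (le_trans (ler_normD _ _)); apply: lerD; last first.
  by rewrite [leRHS]splitr; apply: (le_trans (ler_normB _ _)); exact: lerD.
apply: (le_trans (ler_normD _ _)).
have -> : e * `|h| = `|h| * (e / 3 + e / 3) + `|h| * (e / 3) by field.
by apply: lerD => //; rewrite normrM; exact: ler_wpM2l.
Qed.

Lemma is_derive_outer (G : R -> R) U x v w w' : is_derive x v U w ->
  is_derive (U x) 1 G w' -> is_derive x v (G \o U) (w' * w).
Proof.
move=> /is_derive_lineP dU dG; apply/is_derive_lineP.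
have dG' : is_derive (U (0 *: v + x)) 1 G w' by rewrite scale0r add0r.
have := is_derive1_comp dG' dU.
exact.
Qed.

End directional_derivative.

Lemma powR_taylor {R : realType} p (c C : R) : 0 < c -> exists2 L, 0 <= L &
  forall x y, c <= x <= C -> c <= y <= C ->
    `|y `^ p - x `^ p - p * x `^ (p - 1) * (y - x)| <= L * (y - x) ^+ 2.
Proof.
move=> c0; have [L L0 HL] := powR_lipschitz (p - 1) C c0.
exists (`|p| * L); first exact: mulr_ge0.
move=> x y xc yc; have [/andP[x0 xC] /andP[y0 yC]] := (xc, yc).
have H z : c <= z <= C -> `|z - x| <= `|y - x| -> y `^ p - x `^ p = p * z `^ (p - 1) * (y - x) ->
    `|y `^ p - x `^ p - p * x `^ (p - 1) * (y - x)| <= `|p| * L * (y - x) ^+ 2.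
  move=> zc zy ->.
  rewrite (_ : _ - _ = p * (z `^ (p - 1) - x `^ (p - 1)) * (y - x)); last by ring.
  rewrite !normrM -[(y - x) ^+ 2]real_normK ?num_real// expr2 !mulrA.
  apply: ler_wpM2r => //; rewrite -!mulrA; apply: ler_wpM2l => //.
  by apply: (le_trans (HL _ _ zc xc)); exact: ler_wpM2l.
have [xy|yx|xy] := ltgtP x y.
- have [z /andP[xz zy]] := powR_MVT p (lt_le_trans c0 x0) xy; apply: H.
    by apply/andP; split; lra.
  by rewrite !gtr0_norm ?subr_gt0// lerD2r ltW.
- have [z /andP[yz zx] zE] := powR_MVT p (lt_le_trans c0 y0) yx; apply: (H z).
  + by apply/andP; split; lra.
  + by rewrite !ltr0_norm ?subr_lt0// lerN2 lerD2r ltW.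
  + by rewrite -opprB zE -mulrN opprB.
- by rewrite xy !subrr mulr0 subr0 normr0 expr0n/= mulr0.
Qed.

Section norm_bint_le.
Context {d} {T : measurableType d} {R : realType}.
Variables (mu : {measure set T -> \bar R}) (D : set T).
Hypotheses (mD : measurable D) (fD : (mu D < +oo)%E).

Lemma norm_bint_le c h f : bmeas D h -> bmeas D f ->
  (forall x, D x -> `|h x| <= c * `|f x|) ->
  `|\int[mu]_(x in D) h x| <= c * \int[mu]_(x in D) `|f x|.
Proof.
move=> bh bf hf; apply: (le_trans (le_norm_bint mD fD bh)).
rewrite -(bintZ mD fD); last exact: bmeas_norm.
by apply: (le_bint mD fD) => //; [exact: bmeas_norm|apply: bmeasZ; exact: bmeas_norm].
Qed.

End norm_bint_le.

Lemma taylor_arith {R : realType} (a a0 a1 p h b L C Q : R) : 0 <= L -> 0 <= a1 <= Q ->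
  (2 * h * b + h ^+ 2) ^+ 2 <= C * h ^+ 2 ->
  `|a - a0 - p * a1 * (2 * h * b + h ^+ 2)| <= L * (2 * h * b + h ^+ 2) ^+ 2 ->
  `|a - a0 - h * (2 * p * b * a1)| <= (L * C + `|p| * Q) * h ^+ 2.
Proof.
move=> L0 /andP[a10 a1Q] wC H.
have -> : a - a0 - h * (2 * p * b * a1) =
  (a - a0 - p * a1 * (2 * h * b + h ^+ 2)) + p * a1 * h ^+ 2 by ring.
apply: (le_trans (ler_normD _ _)); rewrite [leRHS]mulrDl; apply: lerD.
  by apply: (le_trans H); rewrite -[leRHS]mulrA; exact: ler_wpM2l.
rewrite normrM [`|h ^+ 2|]ger0_norm ?sqr_ge0//; apply: ler_wpM2r; first exact: sqr_ge0.
by rewrite normrM; apply: ler_wpM2l => //; rewrite ger0_norm.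
Qed.

(** * Smoothed kernels *)

Section smooth_kernel.
Context {R : realType} {n : nat}.
Implicit Types (x y z : 'rV[R]_n) (i : 'I_n).

(** For eta > 0 its powers are smooth also at z = 0; with p = g / 2 the kernel [sk] tends to |x -
    y|^g as eta tends to 0, and [dsk] is its partial derivative in x. *)
Definition sq (eta : R) z : R := enorm z ^+ 2 + eta.

Definition sk (p eta : R) x y : R := sq eta (x - y) `^ p.

Definition dsk (p eta : R) i x y : R :=
  2 * p * (x - y) ord0 i * sq eta (x - y) `^ (p - 1).

Lemma enorm_shift_sqr i h z :
  enorm (h *: unit_vec R i + z) ^+ 2 = enorm z ^+ 2 + 2 * h * z ord0 i + h ^+ 2.
Proof.
rewrite !enorm_sqr (bigD1 i)//= [in RHS](bigD1 i)//= !mxE !eqxx/=.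
rewrite (eq_bigr (fun k => z ord0 k ^+ 2)); first by ring.
by move=> k ki; rewrite !mxE (negbTE ki) andbF mulr0 add0r.
Qed.

Lemma enorm_unit_vec i h : enorm (h *: unit_vec R i) = `|h|.
Proof.
apply/eqP; rewrite -(eqrXn2 (ltn0Sn 1)) ?enorm_ge0//.
have := enorm_shift_sqr i h 0; rewrite addr0 mxE mulr0 addr0 enorm0 expr0n/= add0r => ->.
by rewrite real_normK ?num_real.
Qed.

Section estimates.
Variables (Rr eta : R).
Hypotheses (R0 : 0 < Rr) (eta0 : 0 < eta).

Let sq_itv x y : enorm (x - y) <= Rr -> eta <= sq eta (x - y) <= Rr ^+ 2 + eta.
Proof.
move=> h; rewrite /sq lerDr sqr_ge0/= lerD2r.
by apply: lerXn2r; rewrite ?nnegrE ?enorm_ge0 ?(ltW R0).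
Qed.

Lemma sk_taylor p : exists2 L, 0 <= L & forall i h x y,
  enorm (x - y) <= Rr -> enorm (h *: unit_vec R i + x - y) <= Rr ->
  `|sk p eta (h *: unit_vec R i + x) y - sk p eta x y - h * dsk p eta i x y| <= L * h ^+ 2.
Proof.
have [L L0 HL] := powR_taylor p (Rr ^+ 2 + eta) eta0.
pose P := `|p| * (eta `^ (p - 1) + (Rr ^+ 2 + eta) `^ (p - 1)).
have P0 : 0 <= P by apply: mulr_ge0 => //; apply: addr_ge0; exact: powR_ge0.
exists (L * (4 * Rr) ^+ 2 + P).
  by apply: addr_ge0 => //; apply: mulr_ge0 => //; exact: sqr_ge0.
move=> i h x y xR hR; set z := x - y.
have hzE : h *: unit_vec R i + x - y = h *: unit_vec R i + z by rewrite /z addrA.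
have [Az Ah] := (sq_itv xR, sq_itv hR).
have dA : sq eta (h *: unit_vec R i + x - y) - sq eta z = 2 * h * z ord0 i + h ^+ 2.
  by rewrite /sq hzE enorm_shift_sqr; ring.
have hle : `|h| <= 2 * Rr.
  rewrite -(enorm_unit_vec i) (_ : _ *: _ = (h *: unit_vec R i + x - y) - (x - y)).
    apply: (le_trans (enorm_triangleB _ 0 _)); rewrite subr0 sub0r enormN.
    by move: xR hR; lra.
  by rewrite hzE addrK.
have hz : `|2 * h * z ord0 i + h ^+ 2| <= 4 * Rr * `|h|.
  apply: (le_trans (ler_normD _ _)); rewrite !normrM ger0_norm//.
  have := coord_le_enorm z i; have := xR; rewrite -/z => h1 h2.
  have h3 : `|h| * `|z ord0 i| <= `|h| * Rr by rewrite ler_wpM2l// (le_trans h2).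
  have h4 : `|h| * `|h| <= `|h| * (2 * Rr) by rewrite ler_wpM2l.
  rewrite -mulrA (_ : 4 * Rr * `|h| = 2 * (`|h| * Rr) + `|h| * (2 * Rr)); last by ring.
  by apply: lerD => //; exact: ler_wpM2l.
have hz2 : (2 * h * z ord0 i + h ^+ 2) ^+ 2 <= (4 * Rr) ^+ 2 * h ^+ 2.
  rewrite -[leLHS]real_normK ?num_real// -[X in _ <= _ * X]real_normK ?num_real// -exprMn.
  have R4 : 0 <= 4 * Rr * `|h| by rewrite mulr_ge0// mulr_ge0// ltW.
  by apply: lerXn2r; rewrite ?nnegrE.
have := HL _ _ Az Ah; rewrite -/z dA => H.
apply: (taylor_arith L0 _ hz2 H); rewrite powR_ge0/=.
have /andP[h1 h2] := Az; have s0 : 0 < sq eta z by exact: lt_le_trans h1.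
have [p1|/ltW p1] := leP (p - 1) 0.
  by apply: ler_wpDr; [exact: powR_ge0|exact: powR_decr].
apply: ler_wpDl; first exact: powR_ge0.
by apply: ge0_ler_powR; rewrite ?nnegrE ?(ltW s0)// (le_trans (ltW s0)).
Qed.

Lemma dsk_lipschitz p : exists2 L, 0 <= L & forall i x x' y,
  enorm (x - y) <= Rr -> enorm (x' - y) <= Rr ->
  `|dsk p eta i x' y - dsk p eta i x y| <= L * enorm (x' - x).
Proof.
have [L L0 HL] := powR_lipschitz (p - 1) (Rr ^+ 2 + eta) eta0.
pose P := eta `^ (p - 1) + (Rr ^+ 2 + eta) `^ (p - 1).
have P0 : 0 <= P by apply: addr_ge0; exact: powR_ge0.
exists (2 * `|p| * (P + Rr * (L * (2 * Rr)))).
  apply: mulr_ge0; first exact: mulr_ge0.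
  by apply: addr_ge0 => //; do ![apply: mulr_ge0 => //; try exact: ltW].
move=> i x x' y xR x'R.
have [Ax Ax'] := (sq_itv xR, sq_itv x'R).
have bnd : sq eta (x' - y) `^ (p - 1) <= P.
  have /andP[h1 h2] := Ax'; have s0 : 0 < sq eta (x' - y) by exact: lt_le_trans h1.
  have [p1|/ltW p1] := leP (p - 1) 0.
    by apply: ler_wpDr; [exact: powR_ge0|exact: powR_decr].
  apply: ler_wpDl; first exact: powR_ge0.
  by apply: ge0_ler_powR; rewrite ?nnegrE ?(ltW s0)// (le_trans (ltW s0)).
have H := HL _ _ Ax' Ax.
have sqd : `|sq eta (x' - y) - sq eta (x - y)| <= 2 * Rr * enorm (x' - x).
  rewrite /sq opprD addrACA subrr addr0 subr_sqr normrM mulrC.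
  apply: ler_pM => //; last exact: enorm_dist.
  rewrite ger0_norm ?addr_ge0 ?enorm_ge0//; move: xR x'R; lra.
have xi : `|(x - y) ord0 i| <= Rr by exact: le_trans (coord_le_enorm _ _) xR.
have xx : `|(x' - y) ord0 i - (x - y) ord0 i| <= enorm (x' - x).
  have := coord_le_enorm (x' - x) i; rewrite !mxE.
  by rewrite (_ : x' ord0 i - y ord0 i - _ = x' ord0 i - x ord0 i)//; ring.
rewrite /dsk; move: H bnd sqd xi xx.
move: (sq eta (x' - y) `^ (p - 1)) (sq eta (x - y) `^ (p - 1)) (powR_ge0 (sq eta (x' - y)) (p - 1)).
move=> a' a a'0; move: ((x' - y) ord0 i) ((x - y) ord0 i) => b' b H bnd sqd xi xx.
rewrite (_ : _ - _ = 2 * p * ((b' - b) * a' + b * (a' - a))); last by ring.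
rewrite normrM normrM [`|2|]ger0_norm// -[leRHS]mulrA; apply: ler_wpM2l; first exact: mulr_ge0.
apply: (le_trans (ler_normD _ _)); rewrite [leRHS]mulrDl !normrM (ger0_norm a'0); apply: lerD.
  by rewrite mulrC; apply: ler_pM.
rewrite -!mulrA; apply: ler_pM => //; apply: (le_trans H); apply: ler_wpM2l => //.
by rewrite mulrA.
Qed.

End estimates.

Lemma dsk_eta_dist p (Rr rho : R) : 0 < rho -> exists2 L, 0 <= L & forall i x y eta eta',
  rho <= enorm (x - y) <= Rr -> 0 <= eta <= 1 -> 0 <= eta' <= 1 ->
  `|dsk p eta i x y - dsk p eta' i x y| <= L * `|eta - eta'|.
Proof.
move=> rho0; have rr0 : 0 < rho ^+ 2 by exact: exprn_gt0.
have [L L0 HL] := powR_lipschitz (p - 1) (Rr ^+ 2 + 1) rr0.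
exists (2 * `|p| * `|Rr| * L); first by rewrite !mulr_ge0.
move=> i x y eta eta' /andP[rx xR] h h'.
have itv e : 0 <= e <= 1 -> rho ^+ 2 <= sq e (x - y) <= Rr ^+ 2 + 1.
  move=> /andP[e0 e1]; apply/andP; split.
    apply: ler_wpDr => //; apply: lerXn2r; rewrite ?nnegrE ?enorm_ge0 ?(ltW rho0)//.
  apply: lerD => //; apply: lerXn2r; rewrite ?nnegrE ?enorm_ge0//.
  by apply: le_trans xR; exact: enorm_ge0.
have := HL _ _ (itv _ h) (itv _ h'); rewrite {3 4}/sq opprD addrACA subrr add0r => H.
rewrite /dsk -mulrBr normrM -[leRHS]mulrA; apply: ler_pM => //.
rewrite !normrM [`|2|]ger0_norm//; apply: ler_wpM2l; first exact: mulr_ge0.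
apply: (le_trans (coord_le_enorm _ _)); exact: le_trans (ler_norm _).
Qed.

(** With A = |x - y|^2 + eta, the coordinate factor is at most A^(1 / 2), which leaves A^((g - 1) /
    2), singular for g < 1. The singular factor A^(-th / 2) is split off, to be integrated uniformly
    in eta when th < 1; the remaining power is nonnegative and bounded. *)
Lemma dsk_near g th i x y (Rr eta : R) : 0 < g -> 0 <= g - 1 + th -> 0 < eta <= 1 ->
  enorm (x - y) <= Rr -> `|dsk (g / 2) eta i x y| <=
  g * (Rr ^+ 2 + 1) `^ ((g - 1 + th) / 2) * sq eta (x - y) `^ (- (th / 2)).
Proof.
move=> g0 gth /andP[eta0 eta1] xR; set A := sq eta (x - y).
have A0 : 0 < A by rewrite ltr_wpDl ?sqr_ge0.
have AR : A <= Rr ^+ 2 + 1.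
  apply: lerD => //; apply: lerXn2r; rewrite ?nnegrE ?enorm_ge0//.
  by apply: le_trans xR; exact: enorm_ge0.
have xA : `|(x - y) ord0 i| <= A `^ (2^-1).
  apply: (le_trans (coord_le_enorm _ _)); rewrite -[leLHS]powRr1 ?enorm_ge0//.
  rewrite -[X in _ `^ X](mulfV (_ : 2 != 0 :> R))// powRrM.
  apply: ge0_ler_powR; rewrite ?nnegrE ?powR_ge0 ?invr_ge0 ?(ltW A0)//.
  by rewrite powR_mulrn ?enorm_ge0// /A /sq lerDl ltW.
have g2 : 2 * (g / 2) = g by field.
rewrite /dsk -/A g2 !normrM (gtr0_norm g0) (ger0_norm (powR_ge0 A _)) -!mulrA.
apply: ler_wpM2l; first exact: ltW.
apply: (@le_trans _ _ (A `^ (2^-1) * A `^ (g / 2 - 1))).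
  by apply: ler_wpM2r => //; exact: powR_ge0.
rewrite -powRD ?(gt_eqF A0) ?implybT//.
have -> : 2^-1 + (g / 2 - 1) = (g - 1 + th) / 2 + - (th / 2) by field.
rewrite powRD ?(gt_eqF A0) ?implybT//; apply: ler_wpM2r; first exact: powR_ge0.
apply: ge0_ler_powR; rewrite ?nnegrE ?(ltW A0) ?divr_ge0//.
by rewrite addr_ge0 ?sqr_ge0.
Qed.

End smooth_kernel.

Section bounded_domain.
Context {R : realType} {n : nat}.
Variables (D : set 'rV[R]_n) (d : R).
Hypothesis Dd : forall x y, D x -> D y -> enorm (x - y) <= d.

Lemma enorm_bounded x : exists2 C, 0 < C & forall y, D y -> enorm (x - y) <= C.
Proof.
have [[y0 Dy0]|D0] := pselect (D !=set0); last first.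
  by exists 1 => // y Dy; case: D0; exists y.
exists (enorm (x - y0) + `|d| + 1); first by rewrite ltr_wpDl// addr_ge0// enorm_ge0.
move=> y Dy; apply: (le_trans (enorm_triangleB x y0 y)); rewrite -addrA lerD2l.
by apply: (le_trans (Dd Dy0 Dy)); rewrite (le_trans (ler_norm _))// lerDl.
Qed.

Lemma bmeas_enorm x : bmeas D (fun y => enorm (x - y)).
Proof.
split.
  apply: measurable_funTS.
  exact: (measurableT_comp measurable_enormB (pair1_measurable x)).
have [C C0 HC] := enorm_bounded x.
by exists C => y Dy; rewrite ger0_norm ?enorm_ge0 ?HC.
Qed.

Lemma bmeas_coordB x i : bmeas D (fun y => (x - y) ord0 i).
Proof.
split.
  apply: measurable_funTS.
  under eq_fun do rewrite !mxE.
  by apply: measurable_funB; [exact: measurable_cst|exact: measurable_coord].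
have [C C0 HC] := enorm_bounded x.
by exists C => y Dy; exact: le_trans (coord_le_enorm _ _) (HC _ Dy).
Qed.

Lemma bmeas_rkx p x : 0 < p -> bmeas D (rk p x).
Proof.
by move=> p0; apply: bmeas_powR; [move=> y _; exact: enorm_ge0|exact: ltW|exact: bmeas_enorm].
Qed.

Lemma bmeas_sq p eta x : 0 < eta -> bmeas D (fun y => sq eta (x - y) `^ p).
Proof.
move=> eta0; apply: (bmeas_powR_pos p eta0).
  by move=> y _; rewrite lerDr sqr_ge0.
apply: bmeasD; last exact: bmeas_cst.
by rewrite (_ : (fun y => _) = (fun y => enorm (x - y) * enorm (x - y)))//;
  apply: bmeasM; exact: bmeas_enorm.
Qed.

Lemma bmeas_dsk p eta i x : 0 < eta -> bmeas D (dsk p eta i x).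
Proof.
move=> eta0; apply: bmeasM; last exact: bmeas_sq.
by apply: bmeasZ; exact: bmeas_coordB.
Qed.

End bounded_domain.

Section near_diagonal.
Context {R : realType} {n : nat}.
Hypothesis n0 : (0 < n)%N.

(* With I(rho, eta) the integral, scaling gives
   I(rho / 2, eta) <= 2 ^ (th - n) I(rho, eta), where 2 ^ (th - n) < 1, so I is
   controlled by the contribution of the outer shell. *)
Lemma near_diagonal_le th : 0 <= th < 1 -> exists2 C, 0 < C & forall (x : 'rV[R]_n) rho eta,
  0 < rho -> 0 < eta ->
  \int[@leb R n]_(y in cube x rho) (sq eta (x - y) `^ (- (th / 2))) <=
  C * rho `^ (n%:R - th).
Proof.
move=> /andP[th0 th1]; have nR1 : 1 <= n%:R :> R by rewrite ler1n.
have P1 : 2 `^ (th - n%:R) < 1 :> R.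
  by apply: powR_lt1; rewrite ?ltr1n// subr_lt0 (lt_le_trans th1).
have P0 : 0 < 1 - 2 `^ (th - n%:R) :> R by rewrite subr_gt0.
exists (2 `^ th * 2 ^+ n / (1 - 2 `^ (th - n%:R))).
  by rewrite divr_gt0// mulr_gt0 ?powR_gt0 ?exprn_gt0.
move=> x rho eta rho0 eta0.
pose mu := @leb R n; pose F y := sq eta (x - y) `^ (- (th / 2)).
have r20 : 0 < rho / 2 by rewrite divr_gt0.
have Cd r (y z : 'rV[R]_n) : 0 < r -> cube x r y -> cube x r z -> enorm (y - z) <= n%:R * (2 * r).
  by move=> r0; apply: cube_dist; exact: ltW.
have fin r : 0 < r -> (mu (cube x r) < +oo)%E by move=> /ltW; exact: leb_cube_lty.
have bF r : 0 < r -> bmeas (cube x r) F.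
  by move=> r0; apply: (bmeas_sq (fun y z => Cd r y z r0)).
have mC r : measurable (cube x r) by exact: measurable_cube.
have sub : cube x (rho / 2) `<=` cube x rho.
  by move=> y Hy i; have := Hy i; rewrite !in_itv/= => /andP[? ?]; apply/andP; split; lra.
have F0 y : 0 <= F y by exact: powR_ge0.
have far : \int[mu]_(y in cube x rho `\` cube x (rho / 2)) F y <= (rho / 2) `^ (- th) * (2 * rho) ^+ n.
  have mX : measurable (cube x rho `\` cube x (rho / 2)) by exact: measurableD.
  have XC : cube x rho `\` cube x (rho / 2) `<=` cube x rho by exact: subDsetl.
  apply: (@le_trans _ _ ((rho / 2) `^ (- th) * vol mu (cube x rho `\` cube x (rho / 2)))).
    apply: bint_le_cst => //; first exact: (vol_fin (mC rho) (fin _ rho0)).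
      exact: (bmeasS (mC rho) XC (bF _ rho0)).
    move=> y [_ /not_cube]; rewrite enormC => h.
    have -> : (rho / 2) `^ (- th) = ((rho / 2) ^+ 2) `^ (- (th / 2)).
      by rewrite -powR_mulrn ?(ltW r20)// -powRrM; congr (_ `^ _); field.
    apply: powR_decr; first by rewrite oppr_le0 divr_ge0.
      exact: exprn_gt0.
    apply: ler_wpDr; first exact: ltW.
    by apply: lerXn2r; rewrite ?nnegrE ?enorm_ge0 ?(ltW r20).
  apply: ler_wpM2l; first exact: powR_ge0.
  rewrite -(vol_cube x (ltW rho0)).
  exact: (vol_le (mC rho) (fin _ rho0)).
(* [dil (- x) 2] sends y to 2 y - x: it is the dilation by 2 about x. *)
pose z := - x.
have zE : dil z 2 @^-1` cube x rho = cube x (rho / 2).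
  apply/seteqP; split => y Hy i; have := Hy i; rewrite /dil /z !mxE !in_itv/= => /andP[? ?];
  by apply/andP; split; lra.
have dF y : F y <= 2 `^ th * F (dil z 2 y).
  have E : x - dil z 2 y = 2 *: (x - y).
    by apply/rowP => i; rewrite /dil /z !mxE; ring.
  have s0 : 0 < sq eta (x - dil z 2 y) by rewrite ltr_wpDl ?sqr_ge0.
  rewrite /F; have -> : 2 `^ th = (4^-1) `^ (- (th / 2)) :> R.
    have -> : 4^-1 = 2 `^ (- 2%:R) :> R.
      by rewrite powRN powR_mulrn//; congr (_^-1); rewrite expr2; ring.
    by rewrite -powRrM; congr (_ `^ _); field.
  rewrite -powRM ?invr_ge0 ?(ltW s0)//.
  apply: powR_decr; first by rewrite oppr_le0 divr_ge0.
    by rewrite mulr_gt0 ?invr_gt0.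
  rewrite /sq E enormZ exprMn (ger0_norm (_ : 0 <= 2))//.
  by move: (enorm _ ^+ 2) eta0 => w; rewrite expr2; lra.
set I := \int[_]_(_ in _) _.
have near : \int[mu]_(y in cube x (rho / 2)) F y <= 2 `^ (th - n%:R) * I.
  have bd : bmeas (cube x (rho / 2)) (fun y => F (dil z 2 y)).
    by rewrite -zE; exact: (bmeas_dil (mC rho) _ _ (bF _ rho0)).
  apply: (@le_trans _ _ (\int[mu]_(y in cube x (rho / 2)) (2 `^ th * F (dil z 2 y)))).
    by apply: (le_bint (mC _) (fin _ r20) (bF _ r20) (bmeasZ _ bd)) => y _; exact: dF.
  rewrite (bintZ (mC _) (fin _ r20) _ bd) -zE.
  have two0 : 0 < 2 :> R by [].
  have F0' y : cube x rho y -> 0 <= F y by [].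
  have -> : \int[mu]_(y in dil z 2 @^-1` cube x rho) F (dil z 2 y) = 2 ^- n * I.
    exact: (bint_dil z two0 (mC rho) (fin _ rho0) (bF _ rho0) F0').
  have -> : 2 `^ (th - n%:R) = 2 `^ th * 2 ^- n :> R.
    by rewrite powRD ?(gt_eqF two0) ?implybT// powRN powR_mulrn.
  by rewrite mulrA.
have split : I = \int[mu]_(y in cube x (rho / 2)) F y +
    \int[mu]_(y in cube x rho `\` cube x (rho / 2)) F y.
  exact: (bint_split (mC rho) (fin _ rho0) (mC (rho / 2)) sub (bF _ rho0)).
have H : I <= 2 `^ (th - n%:R) * I + (rho / 2) `^ (- th) * (2 * rho) ^+ n.
  by rewrite {1}split; apply: lerD.
rewrite mulrAC ler_pdivlMr// mulrBr mulr1 lerBlDr addrC mulrC.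
have E : 2 `^ th * 2 ^+ n * rho `^ (n%:R - th) = (rho / 2) `^ (- th) * (2 * rho) ^+ n.
  rewrite powR_div// opprK exprMn powRD ?(gt_eqF rho0) ?implybT// powR_mulrn ?(ltW rho0)//.
  by ring.
by rewrite [2 `^ th * _ * _]E; move: H; rewrite mulrC.
Qed.

End near_diagonal.

Lemma cauchy_real {R : realType} (u : nat -> R) :
  (forall e, 0 < e -> exists N, forall i j, (N <= i)%N -> (N <= j)%N -> `|u i - u j| <= e) ->
  exists l, forall e, 0 < e -> exists N, forall j, (N <= j)%N -> `|u j - l| <= e.
Proof.
move=> H; have : cvg (u @ \oo).
  apply/cauchy_cvgP/cauchy_exP => e e0.
  have e2 : 0 < e / 2 by rewrite divr_gt0.
  have [N HN] := H _ e2; exists (u N); exists N => // j Nj.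
  apply: (@le_lt_trans _ _ (e / 2)); first exact: HN.
  by rewrite ltr_pdivrMr// ltr_pMr// ltr1n.
move=> /cvg_ex[l ul]; exists l => e e0.
have /cvgrPdist_le /(_ _ e0)[N _ HN] := ul.
by exists N => j Nj; rewrite distrC; exact: HN.
Qed.

Lemma dist3 {R : realType} (a b v w e : R) : `|v - a| <= e / 3 -> `|w - b| <= e / 3 ->
  `|v - w| <= e / 3 -> `|a - b| <= e.
Proof.
rewrite !ler_norml => /andP[? ?] /andP[? ?] /andP[? ?].
by apply/andP; split; lra.
Qed.

Lemma dist4 {R : realType} (a b v w e c : R) : `|w - v| <= c -> `|v - a| <= e / 2 ->
  `|w - b| <= e / 2 -> `|b - a| <= c + e.
Proof.
rewrite !ler_norml => /andP[? ?] /andP[? ?] /andP[? ?].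
by apply/andP; split; lra.
Qed.

Lemma continuous_enorm_eps {R : realType} {n : nat} (F : 'rV[R]_n -> R) :
  (forall x e, 0 < e -> exists2 h, 0 < h & forall y, enorm (y - x) <= h -> `|F y - F x| <= e) ->
  continuous F.
Proof.
move=> H x A /nbhs_ballP[e /= e0 eA]; change (nbhs x (F @^-1` A)).
have e20 : 0 < e / 2 by rewrite divr_gt0.
have [h h0 Hh] := H x _ e20; have h1 : 0 < h / (n%:R + 1) by rewrite divr_gt0// ltr_wpDl.
apply/nbhs_ballP; exists (h / (n%:R + 1)) => // y [_ xy]; apply: eA.
apply: (@le_lt_trans _ _ (e / 2)); last by rewrite ltr_pdivrMr// ltr_pMr// ltr1n.
rewrite distrC; apply: Hh.
apply: (@le_trans _ _ (n%:R * (h / (n%:R + 1)))).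
  apply: enorm_le_coord => [|i]; first exact: ltW.
  have := xy ord0 i; rewrite /ball/= => /ltW; rewrite distrC !mxE; exact.
by rewrite mulrA ler_pdivrMr ?ltr_wpDl// mulrC ler_pM2l// lerDl.
Qed.

(** * Differentiability and Lipschitz bounds for Riesz potentials *)

Section riesz_C1.
Context {R : realType} {n : nat}.
Hypothesis n0 : (0 < n)%N.
Variables (D : set 'rV[R]_n) (d : R).
Hypothesis mD : measurable D.
Hypothesis d0 : 0 < d.
Hypothesis Dd : forall x y, D x -> D y -> enorm (x - y) <= d.
Let mu := @leb R n.
Let fD : (mu D < +oo)%E := leb_bounded d0 Dd mD.
Variables (g : R) (f : 'rV[R]_n -> R).
Hypotheses (g0 : 0 < g) (bf : bmeas D f).
Let p := g / 2.
Let p0 : 0 < p. Proof. by rewrite divr_gt0. Qed.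
Let I0 := \int[mu]_(y in D) `|f y|.
Let I00 : 0 <= I0. Proof. by apply: Rintegral_ge0. Qed.

Let U eta := pot mu (sk p eta) D f.
Let V eta i := pot mu (dsk p eta i) D f.

Let near_radius x0 : exists2 Rr, 0 < Rr &
  forall x y, enorm (x - x0) <= 2 -> D y -> enorm (x - y) <= Rr.
Proof.
have [C C0 HC] := enorm_bounded Dd x0.
exists (2 + C) => [|x y xx Dy]; first by rewrite addr_gt0.
by apply: (le_trans (enorm_triangleB x x0 y)); apply: lerD => //; exact: HC.
Qed.

Let bsk eta x : 0 < eta -> bmeas D (fun y => sk p eta x y * f y).
Proof. by move=> eta0; apply: bmeasM => //; exact: (bmeas_sq Dd). Qed.

Let bdsk eta i x : 0 < eta -> bmeas D (fun y => dsk p eta i x y * f y).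
Proof. by move=> eta0; apply: bmeasM => //; exact: (bmeas_dsk Dd). Qed.

Let enorm0' (x : 'rV[R]_n) : enorm (x - x) <= 2.
Proof. by rewrite subrr enorm0. Qed.

Lemma is_derive_sk_pot eta i x : 0 < eta ->
  is_derive x (unit_vec R i) (U eta) (V eta i x).
Proof.
move=> eta0; have [Rr R0 HR] := near_radius x.
have [L L0 HL] := sk_taylor (n:=n) R0 eta0 p.
apply: is_derive_small => e e0.
have LI : 0 < L * I0 + 1 by rewrite ltr_wpDl// mulr_ge0.
exists (Num.min 2 (e / (L * I0 + 1))); first by rewrite lt_min ltr0n divr_gt0.
move=> h; rewrite lt_min => /andP[/ltW h2 he].
have b1 := bsk (h *: unit_vec R i + x) eta0; have b2 := bsk x eta0.
have b3 := bmeasZ h (bdsk i x eta0).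
rewrite /U /V /pot -(bintB mD fD b1 b2) -(bintZ mD fD); last exact: bdsk.
rewrite -(bintB mD fD (bmeasB b1 b2) b3).
apply: (@le_trans _ _ (L * h ^+ 2 * I0)).
  apply: (norm_bint_le mD fD (bmeasB (bmeasB b1 b2) b3) bf) => y Dy.
  rewrite mulrA -!mulrBl normrM; apply: ler_wpM2r => //; apply: HL; first exact: HR.
  by apply: HR => //; rewrite addrK enorm_unit_vec.
rewrite mulrAC -[h ^+ 2]real_normK ?num_real// expr2 mulrA ler_wpM2r//.
rewrite mulrC; move: he; rewrite ltr_pdivlMr// => /ltW; apply: le_trans.
by apply: ler_wpM2l => //; rewrite lerDl.
Qed.

Lemma dsk_pot_lipschitz eta x0 : 0 < eta -> exists2 L, 0 <= L & forall i x x',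
  enorm (x - x0) <= 2 -> enorm (x' - x0) <= 2 ->
  `|V eta i x' - V eta i x| <= L * enorm (x' - x).
Proof.
move=> eta0; have [Rr R0 HR] := near_radius x0.
have [L L0 HL] := dsk_lipschitz (n:=n) R0 eta0 p.
exists (L * I0) => [|i x x' xx xx']; first exact: mulr_ge0.
have b1 := bdsk i x' eta0; have b2 := bdsk i x eta0.
rewrite /V /pot -(bintB mD fD b1 b2) mulrAC.
apply: (norm_bint_le mD fD (bmeasB b1 b2) bf) => y Dy.
rewrite -mulrBl normrM; apply: ler_wpM2r => //; apply: HL; exact: HR.
Qed.

(** The integral is split at distance of order rho from x. Close to x each derivative contributes at
    most a multiple of rho^(n - th), which fixes rho; away from x the derivatives are Lipschitz in
    eta, which then fixes eta0. *)
Lemma dsk_pot_cauchy x0 e : 0 < e -> exists2 eta0, 0 < eta0 & forall i x eta eta',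
  enorm (x - x0) <= 2 -> 0 < eta <= eta0 -> 0 < eta' <= eta0 ->
  `|V eta i x - V eta' i x| <= e.
Proof.
move=> e0; have [Rr R0 HR] := near_radius x0.
have nR1 : 1 <= n%:R :> R by rewrite ler1n.
(* The order of the singularity of the gradient of |x - y|^g, always below 1 <= n. *)
pose th := Num.max 0 (1 - g).
have th01 : 0 <= th < 1 by rewrite le_max lexx/= gt_max ltr01 gtrDl oppr_lt0.
have gth : 0 <= g - 1 + th.
  have : 1 - g <= th by rewrite le_max lexx orbT.
  by lra.
have nth0 : 0 < n%:R - th by case/andP: th01 => _ h; rewrite subr_gt0 (lt_le_trans h).
have [C C0 HC] := near_diagonal_le n0 th01.
have [F F0 HF] : exists2 F, 0 < F & forall y, D y -> `|f y| <= F.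
  have [_ [F HF]] := bf; exists (`|F| + 1) => [|y Dy]; first by rewrite ltr_wpDl.
  by rewrite (le_trans (HF _ Dy))// (le_trans (ler_norm _))// lerDl.
have R21 : 0 < Rr ^+ 2 + 1 by rewrite ltr_wpDl ?sqr_ge0.
have [K K0 HK] : exists2 K, 0 < K & forall i x y eta, enorm (x - x0) <= 2 -> D y ->
    0 < eta <= 1 -> `|dsk p eta i x y| <= K * sq eta (x - y) `^ (- (th / 2)).
  exists (g * (Rr ^+ 2 + 1) `^ ((g - 1 + th) / 2)); first by rewrite mulr_gt0// powR_gt0.
  by move=> i x y eta xx Dy eta01; apply: dsk_near => //; exact: HR.
have A0 : 0 < F * K * 2 * C by rewrite !mulr_gt0.
have e2 : 0 < e / 2 by rewrite divr_gt0.
have [rho rho0 Hrho] := powR_small A0 nth0 e2.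
have {}Hrho : F * K * 2 * C * rho `^ (n%:R - th) <= e / 2.
  by apply: Hrho; rewrite rho0 lexx.
have [L L0 HL] := dsk_eta_dist (n:=n) p Rr rho0.
have Vol0 : 0 <= vol mu D by exact: vol_ge0.
have W0 : 0 < L * F * vol mu D + 1 by rewrite ltr_wpDl// !mulr_ge0// ltW.
exists (Num.min 1 (e / 2 / (L * F * vol mu D + 1))).
  by rewrite lt_min ltr01 divr_gt0.
move=> i x eta eta' xx /andP[eta0]; rewrite le_min => /andP[eta1 etae] /andP[eta'0].
rewrite le_min => /andP[eta'1 eta'e]; move: etae eta'e.
have [h [h0 hE]] : exists h, 0 < h /\ h * (L * F * vol mu D + 1) = e / 2.
  by exists (e / 2 / (L * F * vol mu D + 1)); rewrite divr_gt0// divfK// gt_eqF.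
rewrite -hE mulfK ?gt_eqF// => etae eta'e.
pose B := D `&` cube x rho.
have mC : measurable (cube x rho) by exact: measurable_cube.
have mB : measurable B by exact: measurableI.
have BD : B `<=` D by move=> y [].
have fC : (mu (cube x rho) < +oo)%E by exact/leb_cube_lty/ltW.
have Cd y z : cube x rho y -> cube x rho z -> enorm (y - z) <= n%:R * (2 * rho).
  by apply: cube_dist; exact: ltW.
pose S t y := sq t (x - y) `^ (- (th / 2)).
have bS t : 0 < t -> bmeas D (S t) by exact: (bmeas_sq Dd).
have IS t : 0 < t -> \int[mu]_(y in D) (S t y * \1_B y) <= C * rho `^ (n%:R - th).
  move=> t0; rewrite (bint_indic _ _ mB BD); apply: le_trans (HC x rho t rho0 t0).
  apply: (bintS mC fC mB); [by move=> y []|exact: (bmeas_sq Cd)|].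
  by move=> y _; exact: powR_ge0.
have b1 := bdsk i x eta0; have b2 := bdsk i x eta'0.
have bSB t : 0 < t -> bmeas D (fun y => S t y * \1_B y).
  by move=> t0; apply: bmeasM; [exact: bS|exact: bmeas_indic].
have bH := bmeasD (bmeasZ (F * K) (bSB _ eta0)) (bmeasZ (F * K) (bSB _ eta'0)).
have bH' := bmeasD (@bmeas_cst _ _ R D (L * h * F)) bH.
rewrite /V /pot -(bintB mD fD b1 b2).
apply: (le_trans (le_norm_bint mD fD (bmeasB b1 b2))).
apply: (@le_trans _ _ (\int[mu]_(y in D) (L * h * F +
    (F * K * (S eta y * \1_B y) + F * K * (S eta' y * \1_B y))))).
  apply: (le_bint mD fD (bmeas_norm (bmeasB b1 b2)) bH') => y Dy.
  have S0 t : 0 <= S t y by exact: powR_ge0.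
  have LhF : 0 <= L * h * F.
    by apply: mulr_ge0; [apply: mulr_ge0 => //; exact: ltW|exact: ltW].
  rewrite -mulrBl normrM; have [By|nBy] := pselect (B y).
    rewrite indicE (mem_set By) !mulr1; apply: ler_wpDl => //.
    rewrite -mulrDr -mulrA mulrC; apply: ler_pM => //; first exact: HF.
    rewrite mulrDr; apply: (le_trans (ler_normB _ _)).
    by apply: lerD; apply: HK => //; apply/andP.
  rewrite indicE (memNset nBy) !mulr0 !addr0; apply: ler_pM => //; last exact: HF.
  have xy : rho <= enorm (x - y).
    by rewrite enormC; apply: not_cube => Cy; apply: nBy; split.
  apply: (@le_trans _ _ (L * `|eta - eta'|)).
    by apply: HL; rewrite ?xy ?(ltW eta0) ?(ltW eta'0)//=; exact: HR.
  apply: ler_wpM2l => //; rewrite ler_norml; move: eta0 eta'0 etae eta'e.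
  by move=> *; apply/andP; split; lra.
rewrite (bintD mD fD (@bmeas_cst _ _ R D (L * h * F)) bH) (bint_cst mu mD).
rewrite (bintD mD fD (bmeasZ (F * K) (bSB _ eta0)) (bmeasZ (F * K) (bSB _ eta'0))).
rewrite !(bintZ mD fD); [|exact: bSB|exact: bSB].
rewrite [leRHS]splitr; apply: lerD.
  have -> : L * h * F * vol mu D = h * (L * F * vol mu D) by ring.
  apply: (@le_trans _ _ (h * (L * F * vol mu D + 1))); last by rewrite hE.
  by rewrite ler_pM2l// lerDl.
apply: le_trans Hrho; rewrite -mulrDr -!mulrA.
apply: ler_wpM2l; first exact: ltW.
apply: ler_wpM2l; first exact: ltW.
by rewrite [2 * _]mulrDl mul1r; apply: lerD; exact: IS.
Qed.

Lemma sk_pot_cvg y e : 0 < e -> exists2 h, 0 < h & forall eta, 0 < eta <= h ->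
  `|U eta y - pot mu (rk g) D f y| <= e.
Proof.
move=> e0; have [Rr R0 HR] := near_radius y.
have e1 : 0 < e / (I0 + 1) by rewrite divr_gt0// ltr_wpDl.
have R21 : 0 < Rr ^+ 2 + 1 by rewrite ltr_wpDl ?sqr_ge0.
have [h h0 Hh] := powR_unif p0 R21 e1.
exists (Num.min 1 h); first by rewrite lt_min ltr01.
move=> eta /andP[eta0]; rewrite le_min => /andP[eta1 etah].
have b1 := bsk y eta0.
have b2 : bmeas D (fun z => rk g y z * f z) by apply: bmeasM => //; exact: (bmeas_rkx Dd).
rewrite /U /pot -(bintB mD fD b1 b2); apply: (@le_trans _ _ (e / (I0 + 1) * I0)).
  apply: (norm_bint_le mD fD (bmeasB b1 b2) bf) => z Dz.
  rewrite -mulrBl normrM; apply: ler_wpM2r => //.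
  have -> : rk g y z = (enorm (y - z) ^+ 2) `^ p.
    rewrite -powR_mulrn ?enorm_ge0// -powRrM; congr (_ `^ _).
    by rewrite /p mulrC divfK.
  have zR := HR y z (enorm0' y) Dz.
  have sR : enorm (y - z) ^+ 2 <= Rr ^+ 2.
    by apply: lerXn2r; rewrite ?nnegrE ?enorm_ge0 ?(ltW R0).
  apply: Hh; rewrite /sq.
  + by rewrite addr_ge0 ?sqr_ge0 ?(ltW eta0)//= lerD.
  + by rewrite sqr_ge0/= (le_trans sR)// lerDl.
  + by rewrite addrAC subrr add0r gtr0_norm.
by rewrite mulrAC ler_pdivrMr ?ltr_wpDl// ler_pM2l// lerDl.
Qed.

(** The derivatives of the smoothed potentials are Cauchy in eta, locally uniformly in x, so their
    limit is continuous and is the derivative. It exists on all of R^n, which later gives continuity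
    up to the boundary. *)
Theorem pot_rk_C1 : exists W : 'I_n -> 'rV[R]_n -> R,
  (forall i, continuous (W i)) /\
  forall i x, is_derive x (unit_vec R i) (pot mu (rk g) D f) (W i x).
Proof.
pose et (j : nat) : R := j.+1%:R^-1.
have et0 j : 0 < et j by rewrite invr_gt0 ltr0n.
have ets h : 0 < h -> exists N, forall j, (N <= j)%N -> et j <= h.
  move=> h0; exists (Num.truncn h^-1) => j Nj.
  rewrite /et -[h]invrK lef_pV2 ?posrE ?invr_gt0 ?ltr0n//.
  apply: (le_trans (ltW (truncnS_gt _))); rewrite ler_nat ltnS//.
have cau x0 e : 0 < e -> exists N, forall i x j k, enorm (x - x0) <= 2 ->
    (N <= j)%N -> (N <= k)%N -> `|V (et j) i x - V (et k) i x| <= e.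
  move=> e0; have [h h0 Hh] := dsk_pot_cauchy x0 e0; have [N HN] := ets h h0.
  by exists N => i x j k xx Nj Nk; apply: Hh => //; rewrite et0/= HN.
have /choice[W HW] : forall ix : 'I_n * 'rV[R]_n, exists l, forall e, 0 < e ->
    exists N, forall j, (N <= j)%N -> `|V (et j) ix.1 ix.2 - l| <= e.
  move=> [i x]; apply: cauchy_real => e e0; have [N HN] := cau x e e0.
  by exists N => j k Nj Nk; exact: HN.
have unif x0 e : 0 < e -> exists N, forall i x j, enorm (x - x0) <= 2 -> (N <= j)%N ->
    `|V (et j) i x - W (i, x)| <= e.
  move=> e0; have [N HN] := cau x0 e e0; exists N => i x j xx Nj.
  apply/ler_addgt0Pr => e' e'0; have [N' HN'] := HW (i, x) e' e'0.
  have h1 := HN i x j (maxn N N') xx Nj (leq_maxl _ _).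
  have h2 := HN' (maxn N N') (leq_maxr _ _).
  rewrite -[_ - W _](subrKA (V (et (maxn N N')) i x)).
  by apply: (le_trans (ler_normD _ _)); exact: lerD.
have cont x0 e : 0 < e -> exists2 h, 0 < h & forall i x, enorm (x - x0) <= h ->
    `|W (i, x) - W (i, x0)| <= e.
  move=> e0; have e3 : 0 < e / 3 by rewrite divr_gt0.
  have [N HN] := unif x0 _ e3; have [L L0 HL] := dsk_pot_lipschitz x0 (et0 N).
  have L1 : 0 < L + 1 by rewrite ltr_wpDl.
  exists (Num.min 2 (e / 3 / (L + 1))); first by rewrite lt_min ltr0n divr_gt0.
  move=> i x; rewrite le_min => /andP[x2 xe].
  have h1 := HN i x N x2 (leqnn _); have h2 := HN i x0 N (enorm0' x0) (leqnn _).
  have h3 := HL i x0 x (enorm0' x0) x2.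
  have h4 : L * enorm (x - x0) <= e / 3.
    apply: (@le_trans _ _ ((L + 1) * enorm (x - x0))).
      by apply: ler_wpM2r; rewrite ?enorm_ge0// lerDl.
    by rewrite mulrC -ler_pdivlMr.
  exact: dist3 h1 h2 (le_trans h3 h4).
exists (fun i x => W (i, x)); split=> [i|i x].
  apply: continuous_enorm_eps => x e e0; have [h h0 Hh] := cont x e e0.
  by exists h => // y; exact: Hh.
apply: (@is_derive_limit _ _ (fun j => U (et j)) (fun j => V (et j) i)).
- by move=> j y; exact: is_derive_sk_pot.
- move=> y e e0; have [h h0 Hh] := sk_pot_cvg y e0; have [N HN] := ets _ h0.
  by exists N => j Nj; apply: Hh; rewrite et0/= HN.
- move=> e e0; have e2 : 0 < e / 2 by rewrite divr_gt0.
  have [N HN] := unif x _ e2; have [h h0 Hh] := cont x _ e2.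
  exists N; exists (Num.min 2 h); first by rewrite lt_min ltr0n.
  move=> j t Nj; rewrite lt_min => /andP[/ltW t2 /ltW th].
  have xx : enorm (t *: unit_vec R i + x - x) = `|t| by rewrite addrK enorm_unit_vec.
  have h1 := HN i (t *: unit_vec R i + x) j; rewrite xx in h1.
  have h2 := Hh i (t *: unit_vec R i + x); rewrite xx in h2.
  rewrite -[_ - W _](subrKA (W (i, t *: unit_vec R i + x))) [leRHS]splitr.
  apply: (le_trans (ler_normD _ _)); apply: lerD; [exact: h1|exact: h2].
Qed.

(** The difference of kernels is estimated by [powR_dist], and the singular factor is integrated by
    [near_diagonal_le]; that bound concerns the smoothed norm, whence the detour through eta > 0. *)
Lemma pot_rk_lipschitz : exists2 L, 0 <= L & forall x x', D x -> D x' ->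
  `|pot mu (rk g) D f x' - pot mu (rk g) D f x| <= L * enorm (x' - x).
Proof.
have [F [F0 HF]] : exists F, 0 < F /\ forall y, D y -> `|f y| <= F.
  have [_ [F HF]] := bf; exists (`|F| + 1); split=> [|y Dy]; first by rewrite ltr_wpDl.
  by rewrite (le_trans (HF _ Dy))// (le_trans (ler_norm _))// lerDl.
have d1 : 0 < d + 1 by rewrite addr_gt0.
have [C [th [C0 th01 HC]]] := powR_dist g0 d1.
have [C2 C20 HC2] := near_diagonal_le n0 th01.
pose L := C * F * (C2 * d `^ (n%:R - th)).
have L0 : 0 <= L by rewrite !mulr_ge0 ?powR_ge0// ltW.
exists L => // x x' Dx Dx'; apply/ler_addgt0Pr => e e0.
have e2 : 0 < e / 2 by rewrite divr_gt0.
have [h h0 Hh] := sk_pot_cvg x e2; have [h' h'0 Hh'] := sk_pot_cvg x' e2.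
have [eta [eta0 etah etah' eta1]] : exists eta, [/\ 0 < eta, eta <= h, eta <= h' & eta <= 1].
  exists (Num.min h (Num.min h' 1)); split; first by rewrite !lt_min h0 h'0 ltr01.
  - by rewrite ge_min lexx.
  - by rewrite !ge_min lexx orbT.
  - by rewrite !ge_min lexx !orbT.
have {}Hh : `|U eta x - pot mu (rk g) D f x| <= e / 2 by apply: Hh; rewrite eta0.
have {}Hh' : `|U eta x' - pot mu (rk g) D f x'| <= e / 2 by apply: Hh'; rewrite eta0.
suff HU : `|U eta x' - U eta x| <= L * enorm (x' - x) by exact: dist4 HU Hh Hh'.
pose S y := sq eta (x - y) `^ (- (th / 2)).
have bS : bmeas D S by exact: (bmeas_sq Dd).
have fDc : forall y, D y -> cube x d y.
  by move=> y Dy; apply: enorm_cube; exact: Dd.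
have IS : \int[mu]_(y in D) S y <= C2 * d `^ (n%:R - th).
  apply: le_trans (HC2 x d eta d0 eta0).
  have mC : measurable (cube x d) by exact: measurable_cube.
  apply: (bintS mC (leb_cube_lty x (ltW d0)) mD fDc); last by move=> y _; exact: powR_ge0.
  exact: (bmeas_sq (fun y z => @cube_dist R n x y z d (ltW d0))).
have b1 := bsk x' eta0; have b2 := bsk x eta0.
rewrite /U /pot -(bintB mD fD b1 b2).
apply: (le_trans (le_norm_bint mD fD (bmeasB b1 b2))).
apply: (@le_trans _ _ (C * F * enorm (x' - x) * \int[mu]_(y in D) S y)).
  rewrite -(bintZ mD fD)//; apply: (le_bint mD fD (bmeas_norm (bmeasB b1 b2)) (bmeasZ _ bS)) => y Dy.
  rewrite -mulrBl normrM.
  have -> : C * F * enorm (x' - x) * S y = (C * S y * enorm (x' - x)) * F by ring.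
  apply: ler_pM => //; last exact: HF.
  have sqrtE z : sk p eta z y = (Num.sqrt (sq eta (z - y))) `^ g.
    have s0 : 0 <= sq eta (z - y) by rewrite addr_ge0 ?sqr_ge0 ?(ltW eta0).
    by rewrite -powR12_sqrt// -powRrM /p mulrC.
  have sqrtd z : D z -> 0 < Num.sqrt (sq eta (z - y)) <= d + 1.
    move=> Dz; have s0 : 0 < sq eta (z - y) by rewrite ltr_wpDl ?sqr_ge0.
    rewrite sqrtr_gt0 s0/= -[d + 1]ger0_norm ?(ltW d1)// -sqrtr_sqr ler_wsqrtr//.
    rewrite sqrrD expr1n mulr1; apply: lerD => //; apply: ler_wpDr; first by rewrite mulrn_wge0 ?ltW.
    by apply: lerXn2r; rewrite ?nnegrE ?enorm_ge0 ?(ltW d0) ?Dd.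
  rewrite !sqrtE distrC.
  have /andP[a0 ad] := sqrtd x Dx; have /andP[a'0 a'd] := sqrtd x' Dx'.
  apply: (le_trans (HC _ _ _ _)); rewrite ?a0 ?(ltW a'0)//.
  have -> : Num.sqrt (sq eta (x - y)) `^ (- th) = S y.
    rewrite -powR12_sqrt -?powRrM; last by rewrite addr_ge0 ?sqr_ge0 ?(ltW eta0).
    by rewrite /S; congr (_ `^ _); field.
  apply: ler_wpM2l; first by rewrite mulr_ge0 ?powR_ge0// ltW.
  rewrite -(ler_pM2l (addr_gt0 a0 a'0)).
  have {1}-> : Num.sqrt (sq eta (x - y)) + Num.sqrt (sq eta (x' - y)) =
     `|Num.sqrt (sq eta (x - y)) + Num.sqrt (sq eta (x' - y))|.
    by rewrite gtr0_norm// addr_gt0.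
  rewrite -normrM mulrC -subr_sqr !sqr_sqrtr; [|by rewrite addr_ge0 ?sqr_ge0 ?(ltW eta0)..].
  rewrite /sq opprD addrACA subrr addr0 subr_sqr normrM mulrC.
  have le_sqrt z : enorm z <= Num.sqrt (enorm z ^+ 2 + eta).
    by rewrite -[leLHS]ger0_norm ?enorm_ge0// -sqrtr_sqr ler_wsqrtr// lerDl ltW.
  apply: ler_pM => //; last by rewrite distrC; exact: enorm_dist.
  by rewrite ger0_norm ?addr_ge0 ?enorm_ge0// lerD.
rewrite /L [leRHS]mulrAC; apply: ler_wpM2l => //.
by rewrite !mulr_ge0 ?enorm_ge0// ltW.
Qed.

End riesz_C1.

Section riesz_continuous.
Context {R : realType} {n : nat}.
Variables (D : set 'rV[R]_n) (d : R).
Hypothesis mD : measurable D.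
Hypothesis d0 : 0 < d.
Hypothesis Dd : forall x y, D x -> D y -> enorm (x - y) <= d.
Let mu := @leb R n.
Let fD : (mu D < +oo)%E := leb_bounded d0 Dd mD.

Lemma pot_rk_continuous g f : 0 < g -> bmeas D f -> continuous (pot mu (rk g) D f).
Proof.
move=> g0 bf; apply: continuous_enorm_eps => x e e0.
pose I0 := \int[mu]_(y in D) `|f y|.
have I00 : 0 <= I0 by exact: Rintegral_ge0.
have I1 : 0 < I0 + 1 by rewrite ltr_wpDl.
have [C C0 HC] := enorm_bounded Dd x.
have C1 : 0 < C + 1 by rewrite addr_gt0.
have [h h0 Hh] := powR_unif g0 C1 (divr_gt0 e0 I1).
exists (Num.min 1 h); first by rewrite lt_min ltr01.
move=> x'; rewrite le_min => /andP[x1 xh].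
have b1 z : bmeas D (fun y => rk g z y * f y) by apply: bmeasM => //; exact: (bmeas_rkx Dd).
rewrite /pot -(bintB mD fD (b1 x') (b1 x)); apply: (@le_trans _ _ (e / (I0 + 1) * I0)).
  apply: (norm_bint_le mD fD (bmeasB (b1 x') (b1 x)) bf) => y Dy.
  rewrite -mulrBl normrM; apply: ler_wpM2r => //; apply: Hh.
  - rewrite enorm_ge0/= [C + 1]addrC; apply: (le_trans (enorm_triangleB x' x y)).
    by apply: lerD => //; exact: HC.
  - by rewrite enorm_ge0/= (le_trans (HC _ Dy))// lerDl.
  - exact: le_trans (enorm_dist _ _ _) xh.
by rewrite mulrAC ler_pdivrMr// ler_pM2l// lerDl.
Qed.

End riesz_continuous.

Lemma continuous_ge_closure {T : topologicalType} {R : realType} (A : set T) (u : T -> R) c x :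
  continuous u -> (forall y, A y -> c <= u y) -> closure A x -> c <= u x.
Proof.
move=> cu Ac clx; rewrite leNgt; apply/negP => uc.
have /clx[y [Ay /=]] : nbhs x (u @^-1` [set t | t < c]).
  by apply: cu; apply: open_nbhs_nbhs; split => //; exact: open_lt.
by rewrite ltNge Ac.
Qed.

Lemma powR_continuous_pos {R : realType} (p a : R) : 0 < a -> {for a, continuous (@powR R ^~ p)}.
Proof.
move=> a0; apply/differentiable_continuous/derivable1_diffP.
by have [] := is_derive1_powR p a0.
Qed.

Lemma continuous_powR_comp {T : topologicalType} {R : realType} (u : T -> R) p x :
  0 < u x -> u y @[y --> x] --> u x -> u y `^ p @[y --> x] --> u x `^ p.
Proof.
move=> ux cu; have H2 : (@powR R ^~ p) @ u x --> u x `^ p := @powR_continuous_pos R p _ ux.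
exact: (@cvg_comp _ _ _ u (@powR R ^~ p) _ _ _ cu H2).
Qed.

(** * From the kernel equation to C^1 solutions *)

Section solution_of_kernel.
Context {R : realType} {n : nat}.
Hypothesis n0 : (0 < n)%N.
Variables (D : set 'rV[R]_n) (d : R).
Hypothesis mD : measurable D.
Hypothesis d0 : 0 < d.
Hypothesis Dd : forall x y, D x -> D y -> enorm (x - y) <= d.
Let mu := @leb R n.
Let fD : (mu D < +oo)%E := leb_bounded d0 Dd mD.
Variables (alpha q lam : R).
Let g := alpha - n%:R.
Hypotheses (g0 : 0 < g) (q01 : 0 < q < 1).
Let q1 : q < 1. Proof. by case/andP: q01. Qed.
Let g10 : 0 < g + 1. Proof. by rewrite addr_gt0. Qed.
Let s := (1 - q)^-1.
Let s0 : 0 < s. Proof. by rewrite invr_gt0 subr_gt0. Qed.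
Let sq1 : - s * (q - 1) = 1. Proof. by rewrite /s; field; rewrite subr_eq0 gt_eqF. Qed.

Lemma riesz_potE p f x : 0 < p -> bmeas D f ->
  riesz_pot D (- p) f x = (pot mu (rk p) D f x)%:E.
Proof.
move=> p0 bf.
have bR : bmeas D (fun y => rk p x y * f y) by apply: bmeasM => //; exact: (bmeas_rkx Dd).
rewrite /pot -(bint_EFin mD fD bR); apply: eq_integral => y _.
by rewrite powRN invrK mulrC.
Qed.

(** f is only bounded and measurable; its regularity comes from expressing it through its own
    potential. *)
Lemma solution_of_kernel f c dl : bmeas D f -> 0 < dl -> (forall x, D x -> dl <= f x) ->
  0 < c -> (forall x, D x -> pot mu (ker g lam 0) D f x = c * f x `^ (q - 1)) ->
  exists F, positive_C1_solution D alpha q lam F.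
Proof.
move=> bf dl0 fdl c0 fE.
(* Scaling f by k multiplies the potential by k and f^(q - 1) by k^(q - 1); the constant c
   disappears when k c = k^(q - 1). *)
pose k := c `^ (- (2 - q)^-1).
have k0 : 0 < k by exact: powR_gt0.
have q2 : 0 < 2 - q by rewrite subr_gt0 (lt_trans q1)// ltr1n.
have kE : k * c = k `^ (q - 1).
  rewrite /k -powRrM -{2}[c]powRr1 ?(ltW c0)// -powRD ?(gt_eqF c0) ?implybT//.
  by congr (_ `^ _); field; rewrite gt_eqF.
pose f1 x := k * f x.
have b1 : bmeas D f1 by exact: bmeasZ.
have f10 x : D x -> 0 < f1 x by move=> Dx; rewrite mulr_gt0// (lt_le_trans dl0)// fdl.
pose u x := pot mu (rk g) D f1 x + lam * pot mu (rk (g + 1)) D f1 x.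
have uE x : D x -> u x = f1 x `^ (q - 1).
  move=> Dx; have := pot_kerE mD d0 Dd lam 0 g0 Dx b1; rewrite mul0r addr0 -/(u x) => <-.
  have fx : 0 <= f x by rewrite (le_trans (ltW dl0))// fdl.
  rewrite powRM ?(ltW k0)// -kE -mulrA -fE// -(bintZ mD fD).
    by apply: eq_bint => y Dy; rewrite /f1 mulrCA.
  by apply: bmeasM => //; exact: (bmeas_ker_l mD Dd).
have cu : continuous u.
  have H := pot_rk_continuous mD d0 Dd g0 b1.
  have H1 := pot_rk_continuous mD d0 Dd g10 b1.
  move=> x; have H' : pot mu (rk g) D f1 @ x --> pot mu (rk g) D f1 x := H x.
  have H1' : pot mu (rk (g + 1)) D f1 @ x --> pot mu (rk (g + 1)) D f1 x := H1 x.
  exact: (cvgD H' (cvgM (cvg_cst lam) H1')).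
have [c1 c10 uc1] : exists2 c1, 0 < c1 & forall x, D x -> c1 <= u x.
  have [_ [B HB]] := b1.
  exists ((`|B| + 1) `^ (q - 1)); first by rewrite powR_gt0// ltr_wpDl.
  move=> x Dx; rewrite uE//; apply: powR_decr; [by rewrite subr_le0 ltW|exact: f10|].
  apply: (le_trans (ler_norm _)); apply: (le_trans (HB _ Dx)).
  by rewrite (le_trans (ler_norm _))// lerDl.
have ugt0 x : closure D x -> 0 < u x.
  by move=> clx; apply: lt_le_trans c10 _; exact: continuous_ge_closure uc1 clx.
(* The potential [u] is C^1 on the whole space and bounded below by c1 > 0 on the closure, so F is
   C^1 up to the boundary. It agrees with [f1] on D and hence has the same potentials. *)
pose F x := u x `^ (- s).
have FE x : D x -> F x = f1 x.
  by move=> Dx; rewrite /F (uE _ Dx) -powRrM mulrC sq1 (powRr1 (ltW (f10 _ Dx))).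
have bF : bmeas D F by apply: bmeas_ext b1 => x Dx; rewrite FE.
have [W [cW dW]] := pot_rk_C1 n0 mD d0 Dd g0 b1.
have [W1 [cW1 dW1]] := pot_rk_C1 n0 mD d0 Dd g10 b1.
have du i x : is_derive x (unit_vec R i) u (W i x + lam * W1 i x).
  exact: (is_deriveD (dW i x) (is_deriveZ lam (dW1 i x))).
have dF i x : 0 < u x -> is_derive x (unit_vec R i) F
    (- s * u x `^ (- s - 1) * (W i x + lam * W1 i x)).
  by move=> ux; exact: (is_derive_outer (du i x) (is_derive1_powR (- s) ux)).
exists F; split.
- split.
    apply: continuous_in_subspaceT => x /set_mem /ugt0 ux.
    by apply: continuous_powR_comp => //; exact: cu.
  move=> i; split; first by move=> x Dx; have [] := dF i x (ugt0 _ (subset_closure Dx)).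
  exists (fun x => - s * u x `^ (- s - 1) * (W i x + lam * W1 i x)).
    apply: continuous_in_subspaceT => x /set_mem /ugt0 ux.
    have h1 : W i @ x --> W i x := cW i x.
    have h2 : W1 i @ x --> W1 i x := cW1 i x.
    have h3 := @continuous_powR_comp _ _ u (- s - 1) x ux (cu x).
    exact: (cvgM (cvgM (cvg_cst (- s)) h3) (cvgD h1 (cvgM (cvg_cst lam) h2))).
  by move=> x Dx; have [_ ->] := dF i x (ugt0 _ (subset_closure Dx)).
- move=> x clx; split; first exact: powR_ge0.
  have ux := ugt0 x clx.
  have -> : n%:R - alpha = - g by rewrite opprB.
  have -> : - g - 1 = - (g + 1) by rewrite (opprD g 1).
  rewrite (riesz_potE x g0 bF) (riesz_potE x g10 bF) -EFinM -EFinD -powRrM sq1 (powRr1 (ltW ux)).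
  congr (_%:E); rewrite /u; congr (_ + lam * _); apply: eq_bint => y Dy; by rewrite FE.
- by move=> x clx; rewrite powR_gt0// ugt0.
Qed.

End solution_of_kernel.

(** * Existence on bounded domains *)

Lemma coord_le_norm {R : realType} {n : nat} (x : 'rV[R]_n) i : `|x ord0 i| <= `|x|.
Proof.
rewrite leNgt; apply/negP => xi.
have : ball_ (fun z : 'rV[R]_n => `|z|) 0 `|x ord0 i| x by rewrite /ball_/= sub0r normrN.
rewrite -mx_norm_ball => -[_ /(_ ord0 i)].
by rewrite /ball/= mxE sub0r normrN ltxx.
Qed.

Section domain_facts.
Context {R : realType} {n : nat}.
Hypothesis n0 : (0 < n)%N.
Variable Om : set 'rV[R]_n.
Hypotheses (dOm : domain Om) (bOm : bounded_set Om).

Lemma diam_has_ub : has_ubound [set r | exists x y, [/\ Om x, Om y & r = enorm (x - y)]].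
Proof.
have [M [_ HM]] := bOm.
have {}HM : globally Om [set x | `|x| <= M + 1] by apply: HM; rewrite ltrDl.
exists (n%:R * (2 * `|M + 1|)) => _ [a [b [Oa Ob ->]]].
apply: enorm_le_coord => [|i]; first by rewrite mulr_ge0.
rewrite !mxE; apply: (le_trans (ler_normB _ _)); rewrite mulrDl mul1r.
by apply: lerD; apply: (le_trans (coord_le_norm _ _));
  [apply: (le_trans (HM a Oa))|apply: (le_trans (HM b Ob))]; exact: ler_norm.
Qed.

Lemma diam_ge x y : Om x -> Om y -> enorm (x - y) <= diam Om.
Proof. by move=> Ox Oy; apply: (ub_le_sup diam_has_ub); exists x, y. Qed.

Lemma domain_measurable : measurable Om.
Proof. by case: dOm => oOm _ _; exact: open_measurable_rV. Qed.

Lemma domain_cube : exists c r, 0 < r /\ cube c r `<=` Om.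
Proof.
have [oOm _ [x Ox]] := dOm; have [e e0 eO] := open_rV_ball oOm Ox.
exists x, (e / 2); split => [|y Hy]; first by rewrite divr_gt0.
apply: eO => i; have := Hy i; rewrite in_itv/= ltr_norml => /andP[? ?].
by apply/andP; split; lra.
Qed.

Lemma diam_gt0 : 0 < diam Om.
Proof.
have [c [r [r0 CO]]] := domain_cube.
have Cc : cube c r c by move=> i; rewrite in_itv/= lerBlDr lerDl ltW//= lerDl ltW.
have Cr : cube c r (r *: unit_vec R (Ordinal n0) + c).
  move=> i; rewrite in_itv/= !mxE eqxx/=.
  by case: (i == _); rewrite ?mulr1 ?mulr0; apply/andP; split; lra.
apply: lt_le_trans (diam_ge (CO _ Cr) (CO _ Cc)).
by rewrite addrK enorm_unit_vec normr_gt0 gt_eqF.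
Qed.

Lemma domain_vol_gt0 : 0 < vol (leb n) Om.
Proof.
have [c [r [r0 CO]]] := domain_cube; have mO := domain_measurable.
have fO : (leb n Om < +oo)%E := leb_bounded diam_gt0 diam_ge mO.
apply: (@lt_le_trans _ _ (vol (leb n) (cube c r))).
  by rewrite vol_cube ?(ltW r0)// exprn_gt0// mulr_gt0.
by apply: (vol_le mO fO) => //; exact: measurable_cube.
Qed.

Variables (alpha q lam : R).
Hypothesis an : n%:R < alpha.
Let g := alpha - n%:R.
Let g0 : 0 < g. Proof. by rewrite subr_gt0. Qed.
Hypothesis lamd : - (1 / diam Om) < lam.

Let ld : 0 < 1 + lam * diam Om.
Proof.
move: lamd; rewrite -(ltr_pM2r diam_gt0) mulNr divfK ?gt_eqF ?diam_gt0// => h.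
by rewrite -ltrBlDl sub0r.
Qed.

Let nR0 : 0 < n%:R :> R. Proof. by rewrite ltr0n. Qed.

Lemma subcritical_existence : 0 < q < q_crit n alpha ->
  exists f, positive_C1_solution Om alpha q lam f.
Proof.
move=> /andP[q0 qc]; have na0 : 0 < n%:R + alpha by rewrite addr_gt0// (lt_trans nR0).
have qsub : q * (2 * n%:R + g) < 2 * n%:R.
  by move: qc; rewrite /q_crit ltr_pdivlMr// /g; have -> : 2 * n%:R + (alpha - n%:R) = n%:R + alpha by ring.
have q01 : 0 < q < 1.
  rewrite q0 -(ltr_pM2r (_ : 0 < 2 * n%:R + g)) ?mul1r; last by rewrite addr_gt0// mulr_gt0.
  by rewrite (lt_trans qsub)// ltrDl.
have mO := domain_measurable.
have [t [eta [t0 eta0 sp]]] :=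
  subcritical_spread n0 mO diam_gt0 diam_ge g0 ld domain_vol_gt0 q01 qsub.
have [f [c [dl [bf [dl0 fdl] c0 fE]]]] := solution_of_spread n0 mO diam_gt0 diam_ge
  domain_vol_gt0 g0 ld q01 t0 eta0 ltr01 sp.
exact: (solution_of_kernel n0 mO diam_gt0 diam_ge g0 q01 bf dl0 fdl c0 fE).
Qed.

Lemma critical_existence : q = q_crit n alpha -> lam < 0 ->
  exists f, positive_C1_solution Om alpha q lam f.
Proof.
move=> qE lam0; have na0 : 0 < n%:R + alpha by rewrite addr_gt0// (lt_trans nR0).
have qc : q * (2 * n%:R + g) = 2 * n%:R.
  rewrite qE /q_crit /g; have -> : 2 * n%:R + (alpha - n%:R) = n%:R + alpha by ring.
  by rewrite divfK// gt_eqF.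
have q01 : 0 < q < 1.
  rewrite qE /q_crit divr_gt0 ?mulr_gt0//= ltr_pdivrMr// mul1r.
  by rewrite mulrDl mul1r ltrD2l.
have mO := domain_measurable; have [c [r [r0 CO]]] := domain_cube.
have [f [k [dl [bf [dl0 fdl] k0 fE]]]] := critical_solution n0 mO diam_gt0 diam_ge
  domain_vol_gt0 g0 lam0 ld q01 r0 CO qc.
exact: (solution_of_kernel n0 mO diam_gt0 diam_ge g0 q01 bf dl0 fdl k0 fE).
Qed.

End domain_facts.

(** * Nonexistence on star-shaped domains *)

(* Since [1 - w ^ b = b (1 - w) + O((1 - w)^2)] and [c <= b], dividing by [1 - w]
   and letting w tend to 1 gives [2 k <= 0]. *)
Lemma pohozaev_contradiction {R : realType} (J b c k C : R) : 0 < J -> c <= b -> 0 < k -> 0 <= C ->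
  (forall w, 2^-1 <= w -> w < 1 ->
     J * (1 - w `^ b) <= c * J * (1 - w) - 2 * k * (1 - w) + C * (1 - w) ^+ 2) -> False.
Proof.
move=> J0 cb k0 C0 H.
have h0 : 0 < 2^-1 :> R by rewrite invr_gt0.
have [L L0 HL] := powR_taylor b 1 h0.
have A0 : 0 < J * L + C + 1 by rewrite ltr_wpDl// addr_ge0// mulr_ge0// ltW.
pose e := Num.min 2^-1 (k / (J * L + C + 1)).
have e0 : 0 < e by rewrite lt_min invr_gt0 ltr0n divr_gt0.
have e2 : e <= 2^-1 by rewrite ge_min lexx.
have eA : (J * L + C + 1) * e <= k by rewrite mulrC -ler_pdivlMr// ge_min lexx orbT.
have w1 : 2^-1 <= 1 - e by lra.
have w2 : 1 - e < 1 by lra.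
have half1 : 2^-1 <= 1 :> R by lra.
have I1 : (2^-1 : R) <= (1 : R) <= (1 : R) by rewrite half1 lexx.
have I2 : (2^-1 : R) <= 1 - e <= 1 by rewrite w1 ltW.
have E : 1 - e - 1 = - e by ring.
have := HL _ _ I1 I2; rewrite E !powR1 mulr1 mulrN sqrrN opprK ler_norml => /andP[_ h].
have E' : 1 - (1 - e) = e by ring.
have := H _ w1 w2; rewrite E' => h2.
have h3 : J * ((1 - e) `^ b - 1 + b * e) <= J * (L * e ^+ 2) by rewrite ler_pM2l.
have h4 : J * (b * e) - J * (L * e ^+ 2) <= J * (1 - (1 - e) `^ b).
  have -> : J * (1 - (1 - e) `^ b) = J * (b * e) - J * ((1 - e) `^ b - 1 + b * e) by ring.
  by rewrite lerD2l lerN2.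
have h5 : c * J * e <= J * (b * e) by rewrite [c * J]mulrC -mulrA ler_pM2l// ler_pM2r.
have h6 : 2 * k * e <= (J * L + C) * e ^+ 2.
  have -> : (J * L + C) * e ^+ 2 = J * (L * e ^+ 2) + C * e ^+ 2 by ring.
  move: (le_trans h4 h2) h5.
  move: (J * (b * e)) (J * (L * e ^+ 2)) (c * J * e) (2 * k * e) (C * e ^+ 2) => *; lra.
move: h6; rewrite expr2 mulrA ler_pM2r// => h6.
have : (J * L + C) * e <= (J * L + C + 1) * e by rewrite ler_pM2r// lerDl.
by move: h6 eA k0; lra.
Qed.

Lemma pohozaev_rearrange {R : realType} (J w W qi e V B A : R) :
  J + 2 * (qi * (w - 1) * J + e * ((1 - w) * V)) - B * (A * (1 - w)) ^+ 2 <= W * J ->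
  J * (1 - W) <= 2 * qi * J * (1 - w) - 2 * (e * V) * (1 - w) + B * A ^+ 2 * (1 - w) ^+ 2.
Proof.
rewrite -subr_ge0 => H; rewrite -subr_ge0; apply: (le_trans H).
by rewrite le_eqVlt; apply/orP; left; apply/eqP; ring.
Qed.

Section nonexistence.
Context {R : realType} {n : nat}.
Hypothesis n0 : (0 < n)%N.
Variables (D : set 'rV[R]_n) (d : R).
Hypothesis mD : measurable D.
Hypothesis d0 : 0 < d.
Hypothesis Dd : forall x y, D x -> D y -> enorm (x - y) <= d.
Let mu := @leb R n.
Let fD : (mu D < +oo)%E := leb_bounded d0 Dd mD.
Hypothesis V0 : 0 < vol mu D.
Variables (g lam q : R) (f : 'rV[R]_n -> R) (dl F : R).
Hypotheses (g0 : 0 < g) (lam0 : 0 <= lam) (q01 : 0 < q < 1).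
Hypothesis bf : bmeas D f.
Hypotheses (dl0 : 0 < dl) (fdl : forall x, D x -> dl <= f x <= F).
Hypothesis fE : forall x, D x -> pot mu (ker g lam 0) D f x = f x `^ (q - 1).
Let q0 : 0 < q. Proof. by case/andP: q01. Qed.
Let q1 : q < 1. Proof. by case/andP: q01. Qed.
Let g10 : 0 < g + 1. Proof. by rewrite addr_gt0. Qed.
Let fgt0 x : D x -> 0 < f x. Proof. by move=> /fdl/andP[/(lt_le_trans dl0)]. Qed.
Let f0 x : D x -> 0 <= f x. Proof. by move=> /fgt0/ltW. Qed.
Let s := (1 - q)^-1.

(** f is a power of its potential, which is Lipschitz and stays between positive constants. This
    makes f_t - f of first order in 1 - t where both are positive. *)
Lemma solution_lipschitz : exists2 L, 0 <= L & forall x x', D x -> D x' ->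
  `|f x' - f x| <= L * enorm (x' - x).
Proof.
have [L1 L10 H1] := pot_rk_lipschitz n0 mD d0 Dd g0 bf.
have [L2 L20 H2] := pot_rk_lipschitz n0 mD d0 Dd g10 bf.
pose c1 := (`|F| + 1) `^ (q - 1); pose c2 := dl `^ (q - 1).
have c10 : 0 < c1 by rewrite powR_gt0// ltr_wpDl.
have [L L0 HL] := powR_lipschitz (- s) c2 c10.
exists (L * (L1 + lam * L2)); first by rewrite mulr_ge0// addr_ge0// mulr_ge0.
move=> x x' Dx Dx'.
have conj y : D y -> f y = (f y `^ (q - 1)) `^ (- s).
  move=> Dy; rewrite -powRrM; have -> : (q - 1) * - s = 1.
    by rewrite /s; field; rewrite subr_eq0 gt_eqF.
  by rewrite powRr1// f0.
have itv y : D y -> c1 <= f y `^ (q - 1) <= c2.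
  move=> Dy; have /andP[h1 h2] := fdl Dy; have q10 : q - 1 <= 0 by rewrite subr_le0 ltW.
  rewrite !powR_decr ?fgt0//.
  by rewrite (le_trans h2)// (le_trans (ler_norm _))// lerDl.
have uE y : D y -> f y `^ (q - 1) = pot mu (rk g) D f y + lam * pot mu (rk (g + 1)) D f y.
  by move=> Dy; rewrite -(fE Dy) (pot_kerE mD d0 Dd lam 0 g0 Dy bf) mul0r addr0.
rewrite (conj _ Dx) (conj _ Dx'); apply: (le_trans (HL _ _ (itv _ Dx') (itv _ Dx))).
rewrite -mulrA; apply: ler_wpM2l => //.
rewrite (uE _ Dx) (uE _ Dx') opprD addrACA -mulrBr mulrDl; apply: (le_trans (ler_normD _ _)).
apply: lerD; first exact: H1.
by rewrite normrM ger0_norm// -mulrA; apply: ler_wpM2l => //; exact: H2.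
Qed.

Variable x0 : 'rV[R]_n.
Hypothesis Dx0 : D x0.
Hypothesis star : forall x t, D x -> 0 <= t <= 1 -> D (x0 + t *: (x - x0)).

(** * Contractions about a star centre *)

Section contraction.
Variable t : R.
Hypotheses (t0 : 0 < t) (t1 : t < 1).
(** The expansion by 1 / t about [x0], so that [Dt] is D contracted by t and [ft] is the function
    f_t, extended by zero. *)
Let phi := dil (x0 - t^-1 *: x0) t^-1.
Let Dt := phi @^-1` D.
Let ft := (fun x => f (phi x)) \_ Dt.
Let ti0 : 0 < t^-1. Proof. by rewrite invr_gt0. Qed.

Let phiE x : x = x0 + t *: (phi x - x0).
Proof.
apply/rowP => i; rewrite /phi /dil !mxE.
by field; rewrite gt_eqF.
Qed.

Let DtD : Dt `<=` D.
Proof. by move=> x Dx; rewrite (phiE x); apply: star => //; rewrite !ltW. Qed.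

Let mDt : measurable Dt. Proof. exact: measurable_dil_preimage. Qed.
Let fDt : (mu Dt < +oo)%E. Proof. exact: (vol_fin mD fD). Qed.
Let bphi : bmeas Dt (fun x => f (phi x)). Proof. exact: (bmeas_dil mD). Qed.
Let bft : bmeas D ft. Proof. exact: bmeas_restrict. Qed.
Let Dtd x y : Dt x -> Dt y -> enorm (x - y) <= d.
Proof. by move=> /DtD Dx /DtD; exact: Dd. Qed.
Let phi0 x : Dt x -> 0 <= f (phi x). Proof. exact: f0. Qed.
Let ft0 x : D x -> 0 <= ft x. Proof. exact: restrict_ge0. Qed.
Let w := t ^+ n.
Let w1 : w < 1. Proof. by rewrite /w exprn_ilt1// ?(ltW t0)//; case: (n) n0. Qed.
Let tw : 1 - t <= 1 - w.
Proof.
by rewrite lerD2l lerN2 /w -[leRHS]expr1 ler_wiXn2l// ?(ltW t0) ?(ltW t1)//; case: (n) n0.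
Qed.
Let E0 := bil mu (rk g) D f f.
Let E1 := bil mu (rk (g + 1)) D f f.
Let J := bil mu (ker g lam 0) D f f.

Let tnV : ((t^-1) ^+ n)^-1 = w. Proof. by rewrite exprVn invrK. Qed.

(** The |x - y|^(g + 1)-energy acquires one more factor t < 1 than the other one; since lam >= 0,
    dropping it gives an upper bound. *)
Lemma contraction_energy : bil mu (ker g lam 0) D ft ft <= w * w * t `^ g * J.
Proof.
rewrite /J bil_restrict// !(bil_kerE _ d0 _ _ _ g0)// !mul0r !addr0 -/E0 -/E1.
have bE p : 0 < p -> bil mu (rk p) Dt (fun x => f (phi x)) (fun x => f (phi x)) =
    t `^ p * (w * w) * bil mu (rk p) D f f.
  move=> p0; rewrite (bil_dil mD d0 Dd _ ti0 p0 bf f0); congr (_ * _).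
  by rewrite !invfM !tnV -[t^-1]powR_inv1 ?(ltW t0)// -powRrM mulN1r powRN invrK mulrA.
rewrite !bE// -/E0 -/E1.
have tg : t `^ (g + 1) <= t `^ g.
  rewrite powRD ?(gt_eqF t0) ?implybT// powRr1 ?(ltW t0)// ger_pMr ?powR_gt0//.
  exact: ltW.
have E10 : 0 <= E1 by exact: bil_rk_ge0.
have ww : 0 <= w * w by rewrite -expr2 sqr_ge0.
rewrite mulrDr [w * w * _]mulrC lerD2l.
have -> : lam * (t `^ (g + 1) * (w * w) * E1) = t `^ (g + 1) * (w * w * (lam * E1)) by ring.
have -> : t `^ g * (w * w) * (lam * E1) = t `^ g * (w * w * (lam * E1)) by ring.
by apply: ler_wpM2r => //; apply: mulr_ge0 => //; exact: mulr_ge0.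
Qed.

Let mX : measurable (D `\` Dt). Proof. exact: measurableD. Qed.

Lemma vol_outside : vol mu (D `\` Dt) = (1 - w) * vol mu D.
Proof.
have := vol_split mD fD mDt DtD; have -> : vol mu Dt = w * vol mu D.
  by rewrite /Dt /phi (vol_dil _ ti0 mD fD) tnV.
by rewrite addrC => /eqP; rewrite -subr_eq eq_sym => /eqP ->; rewrite mulrBl mul1r.
Qed.

Let bfq : bmeas D (fun x => f x `^ q). Proof. exact: (powR_bmeas_ge0 (ltW q0) f0 bf). Qed.
Let bft_q : bmeas D (fun x => ft x `^ q).
Proof. exact: (powR_bmeas_ge0 (ltW q0) ft0 bft). Qed.
Let b1X : bmeas D (\1_(D `\` Dt) : _ -> R). Proof. exact: bmeas_indic. Qed.
Let bfq1 : bmeas D (fun x => f x `^ (q - 1)).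
Proof.
apply: (bmeas_powR_pos (q - 1) dl0) => // x Dx.
by have /andP[] := fdl Dx.
Qed.

Lemma energyE : J = \int[mu]_(x in D) (f x `^ q).
Proof.
apply: eq_bint => x Dx; rewrite fE// -{1}[f x]powRr1 ?f0// -powRD.
  by congr (_ `^ _); ring.
by rewrite (gt_eqF (fgt0 Dx)) implybT.
Qed.

(** On [Dt] the tangent inequality bounds the integrand below by (ft^q - f^q) / q. Where ft = 0 the
    integrand is - f^q instead of - f^q / q: the surplus (1 / q - 1) f^q is at least a constant, and
    it produces the contradiction. *)
Lemma contraction_pairing : q^-1 * (w - 1) * J + (q^-1 - 1) * dl `^ q * ((1 - w) * vol mu D) <=
  bil mu (ker g lam 0) D (fun x => ft x - f x) f.
Proof.
have -> : bil mu (ker g lam 0) D (fun x => ft x - f x) f =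
    \int[mu]_(x in D) ((ft x - f x) * f x `^ (q - 1)).
  by apply: eq_bint => x Dx; rewrite fE.
have ftI : \int[mu]_(x in D) (ft x `^ q) = w * J.
  rewrite bint_restrict_powR ?gt_eqF// energyE -tnV.
  have := bint_dil (x0 - t^-1 *: x0) ti0 mD fD bfq; apply => x _; exact: powR_ge0.
have b1 : bmeas D (fun x => ft x `^ q - f x `^ q) by exact: bmeasB.
have b2 := bmeasZ q^-1 b1; have b3 := bmeasZ ((q^-1 - 1) * dl `^ q) b1X.
have -> : q^-1 * (w - 1) * J + (q^-1 - 1) * dl `^ q * ((1 - w) * vol mu D) =
  \int[mu]_(x in D) (q^-1 * (ft x `^ q - f x `^ q) + (q^-1 - 1) * dl `^ q * \1_(D `\` Dt) x).
  rewrite (bintD mD fD b2 b3) (bintZ mD fD _ b1) (bintZ mD fD _ b1X) (bintB mD fD bft_q bfq).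
  rewrite ftI -energyE (bint_indic1 mu mX (@subDsetl _ D Dt)) vol_outside.
  by congr (_ + _); ring.
apply: (le_bint mD fD (bmeasD b2 b3)).
  by apply: bmeasM => //; exact: bmeasB.
move=> x Dx; have fx := fgt0 Dx; rewrite indicE; have [Dtx|nDtx] := pselect (Dt x).
  rewrite memNset; last by move=> [].
  rewrite mulr0 addr0 ler_pdivrMl//.
  have := powR_tangent q01 fx (ft0 Dx); rewrite -lerBlDl => /le_trans; apply.
  by rewrite le_eqVlt -mulrA [f x `^ _ * _]mulrC eqxx.
rewrite mem_set//= mulr1 /ft patchE memNset// powR0 ?gt_eqF//.
have -> : (0 - f x) * f x `^ (q - 1) = - f x `^ q.
  rewrite sub0r mulNr -{1}[f x]powRr1 ?f0// -powRD; last by rewrite (gt_eqF fx) implybT.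
  by congr (- _); congr (_ `^ _); ring.
have h : dl `^ q <= f x `^ q.
  apply: ge0_ler_powR; rewrite ?nnegrE ?(ltW q0) ?(ltW dl0) ?(ltW fx)//.
  by case/andP: (fdl Dx).
have q10 : 0 <= q^-1 - 1 by rewrite subr_ge0 invf_ge1// ltW.
have := ler_wpM2l q10 h; rewrite sub0r mulrBl mul1r; move: (dl `^ q) (f x `^ q) => a b'.
by rewrite mulrN mulrBl !mul1r; lra.
Qed.

(** On [Dt] points are moved by at most (1 - t) d <= (1 - w) d and f is Lipschitz; elsewhere f <= F
    on a set of measure (1 - w) |D|. The quadratic term of the expansion is thus O((1 - w)^2). *)
Lemma contraction_dist L : 0 <= L ->
  (forall x x', D x -> D x' -> `|f x' - f x| <= L * enorm (x' - x)) ->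
  \int[mu]_(x in D) `|ft x - f x| <= (L * d + F) * vol mu D * (1 - w).
Proof.
move=> L0 HL; have bN : bmeas D (fun x => `|ft x - f x|) by apply: bmeas_norm; exact: bmeasB.
have bc := @bmeas_cst _ _ R D (L * d * (1 - w)); have bX := bmeasZ F b1X.
have -> : (L * d + F) * vol mu D * (1 - w) =
    \int[mu]_(x in D) (L * d * (1 - w) + F * \1_(D `\` Dt) x).
  rewrite (bintD mD fD bc bX) (bint_cst mu mD) (bintZ mD fD _ b1X).
  by rewrite (bint_indic1 mu mX (@subDsetl _ D Dt)) vol_outside; ring.
apply: (le_bint mD fD bN (bmeasD bc bX)) => x Dx.
have w0 : 0 <= 1 - w by rewrite subr_ge0 ltW.
have Ld : 0 <= L * d * (1 - w) by apply: mulr_ge0 => //; apply: mulr_ge0 => //; exact: ltW.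
rewrite indicE /ft patchE; have [Dtx|nDtx] := pselect (Dt x).
  rewrite mem_set// memNset; last by move=> [].
  rewrite mulr0 addr0; apply: (le_trans (HL _ _ Dx Dtx)).
  rewrite -mulrA; apply: ler_wpM2l => //.
  have -> : phi x - x = (1 - t) *: (phi x - x0).
    by rewrite {2}(phiE x) scalerBl scale1r opprD addrA.
  rewrite enormZ ger0_norm ?subr_ge0 ?(ltW t1)// mulrC.
  by apply: ler_pM; rewrite ?enorm_ge0 ?subr_ge0 ?(ltW t1)//; exact: Dd.
rewrite memNset// mem_set//= mulr1 sub0r normrN ger0_norm ?f0//.
by apply: ler_wpDl => //; case/andP: (fdl Dx).
Qed.

Lemma contraction_le L B : 0 <= L ->
  (forall x x', D x -> D x' -> `|f x' - f x| <= L * enorm (x' - x)) -> 0 <= B ->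
  (forall x y, D x -> D y -> `|ker g lam 0 x y| <= B) ->
  J + 2 * (q^-1 * (w - 1) * J + (q^-1 - 1) * dl `^ q * ((1 - w) * vol mu D)) -
    B * ((L * d + F) * vol mu D * (1 - w)) ^+ 2 <= w * w * t `^ g * J.
Proof.
move=> L0 HL B0 HB; apply: le_trans contraction_energy.
have bK : bmeas (D `*` D) (fun z => ker g lam 0 z.1 z.2) by exact: (bmeas_ker Dd).
have bh : bmeas D (fun x => ft x - f x) by exact: bmeasB.
have ftE : ft = (fun x => f x + 1 * (ft x - f x)) by apply/funext => x; ring.
have H := bil_line mD fD bK (kerC g lam 0) 1 bf bh.
rewrite [in leRHS]ftE H expr1n !mul1r mulr1 -/J.
set h := (fun x => ft x - f x) in bh H *.
set I := \int[mu]_(y in D) `|h y|.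
have I0 : 0 <= I by exact: Rintegral_ge0.
have hh : - (B * ((L * d + F) * vol mu D * (1 - w)) ^+ 2) <= bil mu (ker g lam 0) D h h.
  have bNh := bmeasZ (-1) bh.
  have := bil_le mD fD bK B0 HB bNh bh.
  rewrite (bilZl mD fD bK) // mulN1r lerNl => /le_trans; apply.
  have -> : \int[mu]_(y in D) `|-1 * h y| = I.
    by apply: eq_bint => y _; rewrite mulN1r normrN.
  rewrite -mulrA; apply: ler_wpM2l => //; rewrite -expr2.
  have I1 := contraction_dist L0 HL.
  by apply: lerXn2r; rewrite ?nnegrE// (le_trans I0).
apply: lerD => //; rewrite lerD2l ler_pM2l//.
exact: contraction_pairing.
Qed.

End contraction.

Hypothesis qc : 2 * n%:R <= q * (2 * n%:R + g).

(* J(f_t) = J(f) + 2 <u, f_t - f> + O((1 - t)^2) for the contraction f_t of f. *)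
Theorem star_shaped_nonexistence : False.
Proof.
pose J := bil mu (ker g lam 0) D f f.
have bK : bmeas (D `*` D) (fun z => ker g lam 0 z.1 z.2) by exact: (bmeas_ker Dd).
have [B B0 HB] := bound_K bK.
have [L L0 HL] := solution_lipschitz.
have nR0 : 0 < n%:R :> R by rewrite ltr0n.
pose k := (q^-1 - 1) * dl `^ q * vol mu D.
have k0 : 0 < k.
  by rewrite !mulr_gt0 ?powR_gt0// subr_gt0 invf_gt1.
pose A := (L * d + F) * vol mu D.
have J0 : 0 < J.
  rewrite /J energyE; apply: (@lt_le_trans _ _ (dl `^ q * vol mu D)).
    by rewrite mulr_gt0// powR_gt0.
  apply: (cst_le_bint mD fD); first exact: (powR_bmeas_ge0 (ltW q0) f0 bf).
  move=> x Dx; apply: ge0_ler_powR; rewrite ?nnegrE ?(ltW q0) ?(ltW dl0) ?f0//.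
  by case/andP: (fdl Dx).
(* This is q >= q_crit. In terms of w the contracted energy is at most w^((2n + g) / n) J, a loss of
   at least (2n + g) / n to first order, while the tangent term allows only 2 / q. *)
have cb : 2 / q <= (2 * n%:R + g) / n%:R.
  by rewrite ler_pdivlMr// mulrAC ler_pdivrMr// [leRHS]mulrC.
have C0 : 0 <= B * A ^+ 2 by rewrite mulr_ge0 ?sqr_ge0// ltW.
apply: (pohozaev_contradiction J0 cb k0 C0) => w w2 w1.
have w0 : 0 < w by apply: lt_le_trans w2; rewrite invr_gt0.
(* The volume ratio w = t^n is the parameter, since the uncovered volume is exactly (1 - w) |D|. *)
pose t := w `^ n%:R^-1.
have t0 : 0 < t by exact: powR_gt0.
have tn : t ^+ n = w.
  by rewrite -powR_mulrn ?(ltW t0)// -powRrM mulVf ?gt_eqF// powRr1// ltW.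
have t1 : t < 1.
  rewrite ltNge; apply/negP => t1; have : 1 <= t ^+ n by exact: exprn_ege1.
  by rewrite tn leNgt w1.
have wb : w * w * t `^ g = w `^ ((2 * n%:R + g) / n%:R).
  rewrite -{1 2}tn -!(powR_mulrn _ (ltW t0)) -!powRD ?(gt_eqF t0) ?implybT//.
  rewrite /t -powRrM; congr (_ `^ _).
  by field; rewrite gt_eqF.
have := contraction_le t0 t1 L0 HL (ltW B0) HB.
rewrite tn wb -/J -/A -/mu => H.
exact: pohozaev_rearrange H.
Qed.

End nonexistence.

Section star_shaped_domain.
Context {R : realType} {n : nat}.
Hypothesis n0 : (0 < n)%N.
Variable Om : set 'rV[R]_n.
Hypotheses (dOm : domain Om) (bOm : bounded_set Om).

Lemma closure_compact : compact (closure Om).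
Proof.
apply: bounded_closed_compact; last exact: closed_closure.
have [M [_ HM]] := bOm.
have {}HM : globally Om [set x | `|x| <= M + 1] by apply: HM; rewrite ltrDl.
exists (M + 1); split => [|r Mr x clx]; first exact: num_real.
rewrite /= (le_trans _ (ltW Mr))// -lerN2.
apply: (@continuous_ge_closure _ _ Om (fun y : 'rV[R]_n => - `|y|) _ _ _ _ clx).
  move=> y; have H : `|z| @[z --> y] --> `|y| := @norm_continuous R 'rV[R]_n y.
  exact: (cvgN H).
by move=> y Oy; rewrite lerN2; exact: HM.
Qed.

Variables (alpha q lam : R).
Hypothesis an : n%:R < alpha.

Lemma critical_nonexistence : q_crit n alpha <= q < 1 -> 0 <= lam -> star_shaped Om ->
  ~ exists f, positive_C1_solution Om alpha q lam f.
Proof.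
move=> /andP[qcr q1] lam0 [x0 Ox0 star] [f [[cf _] sol fpos]].
have nR0 : 0 < n%:R :> R by rewrite ltr0n.
have na0 : 0 < n%:R + alpha by rewrite addr_gt0// (lt_trans nR0).
have g0 : 0 < alpha - n%:R by rewrite subr_gt0.
have g10 : 0 < alpha - n%:R + 1 by rewrite addr_gt0.
have q01 : 0 < q < 1.
  by rewrite q1 andbT (lt_le_trans _ qcr)// /q_crit divr_gt0// mulr_gt0.
have qc : 2 * n%:R <= q * (2 * n%:R + (alpha - n%:R)).
  have -> : 2 * n%:R + (alpha - n%:R) = n%:R + alpha by ring.
  by move: qcr; rewrite /q_crit ler_pdivrMr.
have clO : closure Om !=set0 by exists x0; exact: subset_closure.
(* On the compact closure, positivity and continuity become uniform bounds with a positive minimum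
   [f a]. *)
have [a /set_mem cla fa] := EVT_min_rV clO closure_compact cf.
have [b /set_mem clb fb] := EVT_max_rV clO closure_compact cf.
have fab x : Om x -> f a <= f x <= f b.
  by move=> /subset_closure Ox; rewrite fa ?fb// inE.
have mO := domain_measurable dOm.
have d0 := diam_gt0 n0 dOm bOm; have Dd := diam_ge bOm.
have [oOm _ _] := dOm.
have bf : bmeas Om f.
  split.
    apply: continuous_measurable_rV => //; apply: continuous_subspaceW cf.
    exact: subset_closure.
  exists (f b) => x Ox; have /andP[h1 h2] := fab x Ox.
  by rewrite ger0_norm// (le_trans _ h1)// ltW// fpos.
have fE x : Om x -> pot (leb n) (ker (alpha - n%:R) lam 0) Om f x = f x `^ (q - 1).
  move=> Ox; have [_] := sol x (subset_closure Ox).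
  have -> : n%:R - alpha = - (alpha - n%:R) by rewrite opprB.
  rewrite -(opprD (alpha - n%:R) 1) (riesz_potE mO d0 Dd x g0 bf) (riesz_potE mO d0 Dd x g10 bf).
  rewrite -EFinM -EFinD => -[->].
  by rewrite (pot_kerE mO d0 Dd lam 0 g0 Ox bf) mul0r addr0.
exact: (star_shaped_nonexistence n0 mO d0 Dd (domain_vol_gt0 n0 dOm bOm) g0 lam0 q01 bf
  (fpos a cla) fab fE Ox0 star qc).
Qed.

End star_shaped_domain.

Theorem theorem1p1 (R : realType) (n : nat) (alpha : R) (Om : set 'rV[R]_n) :
  (0 < n)%N -> n%:R < alpha ->
  domain Om -> bounded_set Om -> smooth_boundary Om ->
  [/\ forall q lam : R,
        0 < q < q_crit n alpha -> - (1 / diam Om) < lam ->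
        exists f, positive_C1_solution Om alpha q lam f,
      forall q lam : R,
        q = q_crit n alpha -> - (1 / diam Om) < lam < 0 ->
        exists f, positive_C1_solution Om alpha q lam f
    & forall q lam : R,
        q_crit n alpha <= q < 1 -> 0 <= lam -> star_shaped Om ->
        ~ exists f, positive_C1_solution Om alpha q lam f].
Proof.
move=> n0 an dOm bOm _; split=> q lam.
- by move=> qc ld; exact: subcritical_existence qc.
- by move=> qc /andP[ld l0]; exact: critical_existence qc l0.
- exact: critical_nonexistence.
Qed.
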